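(* Let $1<p<\infty$, and let $q$ be its conjugate index. Let $\mathcal{A}$ be a unital Banach algebra with unit element $\mathbf{e}$, $\omega$ an almost monotone algebra weight on $\mathbb{R}$, and let $f\in L^p(\mathbb{R},\omega,\mathcal{A})$ be such that $\mathbf{e}+\int_{\mathbb{R}} f(x)e^{itx}\,dx$ is left invertible (respectively, right invertible, invertible) in $\mathcal{A}$ for all $t\in\mathbb{R}$. Then there is an almost monotone algebra weight $\nu$ on $\mathbb{R}$ and $g\in L^p(\mathbb{R},\nu,\mathcal{A})$ such that $1\leq\nu\leq K\omega$ for some $K>0$ and $\mathbf{1}+g$ is a left inverse (respectively, right inverse, inverse) of $\mathbf{1}+f$ (in $L^p(\mathbb{R},\nu,\mathcal{A})_{\mathbf{1}}$). In particular, if $\omega$ is admissible, then $\mathbf{1}+f$ is left invertible (respectively, right invertible, invertible) in $L^p(\mathbb{R},\omega,\mathcal{A})_{\mathbf{1}}$.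
   Context: All algebras are complex. The conjugate index $q$ satisfies $\frac1p+\frac1q=1$. A weight on $\mathbb{R}$ is a Borel measurable map $\omega:\mathbb{R}\to[1,\infty)$ with $\omega(x+y)\leq\omega(x)\omega(y)$ for all $x,y\in\mathbb{R}$. Put $\rho_{1,\omega}=\sup\{\log\omega(x)^{1/x}:x<0\}$ and $\rho_{2,\omega}=\inf\{\log\omega(x)^{1/x}:x>0\}$; $\omega$ is admissible if $\rho_{1,\omega}=0=\rho_{2,\omega}$. A weight $\omega$ on $\mathbb{R}$ is an almost monotone algebra weight (relative to $q$) if: (1) $\omega^{-q}\star\omega^{-q}\leq\omega^{-q}$ (where $\star$ is convolution on $\mathbb{R}$) and $\int_{\mathbb{R}}\omega^{-q}<\infty$; (2) if $\rho_{1,\omega}=0$, then there is $K>0$ such that $\omega(x)\leq K\omega(x+y)$ for all $x,y\leq0$; (3) if $\rho_{2,\omega}=0$, then there is $K>0$ such that $\omega(x)\leq K\omega(x+y)$ for all $x,y\geq0$. $L^p(\mathbb{R},\omega,\mathcal{A})$ is the space of (classes of) functions $f:\mathbb{R}\to\mathcal{A}$ with $\|f\|_{p\omega}=\left(\int_{\mathbb{R}}\|f(x)\|^p\omega(x)^p\,dx\right)^{1/p}<\infty$; when $\omega^{-q}\star\omega^{-q}\leq\omega^{-q}$ it is a Banach algebra under convolution $(f\star g)(x)=\int_{\mathbb{R}}f(x-t)g(t)\,dt$. $L^p(\mathbb{R},\omega,\mathcal{A})_{\mathbf{1}}$ is its unitization, obtained by adjoining a unit $\mathbf{1}$. *)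

(* Defs.v *)
From HB Require Import structures.
From mathcomp Require Import all_boot all_order all_algebra.
From mathcomp Require Import complex.
From mathcomp Require Import all_classical all_reals all_analysis.

Set Implicit Arguments.
Unset Strict Implicit.
Unset Printing Implicit Defensive.

Import Order.TTheory GRing.Theory Num.Theory.
Import numFieldNormedType.Exports.

Local Open Scope classical_set_scope.
Local Open Scope ring_scope.
Local Open Scope complex_scope.

(* Unital Banach algebras over K (library structures for normed modules and for
   rings have no common refinement: their only declared join is the ordered
   one). The unit is nonzero, but `|1| = 1 is not required, which covers both
   usual conventions for the norm of the unit. *)
Record banachAlgType (K : numFieldType) := BanachAlg {
  ba_car : completeNormedModType K;
  ba_one : ba_car;
  ba_mul : ba_car -> ba_car -> ba_car;
  ba_mulA : associative ba_mul;
  ba_mul1l : left_id ba_one ba_mul;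
  ba_mul1r : right_id ba_one ba_mul;
  ba_mulDl : left_distributive ba_mul +%R;
  ba_mulDr : right_distributive ba_mul +%R;
  ba_oner_neq0 : ba_one != 0;
  ba_scalerAl : forall (k : K) (x y : ba_car),
    k *: ba_mul x y = ba_mul (k *: x) y;
  ba_scalerAr : forall (k : K) (x y : ba_car),
    k *: ba_mul x y = ba_mul x (k *: y);
  ba_normM_le : forall x y : ba_car, `|ba_mul x y| <= `|x| * `|y|
}.

Definition ba_sort (K : numFieldType) (A : banachAlgType K) : Type := ba_car A.
Coercion ba_sort : banachAlgType >-> Sortclass.

Section BanachAlgebraStructure.
Variables (K : numFieldType) (A : banachAlgType K).
HB.instance Definition _ := CompleteNormedModule.copy (ba_sort A) (ba_car A).
HB.instance Definition _ := GRing.Zmodule_isNzRing.Build (ba_sort A)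
  (@ba_mulA K A) (@ba_mul1l K A) (@ba_mul1r K A) (@ba_mulDl K A)
  (@ba_mulDr K A) (@ba_oner_neq0 K A).
HB.instance Definition _ := GRing.Lmodule_isLalgebra.Build K (ba_sort A)
  (@ba_scalerAl K A).
HB.instance Definition _ := GRing.Lalgebra_isAlgebra.Build K (ba_sort A)
  (@ba_scalerAr K A).

Lemma normM_le (x y : A) : `|x * y| <= `|x| * `|y|.
Proof. exact: ba_normM_le. Qed.
End BanachAlgebraStructure.

Section Weights.
Variable R : realType.
Implicit Types (w : R -> R) (q : R).
Local Notation mu := (@lebesgue_measure R).

Definition weight w : Prop :=
  [/\ measurable_fun setT w, (forall x : R, 1 <= w x)
    & forall x y : R, w (x + y) <= w x * w y].

(* Since w >= 1, the first set is bounded above by 0 and the second one is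
   bounded below by 0, so that these are genuine real sup and inf. *)
Definition rho1 w : R := sup [set ln (w x `^ x^-1) | x in [set x | x < 0]].
Definition rho2 w : R := inf [set ln (w x `^ x^-1) | x in [set x | 0 < x]].

Definition admissible w : Prop := rho1 w = 0 /\ rho2 w = 0.

Definition almost_monotone_algebra_weight q w : Prop :=
  [/\ weight w,
      forall x : R, (\int[mu]_t (w (x - t) `^ (- q) * w t `^ (- q))%:E
                   <= (w x `^ (- q))%:E)%E,
      (\int[mu]_x (w x `^ (- q))%:E < +oo)%E,
      (rho1 w = 0 -> exists2 K : R, 0 < K &
         forall x y : R, x <= 0 -> y <= 0 -> w x <= K * w (x + y))
    & (rho2 w = 0 -> exists2 K : R, 0 < K &
         forall x y : R, 0 <= x -> 0 <= y -> w x <= K * w (x + y))].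

End Weights.

Section Bochner.
Variables (R : realType) (A : banachAlgType R[i]).
Implicit Types (f g s : R -> A) (v : A).
Local Notation mu := (@lebesgue_measure R).

(* The norm of A takes its (nonnegative) values in R[i]. *)
Definition rnorm v : R := complex.Re `|v|.

Definition simple s : Prop :=
  finite_set (range s) /\ forall v, measurable (s @^-1` [set v]).

Definition integrable_simple s : Prop :=
  simple s /\ forall v, v != 0 -> (mu (s @^-1` [set v]) < +oo)%E.

(* The value 0, whose preimage has infinite measure, contributes 0. *)
Definition simple_integral s : A :=
  \sum_(v \in range s) (fine (mu (s @^-1` [set v])))%:C *: v.

(* A is not assumed separable: measurability is Bochner measurability. *)
Definition strongly_measurable f : Prop :=
  exists s_ : nat -> R -> A, (forall n, simple (s_ n)) /\
    {ae mu, forall x, s_ n x @[n --> \oo] --> f x}.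

(* The integrands built below from strongly measurable functions may be
   measurable only with respect to the Lebesgue sigma-algebra. As they are
   nonnegative, \int (a supremum over Borel simple functions below the
   integrand) is still their Lebesgue integral. *)
Definition is_bochner_integral f v : Prop :=
  strongly_measurable f /\
  exists s_ : nat -> R -> A,
    [/\ forall n, integrable_simple (s_ n),
        (\int[mu]_x (rnorm (f x - s_ n x))%:E)%E @[n --> \oo] --> 0%E
      & simple_integral (s_ n) @[n --> \oo] --> v].

(* Equal to 0 when f is not Bochner integrable. *)
Definition bochner f : A := xget 0 [set v | is_bochner_integral f v].

Definition fourier f (t : R) : A :=
  bochner (fun x => (cos (t * x) +i* sin (t * x)) *: f x).

Definition convolution f g : R -> A :=
  fun x => bochner (fun t => f (x - t) * g t).

Definition wnorm (p : R) (w : R -> R) f : \bar R :=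
  ((\int[mu]_x (rnorm (f x) `^ p * w x `^ p)%:E) `^ p^-1)%E.

(* Representatives of the elements of L^p(R, w, A). *)
Definition Lp (p : R) (w : R -> R) : set (R -> A) :=
  [set f | strongly_measurable f /\ (wnorm p w f < +oo)%E].

(* The pair (a, f) stands for the element a.1 + f of the unitization. *)
Definition Lp1 (p : R) (w : R -> R) : set (R[i] * (R -> A)) :=
  [set u | Lp p w u.2].

Definition eq1 (u v : R[i] * (R -> A)) : Prop :=
  u.1 = v.1 /\ {ae mu, forall x, u.2 x = v.2 x}.

Definition one1 : R[i] * (R -> A) := (1, cst 0).

Definition mul1 (u v : R[i] * (R -> A)) : R[i] * (R -> A) :=
  (u.1 * v.1, fun x => u.1 *: v.2 x + v.1 *: u.2 x + convolution u.2 v.2 x).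

End Bochner.

Variant side := LeftSide | RightSide | BothSides.

(* y is a left inverse (resp. right inverse, inverse) of x, for the product mul
   with unit e, up to eqv. *)
Definition is_inverse (T : Type) (eqv : T -> T -> Prop) (mul : T -> T -> T)
    (e : T) (d : side) (x y : T) : Prop :=
  match d with
  | LeftSide => eqv (mul y x) e
  | RightSide => eqv (mul x y) e
  | BothSides => eqv (mul y x) e /\ eqv (mul x y) e
  end.

Definition invertible (R : realType) (A : banachAlgType R[i]) (d : side)
    (a : A) : Prop :=
  exists b : A, is_inverse eq *%R 1 d a b.

Definition is_inverse1 (R : realType) (A : banachAlgType R[i]) (p : R)
    (w : R -> R) (d : side) (u v : R[i] * (R -> A)) : Prop :=
  [/\ Lp1 p w u, Lp1 p w v & is_inverse (@eq1 R A) (@mul1 R A) (@one1 R A) d u v].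

(* Main.v *)
Require Import Defs.
From HB Require Import structures.
From mathcomp Require Import all_boot all_order all_algebra.
From mathcomp Require Import complex separable cyclic cyclotomic.
From mathcomp Require Import all_classical all_reals all_analysis measurable_realfun.
From mathcomp Require Import ring lra.

Set Implicit Arguments.
Unset Strict Implicit.
Unset Printing Implicit Defensive.

Import Order.TTheory GRing.Theory Num.Theory.
Import numFieldNormedType.Exports HBSimple HBNNSimple.

Local Open Scope classical_set_scope.
Local Open Scope ring_scope.
Local Open Scope complex_scope.

(** * Complex numbers and roots of unity *)

(** The weight is first replaced by a smaller one. A [regular_weight] is an almost monotone algebra
    weight that grows more slowly than every exponential in both directions, and [regular_minorant]
    finds such a [v] with [v <= K w]. If [rho1] and [rho2] both vanish, [w] is itself regular by
    almost monotonicity, which gives the assertion on admissible weights. If exactly one vanishes,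
    [w] restricted to the corresponding half-line and extended evenly is regular up to a factor. If
    neither vanishes, [w] grows exponentially on both sides and a multiple of [1 + x^2] lies below a
    multiple of it.

    For a regular weight, L^p is a Banach algebra contained in L^1 (Hölder and the condition on
    w^{-q}, see [young_inequality]), and it contains every e^{-s|t|} with s > 0. Let [unz] be this
    algebra with all of A adjoined. The element U given by e^{-t} on t > 0 is central and has
    Fourier transform 1/(1-it), so V = 1 - 2U ([cayley]) has a transform that maps the real line
    onto the unit circle without the point 1, which corresponds to infinity. By partial fractions
    the one-sided exponentials of other rates provide the resolvent of V off the circle
    ([V_invertible]). The exponentials of integer rates span a dense subspace
    ([exponential_density]), since polynomials in e^{-t} without constant term approximate
    indicators. On exponentials the difference between an element and its transform at t is exactly
    divisible by V - k, where k is the point of the circle belonging to t; by density the same holds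
    for every element up to a small error ([fourier_local], and [infinity_local] for k = 1). Hence,
    if b is a left inverse of 1 + fourier x t, then b(1 + x) is 1 modulo V - k, up to an error of
    norm less than 1: 1 + x is left invertible locally at each point of the circle ([circle_local]).

    The passage from local to global ([left_inverse_of_local]) is a local principle in the style of
    Allan, proved without maximal ideals. Put a = 1 + x in the Banach algebra B. The local inverses
    say that v - l acts invertibly on the module B/Ba for every complex l, so v has empty spectrum
    there, and B/Ba must be zero. This last point follows Rickart: the mean of l/(l-v) over the n
    points of modulus rho whose n-th power is rho^n is the inverse of 1 - (v/rho)^n. Modulo Ba these
    means are Lipschitz in rho uniformly in n, so that smallness of (v/rho)^n propagates from large
    radii down to all positive ones. As v is invertible, 1 is then congruent to an element of norm
    less than 1, and a Neumann series ends the proof.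

    Right inverses come from the opposite ring, and two-sided ones from associativity. The component
    in A of the inverse is forced to be 1, so the inverse has the form 1 + g. *)

Notation normc := Normc.normc.

Section Normc.
Variable R : realType.
Implicit Types x y z : R[i].

Lemma normcD x y : normc (x + y) <= normc x + normc y.
Proof. exact: le_normcD. Qed.

Lemma normcB x y : normc (x - y) = normc (y - x).
Proof. by rewrite -opprB; exact: (@normcN R (y - x)). Qed.

Lemma normc_real (r : R) : normc r%:C = `|r|.
Proof. by rewrite /= expr0n /= addr0 sqrtr_sqr. Qed.

Lemma normc_ge0 x : 0 <= normc x.
Proof. by case: x => a b /=; rewrite sqrtr_ge0. Qed.

Lemma normcX x n : normc (x ^+ n) = normc x ^+ n.
Proof.
by elim: n => [|n IHn]; rewrite ?expr0 ?Normc.normc1// !exprS Normc.normcM IHn.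
Qed.

Lemma normr_complexE x : `|x| = (normc x)%:C.
Proof. by case: x. Qed.

Lemma normc_le x : normc x <= `|complex.Re x| + `|complex.Im x|.
Proof.
case: x => a b /=; rewrite -[leRHS]ger0_norm ?addr_ge0 // -sqrtr_sqr.
rewrite ler_wsqrtr // sqrrD !real_normK ?num_real // -addrA lerD2l lerDr.
by rewrite mulrn_wge0 // mulr_ge0.
Qed.

Lemma Re_le_normc x : `|complex.Re x| <= normc x.
Proof.
by case: x => a b /=; rewrite -sqrtr_sqr ler_wsqrtr // lerDl sqr_ge0.
Qed.

Lemma Im_le_normc x : `|complex.Im x| <= normc x.
Proof.
by case: x => a b /=; rewrite -sqrtr_sqr ler_wsqrtr // lerDr sqr_ge0.
Qed.

Lemma exists_prim_root n : (0 < n)%N ->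
  exists2 z : R[i], n.-primitive_root z & normc z = 1.
Proof.
move=> n_gt0; pose p : {poly R[i]} := 'X^n - 1.
have [r Dp] := closed_field_poly_normal p.
rewrite (monicP _) ?monicXnsubC // scale1r in Dp.
have rn1 : all n.-unity_root r by apply/allP=> z; rewrite -root_prod_XsubC -Dp.
have sz_r : (n < (size r).+1)%N.
  by rewrite -(size_prod_XsubC r id) -Dp size_XnsubC.
have [|z _ zn] := hasP (has_prim_root n_gt0 rn1 _ sz_r).
  by rewrite -separable_prod_XsubC -Dp separable_Xn_sub_1 // pnatr_eq0 -lt0n.
exists z => //; have /(congr1 (@Normc.normc R)) := prim_expr_order zn.
rewrite normcX Normc.normc1 => /eqP; rewrite pexpr_eq1 ?normc_ge0 //.
by move=> /eqP.
Qed.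

Lemma sum_prim_root n (z : R[i]) m : n.-primitive_root z -> (0 < m < n)%N ->
  \sum_(k < n) z ^+ (k * m) = 0.
Proof.
move=> zn /andP[m0 mn]; have zm1 : z ^+ m - 1 != 0.
  by rewrite subr_eq0 -(prim_order_dvd zn) gtnNdvd.
apply: (mulfI zm1); rewrite mulr0.
rewrite (eq_bigr (fun k : 'I_n => (z ^+ m) ^+ k)); last first.
  by move=> k _; rewrite mulnC exprM.
by rewrite -subrX1 -exprM mulnC exprM (prim_expr_order zn) expr1n subrr.
Qed.

(** Compactness of the square [-M,M]^2, which contains the disc: monotonicity in the bound lets
    finitely many local bounds be replaced by one. *)
Lemma complex_disc_bound (P : R[i] -> R -> Prop) :
  (forall l b b', b <= b' -> P l b -> P l b') ->
  (forall l0, exists eta, exists b, 0 < eta /\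
     forall l, normc (l - l0) < eta -> P l b) ->
  forall M, exists b, forall l, normc l <= M -> P l b.
Proof.
move=> Pmon Ploc M.
have cK : compact (`[- M, M] `*` `[- M, M] : set (R * R)%type).
  by apply: compact_setX; apply: segment_compact.
have /compact_near_coveringP cov := cK.
have := cov R (pinfty_nbhs R) (fun b xy => P (xy.1 +i* xy.2) b) _.
move=> /(_ _)[].
  move=> -[x y] _ /=.
  have [eta [b [eta0 Pb]]] := Ploc (x +i* y).
  exists ([set xy | `|x - xy.1| < eta / 2 /\ `|y - xy.2| < eta / 2],
          [set b' | b < b']).
    split => /=; last by exists b; split; rewrite ?num_real.
    have e20 : 0 < eta / 2 by rewrite divr_gt0.
    exists (ball x (eta / 2), ball y (eta / 2)) => /=.
      by split; exact: nbhsx_ballx.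
    by move=> [u v] /= [].
  move=> [[u v] b'] /= [[hu hv] hb].
  apply: (Pmon _ b); first exact: ltW.
  apply: Pb; apply: le_lt_trans (normc_le _) _ => /=.
  by rewrite (splitr eta) ltrD // distrC.
move=> b [_ Pb]; exists (b + 1) => l lM.
have := Pb (b + 1); rewrite ltrDl ltr01 => /(_ isT (complex.Re l, complex.Im l)).
case: l lM => x y lM; apply; split; rewrite /= in_itv /= -ler_norml.
  exact: le_trans (Re_le_normc (x +i* y)) lM.
exact: le_trans (Im_le_normc (x +i* y)) lM.
Qed.

End Normc.

(** * Left inverses from local left inverses *)

Section LeftInverse.
Variables (R : realType) (B : nzRingType) (N : B -> R) (iota : R[i] -> B).
Hypothesis N_ge0 : forall x, 0 <= N x.
Hypothesis ND : forall x y, N (x + y) <= N x + N y.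
Hypothesis NN : forall x, N (- x) = N x.
Hypothesis NM : forall x y, N (x * y) <= N x * N y.
Hypothesis Nneumann : forall x, N x < 1 -> exists y, y * (1 - x) = 1.
Hypothesis iotaD : forall k l, iota (k + l) = iota k + iota l.
Hypothesis iotaM : forall k l, iota (k * l) = iota k * iota l.
Hypothesis iota1 : iota 1 = 1.
Hypothesis iotaC : forall k x, iota k * x = x * iota k.
Hypothesis Niota : forall k x, N (iota k * x) <= normc k * N x.

Lemma iota0 : iota 0 = 0.
Proof. by apply: (addrI (iota 0)); rewrite -iotaD !addr0. Qed.

Lemma iotaN k : iota (- k) = - iota k.
Proof. by apply: (addrI (iota k)); rewrite -iotaD !subrr iota0. Qed.

Lemma iotaB k l : iota (k - l) = iota k - iota l.
Proof. by rewrite iotaD iotaN. Qed.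

Lemma iotaX k n : iota (k ^+ n) = iota k ^+ n.
Proof. by elim: n => [|n IHn]; rewrite ?expr0 // !exprS iotaM IHn. Qed.

Lemma iota_sum (I : Type) (r : seq I) (P : pred I) (F : I -> R[i]) :
  iota (\sum_(i <- r | P i) F i) = \sum_(i <- r | P i) iota (F i).
Proof. exact: (big_morph _ iotaD iota0). Qed.

Lemma semi_norm0 : N 0 = 0.
Proof.
apply/le_anti; rewrite N_ge0 andbT -iota0 -[iota 0]mulr1.
by apply: le_trans (Niota _ _) _; rewrite Normc.normc0 mul0r.
Qed.

Lemma semi_normB x y : N (x - y) <= N x + N y.
Proof. by rewrite -(NN y); exact: ND. Qed.

Lemma semi_norm_sum (I : Type) (r : seq I) (P : pred I) (F : I -> B) :
  N (\sum_(i <- r | P i) F i) <= \sum_(i <- r | P i) N (F i).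
Proof.
apply: (big_ind2 (fun x y => N x <= y)) => [|x u y v xu yv|//].
  by rewrite semi_norm0.
by apply: le_trans (ND _ _) _; exact: lerD.
Qed.

Lemma semi_normX x n : N (x ^+ n) <= N 1 * N x ^+ n.
Proof.
elim: n => [|n IHn]; first by rewrite !expr0 mulr1.
rewrite exprSr; apply: le_trans (NM _ _) _.
by rewrite exprSr mulrA ler_wpM2r.
Qed.

Lemma N1_ge1 : 1 <= N 1.
Proof.
have [|n1] := eqVneq (N 1) 0.
  move=> n1; have [|y] := Nneumann (x := 1); first by rewrite n1 ltr01.
  by rewrite subrr mulr0 => /esym/eqP; rewrite oner_eq0.
have n1p : 0 < N 1 by rewrite lt_neqAle eq_sym n1 N_ge0.
by rewrite -(ler_pM2l n1p) mulr1 -{1}[X in N X]mulr1; exact: NM.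
Qed.

Lemma neumann_bound x y : N x < 1 -> y * (1 - x) = 1 ->
  N y <= N 1 / (1 - N x).
Proof.
move=> x1 yx; rewrite ler_pdivlMr ?subr_gt0 // mulrBr mulr1 lerBlDr.
have {1}-> : y = 1 + y * x by rewrite -yx mulrBr mulr1 subrK.
by apply: le_trans (ND _ _) _; rewrite lerD2l NM.
Qed.

Variables (v : B) (res : R[i] -> B).
Hypothesis vC : forall x, v * x = x * v.
Hypothesis resC : forall l x, res l * x = x * res l.
Hypothesis resE : forall l, normc l != 1 -> res l * (v - iota l) = 1.

Variable a : B.

(** Equality in the left module B/Ba. The quotient is never formed: its norm is replaced by the norm
    of a suitable representative. *)
Definition modL x y := exists c, x - y = c * a.

Lemma modL_refl x : modL x x.
Proof. by exists 0; rewrite subrr mul0r. Qed.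

Lemma modL_trans x y z : modL x y -> modL y z -> modL x z.
Proof.
by move=> [c xy] [d yz]; exists (c + d); rewrite mulrDl -xy -yz addrA subrK.
Qed.

Lemma modL_sym x y : modL x y -> modL y x.
Proof. by move=> [c xy]; exists (- c); rewrite mulNr -xy opprB. Qed.

Lemma modLD x y z t : modL x y -> modL z t -> modL (x + z) (y + t).
Proof.
by move=> [c xy] [d zt]; exists (c + d); rewrite mulrDl -xy -zt opprD addrACA.
Qed.

Lemma modLM x y z : modL x y -> modL (z * x) (z * y).
Proof. by move=> [c xy]; exists (z * c); rewrite -mulrA -xy mulrBr. Qed.

Lemma modLN x y : modL x y -> modL (- x) (- y).
Proof. by rewrite -[- x]mulN1r -[- y]mulN1r; exact: modLM. Qed.

Lemma modL_sum (I : Type) (r : seq I) (F G : I -> B) :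
  (forall i, modL (F i) (G i)) ->
  modL (\sum_(i <- r) F i) (\sum_(i <- r) G i).
Proof.
move=> FG; apply: (big_ind2 modL) => [|x u y w xu yw|//]; first exact: modL_refl.
exact: modLD.
Qed.

(** Local left invertibility of [a] at the point [l] of the circle, up to an error that a Neumann
    series can absorb. *)
Hypothesis spectral : forall l, normc l = 1 ->
  exists c y r, c * a = 1 - r - (v - iota l) * y /\ N r < 1.

(** On the circle the factor 1 - r is inverted and moved into [c] and [y], which is possible because
    v - l is central. Off the circle the resolvent serves, with c = 0. So v has empty spectrum on
    B/Ba. *)
Lemma spectral_exact l : exists c y, c * a = 1 - (v - iota l) * y.
Proof.
have [l1|l1] := eqVneq (normc l) 1; last first.
  by exists 0, (res l); rewrite mul0r -resC resE // subrr.
have [c [y [r [cay r1]]]] := spectral l1.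
have [z zr] := Nneumann r1.
exists (z * c), (z * y); rewrite -mulrA cay mulrBr zr mulrA.
by rewrite mulrBr -vC -iotaC -mulrBl mulrA.
Qed.

(** With ca = 1 - (v - l0)y and z the left inverse of 1 - (l - l0)y, multiplication by z gives zca =
    1 - (v - l)zy, so the resolvent at l is congruent to zy, whose norm is controlled near l0. *)
Lemma res_locally_bounded l0 : exists eta, exists b, 0 < eta /\
  forall l, normc (l - l0) < eta -> normc l != 1 ->
    exists2 y, modL (res l) y & N y <= b.
Proof.
have [c [y cay]] := spectral_exact l0.
have Ny1 : 0 < 2 * (N y + 1) by rewrite mulr_gt0 // ltr_wpDl.
exists (2 * (N y + 1))^-1, (N 1 / 2^-1 * N y); rewrite invr_gt0.
split=> // l ll0 l1.
have Nx : N (iota (l - l0) * y) < 2^-1.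
  apply: le_lt_trans (Niota _ _) _.
  apply: (@le_lt_trans _ _ (normc (l - l0) * (N y + 1))).
    by rewrite ler_wpM2l ?normc_ge0 // lerDl.
  rewrite -ltr_pdivlMr ?ltr_wpDl //; apply: lt_le_trans ll0 _.
  by rewrite invfM.
have Nx1 : N (iota (l - l0) * y) < 1 by apply: lt_trans Nx _; lra.
have [z zx] := Nneumann Nx1.
exists (z * y); last first.
  apply: le_trans (NM _ _) _; rewrite ler_wpM2r //.
  apply: le_trans (neumann_bound Nx1 zx) _.
  rewrite ler_wpM2l // lef_pV2 ?posrE ?subr_gt0 //; lra.
exists (res l * z * c); rewrite -!mulrA cay.
have -> : 1 - (v - iota l0) * y = (1 - iota (l - l0) * y) - (v - iota l) * y.
  rewrite iotaB !mulrBl; set p := v * y; set q := iota l * y.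
  set s := iota l0 * y; rewrite !opprB -addrA; congr (1 + _).
  by rewrite addrA subrK.
rewrite mulrBr zx mulrBr mulr1; congr (_ - _).
have zC : z * (v - iota l) = (v - iota l) * z by rewrite mulrBr mulrBl vC iotaC.
by rewrite [z * (_ * _)]mulrA zC !mulrA resE // mul1r.
Qed.

(** The resolvent may blow up near the circle; only its class modulo Ba has representatives bounded
    on the whole disc. *)
Lemma res_bounded M : exists b, forall l, normc l <= M -> normc l != 1 ->
  exists2 y, modL (res l) y & N y <= b.
Proof.
pose P (l : R[i]) b := normc l != 1 -> exists2 y, modL (res l) y & N y <= b.
apply: (complex_disc_bound (P := P)) => [l b b' bb' Pb l1|l0].
  by have [y ly yb] := Pb l1; exists y => //; exact: le_trans bb'.
exact: res_locally_bounded.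
Qed.

(** Partial fractions: l^n - v^n factors as (l - v) times the sum of the l^(n-1-j) v^j. Every l =
    rho z^k has the same n-th power rho^n, and summation over k kills all terms with j > 0 because
    the powers of a primitive root sum to zero. *)
Lemma iota_pow_sum n (z : R[i]) (rho : R) : n.-primitive_root z ->
  normc z = 1 -> 0 < rho -> rho != 1 ->
  (\sum_(k < n) iota (rho%:C * z ^+ k) * (- res (rho%:C * z ^+ k))) *
    (iota (rho%:C ^+ n) - v ^+ n) = iota (n%:R * rho%:C ^+ n).
Proof.
move=> zn z1 rho0 rho1; have n0 := prim_order_gt0 zn.
rewrite mulr_suml (eq_bigr (fun k : 'I_n => \sum_(j < n)
    iota ((rho%:C * z ^+ k) ^+ (n - j)) * v ^+ j)); last first.
  move=> k _; set l := rho%:C * z ^+ k.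
  have l1 : normc l != 1.
    by rewrite Normc.normcM normcX z1 expr1n mulr1 normc_real gtr0_norm.
  have ln : l ^+ n = rho%:C ^+ n.
    by rewrite exprMn exprAC (prim_expr_order zn) expr1n mulr1.
  rewrite -ln iotaX subrXX_comm; last exact: iotaC.
  rewrite !mulrA -[_ * - _ * _]mulrA mulNr -mulrN opprB resE // mulr1.
  rewrite mulr_sumr; apply: eq_bigr => j _.
  rewrite mulrA -iotaX -iotaM -exprS; congr (iota (_ ^+ _) * _).
  by rewrite -subSn ?prednK // -ltnS prednK.
rewrite exchange_big /=.
rewrite (eq_bigr (fun j : 'I_n =>
   iota (rho%:C ^+ (n - j) * \sum_(k < n) z ^+ (k * (n - j))) * v ^+ j));
  last first.
  move=> j _; rewrite -mulr_suml -iota_sum; congr (iota _ * _).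
  by rewrite mulr_sumr; apply: eq_bigr => k _; rewrite exprMn exprM.
case: n zn n0 => // n zn _; rewrite big_ord_recl [X in _ + X]big1 ?addr0 /=; last first.
  move=> j _; rewrite (sum_prim_root zn) ?mulr0 ?iota0 ?mul0r //.
  by rewrite subn_gt0 ltnS ltn_ord ltn_subrL.
rewrite subn0 mulr1 (eq_bigr (fun=> 1)); last first.
  by move=> k _; rewrite mulnC exprM (prim_expr_order zn) expr1n.
by rewrite sumr_const card_ord mulrC.
Qed.

(** Rickart's discrete substitute for a contour integral: the mean of l/(l-v) over n points of
    modulus rho. By [avg_inv] it is the inverse of 1 - (v/rho)^n. *)
Definition avg n (z : R[i]) (rho : R) : B :=
  iota n%:R^-1 *
  \sum_(k < n) iota (rho%:C * z ^+ k) * (- res (rho%:C * z ^+ k)).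

Definition vpow (rho : R) n : B := iota (rho%:C ^- n) * v ^+ n.

Lemma vpowC rho n x : vpow rho n * x = x * vpow rho n.
Proof.
rewrite /vpow -mulrA [v ^+ n * x](_ : _ = x * v ^+ n); last first.
  by apply/esym/commrX/esym/vC.
by rewrite mulrA iotaC mulrA.
Qed.

Lemma avgC n z rho x : avg n z rho * x = x * avg n z rho.
Proof.
rewrite /avg -mulrA [RHS]mulrA -[x * iota _]iotaC -[RHS]mulrA.
congr (_ * _).
rewrite mulr_suml mulr_sumr; apply: eq_bigr => k _.
set p := iota _; set r := res _.
have pC : p * x = x * p by exact: iotaC.
have rC : - r * x = x * - r by rewrite mulNr mulrN resC.
by rewrite -mulrA rC mulrA pC -mulrA.
Qed.

Lemma avg_inv n z rho : n.-primitive_root z -> normc z = 1 -> 0 < rho ->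
  rho != 1 -> avg n z rho * (1 - vpow rho n) = 1.
Proof.
move=> zn z1 rho0 rho1; have n0 := prim_order_gt0 zn.
have r0 : rho%:C ^+ n != 0 by rewrite expf_neq0 // fmorph_eq0 gt_eqF.
have -> : 1 - vpow rho n = iota (rho%:C ^- n) * (iota (rho%:C ^+ n) - v ^+ n).
  by rewrite mulrBr -iotaM mulVf // iota1.
rewrite [iota (_ ^- _) * _]iotaC /avg mulrA -[_ * _ * (_ - _)]mulrA.
rewrite iota_pow_sum // -!iotaM -[RHS]iota1; congr iota.
by rewrite mulrA mulVf ?mul1r ?mulfV // pnatr_eq0 -lt0n.
Qed.

Lemma avg_lipschitz M : exists K, 0 <= K /\ forall n z rho rho',
  n.-primitive_root z -> normc z = 1 ->
  0 < rho <= M -> rho != 1 -> 0 < rho' <= M -> rho' != 1 ->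
  exists e, modL (avg n z rho - avg n z rho') e /\ N e <= K * `|rho - rho'|.
Proof.
have [b bP] := res_bounded M.
exists (N v * (b * b)); split; first by rewrite mulr_ge0 // -expr2 sqr_ge0.
move=> n z rho rho' zn z1 /andP[rho0 rhoM] rho1 /andP[rho'0 rho'M] rho'1.
have n0 := prim_order_gt0 zn.
have nc (r : R) k : 0 < r -> normc (r%:C * z ^+ k) = r.
  by move=> r0; rewrite Normc.normcM normcX z1 expr1n mulr1 normc_real gtr0_norm.
pose T (l : R[i]) := iota l * - res l.
have TE l : normc l != 1 -> T l = 1 - v * res l.
  move=> l1; have h : (v - iota l) * res l = 1 by rewrite -resC resE.
  by rewrite -h mulrBl addrC addKr /T mulrN.
have [e eP] : exists e : 'I_n -> B, forall k : 'I_n,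
    modL (T (rho%:C * z ^+ k) - T (rho'%:C * z ^+ k)) (e k) /\
    N (e k) <= N v * (b * b) * `|rho - rho'|.
  suff ex (k : 'I_n) : exists f,
      modL (T (rho%:C * z ^+ k) - T (rho'%:C * z ^+ k)) f /\
      N f <= N v * (b * b) * `|rho - rho'| by have [g gP] := boolp.choice ex; exists g.
  set l := rho%:C * _; set l' := rho'%:C * _.
  have l1 : normc l != 1 by rewrite nc.
  have l'1 : normc l' != 1 by rewrite nc.
  have [y ly yb] : exists2 y, modL (res l) y & N y <= b by apply: bP; rewrite ?nc.
  have [y' ly' yb'] : exists2 y, modL (res l') y & N y <= b.
    by apply: bP; rewrite ?nc.
  exists (v * (iota (l' - l) * (y * y'))); split.
    rewrite !TE // addrC opprB addrA subrK -mulrBr.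
    have -> : res l' - res l = iota (l' - l) * (res l' * res l).
      transitivity (res l' * ((v - iota l) * res l)
                    - res l' * (v - iota l') * res l).
        have h : (v - iota l) * res l = 1 by rewrite -resC resE.
        by rewrite h resE // mulr1 mul1r.
      rewrite mulrA -mulrBl -mulrBr mulrA iotaC; congr (_ * _ * _).
      by rewrite opprB addrC addrA subrK iotaB.
    apply: modLM; apply: modLM; apply: (@modL_trans _ (res l' * y)).
      exact: modLM.
    by rewrite resC; exact: modLM.
  apply: le_trans (NM _ _) _; rewrite -!mulrA ler_wpM2l //.
  apply: le_trans (Niota _ _) _.
  rewrite -mulrBl Normc.normcM normcX z1 expr1n mulr1 -rmorphB normc_real.
  rewrite distrC mulrC mulrA ler_wpM2r //.
  apply: le_trans (NM _ _) _; apply: ler_pM => //.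
exists (iota n%:R^-1 * \sum_(k < n) e k); split.
  rewrite /avg -mulrBr -sumrB; apply: modLM; apply: modL_sum => k.
  by have [] := eP k.
apply: le_trans (Niota _ _) _.
rewrite Normc.normcV.
have -> : normc (n%:R : R[i]) = n%:R.
  by rewrite -[n%:R in LHS](rmorph_nat (real_complex R)) normc_real normr_nat.
rewrite mulrC ler_pdivrMr ?ltr0n //.
apply: le_trans (semi_norm_sum _ _ _) _.
apply: (@le_trans _ _ (\sum_(k < n) N v * (b * b) * `|rho - rho'|)).
  by apply: ler_sum => k _; have [] := eP k.
by rewrite sumr_const card_ord mulr_natr.
Qed.

(** The classes of (v/rho)^n tend to zero in the quotient seminorm of B/Ba. *)
Definition vsmall rho := forall eps, 0 < eps -> exists n0, forall n,
  (n0 <= n)%N -> exists2 e, modL (vpow rho n) e & N e < eps.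

Definition vbounded rho c := exists n0, forall n,
  (n0 <= n)%N -> exists2 e, modL (vpow rho n) e & N e <= c.

Lemma vbounded_small rho' rho c : 0 < rho' < rho -> vbounded rho' c ->
  vsmall rho.
Proof.
move=> /andP[rho'0 rho'rho] [n0 bd] eps eps0.
have rho0 := lt_trans rho'0 rho'rho.
have r1 : `|rho' / rho| < 1.
  by rewrite ger0_norm ?divr_ge0 ?ltW // ltr_pdivrMr // mul1r.
have c0 : 0 <= c by have [e _] := bd n0 (leqnn _); apply: le_trans; exact: N_ge0.
have eps1 : 0 < eps / (c + 1) by rewrite divr_gt0 // ltr_wpDl.
have /cvgrPdist_lt/(_ _ eps1)[n1 _ n1P] := cvg_expr r1.
exists (maxn n0 n1) => n; rewrite geq_max => /andP[n0n n1n].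
have [e ve ec] := bd n n0n.
exists (iota ((rho' / rho)%:C ^+ n) * e).
  have -> : vpow rho n = iota ((rho' / rho)%:C ^+ n) * vpow rho' n.
    rewrite /vpow mulrA -iotaM rmorphM /= fmorphV exprMn mulrAC.
    by rewrite mulfV ?mul1r ?exprVn // expf_neq0 // fmorph_eq0 gt_eqF.
  exact: modLM.
apply: le_lt_trans (Niota _ _) _; rewrite normcX normc_real.
have := n1P n n1n; rewrite sub0r normrN normrX ltr_pdivlMr ?ltr_wpDl //.
by apply: le_lt_trans; rewrite ler_wpM2l ?exprn_ge0 // (le_trans ec) ?lerDl.
Qed.

Lemma vbounded_start : vbounded (N v + 1) (N 1).
Proof.
exists 0%N => n _; exists (vpow (N v + 1) n); first exact: modL_refl.
have r0 : 0 < N v + 1 by rewrite ltr_wpDl.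
apply: le_trans (Niota _ _) _.
rewrite Normc.normcV normcX normc_real gtr0_norm //.
rewrite ler_pdivrMl ?exprn_gt0 // mulrC; apply: le_trans (semi_normX _ _) _.
rewrite ler_wpM2l //; apply: lerXn2r; rewrite ?nnegrE ?lerDl //.
exact: ltW.
Qed.

(** If (v/rho)^n is congruent to a small e, the mean at rho is congruent to (1-e)^{-1}, close to 1.
    By the Lipschitz bound the mean at rho' is congruent to some 1 + e' with e' of norm at most 1/2.
    Since that mean inverts 1 - (v/rho')^n, the power (v/rho')^n is congruent to (1+e')^{-1}e',
    which is bounded. *)
Lemma vsmall_step M K :
  (forall n z rho rho',
    n.-primitive_root z -> normc z = 1 ->
    0 < rho <= M -> rho != 1 -> 0 < rho' <= M -> rho' != 1 ->
    exists e, modL (avg n z rho - avg n z rho') e /\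
              N e <= K * `|rho - rho'|) ->
  forall rho rho', 0 < rho <= M -> rho != 1 -> 0 < rho' <= M -> rho' != 1 ->
  K * `|rho - rho'| <= 4^-1 -> vsmall rho -> vbounded rho' (N 1).
Proof.
move=> lip rho rho' rhoM rho1 rho'M rho'1 Kd sm.
have n1p : 0 < N 1 by apply: lt_le_trans N1_ge1.
(* The inverse of 1 - e has norm at most 2 N(1), so an e of norm below 1/(8 N(1)) moves it away from
   1 by at most 1/4; the change of radius costs another 1/4. *)
have [n0 n0P] := sm (8 * N 1)^-1 ltac:(by rewrite invr_gt0 mulr_gt0).
exists n0.+1 => n nn0; have n_gt0 : (0 < n)%N by case: n nn0.
have [e ve eN] := n0P n (ltnW nn0).
have e2 : N e < 2^-1.
  apply: lt_le_trans eN _; rewrite lef_pV2 ?posrE ?mulr_gt0 //.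
  by have := N1_ge1; lra.
have e1 : N e < 1 by apply: lt_trans e2 _; lra.
have [z0 zn z1] := exists_prim_root R n_gt0.
have [z ze] := Nneumann e1.
have avgz : modL (avg n z0 rho) z.
  have : modL 1 ((1 - e) * avg n z0 rho).
    rewrite -[X in modL X](avg_inv zn z1 (andP rhoM).1 rho1) mulrBr mulr1.
    rewrite mulrBl mul1r.
    by apply: modLD; [exact: modL_refl | rewrite -avgC; exact/modLN/modLM].
  by move=> /(modLM z); rewrite mulr1 mulrA ze mul1r; exact: modL_sym.
have zE : z = 1 + z * e by rewrite -ze mulrBr mulr1 subrK.
have Nz : N (z * e) <= 4^-1.
  apply: le_trans (NM _ _) _.
  apply: (@le_trans _ _ ((2 * N 1) * (8 * N 1)^-1)).
    apply: ler_pM => //; last exact: ltW.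
    apply: le_trans (neumann_bound e1 ze) _.
    rewrite mulrC ler_wpM2r // -[leRHS]invrK lef_pV2 ?posrE ?subr_gt0 //; lra.
  by rewrite invfM mulrACA divff ?gt_eqF // mulr1; lra.
have [E [aE NE]] := lip n z0 rho rho' zn z1 rhoM rho1 rho'M rho'1.
pose e' := z * e - E.
have Ne' : N e' <= 2^-1.
  apply: le_trans (semi_normB _ _) _; apply: (@le_trans _ _ (4^-1 + 4^-1)); last by lra.
  by apply: lerD => //; exact: le_trans Kd.
have avg' : modL (avg n z0 rho') (1 + e').
  rewrite /e' addrA -zE -(subKr (avg n z0 rho) (avg n z0 rho')).
  by apply: modLD => //; exact: modLN.
have Ne1 : N (- e') < 1 by rewrite NN; apply: le_lt_trans Ne' _; lra.
have [z' ze'] := Nneumann Ne1; rewrite opprK in ze'.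
exists (z' * e').
  have h : modL 1 ((1 + e') - (1 + e') * vpow rho' n).
    rewrite -[X in modL X](avg_inv zn z1 (andP rho'M).1 rho'1) mulrBr mulr1.
    apply: modLD => //; apply: modLN.
    by rewrite -!vpowC; exact: modLM.
  have {}h : modL ((1 + e') * vpow rho' n) e'.
    set P := (1 + e') * _ in h *; have := modLD h (modL_refl (P - 1)).
    have -> : 1 + (P - 1) = P by rewrite addrC subrK.
    by have -> : 1 + e' - P + (P - 1) = e' by rewrite addrA subrK addrC addKr.
  by have := modLM z' h; rewrite mulrA ze' mul1r.
apply: le_trans (NM _ _) _.
have hz : N z' <= 2 * N 1.
  apply: le_trans (neumann_bound Ne1 _) _; first by rewrite opprK.
  rewrite NN mulrC ler_wpM2r // -[leRHS]invrK lef_pV2 ?posrE ?subr_gt0 //; lra.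
apply: (@le_trans _ _ ((2 * N 1) * 2^-1)); last by lra.
exact: ler_pM.
Qed.

Lemma between_neq1 (x y : R) : x < y -> exists2 c, x < c < y & c != 1.
Proof.
move=> xy; have [h|h] := eqVneq ((x + y) / 2) 1; last first.
  by exists ((x + y) / 2) => //; apply/andP; split; lra.
exists ((x + (x + y) / 2) / 2); first by apply/andP; split; lra.
by apply/eqP => h2; lra.
Qed.

(** Descent from a radius above N(v): the admissible step length depends only on the Lipschitz
    constant for radii up to N(v) + 2, so finitely many steps of length h/2 reach any positive
    radius. Boundedness at a radius gives smallness at every larger one through the factor
    (rho'/rho)^n. *)
Lemma vsmall_all rho : 0 < rho -> vsmall rho.
Proof.
pose M0 := N v + 1.
have M00 : 0 < M0 by rewrite ltr_wpDl.
have [K [K0 lip]] := avg_lipschitz (M0 + 1).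
pose h := (4 * (K + 1))^-1.
have h0 : 0 < h by rewrite invr_gt0 mulr_gt0 // ltr_wpDl.
have Kh : K * h <= 4^-1.
  by rewrite /h invfM mulrCA ler_piMr // ler_pdivrMr ?mul1r ?lerDl // ltr_wpDl.
have h1 : h <= 1.
  by rewrite /h invf_le1 ?mulr_gt0 ?ltr_wpDl //; lra.
have big r : M0 < r -> vsmall r.
  by move=> M0r; apply: vbounded_small vbounded_start; rewrite M00.
suff main j r : 0 < r -> M0 - j%:R * (h / 2) < r -> vsmall r.
  move=> rho0; apply: (main (Num.bound (M0 / (h / 2)))) => //.
  rewrite (le_lt_trans _ rho0) // subr_le0 -ler_pdivrMr ?divr_gt0 //.
  apply: ltW; apply: le_lt_trans (archi_boundP _); first exact: lexx.
  by rewrite !divr_ge0 // ltW.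
elim: j r => [r _|j IHj r r0]; first by rewrite mul0r subr0; exact: big.
rewrite -natr1 => hr; have [/big//|rM0] := ltP M0 r.
(* The radius [rp] is covered by the induction hypothesis, [rm] lies just below [r], and their
   distance is less than h. Both must avoid 1, since the resolvent is only available off the unit
   circle. *)
have [rp rpP rp1] : exists2 c, r + h / 2 < c < r + 3 / 4 * h & c != 1.
  by apply: between_neq1; lra.
have [rm rmP rm1] : exists2 c, Num.max 0 (r - h / 4) < c < r & c != 1.
  by apply: between_neq1; rewrite gt_max r0 /=; lra.
move: rpP rmP; rewrite gt_max => /andP[rp2 rp3] /andP[/andP[rm2 rm3] rm4].
have rps : vsmall rp by apply: IHj; lra.
apply: (@vbounded_small rm _ (N 1)); first by rewrite rm2.
apply: (vsmall_step lip _ rp1 _ rm1 _ rps).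
- by apply/andP; split; lra.
- by apply/andP; split; lra.
apply: le_trans Kh; rewrite ler_wpM2l // ger0_norm; lra.
Qed.

(** The point 0 is off the circle, so v has an inverse w. For rho = 1/(N(w)+1) the identity 1 =
    (rho^n w^n)(v/rho)^n has a first factor of norm at most N(1), while the second is congruent to
    an arbitrarily small e. Hence 1 is congruent modulo Ba to an element of norm less than 1. *)
Theorem left_inverse_of_local : exists c, c * a = 1.
Proof.
have n1p : 0 < N 1 by apply: lt_le_trans N1_ge1.
have w1 : res 0 * v = 1.
  by have := @resE 0; rewrite Normc.normc0 iota0 subr0 eq_sym oner_eq0; exact.
set w := res 0 in w1.
have r0 : 0 < (N w + 1)^-1 by rewrite invr_gt0 ltr_wpDl.
have [n nP] := vsmall_all r0 (eps := (2 * N 1)^-1)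
  ltac:(by rewrite invr_gt0 mulr_gt0).
have [e ve eN] := nP n (leqnn _).
have wv : w ^+ n * v ^+ n = 1.
  rewrite -exprMn_comm ?w1 ?expr1n //; exact/esym/vC.
have h : modL 1 (iota ((N w + 1)^-1%:C ^+ n) * w ^+ n * e).
  have <- : iota ((N w + 1)^-1%:C ^+ n) * w ^+ n * vpow (N w + 1)^-1 n = 1.
    rewrite /vpow [_ * (_ * v ^+ n)]mulrA -[_ * w ^+ n * iota _]mulrA.
    rewrite -[w ^+ n * iota _]iotaC mulrA -iotaM mulfV ?iota1 ?mul1r //.
    by rewrite expf_neq0 // fmorph_eq0 gt_eqF.
  exact: modLM.
set e2 := _ * e in h.
have Ne2 : N e2 < 1.
  apply: le_lt_trans (NM _ _) _.
  apply: (@le_lt_trans _ _ (N 1 * N e)).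
    rewrite ler_wpM2r //; apply: le_trans (Niota _ _) _.
    rewrite normcX normc_real gtr0_norm // exprVn ler_pdivrMl ?exprn_gt0 //;
      last by rewrite ltr_wpDl.
    rewrite mulrC; apply: le_trans (semi_normX _ _) _.
    rewrite ler_wpM2l //; apply: lerXn2r; rewrite ?nnegrE ?lerDl //.
    by rewrite addr_ge0.
  rewrite mulrC -ltr_pdivlMr // mul1r; apply: lt_le_trans eN _.
  by rewrite lef_pV2 ?posrE ?mulr_gt0 // ler_peMl ?N_ge0 //; lra.
have [z ze] := Nneumann Ne2.
by case: h => c hc; exists (z * c); rewrite -mulrA -hc.
Qed.

End LeftInverse.

(** * Strongly measurable functions *)

Section RealNorm.
Variables (R : realType) (A : banachAlgType R[i]).
Implicit Types (u v : A) (k : R[i]).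

Lemma normr_rnorm v : `|v| = (rnorm v)%:C.
Proof. by rewrite /rnorm RRe_real // normr_real. Qed.

Lemma rnorm_ge0 v : 0 <= rnorm v.
Proof. by rewrite -lecR -normr_rnorm; exact: normr_ge0. Qed.

Lemma rnorm0 : rnorm (0 : A) = 0.
Proof. by rewrite /rnorm normr0. Qed.

Lemma rnorm0_eq0 v : rnorm v = 0 -> v = 0.
Proof. by move=> h; apply/eqP; rewrite -normr_eq0 normr_rnorm h. Qed.

Lemma rnormD u v : rnorm (u + v) <= rnorm u + rnorm v.
Proof. by rewrite -lecR rmorphD /= -!normr_rnorm ler_normD. Qed.

Lemma rnormN v : rnorm (- v) = rnorm v.
Proof. by rewrite /rnorm normrN. Qed.

Lemma rnormB u v : rnorm (u - v) <= rnorm u + rnorm v.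
Proof. by rewrite -(rnormN v) rnormD. Qed.

Lemma rnorm_distC u v : rnorm (u - v) = rnorm (v - u).
Proof. by rewrite -rnormN opprB. Qed.

Lemma rnorm_dist u v : `|rnorm u - rnorm v| <= rnorm (u - v).
Proof.
rewrite ler_norml lerBrDr lerBlDr addrC -{1}(subrK u v) rnorm_distC.
rewrite lerBlDl.
have := rnormD (v - u) u; have := rnormD (u - v) v; rewrite !subrK.
by rewrite rnorm_distC => -> h; rewrite andbT; move: h; rewrite addrC.
Qed.

Lemma rnormM u v : rnorm (u * v) <= rnorm u * rnorm v.
Proof. by rewrite -lecR rmorphM /= -!normr_rnorm normM_le. Qed.

Lemma rnormZ k v : rnorm (k *: v) = normc k * rnorm v.
Proof.
apply: complexI; rewrite -normr_rnorm normrZ rmorphM /=.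
by rewrite normr_complexE normr_rnorm.
Qed.

Lemma rnorm_sum (I : Type) (r : seq I) (P : pred I) (F : I -> A) :
  rnorm (\sum_(i <- r | P i) F i) <= \sum_(i <- r | P i) rnorm (F i).
Proof.
apply: (big_ind2 (fun (x : A) y => rnorm x <= y)) => [|x u y v xu yv|//].
  by rewrite rnorm0.
by apply: le_trans (rnormD _ _) _; exact: lerD.
Qed.

Lemma gt0_complexE (e : R[i]) : 0 < e -> e = (complex.Re e)%:C.
Proof. by case: e => a b; rewrite ltcE /= => /andP[/eqP -> _]. Qed.

Lemma cvg_rnormP (u : nat -> A) v :
  u n @[n --> \oo] --> v <-> rnorm (v - u n) @[n --> \oo] --> (0 : R).
Proof.
split=> [/cvgrPdist_lt h|/cvgrPdist_lt h]; apply/cvgrPdist_lt => e e0.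
  have := h e%:C; rewrite ltcR => /(_ e0); apply: filterS => n.
  by rewrite normr_rnorm ltcR sub0r normrN ger0_norm ?rnorm_ge0.
have : 0 < complex.Re e by move: e0; rewrite ltcE /= => /andP[].
move=> /h; apply: filterS => n; rewrite sub0r normrN ger0_norm ?rnorm_ge0 //.
by rewrite normr_rnorm [e in X in _ -> X]gt0_complexE // ltcR.
Qed.

Lemma rnorm_cauchy_cvg (u : nat -> A) :
  (forall e : R, 0 < e -> exists N, forall m n, (N <= m)%N -> (N <= n)%N ->
     rnorm (u m - u n) < e) ->
  exists v, rnorm (v - u n) @[n --> \oo] --> (0 : R).
Proof.
move=> h; suff /cauchy_cvgP uc : cauchy (u @ \oo).
  by exists (lim (u @ \oo)); apply/cvg_rnormP.
apply/cauchy_ballP => e e0.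
have e1 : 0 < complex.Re e by move: e0; rewrite ltcE /= => /andP[].
have [N NP] := h _ e1.
exists (u @` [set n | (N <= n)%N], u @` [set n | (N <= n)%N]) => /=.
  by split; exists N => // n /= Nn; exists n.
move=> [_ _] /= [[m Nm <-] [n Nn <-]]; rewrite -ball_normE /= normr_rnorm.
by rewrite (gt0_complexE e0) ltcR; exact: NP.
Qed.

End RealNorm.

Section StronglyMeasurable.
Variables (R : realType) (A : banachAlgType R[i]).

Section SimpleFunctions.
Context d (T : measurableType d).
Implicit Types (f g s t : T -> A).

Definition simpleT s : Prop :=
  finite_set (range s) /\ forall v, measurable (s @^-1` [set v]).

(** Convergence is required at every point, so that no null set has to be carried through algebraic
    operations. Up to null sets this is Bochner measurability ([strongly_measurableP]). *)
Definition smeas f : Prop := exists s : nat -> T -> A,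
  (forall n, simpleT (s n)) /\
  forall x, rnorm (f x - s n x) @[n --> \oo] --> (0 : R).

Lemma simple_preimage s (P : set A) : simpleT s -> measurable (s @^-1` P).
Proof.
move=> [fs ms].
have -> : s @^-1` P = \bigcup_(v in range s `&` P) (s @^-1` [set v]).
  apply/seteqP; split => [x Px|x [v [_ Pv] /= sxv]].
    by exists (s x) => //; split => //; exists x.
  by rewrite /preimage /= sxv.
by apply: fin_bigcup_measurable => [|v _]; [exact: finite_setIl|exact: ms].
Qed.

Lemma simple_op2 (op : A -> A -> A) s t : simpleT s -> simpleT t ->
  simpleT (fun x => op (s x) (t x)).
Proof.
move=> ss st; have [fs ms] := ss; have [ft mt] := st; split.
  apply: (@sub_finite_set _ _ (image2 (range s) (range t) op)).
    by move=> _ [x _ <-]; exists (s x); [exists x|exists (t x); [exists x|]].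
  exact: finite_image2.
move=> v.
have -> : (fun x => op (s x) (t x)) @^-1` [set v] =
    \bigcup_(a in range s) (s @^-1` [set a] `&` t @^-1` [set b | op a b = v]).
  apply/seteqP; split => [x /= xv|x [a _ [/= <-]]//].
  by exists (s x) => //; exists x.
apply: fin_bigcup_measurable => // a _; apply: measurableI => //.
exact: simple_preimage.
Qed.

Lemma simple_op (op : A -> A) s : simpleT s -> simpleT (fun x => op (s x)).
Proof. by move=> ss; exact: (simple_op2 (fun a _ => op a) ss ss). Qed.

Lemma simple_cst v : simpleT (cst v).
Proof.
split.
  apply: (@sub_finite_set _ _ [set v]); last exact: finite_set1.
  by move=> _ [x _ <-].
move=> w; have [->|vw] := eqVneq v w.
  by rewrite (_ : _ @^-1` _ = setT) //; apply/seteqP; split.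
rewrite (_ : _ @^-1` _ = set0) //; apply/seteqP; split => // x /= xw.
by rewrite xw eqxx in vw.
Qed.

Lemma simple_if (E : T -> bool) s : measurable [set x | E x] -> simpleT s ->
  simpleT (fun x => if E x then s x else 0).
Proof.
move=> mE [fs ms]; split.
  apply: (@sub_finite_set _ _ (range s `|` [set 0])).
    by move=> _ [x _ <-]; case: (E x); [left; exists x|right].
  by rewrite finite_setU.
move=> v.
have -> : (fun x => if E x then s x else 0) @^-1` [set v] =
    ([set x | E x] `&` s @^-1` [set v]) `|`
    (~` [set x | E x] `&` (cst 0 : T -> A) @^-1` [set v]).
  apply/seteqP; split => [x /=|x /=].
    by case: (E x) => xv; [left|right].
  by case: (E x) => [[[]|[]]|[[]|[]]].
apply: measurableU; first exact: measurableI.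
by apply: measurableI; [exact: measurableC | exact: (simple_cst 0).2].
Qed.

Lemma simple_indic (E : set T) v : measurable E ->
  simpleT (fun x => (\1_E x)%:C *: v).
Proof.
move=> mE.
have -> : (fun x => (\1_E x : R)%:C *: v) = (fun x => if x \in E then v else 0).
  by apply/funext => x; rewrite indicE; case: (x \in E); rewrite ?scale1r ?scale0r.
apply: simple_if; last exact: simple_cst.
by rewrite (_ : [set x | _] = E) //; apply/seteqP; split => x /=; rewrite inE.
Qed.

Lemma simple_measurable_fun s d' (T' : measurableType d') (g : A -> T') :
  simpleT s -> measurable_fun setT (fun x => g (s x)).
Proof.
move=> ss _ Y _; rewrite setTI -[X in measurable X]/(s @^-1` (g @^-1` Y)).
exact: simple_preimage.
Qed.

Lemma simple_smeas s : simpleT s -> smeas s.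
Proof.
move=> ss; exists (fun=> s); split => // x.
by under eq_fun do rewrite subrr rnorm0; exact: cvg_cst.
Qed.

Lemma smeas_rnorm f : smeas f -> measurable_fun setT (fun x => rnorm (f x)).
Proof.
move=> [s [ss sf]].
apply: (@measurable_fun_cvg _ _ _ _ (fun n x => rnorm (s n x))).
  by move=> n; exact: simple_measurable_fun.
move=> x _; apply/cvgrPdist_lt => e e0.
have /cvgrPdist_lt/(_ _ e0) := sf x; apply: filterS => n.
rewrite sub0r normrN ger0_norm ?rnorm_ge0 //; apply: le_lt_trans.
exact: rnorm_dist.
Qed.

Lemma smeas_op2 (op : A -> A -> A) f g :
  (forall a b (s t : nat -> A), rnorm (a - s n) @[n --> \oo] --> (0 : R) ->
     rnorm (b - t n) @[n --> \oo] --> (0 : R) ->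
     rnorm (op a b - op (s n) (t n)) @[n --> \oo] --> (0 : R)) ->
  smeas f -> smeas g -> smeas (fun x => op (f x) (g x)).
Proof.
move=> opc [s [ss sf]] [t [st tg]].
exists (fun n x => op (s n x) (t n x)); split=> [n|x]; first exact: simple_op2.
exact: opc.
Qed.

Lemma smeas_op (op : A -> A) f :
  (forall a (s : nat -> A), rnorm (a - s n) @[n --> \oo] --> (0 : R) ->
     rnorm (op a - op (s n)) @[n --> \oo] --> (0 : R)) ->
  smeas f -> smeas (fun x => op (f x)).
Proof.
move=> opc mf; apply: (smeas_op2 (op := fun a _ => op a) _ mf mf).
by move=> a b s t /opc.
Qed.

Lemma rnorm_squeeze (u : nat -> A) (w : nat -> R) :
  (forall n, rnorm (u n) <= w n) -> w n @[n --> \oo] --> (0 : R) ->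
  rnorm (u n) @[n --> \oo] --> (0 : R).
Proof.
move=> uw; apply: (@squeeze_cvgr _ _ _ _ (fun=> 0)); last exact: cvg_cst.
by near=> n; rewrite rnorm_ge0 uw.
Unshelve. all: by end_near. Qed.

Lemma smeasD f g : smeas f -> smeas g -> smeas (fun x => f x + g x).
Proof.
apply: (smeas_op2 (op := +%R)) => a b s t sa tb.
apply: (@rnorm_squeeze _ (fun n => rnorm (a - s n) + rnorm (b - t n))).
  by move=> n; rewrite opprD addrACA rnormD.
by rewrite -[0]addr0; exact: cvgD.
Qed.

Lemma smeasM f g : smeas f -> smeas g -> smeas (fun x => f x * g x).
Proof.
apply: (smeas_op2 (op := *%R)) => a b s t sa tb.
apply: (@rnorm_squeeze _ (fun n => rnorm a * rnorm (b - t n) +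
   rnorm (a - s n) * (rnorm b + rnorm (b - t n)))).
  move=> n.
  have -> : a * b - s n * t n = a * (b - t n) + (a - s n) * (b - (b - t n)).
    by rewrite subKr mulrBr mulrBl addrA subrK.
  apply: le_trans (rnormD _ _) _; apply: lerD; first exact: rnormM.
  apply: le_trans (rnormM _ _) _; rewrite ler_wpM2l ?rnorm_ge0 //.
  exact: rnormB.
rewrite (_ : 0 = rnorm a * 0 + 0 * (rnorm b + 0)); last first.
  by rewrite mulr0 mul0r addr0.
apply: cvgD; first exact: cvgMr.
by apply: cvgM => //; apply: cvgD => //; exact: cvg_cst.
Qed.

Lemma smeasN f : smeas f -> smeas (fun x => - f x).
Proof.
apply: (smeas_op (op := -%R)) => a s.
by apply: rnorm_squeeze => n; rewrite -opprD rnormN.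
Qed.

Lemma smeasB f g : smeas f -> smeas g -> smeas (fun x => f x - g x).
Proof. by move=> mf mg; apply: smeasD => //; exact: smeasN. Qed.

Lemma smeas_scalar (phi : T -> R) v : measurable_fun setT phi ->
  smeas (fun x => (phi x)%:C *: v).
Proof.
move=> mphi.
have [g gphi] := approximation_sfun measurableT ((measurable_EFinP _ _).2 mphi).
exists (fun n x => (g n x)%:C *: v); split => [n|x]; last first.
  have : g n x @[n --> \oo] --> phi x.
    exact: (fine_cvg (gphi x Logic.I)).
  move=> /cvgrPdist_lt h; apply/cvgrPdist_lt => e e0.
  have e1 : 0 < e / (rnorm v + 1) by rewrite divr_gt0 // ltr_wpDl ?rnorm_ge0.
  have := h _ e1; apply: filterS => n.
  rewrite sub0r normrN -scalerBl -rmorphB rnormZ normc_real.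
  rewrite ltr_pdivlMr ?ltr_wpDl ?rnorm_ge0 // [`|_ * rnorm v|]ger0_norm;
    last by rewrite mulr_ge0 ?rnorm_ge0.
  by apply: le_lt_trans; rewrite ler_wpM2l // lerDl.
split.
  apply: (@sub_finite_set _ _ ((fun r => r%:C *: v) @` range (g n))).
    by move=> _ [x' _ <-]; exists (g n x') => //; exists x'.
  exact: finite_image.
move=> w; rewrite (_ : _ @^-1` _ = \bigcup_(r in range (g n) `&`
    [set r | r%:C *: v = w]) (g n @^-1` [set r])).
  by apply: fin_bigcup_measurable; first exact: finite_setIl.
apply/seteqP; split => [x' /= xw|x' [r [_ rw] /= ->]//].
by exists (g n x') => //; split => //; exists x'.
Qed.

End SimpleFunctions.

Lemma smeas_comp d d' (T : measurableType d) (T' : measurableType d')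
  (f : T -> A) (g : T' -> T) : measurable_fun setT g -> smeas f ->
  smeas (fun x => f (g x)).
Proof.
move=> mg [s [ss sf]]; exists (fun n x => s n (g x)); split => // n.
have [fs ms] := ss n; split.
  apply: (@sub_finite_set _ _ (range (s n))) => //.
  by move=> _ [x _ <-]; exists (g x).
by move=> v; rewrite -[X in measurable X]setTI; exact: mg (ms v).
Qed.

Local Notation mu := (@lebesgue_measure R).

Lemma ae_imply (P Q : R -> Prop) : (forall x, P x -> Q x) ->
  {ae mu, forall x, P x} -> {ae mu, forall x, Q x}.
Proof.
by move=> PQ; apply: (@filterS _ _ (ae_filter_ringOfSetsType mu)) => x /PQ.
Qed.

Lemma ae_imply2 (P Q S : R -> Prop) : (forall x, P x -> Q x -> S x) ->
  {ae mu, forall x, P x} -> {ae mu, forall x, Q x} -> {ae mu, forall x, S x}.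
Proof.
move=> PQS; apply: (@filterS2 _ _ (ae_filter_ringOfSetsType mu)) => x.
exact: PQS.
Qed.

Lemma strongly_measurable_ae_eq (f g : R -> A) :
  {ae mu, forall x, f x = g x} ->
  strongly_measurable f -> strongly_measurable g.
Proof.
move=> fg [s [ss sf]]; exists s; split => //.
by apply: ae_imply2 fg sf => x ->.
Qed.

Lemma smeas_strongly_measurable (f : R -> A) :
  smeas f -> strongly_measurable f.
Proof.
by move=> [s [ss sf]]; exists s; split => //; apply/aeW => x; exact/cvg_rnormP.
Qed.

(** Both the function and its simple approximants are set to zero on a measurable null set outside
    which convergence holds. *)
Lemma strongly_measurableP (f : R -> A) : strongly_measurable f ->
  exists2 g, smeas g & {ae mu, forall x, f x = g x}.
Proof.
move=> [s [ss [N [mN N0 sN]]]].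
exists (fun x => if x \in ~` N then f x else 0); last first.
  exists N; split => // x /= fx; apply: contrapT => Nx; apply: fx.
  by rewrite ifT // inE.
exists (fun n x => if x \in ~` N then s n x else 0); split => [n|x].
  apply: simple_if; last exact: ss.
  rewrite (_ : [set x | _] = ~` N); first exact: measurableC.
  by apply/seteqP; split => x /=; rewrite inE.
case E: (x \in ~` N); last first.
  by under eq_fun do rewrite subrr rnorm0; exact: cvg_cst.
apply/cvg_rnormP; apply: contrapT => h.
by have /set_mem := E; apply; exact: sN.
Qed.

End StronglyMeasurable.

(** * Bochner integrals of simple functions *)

Section NonMeasurableIntegrand.
Variable R : realType.
Local Notation mu := (@lebesgue_measure R).

(* No measurability is assumed: a simple function below [f] vanishing on the
   exceptional null set lies below [g]. *)
Lemma ge0_ae_le_integral (f g : R -> \bar R) :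
  (forall x, 0 <= f x)%E -> (forall x, 0 <= g x)%E ->
  {ae mu, forall x, (f x <= g x)%E} ->
  (\int[mu]_x f x <= \int[mu]_x g x)%E.
Proof.
move=> f0 g0 [N [mN N0 fgN]]; rewrite !ge0_integralTE //.
apply: ge_ereal_sup => _ [h hf <-].
pose h' := proj_nnsfun h (measurableC mN).
have -> : sintegral mu h = sintegral mu h'.
  rewrite -!integralT_nnsfun; apply: ge0_ae_eq_integral => //.
  - exact/measurable_EFinP.
  - exact/measurable_EFinP.
  - by move=> x _; rewrite lee_fin.
  - by move=> x _; rewrite lee_fin.
  exists N; split => // x /= hx; apply: contrapT => Nx; apply: hx => _.
  by rewrite /= /= mindicE mem_set // mulr1.
apply: ereal_sup_ubound; exists h' => // x.
rewrite /= mindicE; case: (pselect (N x)) => Nx.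
  by rewrite memNset ?mulr0 //; exact.
rewrite mem_set // mulr1; apply: le_trans (hf x) _.
by apply: contrapT => /fgN.
Qed.

Lemma ge0_ae_eq_integralT (f g : R -> \bar R) :
  (forall x, 0 <= f x)%E -> (forall x, 0 <= g x)%E ->
  {ae mu, forall x, f x = g x} -> (\int[mu]_x f x = \int[mu]_x g x)%E.
Proof.
move=> f0 g0 fg; apply/eqP; rewrite eq_le.
by apply/andP; split; apply: ge0_ae_le_integral => //;
  apply: ae_imply fg => x ->.
Qed.

Lemma lebesgue_measure_le (E F : set R) : measurable E -> measurable F ->
  E `<=` F -> (mu E <= mu F)%E.
Proof.
move=> mE mF EF.
by apply: (@le_measure _ _ _ mu); rewrite ?inE.
Qed.

Lemma lebesgue_measureU_le (E F : set R) : measurable E -> measurable F ->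
  (mu (E `|` F) <= mu E + mu F)%E.
Proof. by move=> mE mF; exact: (@measureU2 _ _ _ mu). Qed.

Lemma ecvg0P (u : nat -> \bar R) : (forall n, 0 <= u n)%E ->
  u n @[n --> \oo] --> 0%E <->
  forall e : R, 0 < e -> \forall n \near \oo, (u n < e%:E)%E.
Proof.
move=> u0; split => [/fine_cvgP[uf /cvgrPdist_lt uc] e e0|h].
  apply: filterS2 uf (uc _ e0) => n un; rewrite sub0r normrN => un1.
  rewrite -(fineK un) lte_fin; apply: le_lt_trans un1; exact: ler_norm.
apply/fine_cvgP; split.
  apply: filterS (h _ ltr01) => n un; rewrite ge0_fin_numE //.
  exact: lt_trans un (ltry _).
apply/cvgrPdist_lt => e e0; apply: filterS (h _ e0) => n un.
rewrite sub0r normrN /= ger0_norm ?fine_ge0 // -lte_fin fineK //.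
by rewrite ge0_fin_numE //; exact: lt_trans un (ltry _).
Qed.

Lemma ecvg0_le (u w : nat -> \bar R) : (forall n, 0 <= u n <= w n)%E ->
  w n @[n --> \oo] --> 0%E -> u n @[n --> \oo] --> 0%E.
Proof.
move=> uw w0; apply: squeeze_cvge; last exact: w0.
  by apply: nearW => n; exact: uw.
exact: cvg_cst.
Qed.

End NonMeasurableIntegrand.

Section SimpleIntegral.
Variables (R : realType) (A : banachAlgType R[i]).
Local Notation mu := (@lebesgue_measure R).
Implicit Types (s t : R -> A) (v w : A).

Local Notation m E := (fine (mu E)).

Lemma integrable_simple_fin s v : integrable_simple s -> v != 0 ->
  mu (s @^-1` [set v]) \is a fin_num.
Proof. by move=> [_ sf] /sf; rewrite ge0_fin_numE. Qed.

Lemma simple_integralE s (S : seq A) : uniq S -> (forall x, s x \in S) ->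
  finite_set (range s) ->
  simple_integral s = \sum_(v <- S) (m (s @^-1` [set v]))%:C *: v.
Proof.
move=> uS sS fs; rewrite /simple_integral (@fsbig_widen _ _ _ _ _ [set` S]).
- by rewrite -fsbig_seq.
- by move=> _ [x _ <-] /=; exact: sS.
move=> v [_ /= Sv]; rewrite (_ : _ @^-1` _ = set0) ?measure0 ?scale0r //.
by apply/seteqP; split => // x /= xv; apply: Sv; exists x.
Qed.

Lemma fine_measure_partition (E : set R) t (S : seq A) : measurable E ->
  (mu E < +oo)%E -> simple t -> uniq S -> (forall x, t x \in S) ->
  m E = \sum_(w <- S) m (E `&` t @^-1` [set w]).
Proof.
move=> mE Efin [ft mt] uS tS.
have mEt w : measurable (E `&` t @^-1` [set w]) by apply: measurableI; [exact: mE|exact: mt].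
have EE : E = \bigcup_(w in [set` S]) (E `&` t @^-1` [set w]).
  apply/seteqP; split => [x Ex|x [w _ []]//].
  by exists (t x) => //=; exact: tS.
rewrite [in LHS]EE measure_fin_bigcup; last first.
- by move=> w _; exact: mEt.
- by move=> v w _ _ [x [[_ /= <-] [_ /= <-]]].
- exact: finite_seq.
rewrite -fsbig_seq // -sum_fine // => w _.
rewrite ge0_fin_numE //; apply: le_lt_trans Efin.
by apply: lebesgue_measure_le => [||x []//]; [exact: mEt|exact: mE].
Qed.

Local Notation supp u := (u @^-1` ~` [set (0 : A)%R]).

Lemma simple_support_fin s : integrable_simple s ->
  (mu (supp s) < +oo)%E.
Proof.
move=> [[fu mu_] ufin].
have -> : supp s = \bigcup_(v in range s `\ 0) (s @^-1` [set v]).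
  apply/seteqP; split => [x /= ux|x [v [_ /= v0] /= ->]//].
  by exists (s x) => //; split => //; exists x.
rewrite measure_fin_bigcup; last first.
- by move=> v _; exact: mu_.
- by move=> v w _ _ [x [/= <- <-]].
- exact: finite_setD.
rewrite fsbig_finite /=; last exact: finite_setD.
rewrite big_seq lte_sum_pinfty // => v.
rewrite in_fset_set; last exact: finite_setD.
by rewrite inE => -[_ /= /eqP]; exact: ufin.
Qed.

Lemma op2_preimage_fin (op : A -> A -> A) s t z : op 0 0 = 0 ->
  integrable_simple s -> integrable_simple t -> z != 0 ->
  (mu ((fun x => op (s x) (t x)) @^-1` [set z]) < +oo)%E.
Proof.
move=> op0 is_ it z0.
have := simple_op2 op is_.1 it.1; set E := _ @^-1` _ => -[_ /(_ z) mE].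
have Esub : E `<=` supp s `|` supp t.
  move=> x /= Ex; apply: contrapT => /not_orP[/contrapT /= s0 /contrapT t0].
  by move: z0; rewrite -Ex s0 t0 op0 eqxx.
have ms : measurable (supp s) by apply: simple_preimage; exact: is_.1.
have mt : measurable (supp t) by apply: simple_preimage; exact: it.1.
apply: (@le_lt_trans _ _ (mu (supp s `|` supp t))).
  apply: lebesgue_measure_le; [exact: mE| |exact: Esub].
  by apply: measurableU; [exact: ms|exact: mt].
apply: (le_lt_trans (lebesgue_measureU_le ms mt)).
by rewrite lte_add_pinfty // simple_support_fin.
Qed.

(** Common refinement of the level sets of [s] and [t]. Additivity and linearity of the simple
    integral are read off from it by choosing [op]. *)
Lemma simple_integral_op2 (op : A -> A -> A) s t (S T : seq A) :
  integrable_simple s -> integrable_simple t -> op 0 0 = 0 ->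
  uniq S -> uniq T -> (forall x, s x \in S) -> (forall x, t x \in T) ->
  simple_integral (fun x => op (s x) (t x)) =
  \sum_(v <- S) \sum_(w <- T)
    (m (s @^-1` [set v] `&` t @^-1` [set w]))%:C *: op v w.
Proof.
move=> is_ it op0 uS uT sS tT.
have [ss sfin] := is_; have [st tfin] := it.
have so := simple_op2 op ss st.
pose Z := undup [seq op v w | v <- S, w <- T].
have oZ v w : v \in S -> w \in T -> op v w \in Z.
  by move=> vS wT; rewrite mem_undup; apply/allpairsP; exists (v, w).
rewrite (@simple_integralE _ Z) ?undup_uniq //; last 2 first.
- by move=> x; exact: oZ.
- exact: so.1.
rewrite (eq_bigr (fun z => \sum_(v <- S) \sum_(w <- T)
    (if op v w == z then
       (m (s @^-1` [set v] `&` t @^-1` [set w]))%:C *: z else 0))); last first.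
  move=> z _; have [->|z0] := eqVneq z 0.
    rewrite scaler0 big1 // => v _; rewrite big1 // => w _.
    by case: ifP; rewrite ?scaler0.
  set E := _ @^-1` _; have mE : measurable E by exact: so.2.
  have Efin : (mu E < +oo)%E.
    exact: op2_preimage_fin.
  rewrite (@fine_measure_partition _ s S) // rmorph_sum scaler_suml.
  apply: eq_bigr => v _.
  rewrite (@fine_measure_partition _ t T) //; last 2 first.
  - by apply: measurableI => //; exact: ss.2.
  - apply: le_lt_trans Efin; apply: lebesgue_measure_le => [||x []//].
      by apply: measurableI; [exact: mE|exact: ss.2].
    exact: mE.
  rewrite rmorph_sum scaler_suml; apply: eq_bigr => w _.
  case: ifPn => [/eqP vwz|vwz].
    congr ((fine (mu _))%:C *: _); apply/seteqP; split => x /=.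
      by case=> -[_ ? ?].
    by move=> [sv tw]; split => //; split => //; rewrite /E /= sv tw.
  rewrite (_ : _ `&` _ = set0) ?measure0 ?scale0r //.
  apply/seteqP; split => // x [[/= Ex sv] tw].
  by move: vwz; rewrite -Ex sv tw eqxx.
rewrite exchange_big /=; apply: eq_big_seq => v vS.
rewrite exchange_big /=; apply: eq_big_seq => w wT.
rewrite (bigD1_seq (op v w)) ?undup_uniq ?oZ //= eqxx big1 ?addr0 // => z.
by rewrite eq_sym => /negPf ->.
Qed.

Lemma exists_range_seq s : simple s ->
  exists2 S : seq A, uniq S & forall x, s x \in S.
Proof.
move=> [/finite_seqP[S rS] _]; exists (undup S); first exact: undup_uniq.
move=> x; rewrite mem_undup.
by have : range s (s x) by [exists x]; rewrite rS.
Qed.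

Lemma simple_integralD s t : integrable_simple s -> integrable_simple t ->
  simple_integral (fun x => s x + t x) = simple_integral s + simple_integral t.
Proof.
move=> is_ it; have [S uS sS] := exists_range_seq is_.1.
have [T uT tT] := exists_range_seq it.1.
rewrite (@simple_integral_op2 +%R s t S T) ?addr0 //.
rewrite (_ : simple_integral s = simple_integral (fun x => s x)) //.
rewrite (@simple_integral_op2 (fun a _ => a) s t S T) //.
rewrite (_ : simple_integral t = simple_integral (fun x => t x)) //.
rewrite (@simple_integral_op2 (fun _ a => a) s t S T) //.
rewrite -big_split; apply: eq_bigr => v _.
by rewrite -big_split; apply: eq_bigr => w _; rewrite scalerDr.
Qed.

Lemma simple_integral_linear (phi : A -> A) s :
  (forall u v, phi (u + v) = phi u + phi v) ->
  (forall (r : R) u, phi (r%:C *: u) = r%:C *: phi u) ->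
  integrable_simple s ->
  simple_integral (fun x => phi (s x)) = phi (simple_integral s).
Proof.
move=> phiD phiZ is_; have [S uS sS] := exists_range_seq is_.1.
have phi0 : phi 0 = 0 by have := phiZ 0 0; rewrite !scale0r.
rewrite (_ : simple_integral s = simple_integral (fun x => s x)) //.
rewrite (@simple_integral_op2 (fun a _ => phi a) s s S S) //.
rewrite (@simple_integral_op2 (fun a _ => a) s s S S) //.
rewrite (big_morph _ phiD phi0); apply: eq_bigr => v _.
by rewrite (big_morph _ phiD phi0); apply: eq_bigr => w _; rewrite phiZ.
Qed.

Lemma integral_rnorm_simple s (S : seq A) : integrable_simple s ->
  uniq S -> (forall x, s x \in S) ->
  (\int[mu]_x (rnorm (s x))%:E =
    (\sum_(v <- S) m (s @^-1` [set v]) * rnorm v)%:E)%E.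
Proof.
move=> is_ uS sS.
have -> : (fun x => (rnorm (s x))%:E) = (fun x => \sum_(v <- S)
    (rnorm v * \1_(s @^-1` [set v]) x)%:E)%E.
  apply/funext => x; rewrite (bigD1_seq (s x)) //= big1 ?adde0.
    by rewrite indicE mem_set // mulr1.
  move=> v; rewrite eq_sym => /eqP sv; rewrite indicE memNset ?mulr0 //.
rewrite ge0_integral_sum //; last 2 first.
- move=> v; apply/measurable_EFinP; apply: measurable_funM => //.
  by apply: measurable_indic; exact: is_.1.2.
- by move=> v x _; rewrite lee_fin mulr_ge0 ?rnorm_ge0.
rewrite -sumEFin; apply: eq_bigr => v _.
have [->|v0] := eqVneq v 0.
  rewrite rnorm0 mulr0; apply: integral0_eq => x _; by rewrite mul0r.
under eq_integral do rewrite EFinM.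
rewrite ge0_integralZl_EFin ?rnorm_ge0 //; last first.
  apply/measurable_EFinP; apply: measurable_indic; exact: is_.1.2.
rewrite integral_indic //; last exact: is_.1.2.
by rewrite setIT EFinM fineK ?integrable_simple_fin // muleC.
Qed.

Lemma rnorm_simple_integral_le s : integrable_simple s ->
  ((rnorm (simple_integral s))%:E <= \int[mu]_x (rnorm (s x))%:E)%E.
Proof.
move=> is_; have [S uS sS] := exists_range_seq is_.1.
rewrite (integral_rnorm_simple is_ uS sS) lee_fin.
rewrite (simple_integralE uS sS is_.1.1).
apply: le_trans (rnorm_sum _ _ _) _; apply: ler_sum => v _.
by rewrite rnormZ normc_real ger0_norm ?fine_ge0.
Qed.

Lemma integrable_simple_op2 (op : A -> A -> A) s t : op 0 0 = 0 ->
  integrable_simple s -> integrable_simple t ->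
  integrable_simple (fun x => op (s x) (t x)).
Proof.
move=> op0 is_ it; split; first exact: (simple_op2 op is_.1 it.1).
by move=> z z0; exact: op2_preimage_fin.
Qed.

End SimpleIntegral.

Lemma ge0_le_integralT (R : realType) (f g : R -> \bar R) :
  (forall x, 0 <= f x)%E -> (forall x, f x <= g x)%E ->
  (\int[@lebesgue_measure R]_x f x <= \int[@lebesgue_measure R]_x g x)%E.
Proof.
move=> f0 fg; apply: ge0_ae_le_integral => //; last exact: aeW.
by move=> x; exact: le_trans (fg x).
Qed.

Lemma ler_powR_base (R : realType) (p a b : R) : 0 <= p -> 0 <= a -> a <= b ->
  a `^ p <= b `^ p.
Proof.
move=> p0 a0 ab; apply: (ge0_ler_powR p0) => //; rewrite nnegrE //.
exact: le_trans ab.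
Qed.

Lemma one_le_powR (R : realType) (p a : R) : 0 <= p -> 1 <= a -> 1 <= a `^ p.
Proof. by move=> p0 a1; have := ler_powR_base p0 ler01 a1; rewrite powR1. Qed.

Lemma dominated_cvg0 (R : realType) (F : nat -> R -> R) (G : R -> R) :
  (forall n, measurable_fun setT (F n)) -> measurable_fun setT G ->
  (forall n x, 0 <= F n x <= G x) ->
  (\int[@lebesgue_measure R]_x (G x)%:E < +oo)%E ->
  {ae @lebesgue_measure R, forall x, F n x @[n --> \oo] --> (0 : R)} ->
  (\int[@lebesgue_measure R]_x (F n x)%:E)%E @[n --> \oo] --> 0%E.
Proof.
move=> mF mG FG Gfin F0.
have G0 x : 0 <= G x by have /andP[] := FG 0%N x; exact: le_trans.
have mu0 : (\int[@lebesgue_measure R]_x (cst 0%E x : \bar R) = 0)%E.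
  by rewrite integral0.
rewrite -mu0.
have [] // := @dominated_convergence _ _ R (@lebesgue_measure R) setT measurableT
  (fun n x => (F n x)%:E) (cst 0%E) (EFin \o G).
- by move=> n; apply/measurable_EFinP; exact: mF.
- by apply: ae_imply F0 => x F0 _; apply/fine_cvgP; split => //; exact: nearW.
- apply/integrableP; split; first exact/measurable_EFinP.
  by under eq_integral do rewrite /= ger0_norm //.
- apply/aeW => x n _ /=; rewrite lee_fin ger0_norm; by have /andP[] := FG n x.
Qed.

(** * Approximation by integrable simple functions in a weighted L^p norm *)

Section SimpleApproximation.
Variables (R : realType) (A : banachAlgType R[i]).
Local Notation mu := (@lebesgue_measure R).
Variables (p : R) (w : R -> R).
Hypotheses (p1 : 1 <= p) (mw : measurable_fun setT w)
  (w1 : forall x, 1 <= w x).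

Lemma measurable_weighted_power (h : R -> R) : measurable_fun setT h ->
  measurable_fun setT (fun x => h x `^ p * w x `^ p).
Proof.
move=> mh; apply: measurable_funM.
  exact: (measurableT_comp (measurable_powR p) mh).
exact: (measurableT_comp (measurable_powR p) mw).
Qed.

(** The pointwise approximants are replaced by 0 wherever their norm exceeds twice that of [f].
    Convergence survives, the error is at most three times the norm of [f], and dominated
    convergence applies. *)
Lemma simple_approximation (f : R -> A) : smeas f ->
  (\int[mu]_x (rnorm (f x) `^ p * w x `^ p)%:E < +oo)%E ->
  exists s : nat -> R -> A,
    [/\ forall n, integrable_simple (s n),
        forall n x, rnorm (f x - s n x) <= 3 * rnorm (f x),
        forall x, rnorm (f x - s n x) @[n --> \oo] --> (0 : R)
      & (\int[mu]_x (rnorm (f x - s n x) `^ p * w x `^ p)%:E)%E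
          @[n --> \oo] --> 0%E].
Proof.
move=> mf ffin; have [s0 [ss0 s0f]] := mf.
have p0 : 0 < p by exact: lt_le_trans ltr01 p1.
have pn0 : p != 0 by rewrite gt_eqF.
pose c n x := rnorm (s0 n x) <= 2 * rnorm (f x).
pose s n x := if c n x then s0 n x else 0.
have mrf := smeas_rnorm mf.
have ss n : simple (s n).
  apply: simple_if; last exact: ss0.
  rewrite -[X in measurable X]setTI.
  have := @measurable_fun_ler _ _ _ setT (fun x => rnorm (s0 n x))
    (fun x => 2 * rnorm (f x)) (smeas_rnorm (simple_smeas (ss0 n))).
  move=> /(_ _); have : measurable_fun setT (fun x => 2 * rnorm (f x)).
    exact: measurable_funM.
  move=> m2 /(_ m2) /(_ measurableT [set true] Logic.I).
  exact.
have sf n x : rnorm (s n x) <= 2 * rnorm (f x).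
  rewrite /s; case: ifP => [//|_]; rewrite rnorm0 mulr_ge0 ?rnorm_ge0 //.
have fs n x : rnorm (f x - s n x) <= rnorm (f x - s0 n x).
  rewrite /s; case: ifPn => //; rewrite /c -ltNge subr0 => /ltW h.
  have := rnormD (s0 n x - f x) (f x); rewrite subrK rnorm_distC => h2.
  by lra.
have fs3 n x : rnorm (f x - s n x) <= 3 * rnorm (f x).
  by apply: le_trans (rnormB _ _) _; have := sf n x; lra.
have sf0 x : rnorm (f x - s n x) @[n --> \oo] --> (0 : R).
  apply: (@rnorm_squeeze _ _ _ (fun n => rnorm (f x - s0 n x))) => // n.
have mW h : measurable_fun setT h ->
    measurable_fun setT (fun x : R => (h x `^ p * w x `^ p)%:E).
  by move=> mh; apply/measurable_EFinP; exact: measurable_weighted_power.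
have W0 h x : (0 <= (h x `^ p * w x `^ p)%:E)%E.
  by rewrite lee_fin mulr_ge0 ?powR_ge0.
exists s; split => //.
  move=> n; split => // v v0.
  have mE : measurable (s n @^-1` [set v]) by exact: (ss n).2.
  (* Chebyshev: where the approximant takes the value v, the norm of [f] is at least half that of v,
     and w >= 1, so this level set has finite measure. *)
  have rv : 0 < (rnorm v / 2) `^ p.
    rewrite powR_gt0 // divr_gt0 // lt_neqAle rnorm_ge0 andbT eq_sym.
    by apply: contra v0 => /eqP /rnorm0_eq0 ->.
  have : (((rnorm v / 2) `^ p)%:E * mu (s n @^-1` [set v]) < +oo)%E.
    apply: le_lt_trans ffin.
    have -> : (mu (s n @^-1` [set v]) =
        \int[mu]_x (\1_(s n @^-1` [set v]) x)%:E)%E.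
      by rewrite integral_indic // setIT.
    rewrite -ge0_integralZl_EFin ?powR_ge0 //; last first.
      by apply/measurable_EFinP; exact: measurable_indic.
    apply: ge0_le_integralT => [x|x].
      by rewrite -EFinM lee_fin mulr_ge0 ?powR_ge0.
    rewrite -EFinM lee_fin indicE.
    have [/set_mem /= sv|_] := boolP (x \in _); last first.
      by rewrite mulr0 mulr_ge0 ?powR_ge0.
    rewrite mulr1 -[leLHS]mulr1; apply: ler_pM; rewrite ?powR_ge0 //.
      apply: ler_powR_base; [exact: ltW|by rewrite divr_ge0 ?rnorm_ge0|].
      by rewrite ler_pdivrMr // mulrC -sv sf.
    by rewrite one_le_powR // ltW.
  rewrite !ltey; apply: contra => /eqP ->.
  by rewrite gt0_muley ?lte_fin.
have mfs n : measurable_fun setT (fun x => rnorm (f x - s n x)).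
  by apply: smeas_rnorm; apply: smeasB => //; apply: simple_smeas; exact: ss.
have mW' h : measurable_fun setT h ->
  measurable_fun setT (fun x : R => h x `^ p * w x `^ p).
  exact: measurable_weighted_power.
apply: (@dominated_cvg0 _ _ (fun x => 3 `^ p * (rnorm (f x) `^ p * w x `^ p))).
- by move=> n; exact: mW'.
- by apply: measurable_funM => //; exact: mW'.
- move=> n x; rewrite mulr_ge0 ?powR_ge0 //= mulrA ler_wpM2r ?powR_ge0 //.
  by rewrite -powRM ?rnorm_ge0 // ler_powR_base ?rnorm_ge0 // ltW.
- under eq_integral do rewrite EFinM.
  rewrite ge0_integralZl_EFin ?powR_ge0 //; last 2 first.
  - by move=> x _; rewrite lee_fin mulr_ge0 ?powR_ge0.
  - exact: mW.
  by rewrite lte_mul_pinfty ?lee_fin ?powR_ge0.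
apply/aeW => x; apply/cvgrPdist_lt => e e0.
pose e1 := Num.min 1 (e / (w x `^ p + 1)).
have wp0 : 0 < w x `^ p + 1 by rewrite ltr_wpDl ?powR_ge0.
have e10 : 0 < e1 by rewrite lt_min ltr01 divr_gt0.
have /cvgrPdist_lt/(_ _ e10) := sf0 x; apply: filterS => n.
rewrite sub0r normrN ger0_norm ?rnorm_ge0 // lt_min => /andP[h1 h2].
rewrite sub0r normrN ger0_norm ?mulr_ge0 ?powR_ge0 //.
apply: (@le_lt_trans _ _ (rnorm (f x - s n x) * w x `^ p)).
  rewrite ler_wpM2r ?powR_ge0 //.
  have [->|r0] := eqVneq (rnorm (f x - s n x)) 0; first by rewrite powR0.
  by apply: ge1r_powR => //; rewrite lt_neqAle eq_sym r0 rnorm_ge0 ltW.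
apply: (@le_lt_trans _ _ (rnorm (f x - s n x) * (w x `^ p + 1))).
  by rewrite ler_wpM2l ?rnorm_ge0 // lerDl.
by rewrite -ltr_pdivlMr.
Qed.

End SimpleApproximation.

(** * The Bochner integral *)

Section BochnerIntegral.
Variables (R : realType) (A : banachAlgType R[i]).
Local Notation mu := (@lebesgue_measure R).
Implicit Types (f g s t : R -> A) (v : A).

Definition L1norm f : \bar R := (\int[mu]_x (rnorm (f x))%:E)%E.

Lemma L1norm_ge0 f : (0 <= L1norm f)%E.
Proof. by apply: integral_ge0 => x _; rewrite lee_fin rnorm_ge0. Qed.

Lemma L1norm_ae f g : {ae mu, forall x, f x = g x} -> L1norm f = L1norm g.
Proof.
move=> fg; apply: ge0_ae_eq_integralT => [x|x|]; rewrite ?lee_fin ?rnorm_ge0 //.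
by apply: ae_imply fg => x ->.
Qed.

Lemma L1norm_le f g : (forall x, rnorm (f x) <= rnorm (g x)) ->
  (L1norm f <= L1norm g)%E.
Proof.
move=> fg; apply: ge0_le_integralT => x; rewrite lee_fin ?rnorm_ge0 //.
Qed.

Lemma L1normD_le f g h : smeas g -> smeas h ->
  (forall x, rnorm (f x) <= rnorm (g x) + rnorm (h x)) ->
  (L1norm f <= L1norm g + L1norm h)%E.
Proof.
move=> mg mh fgh; rewrite /L1norm -ge0_integralD //; last 4 first.
- by move=> x _; rewrite lee_fin rnorm_ge0.
- exact/measurable_EFinP/smeas_rnorm.
- by move=> x _; rewrite lee_fin rnorm_ge0.
- exact/measurable_EFinP/smeas_rnorm.
apply: ge0_le_integralT => x; first by rewrite lee_fin rnorm_ge0.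
by rewrite -EFinD lee_fin.
Qed.

Lemma integrable_simple_smeas s : integrable_simple s -> smeas s.
Proof. by move=> [ss _]; exact: simple_smeas. Qed.

Lemma simple_integralB s t : integrable_simple s -> integrable_simple t ->
  simple_integral (fun x => s x - t x) = simple_integral s - simple_integral t.
Proof.
move=> is_ it.
rewrite (@simple_integralD _ _ s (fun x => - t x)) //; last first.
  exact: (@integrable_simple_op2 _ _ (fun a _ => - a) t t (oppr0 _)).
congr (_ + _); apply: (simple_integral_linear (phi := -%R)) => //.
  by move=> u v; rewrite opprD.
by move=> r u; rewrite scalerN.
Qed.

Lemma simple_integral_dist g s t : smeas g ->
  integrable_simple s -> integrable_simple t ->
  ((rnorm (simple_integral s - simple_integral t)%R)%:E <=
    L1norm (fun x => g x - s x)%R + L1norm (fun x => g x - t x)%R)%E.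
Proof.
move=> mg is_ it; rewrite -simple_integralB //.
apply: le_trans (rnorm_simple_integral_le _) _.
  by apply: (@integrable_simple_op2 _ _ (fun a b => a - b)) => //; rewrite subr0.
apply: L1normD_le.
- by apply: smeasB => //; exact: integrable_simple_smeas.
- by apply: smeasB => //; exact: integrable_simple_smeas.
move=> x /=; rewrite (rnorm_distC (g x) (s x)).
have -> : s x - t x = (s x - g x) + (g x - t x) by rewrite addrA subrK.
exact: rnormD.
Qed.

Lemma is_bochner_integral_ae f g v : {ae mu, forall x, f x = g x} ->
  is_bochner_integral f v -> is_bochner_integral g v.
Proof.
move=> fg [mf [s [is_ fs sv]]]; split; first exact: strongly_measurable_ae_eq mf.
exists s; split => //.
rewrite (_ : (fun n => _) = (fun n => L1norm (fun x => f x - s n x)%R)) //.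
apply/funext => n; apply: L1norm_ae; apply: ae_imply fg => x -> //.
Qed.

Lemma ae_sym f g : {ae mu, forall x, f x = g x} -> {ae mu, forall x, g x = f x}.
Proof. by apply: ae_imply. Qed.

Lemma is_bochner_integral_uniq f v v' :
  is_bochner_integral f v -> is_bochner_integral f v' -> v = v'.
Proof.
move=> bv bv'; have [g mg fg] := strongly_measurableP bv.1.
have [_ [s [is_ gs sv]]] := is_bochner_integral_ae fg bv.
have [_ [t [it gt tv]]] := is_bochner_integral_ae fg bv'.
apply/eqP; rewrite -subr_eq0; apply/eqP/rnorm0_eq0/le_anti.
rewrite rnorm_ge0 andbT; apply/ler_addgt0Pl => e e0; rewrite addr0.
have e4 : 0 < e / 4 by rewrite divr_gt0.
have /cvg_rnormP/cvgrPdist_lt/(_ _ e4) h1 := sv.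
have /cvg_rnormP/cvgrPdist_lt/(_ _ e4) h2 := tv.
have /ecvg0P := gs; have /ecvg0P := gt.
move=> /(_ (fun=> L1norm_ge0 _))/(_ _ e4) h3.
move=> /(_ (fun=> L1norm_ge0 _))/(_ _ e4) h4.
have [n _ /(_ n (leqnn _))[[n1 n2] [n3 n4]]] :=
  filterI (filterI h1 h2) (filterI h3 h4).
have := simple_integral_dist mg (is_ n) (it n).
move=> /le_lt_trans /(_ (lteD n4 n3)); rewrite -EFinD lte_fin => h.
move: n1 n2; rewrite !sub0r !normrN !ger0_norm ?rnorm_ge0 // => n1 n2.
set a := simple_integral _ in h n1 *; set b := simple_integral _ in h n2 *.
have -> : v - v' = (v - a) + (a - b) + (b - v').
  by rewrite [v - a + _]addrA subrK addrA subrK.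
apply: le_trans (rnormD _ _) _; rewrite [rnorm (b - v')]rnorm_distC.
have := rnormD (v - a) (a - b); lra.
Qed.

Lemma bochner_eq f v : is_bochner_integral f v -> bochner f = v.
Proof.
move=> fv; apply: (@is_bochner_integral_uniq f) => //.
by apply: (@xgetPex _ 0 [set v | is_bochner_integral f v]); exists v.
Qed.

Lemma bochner_ae f g : {ae mu, forall x, f x = g x} -> bochner f = bochner g.
Proof.
move=> fg; rewrite /bochner; congr xget; apply/seteqP; split => v /=.
  exact: is_bochner_integral_ae.
by apply: is_bochner_integral_ae; exact: ae_sym.
Qed.

Lemma L1_approximation f : smeas f -> (L1norm f < +oo)%E ->
  exists s : nat -> R -> A, (forall n, integrable_simple (s n)) /\
    L1norm (fun x => f x - s n x)%R @[n --> \oo] --> 0%E.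
Proof.
move=> mf ffin.
have E h : (\int[mu]_x (rnorm (h x) `^ 1 * (cst 1 : R -> R) x `^ 1)%:E = L1norm h)%E.
  by apply: eq_integral => x _; rewrite !powRr1 ?rnorm_ge0 // mulr1.
have [//|//||s [is_ _ _ sc]] :=
  @simple_approximation _ _ 1 (cst 1) (lexx _) _ _ f mf; last first.
  exists s; split => //.
  by rewrite (_ : (fun n => _) = (fun n => \int[mu]_x (rnorm (f x - s n x) `^ 1 *
    (cst 1 : R -> R) x `^ 1)%:E)%E) //; apply/funext => n; rewrite E.
by rewrite E.
Qed.

(** The integrals of simple approximants form a Cauchy sequence by [simple_integral_dist], and A is
    complete. *)
Lemma bochner_exists f : strongly_measurable f -> (L1norm f < +oo)%E ->
  is_bochner_integral f (bochner f).
Proof.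
move=> mf; have [g mg fg] := strongly_measurableP mf.
rewrite (L1norm_ae fg) => gfin.
apply: is_bochner_integral_ae (ae_sym fg) _.
rewrite (bochner_ae fg).
suff [v gv] : exists v, is_bochner_integral g v by rewrite (bochner_eq gv).
have [s [is_ gs]] := L1_approximation mg gfin.
have [e e0|v sv] := @rnorm_cauchy_cvg _ A (fun n => simple_integral (s n)).
  have e2 : 0 < e / 2 by rewrite divr_gt0.
  have [N _ NP] := (ecvg0P (fun n => L1norm_ge0 _)).1 gs _ e2.
  exists N => m n Nm Nn.
  have := simple_integral_dist mg (is_ m) (is_ n).
  move=> /le_lt_trans /(_ (lteD (NP m Nm) (NP n Nn))).
  by rewrite -EFinD lte_fin -splitr.
exists v; split; first exact: smeas_strongly_measurable.
by exists s; split => //; exact/cvg_rnormP.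
Qed.

Lemma rnorm_bochner_le f : ((rnorm (bochner f))%:E <= L1norm f)%E.
Proof.
have [[v fv]|nv] := pselect (exists v, is_bochner_integral f v); last first.
  (* Without an integral the default value 0 satisfies the bound. *)
  rewrite /bochner xgetPN; first by rewrite rnorm0 L1norm_ge0.
  by move=> v fv; apply: nv; exists v.
rewrite (bochner_eq fv).
have [g mg fg] := strongly_measurableP fv.1.
rewrite (L1norm_ae fg).
have [_ [s [is_ gs sv]]] := is_bochner_integral_ae fg fv.
apply/lee_addgt0Pr => e e0.
have e2 : 0 < e / 2 by rewrite divr_gt0.
have /cvg_rnormP/cvgrPdist_lt/(_ _ e2) h1 := sv.
have h2 := (ecvg0P (fun n => L1norm_ge0 _)).1 gs _ e2.
have [n _ /(_ n (leqnn _))[n1 n2]] := filterI h1 h2.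
move: n1; rewrite !sub0r !normrN !ger0_norm ?rnorm_ge0 // => n1.
apply: (@le_trans _ _ ((e / 2)%:E + (rnorm (simple_integral (s n)))%:E)%E).
  rewrite -EFinD lee_fin -[X in rnorm X](subrK (simple_integral (s n))).
  by apply: le_trans (rnormD _ _) _; rewrite lerD2r ltW.
have h : ((rnorm (simple_integral (s n)))%:E <= L1norm g + (e / 2)%:E)%E.
  apply: le_trans (rnorm_simple_integral_le (is_ n)) _.
  apply: (@le_trans _ _ (L1norm g + L1norm (fun x => g x - s n x)%R)%E).
    apply: L1normD_le => //.
      by apply: smeasB => //; exact: integrable_simple_smeas.
    by move=> x; rewrite -{1}(subKr (g x) (s n x)) rnormB.
  by rewrite leeD2l // ltW.
apply: le_trans (leeD2l _ h) _.
by rewrite addeCA -EFinD -splitr.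
Qed.

Lemma bochnerD f g : strongly_measurable f -> (L1norm f < +oo)%E ->
  strongly_measurable g -> (L1norm g < +oo)%E ->
  bochner (fun x => f x + g x) = bochner f + bochner g.
Proof.
move=> mf ffin mg gfin.
have bf := bochner_exists mf ffin; have bg := bochner_exists mg gfin.
have [f' mf' ff'] := strongly_measurableP mf.
have [g' mg' gg'] := strongly_measurableP mg.
have [_ [s [is_ fs sv]]] := is_bochner_integral_ae ff' bf.
have [_ [t [it gt tv]]] := is_bochner_integral_ae gg' bg.
rewrite (@bochner_ae _ (fun x => f' x + g' x)); last first.
  by apply: ae_imply2 ff' gg' => x -> ->.
apply: bochner_eq; split; first exact/smeas_strongly_measurable/smeasD.
exists (fun n x => s n x + t n x); split.
- by move=> n; apply: (@integrable_simple_op2 _ _ +%R); rewrite ?addr0.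
- apply: (@ecvg0_le _ _ (fun n => L1norm (fun x => f' x - s n x)%R +
      L1norm (fun x => g' x - t n x)%R)%E).
    move=> n; rewrite L1norm_ge0 /=; apply: L1normD_le.
    + by apply: smeasB => //; exact: integrable_simple_smeas.
    + by apply: smeasB => //; exact: integrable_simple_smeas.
    by move=> x; rewrite opprD addrACA rnormD.
  by rewrite -[0%E]adde0; apply: cvgeD.
rewrite (_ : (fun n => _) = (fun n => simple_integral (s n) +
  simple_integral (t n))); first exact: cvgD.
by apply/funext => n; rewrite simple_integralD.
Qed.

(** Homogeneity over the reals is the right condition because the coefficients of a simple integral
    are measures. The lemma serves for left and right multiplications and for negation. *)
Lemma bochner_linear (phi : A -> A) (C : R) f :
  (forall u v, phi (u + v) = phi u + phi v) ->
  (forall (r : R) u, phi (r%:C *: u) = r%:C *: phi u) ->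
  (forall u, rnorm (phi u) <= C * rnorm u) ->
  strongly_measurable f -> (L1norm f < +oo)%E ->
  bochner (fun x => phi (f x)) = phi (bochner f).
Proof.
move=> phiD phiZ phiC mf ffin.
have C0 : 0 <= C.
  have := phiC 1; rewrite -ler_pdivrMr; first by apply: le_trans; rewrite divr_ge0 ?rnorm_ge0.
  rewrite lt_neqAle rnorm_ge0 andbT eq_sym; apply/eqP => /rnorm0_eq0/eqP.
  by rewrite oner_eq0.
have phiB u v : phi (u - v) = phi u - phi v.
  rewrite phiD; congr (_ + _); have := phiZ (-1) v.
  by rewrite rmorphN rmorph1 !scaleN1r.
have phic a (s : nat -> A) : rnorm (a - s n) @[n --> \oo] --> (0 : R) ->
    rnorm (phi a - phi (s n)) @[n --> \oo] --> (0 : R).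
  move=> h; apply: (@rnorm_squeeze _ _ _ (fun n => C * rnorm (a - s n))).
    by move=> n; rewrite -phiB.
  by rewrite -(mulr0 C); exact: cvgMr.
have bf := bochner_exists mf ffin.
have [f' mf' ff'] := strongly_measurableP mf.
have [_ [s [is_ fs sv]]] := is_bochner_integral_ae ff' bf.
rewrite (@bochner_ae _ (fun x => phi (f' x))); last by apply: ae_imply ff' => x ->.
apply: bochner_eq; split.
  by apply: smeas_strongly_measurable; exact: smeas_op.
exists (fun n x => phi (s n x)); split.
- move=> n; apply: (@integrable_simple_op2 _ _ (fun a _ => phi a)) => //.
  by have := phiZ 0 0; rewrite !scale0r.
- apply: (@ecvg0_le _ _ (fun n => C%:E * L1norm (fun x => f' x - s n x)%R)%E).
    move=> n; rewrite L1norm_ge0 /= /L1norm -ge0_integralZl_EFin //; last 2 first.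
    + by move=> x _; rewrite lee_fin rnorm_ge0.
    + apply/measurable_EFinP/smeas_rnorm; apply: smeasB => //.
      exact: integrable_simple_smeas.
    apply: ge0_le_integralT => x; first by rewrite lee_fin rnorm_ge0.
    by rewrite -EFinM lee_fin -phiB.
  by rewrite -(mule0 C%:E); apply: cvgeZl.
rewrite (_ : (fun n => _) = (fun n => phi (simple_integral (s n)))).
  by apply/cvg_rnormP; apply: phic; exact/cvg_rnormP.
by apply/funext => n; exact: simple_integral_linear.
Unshelve. exact: 0%N. Qed.

(** The bridge from vector integrals to scalar ones, where Tonelli is available. Increasing simple
    functions below [phi], multiplied by v, have simple integrals equal to their scalar integrals
    times v, and the errors are controlled by dominated convergence. *)
Lemma bochner_scalar_ge0 (phi : R -> R) v : measurable_fun setT phi ->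
  (forall x, 0 <= phi x) -> (\int[mu]_x (phi x)%:E < +oo)%E ->
  bochner (fun x => (phi x)%:C *: v) = (fine (\int[mu]_x (phi x)%:E))%:C *: v.
Proof.
move=> mphi phi0 phifin.
have [v0|v0] := eqVneq v 0.
  rewrite v0 scaler0 (@bochner_ae _ (fun=> 0)); last first.
    by apply/aeW => x; rewrite scaler0.
  apply/rnorm0_eq0/le_anti; rewrite rnorm_ge0 andbT -lee_fin.
  apply: le_trans (rnorm_bochner_le _) _; rewrite /L1norm.
  under eq_integral do rewrite rnorm0; by rewrite integral0.
have mphiE : @measurable_fun _ _ (measurableTypeR R) _ setT (EFin \o phi).
  exact/measurable_EFinP.
pose g := nnsfun_approx (@measurableT _ (measurableTypeR R)) mphiE.
have g0 n x : 0 <= g n x by [].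
have mg n : measurable_fun setT (g n : R -> R) by exact: (@measurable_funPT _ _ (measurableTypeR R) R (g n)).
have mgr n r : measurable ((g n : R -> R) @^-1` [set r]).
  by have := mg n measurableT [set r] (measurable_set1 r); rewrite setTI.
have gphi n x : g n x <= phi x.
  by rewrite -lee_fin /g nnsfun_approxE le_approx // => y _; rewrite lee_fin.
have gcvg x : g n x @[n --> \oo] --> phi x.
  have := cvg_nnsfun_approx (@measurableT _ (measurableTypeR R)) mphiE (fun y _ => phi0 y) (x := x) Logic.I.
  exact: fine_cvg.
have gint n : (\int[mu]_x (g n x)%:E < +oo)%E.
  by apply: le_lt_trans phifin; apply: ge0_le_integralT => x; rewrite lee_fin.
have gcint : (\int[mu]_x (g n x)%:E)%E @[n --> \oo] --> (\int[mu]_x (phi x)%:E)%E.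
  apply: (@dominated_cvg _ _ R mu setT measurableT (fun n x => (g n x)%:E)
    (EFin \o phi) (EFin \o phi)) => //.
  - by move=> n; apply/measurable_EFinP; exact: mg.
  - move=> x _; apply/fine_cvgP; split; [exact: nearW|exact: gcvg].
  - apply/integrableP; split => //.
    by under eq_integral do rewrite /= ger0_norm //.
  - by move=> n x _; rewrite /= lee_fin ger0_norm.
(* As v is nonzero, r determines rv and conversely, so the scalar and vector functions have the same
   level sets. *)
have fiber n r : (fun x => (g n x)%:C *: v) @^-1` [set r%:C *: v] =
    g n @^-1` [set r].
  apply/seteqP; split => x /=; last by move=> ->.
  move=> /eqP; rewrite -subr_eq0 -scalerBl scaler_eq0 (negPf v0) orbF -rmorphB.
  by rewrite fmorph_eq0 subr_eq0 => /eqP.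
have rangeE n : range (fun x => (g n x)%:C *: v) =
    (fun r : R => r%:C *: v) @` range (g n).
  apply/seteqP; split => [_ [x _ <-]|_ [_ [x _ <-] <-]]; last by exists x.
  by exists (g n x) => //; exists x.
have gfin n r : r != 0 -> (mu (g n @^-1` [set r]) < +oo)%E.
  move=> r0; have [rpos|rneg] := ltP 0 r; last first.
    rewrite (_ : _ @^-1` _ = set0) ?measure0 //; apply/seteqP; split => // x /= xr.
    have := g0 n x; rewrite xr => rg; case/negP: r0.
    by apply/eqP/le_anti; rewrite rg rneg.
  have : (r%:E * mu (g n @^-1` [set r]) < +oo)%E.
    apply: le_lt_trans (gint n).
    have -> : (mu (g n @^-1` [set r]) = \int[mu]_x (\1_(g n @^-1` [set r]) x)%:E)%E.
      by rewrite integral_indic ?setIT //; exact: mgr.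
    have r_ge0 : 0 <= r by exact: ltW.
    rewrite -ge0_integralZl_EFin //; last first.
      by apply/measurable_EFinP; apply: measurable_indic; exact: mgr.
    apply: ge0_le_integralT => x.
      by rewrite -EFinM lee_fin mulr_ge0.
    rewrite -EFinM lee_fin indicE.
    have [/set_mem /= ->|_] := boolP (x \in _); first by rewrite mulr1.
    by rewrite mulr0.
  by rewrite !ltey; apply: contra => /eqP ->; rewrite gt0_muley ?lte_fin.
have is_ n : integrable_simple (fun x => (g n x)%:C *: v).
  split; first split.
  - by rewrite rangeE; exact: finite_image.
  - move=> w; have [[x xw]|nw] := pselect (exists x, (g n x)%:C *: v = w).
      by rewrite -xw fiber; exact: mgr.
    rewrite (_ : _ @^-1` _ = set0) //; apply/seteqP; split => // x /= xw.
    by apply: nw; exists x.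
  move=> w w0; have [[x xw]|nw] := pselect (exists x, (g n x)%:C *: v = w).
    rewrite -xw fiber gfin //; apply: contra w0 => /eqP gx.
    by rewrite -xw gx scale0r.
  rewrite (_ : _ @^-1` _ = set0) ?measure0 //; apply/seteqP; split => // x /= xw.
  by apply: nw; exists x.
have Ig n : simple_integral (fun x => (g n x)%:C *: v) =
    (fine (\int[mu]_x (g n x)%:E))%:C *: v.
  rewrite /simple_integral rangeE fsbig_image; last first.
    move=> r r' _ _ /eqP; rewrite -subr_eq0 -scalerBl scaler_eq0 (negPf v0) orbF.
    by rewrite -rmorphB fmorph_eq0 subr_eq0 => /eqP.
  have -> : (\int[mu]_x (g n x)%:E = sintegral mu (g n))%E.
    exact: integralT_nnsfun.
  rewrite sintegralE !fsbig_finite //=.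
  rewrite -sum_fine; last first.
    move=> r _; have [->|r0] := eqVneq r 0; first by rewrite mul0e.
    by rewrite fin_numM // ge0_fin_numE // gfin.
  rewrite rmorph_sum scaler_suml; apply: eq_bigr => r _.
  rewrite fiber scalerA -rmorphM; congr (_%:C *: _).
  have [->|r0] := eqVneq r 0; first by rewrite mulr0 mul0e.
  by rewrite fineM // 1?ge0_fin_numE ?gfin //= mulrC.
apply: bochner_eq; split.
  by apply: smeas_strongly_measurable; exact: smeas_scalar.
exists (fun n x => (g n x)%:C *: v); split => //.
- rewrite (_ : (fun n => _) =
      (fun n => \int[mu]_x ((phi x - g n x) * rnorm v)%:E)%E); last first.
    apply/funext => n; apply: eq_integral => x _.
    rewrite -scalerBl -rmorphB rnormZ normc_real ger0_norm //.
    by rewrite subr_ge0.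
  apply: (@dominated_cvg0 _ _ (fun x => phi x * rnorm v)).
  + move=> n; apply: measurable_funM => //.
    by apply: measurable_funB => //.
  + exact: measurable_funM.
  + move=> n x; rewrite mulr_ge0 ?rnorm_ge0 ?subr_ge0 //=.
    by rewrite ler_wpM2r ?rnorm_ge0 // gerBl.
  + under eq_integral do rewrite mulrC EFinM.
    rewrite ge0_integralZl_EFin ?rnorm_ge0 //; last first.
      by move=> x _; rewrite lee_fin.
    by rewrite lte_mul_pinfty ?lee_fin ?rnorm_ge0.
  apply/aeW => x; rewrite -(mul0r (rnorm v)); apply: cvgM; last exact: cvg_cst.
  by rewrite -(subrr (phi x)); apply: cvgB => //; exact: cvg_cst.
apply/cvg_rnormP.
rewrite (_ : (fun n => _) = (fun n => `|fine (\int[mu]_x (phi x)%:E) -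
  fine (\int[mu]_x (g n x)%:E)%E| * rnorm v)); last first.
  by apply/funext => n; rewrite Ig -scalerBl -rmorphB rnormZ normc_real.
rewrite -(mul0r (rnorm v)); apply: cvgM; last exact: cvg_cst.
rewrite -[X in _ --> X](@normr0 _ R) -(subrr (fine (\int[mu]_x (phi x)%:E)%E)).
apply: cvg_norm; apply: cvgB; first exact: cvg_cst.
apply: fine_cvg; rewrite fineK // ge0_fin_numE // integral_ge0 // => x _.
by rewrite lee_fin.
Qed.

End BochnerIntegral.

(** * Weighted norms and convolution of scalar functions *)

Section Reflection.
Variable R : realType.
Local Notation mu := (@lebesgue_measure R).

Definition reflection (c : R) : R -> measurableTypeR R := fun t => c - t.

Lemma measurable_reflection c : measurable_fun setT (reflection c).
Proof. by apply: measurable_funB => //; exact: measurable_id. Qed.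

Lemma lebesgue_measure_reflection c (E : set R) : measurable E ->
  pushforward mu (reflection c) E = mu E.
Proof.
move=> mE; apply/esym/lebesgue_measure_unique; last exact: mE.
  exact: measurable_reflection.
move=> mr /= _ [[a b] _ <-].
rewrite /pushforward (_ : _ @^-1` _ = `[c - b, c - a[%classic); last first.
  by apply/seteqP; split => t /=; rewrite !in_itv /= /reflection;
    move=> /andP[h1 h2]; apply/andP; split; lra.
rewrite !lebesgue_measure_itv /= !lte_fin ltrD2l ltrN2.
by case: ifP => // _; rewrite -!EFinB; congr EFin; lra.
Qed.

Lemma ge0_integral_reflection (c : R) (h : R -> \bar R) : measurable_fun setT h ->
  (forall t, 0 <= h t)%E -> (\int[mu]_t h (c - t)%R = \int[mu]_t h t)%E.
Proof.
move=> mh h0.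
have := @ge0_integral_pushforward _ _ (measurableTypeR R) (measurableTypeR R) R
  (reflection c) (measurable_reflection c) mu setT h measurableT mh (fun y _ => h0 y).
rewrite preimage_setT => <-.
apply: eq_measure_integral; first exact: measurable_reflection.
by move=> mr E mE _; exact: lebesgue_measure_reflection.
Qed.

Lemma ge0_integral_shift (c : R) (h : R -> \bar R) : measurable_fun setT h ->
  (forall t, 0 <= h t)%E -> (\int[mu]_t h (t - c)%R = \int[mu]_t h t)%E.
Proof.
move=> mh h0.
rewrite -(@ge0_integral_reflection (- c) h) // -[RHS](@ge0_integral_reflection 0).
- by apply: eq_integral => t _; congr h; lra.
- apply: (measurableT_comp mh); exact: (measurable_reflection (- c)).
- by [].
Qed.

Lemma ae_reflection c (P : R -> Prop) :
  {ae mu, forall x, P x} -> {ae mu, forall x, P (c - x)}.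
Proof.
move=> [N [mN N0 PN]]; exists (reflection c @^-1` N); split.
- by rewrite -[X in measurable X]setTI; exact: measurable_reflection.
- by have := lebesgue_measure_reflection c mN; rewrite N0.
- by move=> x /= Px; exact: PN.
Qed.

End Reflection.

(** The data that turn the weighted L^p space into a convolution algebra. Almost monotonicity acts
    separately, through the growth of the weight. *)
Record algWeight (R : realType) := AlgWeight {
  aw_p : R;
  aw_q : R;
  aw_w : R -> R;
  aw_p_gt1 : 1 < aw_p;
  aw_conjugate : aw_p^-1 + aw_q^-1 = 1;
  aw_weight : weight aw_w;
  aw_conv : forall x : R, (\int[@lebesgue_measure R]_t
    (aw_w (x - t) `^ (- aw_q) * aw_w t `^ (- aw_q))%:E <=
    (aw_w x `^ (- aw_q))%:E)%E;
  aw_int : (\int[@lebesgue_measure R]_x (aw_w x `^ (- aw_q))%:E < +oo)%E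
}.

Section ScalarNorm.
Variables (R : realType) (D : algWeight R).
Local Notation mu := (@lebesgue_measure R).
Local Notation p := (aw_p D).
Local Notation q := (aw_q D).
Local Notation w := (aw_w D).
Implicit Types (phi psi : R -> R).

Lemma aw_p_gt0 : 0 < p. Proof. exact: lt_trans ltr01 (aw_p_gt1 D). Qed.
Lemma aw_p_neq0 : p != 0. Proof. by rewrite gt_eqF // aw_p_gt0. Qed.

Lemma aw_q_gt0 : 0 < q.
Proof.
rewrite -invr_gt0; have := aw_conjugate D; have := aw_p_gt1 D => p1.
have : p^-1 < 1 by rewrite invf_lt1 // aw_p_gt0.
lra.
Qed.
Lemma aw_q_neq0 : q != 0. Proof. by rewrite gt_eqF // aw_q_gt0. Qed.

Lemma aw_w_ge1 x : 1 <= w x. Proof. by have [] := aw_weight D. Qed.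
Lemma aw_w_gt0 x : 0 < w x. Proof. exact: lt_le_trans ltr01 (aw_w_ge1 x). Qed.
Lemma aw_w_ge0 x : 0 <= w x. Proof. exact: ltW (aw_w_gt0 x). Qed.
Lemma aw_w_measurable : measurable_fun setT w.
Proof. by have [] := aw_weight D. Qed.

Definition wpow phi : \bar R := (\int[mu]_x (phi x `^ p * w x `^ p)%:E)%E.

(* The norm is an opaque constant, lest failed unifications compare integrals. *)
Fact snorm_spec : {N : (R -> R) -> \bar R | forall phi, N phi = (wpow phi `^ p^-1)%E}.
Proof. by exists (fun phi => wpow phi `^ p^-1)%E. Qed.

Definition snorm phi : \bar R := sval snorm_spec phi.

Lemma snormE phi : snorm phi = (wpow phi `^ p^-1)%E.
Proof. exact: svalP snorm_spec phi. Qed.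

Lemma wpow_integrand_ge0 phi x : 0 <= phi x `^ p * w x `^ p.
Proof. by rewrite mulr_ge0 ?powR_ge0. Qed.

Lemma measurable_wpow phi : measurable_fun setT phi ->
  measurable_fun setT (fun x => phi x `^ p * w x `^ p).
Proof. exact: (measurable_weighted_power p aw_w_measurable). Qed.

Lemma wpow_ge0 phi : (0 <= wpow phi)%E.
Proof. by apply: integral_ge0 => x _; rewrite lee_fin wpow_integrand_ge0. Qed.

Lemma snorm_ge0 phi : (0 <= snorm phi)%E.
Proof. by rewrite snormE; exact: poweR_ge0. Qed.

Lemma snorm_pow phi : (snorm phi `^ p = wpow phi)%E.
Proof. by rewrite snormE -poweRrM mulVf ?aw_p_neq0 // poweRe1 ?wpow_ge0. Qed.

Lemma snorm_lty phi : (snorm phi < +oo)%E <-> (wpow phi < +oo)%E.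
Proof.
rewrite snormE; split; first by apply: lty_poweRy; rewrite invr_neq0 // aw_p_neq0.
exact: poweR_lty.
Qed.

Lemma wpow_ae_le phi psi : {ae mu, forall x, 0 <= phi x <= psi x} ->
  (wpow phi <= wpow psi)%E.
Proof.
move=> h; apply: ge0_ae_le_integral => [x|x|].
- by rewrite lee_fin wpow_integrand_ge0.
- by rewrite lee_fin wpow_integrand_ge0.
apply: ae_imply h => x /andP[phi0 phipsi]; rewrite lee_fin.
by rewrite ler_wpM2r ?powR_ge0 // ler_powR_base // ltW // aw_p_gt0.
Qed.

Lemma snorm_ae_le phi psi : {ae mu, forall x, 0 <= phi x <= psi x} ->
  (snorm phi <= snorm psi)%E.
Proof.
move=> /wpow_ae_le h; rewrite !snormE; apply: gt0_ler_poweR => //.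
- by rewrite invr_ge0 ltW // aw_p_gt0.
- by rewrite in_itv /= leey wpow_ge0.
- by rewrite in_itv /= leey wpow_ge0.
Qed.

Lemma snorm_Lnorm phi : (forall x, 0 <= phi x) ->
  snorm phi = ('N[mu]_p%:E[EFin \o (fun x => phi x * w x)%R])%E.
Proof.
move=> phi0; rewrite snormE unlock; congr poweR; apply: eq_integral => x _.
by rewrite /= ?poweR_EFin ger0_norm ?mulr_ge0 ?aw_w_ge0 // powRM ?aw_w_ge0.
Qed.

Lemma snormD phi psi : measurable_fun setT phi -> measurable_fun setT psi ->
  (forall x, 0 <= phi x) -> (forall x, 0 <= psi x) ->
  (snorm (fun x => phi x + psi x)%R <= snorm phi + snorm psi)%E.
Proof.
move=> mphi mpsi phi0 psi0; rewrite !snorm_Lnorm //; last first.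
  by move=> x; rewrite addr_ge0.
have mw := aw_w_measurable.
have := @minkowski_EFin _ _ R mu _ _ p (measurable_funM mphi mw)
  (measurable_funM mpsi mw) (ltW (aw_p_gt1 D)).
by apply: le_trans; rewrite le_eqVlt; apply/orP; left; apply/eqP;
  apply: eq_Lnorm => x /=; rewrite mulrDl.
Qed.

Lemma snormZ (c : R) phi : 0 <= c -> measurable_fun setT phi ->
  (forall x, 0 <= phi x) ->
  (snorm (fun x => c * phi x)%R = c%:E * snorm phi)%E.
Proof.
move=> c0 mphi phi0; rewrite !snormE.
have -> : wpow (fun x => c * phi x) = ((c `^ p)%:E * wpow phi)%E.
  rewrite /wpow -ge0_integralZl_EFin ?powR_ge0 //; last 2 first.
  - by move=> x _; rewrite lee_fin wpow_integrand_ge0.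
  - by apply/measurable_EFinP; exact: measurable_wpow.
  by apply: eq_integral => x _; rewrite powRM // -mulrA EFinM.
rewrite poweRM ?wpow_ge0 ?lee_fin ?powR_ge0 // poweR_EFin -powRrM.
by rewrite mulfV ?aw_p_neq0 // powRr1.
Qed.

Lemma measurable_w_powR (r : R) : measurable_fun setT (fun x => w x `^ r).
Proof. exact: (measurableT_comp (measurable_powR r) aw_w_measurable). Qed.

Definition aw_cst : R := fine ((\int[mu]_x (w x `^ (- q))%:E) `^ q^-1)%E.

Lemma aw_cst_ge0 : 0 <= aw_cst.
Proof. by rewrite fine_ge0 // poweR_ge0. Qed.

(** Hölder's inequality for [phi w] and w^{-1}: the weighted L^p space embeds in L^1, so Fourier
    transforms exist. *)
Lemma integral_le_snorm phi : measurable_fun setT phi ->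
  (forall x, 0 <= phi x) ->
  (\int[mu]_x (phi x)%:E <= snorm phi * aw_cst%:E)%E.
Proof.
move=> mphi phi0.
have mw1 : measurable_fun setT (fun x => w x `^ (-1)) by exact: measurable_w_powR.
have mpw : measurable_fun setT (fun x => phi x * w x).
  by apply: measurable_funM => //; exact: aw_w_measurable.
have := @hoelder _ _ R mu _ _ p q mpw mw1 aw_p_gt0 aw_q_gt0 (aw_conjugate D).
rewrite -snorm_Lnorm // Lnorm1.
have -> : (\int[mu]_x `|(EFin \o ((fun x => phi x * w x) \*
    (fun x => w x `^ (-1)))%R) x| = \int[mu]_x (phi x)%:E)%E.
  apply: eq_integral => x _ /=; rewrite powR_inv1 ?aw_w_ge0 //.
  by rewrite mulfK ?gt_eqF ?aw_w_gt0 // ger0_norm.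
move/le_trans; apply; rewrite le_eqVlt; apply/orP; left; apply/eqP.
congr (_ * _)%E; rewrite unlock fineK; last first.
  rewrite ge0_fin_numE ?poweR_ge0 //; apply: poweR_lty; exact: aw_int.
congr poweR; apply: eq_integral => x _.
by rewrite /= ?poweR_EFin ger0_norm ?powR_ge0 // -powRrM mulN1r.
Qed.

Definition sconv phi psi x : \bar R := (\int[mu]_t (phi (x - t) * psi t)%:E)%E.

Definition young_kernel phi psi x : \bar R := (\int[mu]_t
  (phi (x - t) `^ p * w (x - t) `^ p * (psi t `^ p * w t `^ p))%:E)%E.

Lemma sconv_ge0 phi psi x : (forall x, 0 <= phi x) -> (forall x, 0 <= psi x) ->
  (0 <= sconv phi psi x)%E.
Proof. by move=> h1 h2; apply: integral_ge0 => t _; rewrite lee_fin mulr_ge0. Qed.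

Lemma measurable_reflect_comp phi (x : R) : measurable_fun setT phi ->
  measurable_fun setT (fun t : R => phi (x - t)).
Proof. by move=> mphi; apply: (measurableT_comp mphi (measurable_reflection x)). Qed.

Lemma measurable_sub2 phi : measurable_fun setT phi ->
  measurable_fun setT (fun z : R * R => phi (z.1 - z.2)).
Proof.
move=> mphi; apply: (measurableT_comp mphi).
by apply: measurable_funB; [exact: measurable_fst|exact: measurable_snd].
Qed.

Lemma measurable_snd_comp phi : measurable_fun setT phi ->
  measurable_fun setT (fun z : R * R => phi z.2).
Proof. by move=> mphi; apply: (measurableT_comp mphi); exact: measurable_snd. Qed.

Lemma measurable_sconv phi psi : measurable_fun setT phi ->
  measurable_fun setT psi -> (forall x, 0 <= phi x) -> (forall x, 0 <= psi x) ->
  measurable_fun setT (sconv phi psi).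
Proof.
move=> mphi mpsi phi0 psi0.
apply: (@measurable_fun_fubini_tonelli_F _ _ _ _ R mu
  (fun z : R * R => (phi (z.1 - z.2) * psi z.2)%:E)).
  apply/measurable_EFinP; apply: measurable_funM.
    exact: measurable_sub2.
  exact: measurable_snd_comp.
by move=> z; rewrite lee_fin mulr_ge0.
Qed.

Lemma measurable_young_kernel phi psi : measurable_fun setT phi ->
  measurable_fun setT psi -> measurable_fun setT (young_kernel phi psi).
Proof.
move=> mphi mpsi; have mf := measurable_wpow mphi; have mg := measurable_wpow mpsi.
apply: (@measurable_fun_fubini_tonelli_F _ _ _ _ R mu
  (fun z : R * R => (phi (z.1 - z.2) `^ p * w (z.1 - z.2) `^ p *
     (psi z.2 `^ p * w z.2 `^ p))%:E)).
  apply/measurable_EFinP; apply: measurable_funM.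
    exact: (measurable_sub2 mf).
  exact: (measurable_snd_comp mg).
by move=> z; rewrite lee_fin mulr_ge0 ?wpow_integrand_ge0.
Qed.

Lemma integral_young_kernel phi psi : measurable_fun setT phi ->
  measurable_fun setT psi ->
  (\int[mu]_x young_kernel phi psi x = wpow phi * wpow psi)%E.
Proof.
move=> mphi mpsi; have mf := measurable_wpow mphi; have mg := measurable_wpow mpsi.
rewrite /young_kernel (@fubini_tonelli _ _ _ _ R mu mu
  (fun z : R * R => (phi (z.1 - z.2) `^ p * w (z.1 - z.2) `^ p *
     (psi z.2 `^ p * w z.2 `^ p))%:E)); last 2 first.
- apply/measurable_EFinP; apply: measurable_funM.
    exact: (measurable_sub2 mf).
  exact: (measurable_snd_comp mg).
- by move=> z; rewrite lee_fin mulr_ge0 ?wpow_integrand_ge0.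
rewrite -ge0_integralZl //; last 3 first.
- by apply/measurable_EFinP.
- by move=> t _; rewrite lee_fin wpow_integrand_ge0.
- exact: wpow_ge0.
apply: eq_integral => t _ /=; rewrite muleC.
rewrite /wpow -(@ge0_integral_shift _ t (fun x => (phi x `^ p * w x `^ p)%:E)).
- rewrite -ge0_integralZl_EFin ?wpow_integrand_ge0 //.
  + by apply: eq_integral => x _; rewrite mulrC EFinM.
  + by move=> x _; rewrite lee_fin wpow_integrand_ge0.
  + apply/measurable_EFinP.
    by apply: (measurableT_comp mf); exact: measurable_funB.
- exact/measurable_EFinP.
- by move=> x; rewrite lee_fin wpow_integrand_ge0.
Qed.

(** Hölder's inequality after inserting the factors w(x-t)w(t) and their inverses. The L^q norm of
    the inverse factors is at most 1/w(x), which is exactly the convolution condition on w^{-q}. *)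
Lemma sconv_le phi psi x : measurable_fun setT phi -> measurable_fun setT psi ->
  (forall x, 0 <= phi x) -> (forall x, 0 <= psi x) ->
  (sconv phi psi x <= young_kernel phi psi x `^ p^-1 * (w x)^-1%:E)%E.
Proof.
move=> mphi mpsi phi0 psi0.
pose F t := phi (x - t) * w (x - t) * (psi t * w t).
pose G t := w (x - t) `^ (-1) * w t `^ (-1).
have mw := aw_w_measurable.
have mF : measurable_fun setT F.
  apply: measurable_funM; last exact: measurable_funM.
  by apply: measurable_funM; exact: measurable_reflect_comp.
have mG : measurable_fun setT G.
  apply: measurable_funM; last exact: measurable_w_powR.
  exact: (measurable_reflect_comp x (measurable_w_powR (-1))).
have := @hoelder _ _ R mu _ _ p q mF mG aw_p_gt0 aw_q_gt0 (aw_conjugate D).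
rewrite Lnorm1.
have -> : (\int[mu]_t `|(EFin \o (F \* G)%R) t| = sconv phi psi x)%E.
  apply: eq_integral => t _ /=; rewrite /F /G !powR_inv1 ?aw_w_ge0 //.
  by rewrite mulrACA !mulfK ?gt_eqF ?aw_w_gt0 // ger0_norm // mulr_ge0.
move/le_trans; apply; apply: lee_pmul.
- exact: Lnorm_ge0.
- exact: Lnorm_ge0.
- rewrite unlock le_eqVlt; apply/orP; left; apply/eqP; congr poweR.
  apply: eq_integral => t _; rewrite /= ?poweR_EFin /F.
  by rewrite ger0_norm ?mulr_ge0 ?aw_w_ge0 // !powRM ?mulr_ge0 ?aw_w_ge0.
rewrite unlock.
have -> : (\int[mu]_t (`|(EFin \o G) t| `^ q) =
    \int[mu]_t (w (x - t) `^ (- q) * w t `^ (- q))%:E)%E.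
  apply: eq_integral => t _; rewrite /= ?poweR_EFin /G.
  by rewrite ger0_norm ?mulr_ge0 ?powR_ge0 // powRM ?powR_ge0 // -!powRrM mulN1r.
have -> : (w x)^-1%:E = ((w x `^ (- q))%:E `^ q^-1)%E.
  by rewrite poweR_EFin -powRrM mulNr mulfV ?aw_q_neq0 // powR_inv1 ?aw_w_ge0.
apply: gt0_ler_poweR.
- by rewrite invr_ge0 ltW // aw_q_gt0.
- rewrite in_itv /= leey andbT; apply: integral_ge0 => t _.
  by rewrite lee_fin mulr_ge0 ?powR_ge0.
- by rewrite in_itv /= leey andbT lee_fin powR_ge0.
- exact: aw_conv.
Qed.

(** The p-th power of [sconv_le] is integrated; by Tonelli the kernel has integral equal to the
    product of the p-th powers of the norms. Infinite values of the convolution are sent to 0 by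
    [fine], which only decreases the left side. *)
Lemma young_inequality phi psi : measurable_fun setT phi ->
  measurable_fun setT psi -> (forall x, 0 <= phi x) -> (forall x, 0 <= psi x) ->
  (snorm (fun x => fine (sconv phi psi x)) <= snorm phi * snorm psi)%E.
Proof.
move=> mphi mpsi phi0 psi0.
rewrite !snormE -poweRM ?wpow_ge0 //; apply: gt0_ler_poweR.
- by rewrite invr_ge0 ltW // aw_p_gt0.
- by rewrite in_itv /= leey wpow_ge0.
- by rewrite in_itv /= leey mule_ge0 ?wpow_ge0.
rewrite -integral_young_kernel //; apply: ge0_le_integralT => x.
  by rewrite lee_fin mulr_ge0 ?powR_ge0.
have s0 := sconv_ge0 x phi0 psi0; have := sconv_le x mphi mpsi phi0 psi0.
have k0 : (0 <= young_kernel phi psi x)%E.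
  by apply: integral_ge0 => t _; rewrite lee_fin mulr_ge0 ?wpow_integrand_ge0.
case: (young_kernel phi psi x) k0 => [k| |] // k0; last by rewrite leey.
case: (sconv phi psi x) s0 => [s| |] // s0.
rewrite poweR_EFin -EFinM !lee_fin /= => h.
rewrite lee_fin in k0; rewrite lee_fin in s0.
rewrite -powRM ?aw_w_ge0 //.
apply: (@le_trans _ _ ((k `^ p^-1) `^ p)); last first.
  by rewrite -powRrM mulVf ?aw_p_neq0 // powRr1.
apply: ler_powR_base; first exact: ltW aw_p_gt0.
  by rewrite mulr_ge0 ?aw_w_ge0.
by rewrite -ler_pdivlMr ?aw_w_gt0.
Qed.

Lemma sconv_ae_fin phi psi : measurable_fun setT phi ->
  measurable_fun setT psi -> (forall x, 0 <= phi x) -> (forall x, 0 <= psi x) ->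
  (snorm phi < +oo)%E -> (snorm psi < +oo)%E ->
  {ae mu, forall x, (sconv phi psi x < +oo)%E}.
Proof.
move=> mphi mpsi phi0 psi0 /snorm_lty fphi /snorm_lty fpsi.
have k0 x : (0 <= young_kernel phi psi x)%E.
  by apply: integral_ge0 => t _; rewrite lee_fin mulr_ge0 ?wpow_integrand_ge0.
have ik : mu.-integrable setT (young_kernel phi psi).
  apply/integrableP; split; first exact: measurable_young_kernel.
  under eq_integral do rewrite gee0_abs //.
  rewrite integral_young_kernel // lte_mul_pinfty ?wpow_ge0 //.
  by rewrite ge0_fin_numE // wpow_ge0.
apply: ae_imply (integrable_ae measurableT ik) => x /(_ Logic.I) kfin.
apply: le_lt_trans (sconv_le x mphi mpsi phi0 psi0) _.
rewrite lte_mul_pinfty ?poweR_ge0 ?ltry // fin_num_poweR //.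
Qed.

End ScalarNorm.

(** * Weighted norms of vector-valued functions *)

Section VectorNorm.
Variables (R : realType) (D : algWeight R) (A : banachAlgType R[i]).
Local Notation mu := (@lebesgue_measure R).
Local Notation p := (aw_p D).
Local Notation w := (aw_w D).
Implicit Types (f g : R -> A).

Definition Lpnorm f : \bar R := snorm D (fun x => rnorm (f x)).

Lemma LpE f : Lp p w f <-> strongly_measurable f /\ (Lpnorm f < +oo)%E.
Proof. by rewrite /Lpnorm snormE. Qed.

Lemma vnorm_ge0 f : (0 <= Lpnorm f)%E. Proof. exact: snorm_ge0. Qed.

Lemma vnorm_ae f g : {ae mu, forall x, f x = g x} -> Lpnorm f = Lpnorm g.
Proof.
move=> fg; apply/eqP; rewrite eq_le; apply/andP; split; apply: snorm_ae_le;
  by apply: ae_imply fg => x ->; rewrite rnorm_ge0 lexx.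
Qed.

Lemma vnorm_le f (phi : R -> R) : {ae mu, forall x, rnorm (f x) <= phi x} ->
  (Lpnorm f <= snorm D phi)%E.
Proof. by move=> h; apply: snorm_ae_le; apply: ae_imply h => x ->; rewrite rnorm_ge0. Qed.

Lemma vnormD_le f g h : smeas g -> smeas h ->
  {ae mu, forall x, rnorm (f x) <= rnorm (g x) + rnorm (h x)} ->
  (Lpnorm f <= Lpnorm g + Lpnorm h)%E.
Proof.
move=> mg mh fgh.
have := @snormD _ D _ _ (smeas_rnorm mg) (smeas_rnorm mh)
  (fun x => rnorm_ge0 _) (fun x => rnorm_ge0 _).
by apply: le_trans; exact: vnorm_le.
Qed.

Lemma vnormD f g : smeas f -> smeas g ->
  (Lpnorm (fun x => f x + g x)%R <= Lpnorm f + Lpnorm g)%E.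
Proof. by move=> mf mg; apply: vnormD_le => //; apply/aeW => x; exact: rnormD. Qed.

Lemma vnormN f : Lpnorm (fun x => - f x) = Lpnorm f.
Proof. by rewrite /Lpnorm; congr snorm; apply/funext => x; rewrite rnormN. Qed.

Lemma vnorm0 : Lpnorm (fun=> 0) = 0%E.
Proof.
rewrite /Lpnorm snormE /wpow.
under eq_integral do rewrite rnorm0 powR0 ?aw_p_neq0 // mul0r.
by rewrite integral0 poweR0r // invr_neq0 // aw_p_neq0.
Qed.

Lemma vnorm_scale_le f g (c : R) : smeas g -> 0 <= c ->
  {ae mu, forall x, rnorm (f x) <= c * rnorm (g x)} ->
  (Lpnorm f <= c%:E * Lpnorm g)%E.
Proof.
move=> mg c0 fg; rewrite -snormZ //; first exact: vnorm_le.
- exact: smeas_rnorm.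
- by move=> x; exact: rnorm_ge0.
Qed.

Lemma L1norm_le_vnorm f : smeas f -> (L1norm f <= Lpnorm f * (aw_cst D)%:E)%E.
Proof.
move=> mf; apply: integral_le_snorm; first exact: smeas_rnorm.
by move=> x; exact: rnorm_ge0.
Qed.

Lemma L1norm_lty f : smeas f -> (Lpnorm f < +oo)%E -> (L1norm f < +oo)%E.
Proof.
move=> mf ffin; apply: le_lt_trans (L1norm_le_vnorm mf) _.
by rewrite muleC lte_mul_pinfty // lee_fin aw_cst_ge0.
Qed.

(** T is the sum of all a_j^p w^p. Where T is finite, which is almost everywhere, T^{1/p} bounds all
    a_j w at once; this turns fast convergence in norm into pointwise convergence. *)
Lemma summable_majorant (a : nat -> R -> R) :
  (forall j, measurable_fun setT (a j)) ->
  (forall j, (wpow D (a j) <= (2 ^- j.+1)%:E)%E) ->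
  exists T : R -> \bar R, [/\ measurable_fun setT T, forall x, (0 <= T x)%E,
    (\int[mu]_x T x <= 1)%E &
    forall j x, ((a j x `^ p * w x `^ p)%:E <= T x)%E].
Proof.
move=> ma wa.
pose u j x := ((a j x) `^ p * w x `^ p)%:E.
have u0 j x : (0 <= u j x)%E by rewrite lee_fin wpow_integrand_ge0.
have mu_ j : measurable_fun setT (u j).
  by apply/measurable_EFinP; exact: measurable_wpow.
exists (fun x => \sum_(j <oo) u j x)%E; split.
- by apply: ge0_emeasurable_sum => // j x _ _; exact: u0.
- by move=> x; apply: nneseries_ge0.
- rewrite integral_nneseries //.
  apply: (@le_trans _ _ (\sum_(j <oo) (2 ^- j.+1)%:E)%E).
    by apply: lee_nneseries => [j _ _|j _]; [exact: wpow_ge0|exact: wa].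
  apply: le_trans (epsilon_trick0 xpredT ler01).
  apply: lee_nneseries => [j _ _|j _].
    by rewrite lee_fin invr_ge0 exprn_ge0.
  by rewrite div1r natrX.
move=> j x; apply: le_trans (nneseries_lim_ge j.+1 _) => //.
by rewrite big_nat_recr //= leeDr // sume_ge0.
Qed.

Lemma majorant_bound (a : nat -> R -> R) (T : R -> \bar R) :
  (forall j x, 0 <= a j x) ->
  (forall j x, ((a j x `^ p * w x `^ p)%:E <= T x)%E) ->
  forall x j, (T x < +oo)%E -> a j x * w x <= fine (T x) `^ p^-1.
Proof.
move=> a0 aT x j Tfin.
have T0 : (0 <= T x)%E.
  by apply: le_trans (aT j x); rewrite lee_fin wpow_integrand_ge0.
have := aT j x; rewrite -[T x]fineK ?ge0_fin_numE // lee_fin => h.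
rewrite -powRM ?aw_w_ge0 // in h.
have := ler_powR_base (p := p^-1) _ _ h.
rewrite -powRrM mulfV ?aw_p_neq0 // powRr1 ?mulr_ge0 ?aw_w_ge0 //; apply.
  by rewrite invr_ge0 ltW // aw_p_gt0.
exact: powR_ge0.
Qed.

Lemma majorant_ae_fin (T : R -> \bar R) : measurable_fun setT T ->
  (forall x, 0 <= T x)%E -> (\int[mu]_x T x < +oo)%E ->
  {ae mu, forall x, (T x < +oo)%E}.
Proof.
move=> mT T0 Tfin; have iT : mu.-integrable setT T.
  apply/integrableP; split => //.
  by under eq_integral do rewrite gee0_abs //.
by apply: ae_imply (integrable_ae measurableT iT) => x /(_ Logic.I);
  rewrite ge0_fin_numE.
Qed.

Lemma wpowZ (c : R) (phi : R -> R) : 0 <= c -> measurable_fun setT phi ->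
  (forall x, 0 <= phi x) ->
  (wpow D (fun x => c * phi x)%R = (c `^ p)%:E * wpow D phi)%E.
Proof.
move=> c0 mphi phi0.
rewrite /wpow -ge0_integralZl_EFin ?powR_ge0 //; last 2 first.
- by move=> x _; rewrite lee_fin wpow_integrand_ge0.
- by apply/measurable_EFinP; exact: measurable_wpow.
by apply: eq_integral => x _; rewrite powRM // -mulrA EFinM.
Qed.

Lemma simple_approximation_eps f (e : R) : smeas f -> (Lpnorm f < +oo)%E ->
  0 < e -> exists2 s, integrable_simple s &
    (wpow D (fun x => rnorm (f x - s x)%R) < e%:E)%E.
Proof.
move=> mf /snorm_lty ffin e0.
have [s [is_ _ _ sf]] := simple_approximation (ltW (aw_p_gt1 D))
  (aw_w_measurable D) (aw_w_ge1 D) mf ffin.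
have [n _ nP] := (ecvg0P (fun n => wpow_ge0 D (fun x => rnorm (f x - s n x)))).1 sf _ e0.
by exists (s n); [exact: is_|exact: (nP n (leqnn n))].
Qed.

Lemma cvg_rnorm_two_powers (u : nat -> A) (c : R) :
  (forall j, rnorm (u j) <= c / 2 ^+ j) -> rnorm (u j) @[j --> \oo] --> (0 : R).
Proof.
move=> h; apply: (@rnorm_squeeze _ _ _ (fun j => c * 2^-1 ^+ j)) => [j|].
  by rewrite exprVn.
rewrite -(mulr0 c); apply: cvgMr; apply: cvg_expr.
by rewrite ger0_norm ?invr_ge0 // invf_lt1 // ltr1n.
Qed.

(** Diagonal argument: the j-th function is approximated by a simple one so closely that 2^j times
    the error still has a summable majorant. The simple functions then have the same limit almost
    everywhere. *)
Lemma strongly_measurable_limit (F : nat -> R -> A) f :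
  (forall n, smeas (F n)) -> (forall n, (Lpnorm (F n) < +oo)%E) ->
  {ae mu, forall x, rnorm (f x - F n x) @[n --> \oo] --> (0 : R)} ->
  strongly_measurable f.
Proof.
move=> mF Ffin Ff.
have c0 j : 0 <= (2 : R) ^+ j by rewrite exprn_ge0.
have e0 j : 0 < 2 ^- j.+1 / ((2 : R) ^+ j) `^ p.
  by rewrite divr_gt0 ?invr_gt0 ?powR_gt0 ?exprn_gt0.
have ex j : exists s : R -> A, integrable_simple s /\
    (wpow D (fun x => rnorm (F j x - s x)%R) <
      (2 ^- j.+1 / ((2 : R) ^+ j) `^ p)%:E)%E.
  by have [s' is_ sF] := simple_approximation_eps (mF j) (Ffin j) (e0 j); exists s'.
have [s sP] := choice ex.
pose a j x := 2 ^+ j * rnorm (F j x - s j x).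
have ms j : smeas (fun x => F j x - s j x).
  by apply: smeasB => //; apply: integrable_simple_smeas; exact: (sP j).1.
have ma j : measurable_fun setT (a j).
  by apply: measurable_funM => //; exact: (smeas_rnorm (ms j)).
have wa j : (wpow D (a j) <= (2 ^- j.+1)%:E)%E.
  rewrite wpowZ //; last 2 first.
  - exact: (smeas_rnorm (ms j)).
  - by move=> x; exact: rnorm_ge0.
  have /ltW h := (sP j).2.
  apply: le_trans (lee_wpmul2l _ h) _; first by rewrite lee_fin powR_ge0.
  by rewrite -EFinM lee_fin mulrC divfK // gt_eqF // powR_gt0 // exprn_gt0.
have [T [mT T0 Tint aT]] := summable_majorant ma wa.
have Tae := majorant_ae_fin mT T0 (le_lt_trans Tint (ltry 1)).
exists s; split; first by move=> n; exact: (sP n).1.1.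
apply: ae_imply2 Ff Tae => x Fx Tx; apply/cvg_rnormP.
apply: (@rnorm_squeeze _ _ _ (fun n => rnorm (f x - F n x) +
    rnorm (F n x - s n x))).
  move=> n; have -> : f x - s n x = (f x - F n x) + (F n x - s n x).
    by rewrite addrA subrK.
  exact: rnormD.
rewrite -[0]addr0; apply: cvgD => //.
apply: (@cvg_rnorm_two_powers _ (fine (T x) `^ p^-1)) => j.
rewrite ler_pdivlMr ?exprn_gt0 //.
have a_ge0 i y : 0 <= a i y by rewrite mulr_ge0 ?rnorm_ge0.
have := majorant_bound a_ge0 aT j Tx; rewrite /a mulrC => h.
apply: le_trans _ h; rewrite [leLHS]mulrC ler_peMl ?aw_w_ge1 //.
by rewrite mulr_ge0 ?rnorm_ge0.
Qed.

(** Riesz-Fischer for sequences with steps at most 4^{-(k+1)}: half of the geometric decay is spent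
    on the majorant, and the remaining 2^{-k} makes the sequence Cauchy at almost every point. *)
Lemma Lp_complete (f : nat -> R -> A) :
  (forall k, smeas (f k)) -> (forall k, (Lpnorm (f k) < +oo)%E) ->
  (forall k, (Lpnorm (fun x => f k.+1 x - f k x)%R <= (4 ^- k.+1)%:E)%E) ->
  exists F, [/\ smeas F, (Lpnorm F < +oo)%E &
    forall e : R, 0 < e -> exists K, forall k, (K <= k)%N ->
      (Lpnorm (fun x => F x - f k x)%R < e%:E)%E].
Proof.
move=> mf ffin fd.
pose a j x := 2 ^+ j * rnorm (f j.+1 x - f j x).
have ms j : smeas (fun x => f j.+1 x - f j x) by exact: smeasB.
have ma j : measurable_fun setT (a j).
  by apply: measurable_funM => //; exact: (smeas_rnorm (ms j)).
have a_ge0 i y : 0 <= a i y by rewrite mulr_ge0 ?exprn_ge0 ?rnorm_ge0.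
have wa j : (wpow D (a j) <= (2 ^- j.+1)%:E)%E.
  rewrite -snorm_pow.
  have -> : snorm D (a j) = ((2 ^+ j)%:E * Lpnorm (fun x => f j.+1 x - f j x)%R)%E.
    rewrite snormZ ?exprn_ge0 //; first exact: (smeas_rnorm (ms j)).
    by move=> x; exact: rnorm_ge0.
  have h : ((2 ^+ j)%:E * Lpnorm (fun x => f j.+1 x - f j x)%R <=
      (2 ^- j.+1)%:E)%E.
    apply: le_trans (lee_wpmul2l _ (fd j)) _; first by rewrite lee_fin exprn_ge0.
    rewrite -EFinM lee_fin ler_pdivrMr ?exprn_gt0 //.
    rewrite (_ : 4 = 2 * 2 :> R); last by lra.
    rewrite exprMn mulrA mulVf ?gt_eqF ?exprn_gt0 // mul1r.
    by rewrite ler_eXn2l // ltr1n.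
  apply: (@le_trans _ _ ((2 ^- j.+1)%:E `^ p)%E).
    apply: gt0_ler_poweR => //.
    - by rewrite ltW // aw_p_gt0.
    - by rewrite in_itv /= leey mule_ge0 ?vnorm_ge0 ?lee_fin ?exprn_ge0.
    - by rewrite in_itv /= leey lee_fin invr_ge0 exprn_ge0.
  rewrite poweR_EFin lee_fin ge1r_powR ?(ltW (aw_p_gt1 D)) //.
  by rewrite invr_gt0 exprn_gt0 //= invf_le1 ?exprn_gt0 // exprn_ege1 // ler1n.
have [T [mT T0 Tint aT]] := summable_majorant ma wa.
have Tae := majorant_ae_fin mT T0 (le_lt_trans Tint (ltry 1)).
have dist x k m : (T x < +oo)%E -> (k <= m)%N ->
    rnorm (f m x - f k x) * w x <= 2 / 2 ^+ k * fine (T x) `^ p^-1.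
  move=> Tx km; set t := fine (T x) `^ p^-1.
  have t0 : 0 <= t by exact: powR_ge0.
  (* The exact telescoped geometric bound, so that the induction closes. *)
  suff h : rnorm (f m x - f k x) * w x <= (2 / 2 ^+ k - 2 / 2 ^+ m) * t.
    by apply: le_trans h _; rewrite ler_wpM2r // gerBl divr_ge0 ?exprn_ge0.
  rewrite -(subnK km); elim: (m - k)%N => [|n IHn].
    by rewrite add0n !subrr rnorm0 !mul0r.
  have := majorant_bound a_ge0 aT (n + k)%N Tx; rewrite /a -/t => h.
  have h2 : rnorm (f (n + k).+1 x - f (n + k)%N x) * w x <= t / 2 ^+ (n + k).
    by rewrite ler_pdivlMr ?exprn_gt0 // mulrC mulrA.
  rewrite addSn; set i := (n + k)%N in IHn h2 *.
  have -> : f i.+1 x - f k x = (f i.+1 x - f i x) + (f i x - f k x).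
    by rewrite addrA subrK.
  apply: (@le_trans _ _ ((rnorm (f i.+1 x - f i x) + rnorm (f i x - f k x)) * w x)).
    by rewrite ler_wpM2r ?aw_w_ge0 // rnormD.
  rewrite mulrDl; apply: le_trans (lerD h2 IHn) _.
  rewrite le_eqVlt; apply/orP; left; apply/eqP; rewrite exprS.
  have e0 : (2 : R) ^+ i != 0 by rewrite gt_eqF // exprn_gt0.
  have e1 : (2 : R) ^+ k != 0 by rewrite gt_eqF // exprn_gt0.
  by field; rewrite e0 e1.
have lim x : (T x < +oo)%E ->
    exists v, rnorm (v - f n x) @[n --> \oo] --> (0 : R).
  move=> Tx; apply: rnorm_cauchy_cvg => e e0.
  set t := fine (T x) `^ p^-1.
  have t0 : 0 <= t by exact: powR_ge0.
  have : (4 * t) * 2^-1 ^+ n @[n --> \oo] --> (0 : R).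
    rewrite -(mulr0 (4 * t)); apply: cvgMr; apply: cvg_expr.
    by rewrite ger0_norm ?invr_ge0 // invf_lt1 // ltr1n.
  move=> /cvgrPdist_lt/(_ _ e0)[N _ /(_ N (leqnn _)) /=].
  rewrite sub0r normrN ger0_norm ?mulr_ge0 ?exprn_ge0 ?invr_ge0 // => h.
  exists N => m n Nm Nn; apply: le_lt_trans h.
  have dN i : (N <= i)%N -> rnorm (f i x - f N x) <= 2 / 2 ^+ N * t.
    move=> Ni; apply: le_trans (dist x N i Tx Ni).
    by rewrite ler_peMr ?rnorm_ge0 ?aw_w_ge1.
  have -> : f m x - f n x = (f m x - f N x) + (f N x - f n x).
    by rewrite addrA subrK.
  apply: le_trans (rnormD _ _) _; rewrite [rnorm (f N x - _)]rnorm_distC.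
  apply: le_trans (lerD (dN m Nm) (dN n Nn)) _.
  by rewrite exprVn -mulrDl; lra.
pose F0 x := xget 0 [set v | rnorm (v - f n x) @[n --> \oo] --> (0 : R)].
have F0P x : (T x < +oo)%E -> rnorm (F0 x - f n x) @[n --> \oo] --> (0 : R).
  move=> /lim[v vP]; apply: (@xgetPex _ 0 [set v | rnorm (v - f n x)
    @[n --> \oo] --> (0 : R)]); by exists v.
have mF0 : strongly_measurable F0.
  by apply: (strongly_measurable_limit mf ffin); apply: ae_imply Tae => x /F0P.
have [F mF F0F] := strongly_measurableP mF0.
have bound k : (Lpnorm (fun x => F x - f k x)%R <= (2 / 2 ^+ k)%:E)%E.
  rewrite (@vnorm_ae _ (fun x => F0 x - f k x)); last by apply: ae_imply F0F => x ->.
  have c0 : 0 <= 2 / (2 : R) ^+ k by rewrite divr_ge0 ?exprn_ge0.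
  have W : (wpow D (fun x => rnorm (F0 x - f k x)%R) <=
      ((2 / 2 ^+ k) `^ p)%:E * \int[mu]_x T x)%E.
    rewrite -ge0_integralZl_EFin ?powR_ge0 //.
    apply: ge0_ae_le_integral => [x|x|].
    - by rewrite lee_fin mulr_ge0 ?powR_ge0.
    - by rewrite mule_ge0 ?lee_fin ?powR_ge0.
    apply: ae_imply Tae => x Tx.
    set t := fine (T x) `^ p^-1.
    have t0 : 0 <= t by exact: powR_ge0.
    have Fk : rnorm (F0 x - f k x) * w x <= 2 / 2 ^+ k * t.
      apply/ler_addgt0Pl => e e0.
      have e1 : 0 < e / w x by rewrite divr_gt0 ?aw_w_gt0.
      have /cvgrPdist_lt/(_ _ e1)[N _ NP] := F0P x Tx.
      have := NP (maxn N k) (leq_maxl _ _); rewrite /= sub0r normrN.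
      rewrite ger0_norm ?rnorm_ge0 // ltr_pdivlMr ?aw_w_gt0 // => h.
      have h2 := dist x k (maxn N k) Tx (leq_maxr _ _).
      have -> : F0 x - f k x = (F0 x - f (maxn N k) x) + (f (maxn N k) x - f k x).
        by rewrite addrA subrK.
      apply: le_trans (lerD (ltW h) h2); rewrite -mulrDl.
      by rewrite ler_wpM2r ?aw_w_ge0 // rnormD.
    rewrite -[T x]fineK; last by rewrite ge0_fin_numE.
    rewrite -EFinM lee_fin -powRM ?rnorm_ge0 ?aw_w_ge0 //.
    have -> : fine (T x) = t `^ p.
      by rewrite -powRrM mulVf ?aw_p_neq0 // powRr1 // fine_ge0.
    rewrite -powRM //; apply: ler_powR_base => //.
      by rewrite ltW // aw_p_gt0.
    by rewrite mulr_ge0 ?rnorm_ge0 ?aw_w_ge0.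
  have -> : (2 / 2 ^+ k)%:E = (((2 / 2 ^+ k) `^ p)%:E `^ p^-1)%E.
    by rewrite poweR_EFin -powRrM mulfV ?aw_p_neq0 // powRr1.
  rewrite /Lpnorm snormE; apply: gt0_ler_poweR.
  - by rewrite invr_ge0 ltW // aw_p_gt0.
  - by rewrite in_itv /= leey wpow_ge0.
  - by rewrite in_itv /= leey lee_fin powR_ge0.
  apply: le_trans W _; rewrite -[leRHS]mule1 lee_wpmul2l // lee_fin powR_ge0.
exists F; split => //.
  apply: (@le_lt_trans _ _ (Lpnorm (fun x => F x - f 0%N x)%R + Lpnorm (f 0%N))%E).
    apply: vnormD_le => //; first exact: smeasB.
    by apply/aeW => x; rewrite -{1}(subrK (f 0%N x) (F x)) rnormD.
  by rewrite lte_add_pinfty // (le_lt_trans (bound 0%N)) // ltry.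
move=> e e0; have : 2 * 2^-1 ^+ n @[n --> \oo] --> (0 : R).
  rewrite -(mulr0 2); apply: cvgMr; apply: cvg_expr.
  by rewrite ger0_norm ?invr_ge0 // invf_lt1 // ltr1n.
move=> /cvgrPdist_lt/(_ _ e0)[N _ NP]; exists N => k Nk.
apply: le_lt_trans (bound k) _; rewrite lte_fin.
have := NP k Nk; rewrite /= sub0r normrN ger0_norm ?exprVn //.
Qed.

End VectorNorm.

(** * Convolution of vector-valued functions *)

Section Convolution.
Variables (R : realType) (D : algWeight R) (A : banachAlgType R[i]).
Local Notation mu := (@lebesgue_measure R).
Local Notation vnorm := (Lpnorm D).
Implicit Types (f g : R -> A) (a b : A).
Local Notation nm f := (fun x => rnorm (f x)).

Lemma conv_kernel_smeas f g x : smeas f -> smeas g ->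
  smeas (fun t : R => f (x - t) * g t).
Proof.
move=> mf mg; apply: smeasM => //.
exact: (smeas_comp (measurable_reflection x)).
Qed.

Lemma conv_kernel_L1 f g x :
  (L1norm (fun t => f (x - t) * g t)%R <= sconv (nm f) (nm g) x)%E.
Proof.
apply: ge0_le_integralT => t; rewrite lee_fin ?rnorm_ge0 //.
exact: rnormM.
Qed.

Lemma rnorm_conv_le f g x :
  ((rnorm (convolution f g x))%:E <= sconv (nm f) (nm g) x)%E.
Proof. exact: le_trans (rnorm_bochner_le _) (conv_kernel_L1 _ _ _). Qed.

Lemma sconv_rnorm_ae_fin f g : smeas f -> smeas g ->
  (vnorm f < +oo)%E -> (vnorm g < +oo)%E ->
  {ae mu, forall x, (sconv (nm f) (nm g) x < +oo)%E}.
Proof.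
move=> mf mg ff gf.
exact: (@sconv_ae_fin _ D _ _ (smeas_rnorm mf) (smeas_rnorm mg)
  (fun=> rnorm_ge0 _) (fun=> rnorm_ge0 _) ff gf).
Qed.

Lemma rnorm_conv_ae_le f g : smeas f -> smeas g ->
  (vnorm f < +oo)%E -> (vnorm g < +oo)%E ->
  {ae mu, forall x, rnorm (convolution f g x) <= fine (sconv (nm f) (nm g) x)}.
Proof.
move=> mf mg ff gf; apply: ae_imply (sconv_rnorm_ae_fin mf mg ff gf) => x fin.
rewrite -lee_fin fineK; first exact: rnorm_conv_le.
by rewrite ge0_fin_numE // sconv_ge0 // => y; exact: rnorm_ge0.
Qed.

Lemma vnorm_conv_le f g : smeas f -> smeas g ->
  (vnorm f < +oo)%E -> (vnorm g < +oo)%E ->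
  (vnorm (convolution f g) <= vnorm f * vnorm g)%E.
Proof.
move=> mf mg ff gf; apply: le_trans (vnorm_le D (rnorm_conv_ae_le mf mg ff gf)) _.
apply: young_inequality; do ?exact: smeas_rnorm.
- by move=> x; exact: rnorm_ge0.
- by move=> x; exact: rnorm_ge0.
Qed.

(** Equality holds at every point: for each x the integrands differ only on a null set, reflections
    preserving null sets. *)
Lemma conv_ae f f' g g' : {ae mu, forall x, f x = f' x} ->
  {ae mu, forall x, g x = g' x} -> convolution f g = convolution f' g'.
Proof.
move=> ff' gg'; apply/funext => x; apply: bochner_ae.
by apply: ae_imply2 (ae_reflection x ff') gg' => t -> ->.
Qed.

Lemma conv_linear (phi : A -> A) (C : R) f g f' g' :
  (forall u v, phi (u + v) = phi u + phi v) ->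
  (forall (r : R) u, phi (r%:C *: u) = r%:C *: phi u) ->
  (forall u, rnorm (phi u) <= C * rnorm u) ->
  smeas f -> smeas g -> (vnorm f < +oo)%E -> (vnorm g < +oo)%E ->
  (forall x t, f' (x - t) * g' t = phi (f (x - t) * g t)) ->
  {ae mu, forall x, convolution f' g' x = phi (convolution f g x)}.
Proof.
move=> phiD phiZ phiC mf mg ff gf E.
apply: ae_imply (sconv_rnorm_ae_fin mf mg ff gf) => x fin; rewrite /convolution.
rewrite -(bochner_linear phiD phiZ phiC).
- by congr bochner; apply/funext => t; exact: E.
- by apply: smeas_strongly_measurable; exact: conv_kernel_smeas.
- exact: le_lt_trans (conv_kernel_L1 _ _ _) fin.
Qed.

Lemma conv_mulAl b f g : smeas f -> smeas g ->
  (vnorm f < +oo)%E -> (vnorm g < +oo)%E ->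
  {ae mu, forall x, convolution (fun x => b * f x) g x = b * convolution f g x}.
Proof.
move=> mf mg ff gf; apply: (@conv_linear ( *%R b) (rnorm b) f g) => //.
- by move=> u v; rewrite mulrDr.
- by move=> r u; rewrite scalerAr.
- by move=> u; exact: rnormM.
- by move=> x t; rewrite mulrA.
Qed.

Lemma conv_mulAr b f g : smeas f -> smeas g ->
  (vnorm f < +oo)%E -> (vnorm g < +oo)%E ->
  {ae mu, forall x, convolution f (fun x => g x * b) x = convolution f g x * b}.
Proof.
move=> mf mg ff gf; apply: (@conv_linear ( *%R^~ b) (rnorm b) f g) => //.
- by move=> u v; rewrite mulrDl.
- by move=> r u; rewrite scalerAl.
- by move=> u; rewrite mulrC; exact: rnormM.
- by move=> x t; rewrite mulrA.
Qed.

Lemma conv_mulAm b f g :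
  convolution (fun x => f x * b) g = convolution f (fun x => b * g x).
Proof.
apply/funext => x; congr bochner; apply/funext => t; exact/esym/mulrA.
Qed.

Lemma convDl f f' g : smeas f -> smeas f' -> smeas g ->
  (vnorm f < +oo)%E -> (vnorm f' < +oo)%E -> (vnorm g < +oo)%E ->
  {ae mu, forall x, convolution (fun x => f x + f' x) g x =
    convolution f g x + convolution f' g x}.
Proof.
move=> mf mf' mg ff ff' gf.
apply: ae_imply2 (sconv_rnorm_ae_fin mf mg ff gf) (sconv_rnorm_ae_fin mf' mg ff' gf).
move=> x fin fin'; rewrite /convolution -bochnerD.
- by congr bochner; apply/funext => t; rewrite mulrDl.
- by apply: smeas_strongly_measurable; exact: conv_kernel_smeas.
- exact: le_lt_trans (conv_kernel_L1 _ _ _) fin.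
- by apply: smeas_strongly_measurable; exact: conv_kernel_smeas.
- exact: le_lt_trans (conv_kernel_L1 _ _ _) fin'.
Qed.

Lemma convDr f g g' : smeas f -> smeas g -> smeas g' ->
  (vnorm f < +oo)%E -> (vnorm g < +oo)%E -> (vnorm g' < +oo)%E ->
  {ae mu, forall x, convolution f (fun x => g x + g' x) x =
    convolution f g x + convolution f g' x}.
Proof.
move=> mf mg mg' ff gf gf'.
apply: ae_imply2 (sconv_rnorm_ae_fin mf mg ff gf) (sconv_rnorm_ae_fin mf mg' ff gf').
move=> x fin fin'; rewrite /convolution -bochnerD.
- by congr bochner; apply/funext => t; rewrite mulrDr.
- by apply: smeas_strongly_measurable; exact: conv_kernel_smeas.
- exact: le_lt_trans (conv_kernel_L1 _ _ _) fin.
- by apply: smeas_strongly_measurable; exact: conv_kernel_smeas.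
- exact: le_lt_trans (conv_kernel_L1 _ _ _) fin'.
Qed.

Lemma conv_scalar_ge0 (phi psi : R -> R) a b x :
  measurable_fun setT phi -> measurable_fun setT psi ->
  (forall x, 0 <= phi x) -> (forall x, 0 <= psi x) ->
  (sconv phi psi x < +oo)%E ->
  convolution (fun x => (phi x)%:C *: a) (fun x => (psi x)%:C *: b) x =
  (fine (sconv phi psi x))%:C *: (a * b).
Proof.
move=> mphi mpsi phi0 psi0 fin.
have mk : measurable_fun setT (fun t : R => phi (x - t) * psi t).
  by apply: measurable_funM => //; exact: measurable_reflect_comp.
have k0 t : 0 <= phi (x - t) * psi t by rewrite mulr_ge0.
apply: etrans (bochner_scalar_ge0 (a * b) mk k0 fin).
congr bochner; apply/funext => t.
by rewrite -scalerAl -scalerAr scalerA -rmorphM.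
Qed.

Lemma rnorm_scalar_ge0 (phi : R) a : 0 <= phi ->
  rnorm (phi%:C *: a) = phi * rnorm a.
Proof. by move=> p0; rewrite rnormZ normc_real ger0_norm. Qed.

Lemma vnorm_scalar (phi : R -> R) a : measurable_fun setT phi ->
  (forall x, 0 <= phi x) ->
  vnorm (fun x => (phi x)%:C *: a)%R = ((rnorm a)%:E * snorm D phi)%E.
Proof.
move=> mphi phi0.
rewrite -(@snormZ _ D (rnorm a) phi (rnorm_ge0 a) mphi phi0) /Lpnorm.
by congr (snorm D _); apply/funext => x; rewrite rnorm_scalar_ge0 // mulrC.
Qed.

(** A simple function is the sum of its restrictions to level sets, each of norm at most that of the
    whole, so the sum can be built inside L^p. *)
Lemma simple_ind (P : (R -> A) -> Prop) :
  (forall (E : set R) a, measurable E ->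
    (vnorm (fun x => (\1_E x)%:C *: a)%R < +oo)%E -> P (fun x => (\1_E x)%:C *: a)) ->
  (forall f g, smeas f -> smeas g -> (vnorm f < +oo)%E -> (vnorm g < +oo)%E ->
    P f -> P g -> P (fun x => f x + g x)) ->
  forall s, simple s -> (vnorm s < +oo)%E -> P s.
Proof.
move=> P1 PD s ss sf.
have [S uS sS] := exists_range_seq ss.
pose r v x := (\1_(s @^-1` [set v]) x : R)%:C *: v.
have mr v : smeas (r v) by apply/simple_smeas/simple_indic; exact: ss.2.
have rE x v : r v x = if s x == v then v else 0.
  rewrite /r indicE; case: eqP => sxv.
    by rewrite mem_set //= scale1r.
  by rewrite memNset //= scale0r.
have rf v : (vnorm (r v) < +oo)%E.
  apply: le_lt_trans sf; apply: vnorm_le; apply/aeW => x; rewrite rE.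
  by case: eqP => [->//|_]; rewrite rnorm0 rnorm_ge0.
have Pr v : P (r v) := P1 _ v (ss.2 v) (rf v).
clearbody r; have step (T : seq A) : [/\ smeas (fun x => \sum_(v <- T) r v x),
    (vnorm (fun x => \sum_(v <- T) r v x)%R < +oo)%E &
    P (fun x => \sum_(v <- T) r v x)].
  elim: T => [|v T [IH1 IH2 IH3]].
    under [X in smeas X]funext do rewrite big_nil.
    under [X in vnorm X]funext do rewrite big_nil.
    under [X in P X]funext do rewrite big_nil.
    split; [exact: simple_smeas (simple_cst _ _)|by rewrite vnorm0|].
    have E0 : (fun x => (\1_(set0 : set R) x : R)%:C *: (0 : A)) = fun=> 0.
      by apply/funext => x; rewrite scaler0.
    rewrite -E0; apply: P1; first exact: measurable0.
    by rewrite E0 vnorm0 ltry.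
  under [X in smeas X]funext do rewrite big_cons.
  under [X in vnorm X]funext do rewrite big_cons.
  under [X in P X]funext do rewrite big_cons.
  split; [exact: smeasD| |].
    exact: le_lt_trans (vnormD D (mr v) IH1) (lte_add_pinfty (rf v) IH2).
  exact: PD (mr v) IH1 (rf v) IH2 (Pr v) IH3.
suff <- : (fun x => \sum_(v <- S) r v x) = s by have [] := step S.
apply/funext => x; rewrite (bigD1_seq (s x)) //= rE eqxx big1 ?addr0 // => v vs.
by rewrite rE eq_sym (negbTE vs).
Qed.

Lemma strongly_measurableD f g : strongly_measurable f ->
  strongly_measurable g -> strongly_measurable (fun x => f x + g x).
Proof.
move=> /strongly_measurableP[f' mf' ff'] /strongly_measurableP[g' mg' gg'].
apply: (@strongly_measurable_ae_eq _ _ (fun x => f' x + g' x)).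
  by apply: ae_imply2 ff' gg' => x -> ->.
by apply: smeas_strongly_measurable; exact: smeasD.
Qed.

Lemma conv_indic_strongly_measurable (E F : set R) a b :
  measurable E -> measurable F ->
  (vnorm (fun x => (\1_E x)%:C *: a)%R < +oo)%E ->
  (vnorm (fun x => (\1_F x)%:C *: b)%R < +oo)%E ->
  strongly_measurable
    (convolution (fun x => (\1_E x)%:C *: a) (fun x => (\1_F x)%:C *: b)).
Proof.
move=> mE mF.
have mI (G : set R) : measurable G -> measurable_fun setT (\1_G : R -> R).
  by move=> mG; exact: measurable_indic.
have I0 (G : set R) x : 0 <= \1_G x :> R by rewrite indicE.
rewrite !vnorm_scalar //; do ?exact: mI.
have zero : strongly_measurable (fun=> 0 : A).
  by apply/smeas_strongly_measurable/simple_smeas/simple_cst.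
(* For a = 0 the scalar indicator may have infinite norm, although the vector function is zero; this
   case is settled directly. *)
have [->|a0] := eqVneq a 0.
  move=> _ _; rewrite [X in strongly_measurable X](_ : _ = fun=> 0) //.
  apply/funext => x; apply: rnorm0_eq0; apply/eqP.
  rewrite eq_le rnorm_ge0 andbT -lee_fin.
  apply: le_trans (rnorm_conv_le _ _ _) _; rewrite /sconv.
  by under eq_integral do rewrite scaler0 rnorm0 mul0r; rewrite integral0.
have [->|b0] := eqVneq b 0.
  move=> _ _; rewrite [X in strongly_measurable X](_ : _ = fun=> 0) //.
  apply/funext => x; apply: rnorm0_eq0; apply/eqP.
  rewrite eq_le rnorm_ge0 andbT -lee_fin.
  apply: le_trans (rnorm_conv_le _ _ _) _; rewrite /sconv.
  by under eq_integral do rewrite scaler0 rnorm0 mulr0; rewrite integral0.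
have fin (c : A) (G : set R) : c != 0 -> ((rnorm c)%:E * snorm D \1_G < +oo)%E ->
    (snorm D \1_G < +oo)%E.
  move=> c0; case: (snorm D \1_G) (snorm_ge0 D (\1_G)) => [s _ _| |//].
    by rewrite ltry.
  rewrite gt0_muley // lte_fin lt_def rnorm_ge0 andbT.
  by apply: contra c0 => /eqP/rnorm0_eq0/eqP.
move=> /(fin _ _ a0) fE /(fin _ _ b0) fF.
apply: (@strongly_measurable_ae_eq _ _
  (fun x => (fine (sconv \1_E \1_F x))%:C *: (a * b))).
  have := sconv_ae_fin (mI _ mE) (mI _ mF) (I0 E) (I0 F) fE fF.
  by apply: ae_imply => x xfin; rewrite conv_scalar_ge0 //; exact: mI.
apply/smeas_strongly_measurable/smeas_scalar.
have := measurable_sconv (mI _ mE) (mI _ mF) (I0 E) (I0 F).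
exact: (measurableT_comp (fine_measurable measurableT)).
Qed.

Lemma conv_simple_strongly_measurable (s t : R -> A) : simple s -> simple t ->
  (vnorm s < +oo)%E -> (vnorm t < +oo)%E ->
  strongly_measurable (convolution s t).
Proof.
move=> ss st sf tf; move: t st tf.
apply: (@simple_ind (fun s => forall t, simple t -> (vnorm t < +oo)%E ->
  strongly_measurable (convolution s t)) _ _ s ss sf) => [E a mE fE|].
  apply: (@simple_ind (fun t => strongly_measurable (convolution _ t)))
      => [F b mF fF|f g mf mg ff gf cf cg].
    exact: conv_indic_strongly_measurable.
  have mEa : smeas (fun x => (\1_E x)%:C *: a).
    by apply/simple_smeas/simple_indic.
  apply: strongly_measurable_ae_eq (strongly_measurableD cf cg).
  by apply: ae_sym; exact: convDr.
move=> f g mf mg ff gf cf cg t st tf.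
apply: strongly_measurable_ae_eq (strongly_measurableD (cf t st tf) (cg t st tf)).
by apply: ae_sym; apply: convDl => //; exact: simple_smeas.
Qed.

(** For indicators the convolution is a measurable scalar function times a vector, and bilinearity
    extends this to simple functions. In general the convolutions of dominated simple approximants
    converge at every point where the scalar convolution of the norms is finite, hence almost
    everywhere. *)
Lemma conv_strongly_measurable f g : smeas f -> smeas g ->
  (vnorm f < +oo)%E -> (vnorm g < +oo)%E ->
  strongly_measurable (convolution f g).
Proof.
move=> mf mg ff gf.
have approx h : smeas h -> (vnorm h < +oo)%E -> exists s : nat -> R -> A,
    [/\ forall n, simple (s n), forall n, (vnorm (s n) < +oo)%E,
        forall n x, rnorm (h x - s n x) <= 3 * rnorm (h x)
      & forall x, rnorm (h x - s n x) @[n --> \oo] --> (0 : R)].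
  move=> mh hf; have [|||s [s1 s2 s3 _]] := @simple_approximation _ _
      (aw_p D) (aw_w D) _ _ _ h mh ((snorm_lty D _).1 hf).
  - exact: ltW (aw_p_gt1 D).
  - exact: aw_w_measurable.
  - exact: aw_w_ge1.
  exists s; split=> // n; first by have [] := s1 n.
  apply: le_lt_trans (@vnorm_scale_le _ D _ (s n) h 4 mh _ _) _ => //.
    apply/aeW => x; have := rnormB (h x) (h x - s n x).
    by rewrite subKr => /le_trans; apply; have := s2 n x; lra.
  by rewrite lte_mul_pinfty.
have [s [s1 s2 s3 s4]] := approx f mf ff.
have [t [t1 t2 t3 t4]] := approx g mg gf.
have ex n : exists h, smeas h /\ {ae mu, forall x, convolution (s n) (t n) x = h x}.
  have := conv_simple_strongly_measurable (s1 n) (t1 n) (s2 n) (t2 n).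
  by move=> /strongly_measurableP[h]; exists h.
have [F FP] := choice ex.
apply: (@strongly_measurable_limit _ D _ F).
- by move=> n; have [] := FP n.
- move=> n; have [_ /vnorm_ae <-] := FP n.
  apply: le_lt_trans (vnorm_conv_le (simple_smeas (s1 n)) (simple_smeas (t1 n))
    (s2 n) (t2 n)) _.
  rewrite -(@fineK _ (vnorm (s n))) ?ge0_fin_numE ?vnorm_ge0 //.
  by rewrite lte_mul_pinfty // lee_fin fine_ge0 ?vnorm_ge0.
have FE : {ae mu, forall x, forall n, convolution (s n) (t n) x = F n x}.
  by apply: ae_foralln => n; have [] := FP n.
apply: ae_imply2 (sconv_rnorm_ae_fin mf mg ff gf) FE => x fin FEx.
have mst n : smeas (fun u : R => s n (x - u) * t n u).
  exact: conv_kernel_smeas (simple_smeas (s1 n)) (simple_smeas (t1 n)).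
have mfg := conv_kernel_smeas x mf mg.
have mk : measurable_fun setT (fun u : R => rnorm (f (x - u)) * rnorm (g u)).
  apply: measurable_funM (smeas_rnorm mg).
  exact: (measurable_reflect_comp x (smeas_rnorm mf)).
have G u n : rnorm (f (x - u) * g u - s n (x - u) * t n u) <=
    rnorm (f (x - u) - s n (x - u)) * rnorm (g u) +
    (rnorm (f (x - u)) + rnorm (f (x - u) - s n (x - u))) * rnorm (g u - t n u).
  rewrite (_ : _ - _ = (f (x - u) - s n (x - u)) * g u +
      s n (x - u) * (g u - t n u)); last first.
    by rewrite mulrBl mulrBr addrA subrK.
  apply: le_trans (rnormD _ _) _; apply: lerD; first exact: rnormM.
  apply: le_trans (rnormM _ _) _; rewrite ler_wpM2r ?rnorm_ge0 //.
  by have := rnormB (f (x - u)) (f (x - u) - s n (x - u)); rewrite subKr.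
have L n : ((rnorm (convolution f g x - convolution (s n) (t n) x)%R)%:E <=
    L1norm (fun u => f (x - u) * g u - s n (x - u) * t n u)%R)%E.
  have fin1 : (L1norm (fun u => f (x - u) * g u)%R < +oo)%E.
    exact: le_lt_trans (conv_kernel_L1 _ _ _) fin.
  have fin2 : (L1norm (fun u => s n (x - u) * t n u)%R < +oo)%E.
    apply: (@le_lt_trans _ _ (16%:E * sconv (nm f) (nm g) x)%E); last first.
      by rewrite lte_mul_pinfty.
    rewrite /L1norm /sconv -ge0_integralZl_EFin //; first last.
    - exact/measurable_EFinP.
    - by move=> u _; rewrite lee_fin mulr_ge0 ?rnorm_ge0.
    apply: ge0_le_integralT => u; first by rewrite lee_fin rnorm_ge0.
    rewrite -EFinM lee_fin; apply: le_trans (rnormM _ _) _.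
    have -> : 16 * (rnorm (f (x - u)) * rnorm (g u)) =
      (4 * rnorm (f (x - u))) * (4 * rnorm (g u)) by ring.
    have bd a b : rnorm (a - b) <= 3 * rnorm a -> rnorm b <= 4 * rnorm a.
      move=> ab; have := rnormB a (a - b).
      by rewrite subKr => /le_trans; apply; lra.
    exact: ler_pM (rnorm_ge0 _) (rnorm_ge0 _) (bd _ _ (s3 n _)) (bd _ _ (t3 n _)).
  have -> : convolution f g x - convolution (s n) (t n) x =
      bochner (fun u => f (x - u) * g u - s n (x - u) * t n u).
    rewrite (_ : (fun u => _) = (fun u => f (x - u) * g u +
        (fun u => - (s n (x - u) * t n u)) u)) // bochnerD; first last.
    - rewrite (_ : L1norm _ = L1norm (fun u => s n (x - u) * t n u)%R) //.
      by rewrite /L1norm; apply: eq_integral => u _; rewrite rnormN.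
    - exact/smeas_strongly_measurable/smeasN.
    - by [].
    - exact: smeas_strongly_measurable.
    congr (_ + _); rewrite /convolution.
    rewrite -(@bochner_linear _ _ (fun v => - v) 1) //.
    - by move=> u v; rewrite opprD.
    - by move=> r u; rewrite scalerN.
    - by move=> u; rewrite rnormN mul1r.
    - exact: smeas_strongly_measurable.
  exact: rnorm_bochner_le.
(* Dominated convergence. The errors are at most 3|f| and 3|g|, so [G] is bounded by 3 + (1 + 3)3 =
   15 times |f(x-u)||g(u)|. *)
have C0 : L1norm (fun u => f (x - u) * g u - s n (x - u) * t n u)%R
    @[n --> \oo] --> 0%E.
  apply: (@dominated_cvg0 _ (fun n u => rnorm (f (x - u) * g u -
      s n (x - u) * t n u)%R)
    (fun u => 15 * (rnorm (f (x - u)) * rnorm (g u)))).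
  - by move=> n; apply: smeas_rnorm; exact: smeasB.
  - exact: measurable_funM.
  - move=> n u; rewrite rnorm_ge0 /=; apply: le_trans (G u n) _.
    have := s3 n (x - u); have := t3 n u.
    have := rnorm_ge0 (f (x - u)); have := rnorm_ge0 (g u).
    have := rnorm_ge0 (f (x - u) - s n (x - u)); have := rnorm_ge0 (g u - t n u).
    nra.
  - under eq_integral do rewrite EFinM.
    rewrite ge0_integralZl_EFin //; first by rewrite lte_mul_pinfty.
    + by move=> u _; rewrite lee_fin mulr_ge0 ?rnorm_ge0.
    + exact/measurable_EFinP.
  - apply/aeW => u; apply: rnorm_squeeze (fun n => G u n) _.
    rewrite -[0 : R](addr0 0) -{1}(mul0r (rnorm (g u))).
    rewrite -[X in _ --> _ + X](mulr0 (rnorm (f (x - u)) + 0)).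
    apply: cvgD; first by apply: cvgMl; exact: s4.
    by apply: cvgM; [apply: cvgD; [exact: cvg_cst|exact: s4]|exact: t4].
have L0 n : (0 <= (rnorm (convolution f g x - F n x)%R)%:E <=
    L1norm (fun u => f (x - u) * g u - s n (x - u) * t n u)%R)%E.
  by rewrite -FEx lee_fin rnorm_ge0 L.
exact: (fine_cvg (ecvg0_le L0 C0)).
Qed.

End Convolution.

(** * Commutativity and associativity of the scalar convolution *)

Section ScalarConvolution.
Variables (R : realType) (D : algWeight R).
Local Notation mu := (@lebesgue_measure R).
Implicit Types (phi psi chi : R -> R).
Local Notation fconv phi psi := (fun x => fine (sconv phi psi x)).

Lemma sconvC phi psi x : measurable_fun setT phi -> measurable_fun setT psi ->
  (forall x, 0 <= phi x) -> (forall x, 0 <= psi x) ->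
  sconv phi psi x = sconv psi phi x.
Proof.
move=> mphi mpsi phi0 psi0; rewrite /sconv.
rewrite -(@ge0_integral_reflection _ x (fun t => (psi (x - t) * phi t)%:E)).
- by apply: eq_integral => t _; rewrite subKr mulrC.
- apply/measurable_EFinP/measurable_funM => //.
  exact: (measurable_reflect_comp x mpsi).
- by move=> t; rewrite lee_fin mulr_ge0.
Qed.

Lemma sconv_fine_ge0 phi psi x :
  (forall x, 0 <= phi x) -> (forall x, 0 <= psi x) -> 0 <= fine (sconv phi psi x).
Proof. by move=> phi0 psi0; rewrite fine_ge0 // sconv_ge0. Qed.

Lemma measurable_fconv phi psi : measurable_fun setT phi ->
  measurable_fun setT psi -> (forall x, 0 <= phi x) -> (forall x, 0 <= psi x) ->
  measurable_fun setT (fconv phi psi).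
Proof.
move=> mphi mpsi phi0 psi0; have := measurable_sconv mphi mpsi phi0 psi0.
exact: (measurableT_comp (fine_measurable measurableT)).
Qed.

Lemma measurable_triple_kernel phi psi chi x : measurable_fun setT phi ->
  measurable_fun setT psi -> measurable_fun setT chi ->
  measurable_fun setT
    (fun z : R * R => (phi (x - z.1) * (psi (z.1 - z.2) * chi z.2))%:E).
Proof.
move=> mphi mpsi mchi; apply/measurable_EFinP/measurable_funM.
  apply: (measurableT_comp (measurable_reflect_comp x mphi)).
  exact: measurable_fst.
apply: measurable_funM; first exact: measurable_sub2.
exact: measurable_snd_comp.
Qed.

(** Inner convolutions are finite almost everywhere, so [fine] may be removed under the outer
    integral. Tonelli and a translation then exchange the two orders. *)
Lemma sconvA phi psi chi x : measurable_fun setT phi ->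
  measurable_fun setT psi -> measurable_fun setT chi ->
  (forall x, 0 <= phi x) -> (forall x, 0 <= psi x) -> (forall x, 0 <= chi x) ->
  (snorm D phi < +oo)%E -> (snorm D psi < +oo)%E -> (snorm D chi < +oo)%E ->
  sconv (fconv phi psi) chi x = sconv phi (fconv psi chi) x.
Proof.
move=> mphi mpsi mchi phi0 psi0 chi0 fphi fpsi fchi.
have -> : sconv (fconv phi psi) chi x =
    (\int[mu]_t (sconv phi psi (x - t)%R * (chi t)%:E))%E.
  apply: ge0_ae_eq_integralT => [t|t|].
  - by rewrite lee_fin mulr_ge0 // sconv_fine_ge0.
  - by rewrite mule_ge0 ?lee_fin // sconv_ge0.
  apply: ae_imply (ae_reflection x (sconv_ae_fin mphi mpsi phi0 psi0 fphi fpsi)).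
  by move=> t fin; rewrite EFinM fineK // ge0_fin_numE // sconv_ge0.
have -> : sconv phi (fconv psi chi) x =
    (\int[mu]_s ((phi (x - s)%R)%:E * sconv psi chi s))%E.
  apply: ge0_ae_eq_integralT => [t|t|].
  - by rewrite lee_fin mulr_ge0 // sconv_fine_ge0.
  - by rewrite mule_ge0 ?lee_fin // sconv_ge0.
  apply: ae_imply (sconv_ae_fin mpsi mchi psi0 chi0 fpsi fchi).
  by move=> t fin; rewrite EFinM fineK // ge0_fin_numE // sconv_ge0.
have mK := measurable_triple_kernel x mphi mpsi mchi.
transitivity (\int[mu]_s \int[mu]_t
    (phi (x - s) * (psi (s - t) * chi t))%:E)%E; last first.
  apply: eq_integral => s _; rewrite /sconv -ge0_integralZl_EFin //.
  - by move=> t _; rewrite lee_fin mulr_ge0.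
  - apply/measurable_EFinP/measurable_funM => //.
    exact: (measurable_reflect_comp s mpsi).
rewrite (@fubini_tonelli _ _ _ _ R mu mu
  (fun z : R * R => (phi (x - z.1) * (psi (z.1 - z.2) * chi z.2))%:E)) //.
  apply: eq_integral => t _ /=.
  have mh : measurable_fun setT (fun u : R => phi (x - t - u) * psi u).
    apply: measurable_funM => //; exact: (measurable_reflect_comp (x - t) mphi).
  have h0 u : 0 <= phi (x - t - u) * psi u by rewrite mulr_ge0.
  rewrite /sconv -(@ge0_integral_shift _ t (fun u => (phi (x - t - u) * psi u)%:E)).
  - rewrite muleC -ge0_integralZl_EFin //.
    + apply: eq_integral => s _; rewrite -EFinM; congr (_%:E).
      by rewrite (_ : x - t - (s - t) = x - s); [ring|ring].
    + by move=> s _; rewrite lee_fin h0.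
    + apply/measurable_EFinP.
      by apply: (measurableT_comp mh); exact: measurable_funB.
  - exact/measurable_EFinP.
  - by move=> u; rewrite lee_fin.
by move=> z; rewrite lee_fin !mulr_ge0.
Qed.

End ScalarConvolution.

(** * The convolution algebra and its unitization *)

Section LpSpace.
Variables (R : realType) (D : algWeight R) (A : banachAlgType R[i]).
Local Notation mu := (@lebesgue_measure R).
Local Notation vnorm := (Lpnorm D).
Implicit Types (f g : R -> A) (a b : A).

Lemma ae_of_forall (P : R -> Prop) : (forall x, P x) -> {ae mu, forall x, P x}.
Proof. by move=> ?; exact/aeW. Qed.

Lemma ae_mp (P Q : R -> Prop) : {ae mu, forall x, P x} ->
  {ae mu, forall x, P x -> Q x} -> {ae mu, forall x, Q x}.
Proof. by move=> h1 h2; apply: ae_imply2 h1 h2 => x px; apply. Qed.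

(** The set from which the representative is chosen depends only on the class of [f] modulo null
    sets, hence so does the representative. *)
Definition ae_canon f : R -> A :=
  xget (fun=> 0) [set g | smeas g /\ {ae mu, forall x, f x = g x}].

Lemma ae_canonP f : strongly_measurable f ->
  smeas (ae_canon f) /\ {ae mu, forall x, f x = ae_canon f x}.
Proof.
move=> /strongly_measurableP[g mg fg].
by apply: (@xgetPex _ (fun=> 0) [set g | smeas g /\ {ae mu, forall x, f x = g x}]);
  exists g.
Qed.

Lemma ae_canon_eq f g : {ae mu, forall x, f x = g x} -> ae_canon f = ae_canon g.
Proof.
move=> fg; congr xget; apply/seteqP; split=> h [mh fh]; split=> //;
  by apply: ae_imply2 fg fh => x ->.
Qed.

(** Classes are encoded by canonical representatives. Equality almost everywhere becomes equality of
    elements ([lspace_eq]), so that algebraic structures can be declared on the type. *)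
Record lspace := LSpace {
  lfun : R -> A;
  lfunP : [/\ smeas lfun, (vnorm lfun < +oo)%E & ae_canon lfun = lfun] }.

Coercion lfun : lspace >-> Funclass.
Implicit Types (x y z : lspace).

Lemma lfun_smeas x : smeas (lfun x). Proof. by have [] := lfunP x. Qed.

Lemma lfun_fin x : (vnorm (lfun x) < +oo)%E. Proof. by have [] := lfunP x. Qed.

Lemma lspace_eq x y : {ae mu, forall t, x t = y t} -> x = y.
Proof.
case: x => f [mf ff cf]; case: y => g [mg gf cg] /= fg.
have fgE : f = g by rewrite -cf -cg; exact: ae_canon_eq.
by subst g; congr LSpace; exact: Prop_irrelevance.
Qed.

Definition Lpfun f := strongly_measurable f /\ (vnorm f < +oo)%E.

Lemma Lpfun_smeas f : smeas f -> (vnorm f < +oo)%E -> Lpfun f.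
Proof. by move=> /smeas_strongly_measurable. Qed.

Lemma ae_canon_lspaceP f : Lpfun f -> [/\ smeas (ae_canon f),
  (vnorm (ae_canon f) < +oo)%E & ae_canon (ae_canon f) = ae_canon f].
Proof.
move=> [mf ff]; have [mg fg] := ae_canonP mf; split=> //.
  by rewrite -(vnorm_ae D fg).
by apply: ae_canon_eq; exact: ae_sym.
Qed.

Lemma Lpfun0 : Lpfun (fun=> 0).
Proof. by apply: Lpfun_smeas; [exact/simple_smeas/simple_cst|rewrite vnorm0]. Qed.

(** Functions outside L^p get the zero class as a default. *)
Fact toL_spec : {F : (R -> A) -> lspace |
  forall f, Lpfun f -> {ae mu, forall t, F f t = f t}}.
Proof.
exists (fun f => if pselect (Lpfun f) is left h then LSpace (ae_canon_lspaceP h)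
  else LSpace (ae_canon_lspaceP Lpfun0)).
move=> f; case: pselect => //= h _.
by apply: ae_sym; exact: (ae_canonP h.1).2.
Qed.

Definition toL f : lspace := sval toL_spec f.

Lemma toLE f : Lpfun f -> {ae mu, forall t, toL f t = f t}.
Proof. exact: (svalP toL_spec f). Qed.

Definition lnorm x : R := fine (vnorm x).

Lemma vnormE x : vnorm x = (lnorm x)%:E.
Proof. by rewrite fineK // ge0_fin_numE ?vnorm_ge0 // lfun_fin. Qed.

Lemma lnorm_ge0 x : 0 <= lnorm x.
Proof. by rewrite fine_ge0 // vnorm_ge0. Qed.

Lemma toL_lnorm f : Lpfun f -> (lnorm (toL f))%:E = vnorm f.
Proof. by move=> Lf; rewrite -vnormE; apply: vnorm_ae; exact: toLE. Qed.

Lemma Lpfun_add x y : Lpfun (fun t => x t + y t).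
Proof.
apply: Lpfun_smeas; first exact: smeasD (lfun_smeas x) (lfun_smeas y).
apply: le_lt_trans (vnormD D (lfun_smeas x) (lfun_smeas y)) _.
exact: lte_add_pinfty (lfun_fin x) (lfun_fin y).
Qed.

Lemma Lpfun_opp x : Lpfun (fun t => - x t).
Proof. by apply: Lpfun_smeas; [exact: smeasN (lfun_smeas x)|rewrite vnormN lfun_fin]. Qed.

Lemma Lpfun_scale_le f x (c : R) : smeas f -> 0 <= c ->
  (forall t, rnorm (f t) <= c * rnorm (x t)) -> Lpfun f.
Proof.
move=> mf c0 fx; apply: Lpfun_smeas => //.
apply: le_lt_trans (vnorm_scale_le D (lfun_smeas x) c0 (ae_of_forall fx)) _.
by rewrite vnormE -EFinM ltry.
Qed.

Lemma smeas_cst a : smeas (fun _ : R => a : A).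
Proof. exact/simple_smeas/simple_cst. Qed.

Lemma Lpfun_mull a x : Lpfun (fun t => a * x t).
Proof.
apply: (@Lpfun_scale_le _ x (rnorm a)); rewrite ?rnorm_ge0 //.
- exact: smeasM (smeas_cst a) (lfun_smeas x).
- by move=> t; exact: rnormM.
Qed.

Lemma Lpfun_mulr a x : Lpfun (fun t => x t * a).
Proof.
apply: (@Lpfun_scale_le _ x (rnorm a)); rewrite ?rnorm_ge0 //.
- exact: smeasM (lfun_smeas x) (smeas_cst a).
- by move=> t; rewrite mulrC; exact: rnormM.
Qed.

Lemma vnorm_conv_lnorm x y : (vnorm (convolution x y) <= (lnorm x * lnorm y)%:E)%E.
Proof.
rewrite EFinM -!vnormE.
exact: vnorm_conv_le (lfun_smeas x) (lfun_smeas y) (lfun_fin x) (lfun_fin y).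
Qed.

Lemma Lpfun_conv x y : Lpfun (convolution x y).
Proof.
split; last exact: le_lt_trans (vnorm_conv_lnorm x y) (ltry _).
exact: (conv_strongly_measurable (lfun_smeas x) (lfun_smeas y) (lfun_fin x) (lfun_fin y)).
Qed.

Definition ladd x y := toL (fun t => x t + y t).
Definition lopp x := toL (fun t => - x t).
Definition lact a x := toL (fun t => a * x t).
Definition ract x a := toL (fun t => x t * a).
Definition lmul x y := toL (convolution x y).

Lemma laddA : associative ladd.
Proof.
move=> x y z; apply: lspace_eq.
apply: (ae_mp (toLE (Lpfun_add x (ladd y z)))).
apply: (ae_mp (toLE (Lpfun_add (ladd x y) z))).
apply: (ae_mp (toLE (Lpfun_add x y))); apply: (ae_mp (toLE (Lpfun_add y z))).
by apply/aeW => t h1 h2 h3 h4; rewrite [LHS]h4 [RHS]h3 [ladd y z t]h1 [ladd x y t]h2 addrA.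
Qed.

Lemma laddC : commutative ladd.
Proof. by move=> x y; congr toL; apply/funext => t; rewrite addrC. Qed.

Lemma ladd0 : left_id (toL (fun=> 0)) ladd.
Proof.
move=> x; apply: lspace_eq; apply: (ae_mp (toLE (Lpfun_add (toL (fun=> 0)) x))).
by apply: (ae_mp (toLE Lpfun0)); apply/aeW => t h1 h2; rewrite [LHS]h2 h1 add0r.
Qed.

Lemma laddN : left_inverse (toL (fun=> 0)) lopp ladd.
Proof.
move=> x; apply: lspace_eq; apply: (ae_mp (toLE (Lpfun_add (lopp x) x))).
apply: (ae_mp (toLE (Lpfun_opp x))); apply: (ae_mp (toLE Lpfun0)).
by apply/aeW => t h1 h2 h3; rewrite [LHS]h3 [lopp x t]h2 [RHS]h1 addNr.
Qed.

HB.instance Definition _ := gen_eqMixin lspace.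
HB.instance Definition _ := gen_choiceMixin lspace.
HB.instance Definition _ := GRing.isZmodule.Build lspace laddA laddC ladd0 laddN.

Lemma lspace0E : {ae mu, forall t, (0 : lspace) t = 0}.
Proof. exact: toLE Lpfun0. Qed.

Lemma lspaceDE x y : {ae mu, forall t, (x + y) t = x t + y t}.
Proof. exact: toLE (Lpfun_add x y). Qed.

Lemma lspaceNE x : {ae mu, forall t, (- x) t = - x t}.
Proof. exact: toLE (Lpfun_opp x). Qed.

Lemma lspaceBE x y : {ae mu, forall t, (x - y) t = x t - y t}.
Proof. by apply: ae_imply2 (lspaceDE x (- y)) (lspaceNE y) => t -> ->. Qed.

Lemma lactE a x : {ae mu, forall t, lact a x t = a * x t}.
Proof. exact: toLE (Lpfun_mull a x). Qed.

Lemma ractE a x : {ae mu, forall t, ract x a t = x t * a}.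
Proof. exact: toLE (Lpfun_mulr a x). Qed.

Lemma lmulE x y : {ae mu, forall t, lmul x y t = convolution x y t}.
Proof. exact: toLE (Lpfun_conv x y). Qed.

Lemma lactDl a b x : lact (a + b) x = lact a x + lact b x.
Proof.
apply: lspace_eq; apply: (ae_mp (lspaceDE (lact a x) (lact b x))).
apply: (ae_mp (lactE (a + b) x)); apply: (ae_mp (lactE a x)).
apply: (ae_mp (lactE b x)).
by apply/aeW => t h1 h2 h3 h4; rewrite h4 h3 h2 h1 mulrDl.
Qed.

Lemma lactDr a x y : lact a (x + y) = lact a x + lact a y.
Proof.
apply: lspace_eq; apply: (ae_mp (lspaceDE (lact a x) (lact a y))).
apply: (ae_mp (lactE a (x + y))); apply: (ae_mp (lactE a x)).
apply: (ae_mp (lactE a y)); apply: (ae_mp (lspaceDE x y)).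
by apply/aeW => t h1 h2 h3 h4 h5; rewrite h5 h4 h3 h2 h1 mulrDr.
Qed.

Lemma ractDl a x y : ract (x + y) a = ract x a + ract y a.
Proof.
apply: lspace_eq; apply: (ae_mp (lspaceDE (ract x a) (ract y a))).
apply: (ae_mp (ractE a (x + y))); apply: (ae_mp (ractE a x)).
apply: (ae_mp (ractE a y)); apply: (ae_mp (lspaceDE x y)).
by apply/aeW => t h1 h2 h3 h4 h5; rewrite h5 h4 h3 h2 h1 mulrDl.
Qed.

Lemma ractDr a b x : ract x (a + b) = ract x a + ract x b.
Proof.
apply: lspace_eq; apply: (ae_mp (lspaceDE (ract x a) (ract x b))).
apply: (ae_mp (ractE (a + b) x)); apply: (ae_mp (ractE a x)).
apply: (ae_mp (ractE b x)).
by apply/aeW => t h1 h2 h3 h4; rewrite h4 h3 h2 h1 mulrDr.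
Qed.

Lemma lactM a b x : lact (a * b) x = lact a (lact b x).
Proof.
apply: lspace_eq; apply: (ae_mp (lactE (a * b) x)).
apply: (ae_mp (lactE a (lact b x))); apply: (ae_mp (lactE b x)).
by apply/aeW => t h1 h2 h3; rewrite h3 h2 h1 mulrA.
Qed.

Lemma ractM a b x : ract x (a * b) = ract (ract x a) b.
Proof.
apply: lspace_eq; apply: (ae_mp (ractE (a * b) x)).
apply: (ae_mp (ractE b (ract x a))); apply: (ae_mp (ractE a x)).
by apply/aeW => t h1 h2 h3; rewrite h3 h2 h1 mulrA.
Qed.

Lemma lact_ract a b x : ract (lact a x) b = lact a (ract x b).
Proof.
apply: lspace_eq; apply: (ae_mp (ractE b (lact a x))).
apply: (ae_mp (lactE a (ract x b))); apply: (ae_mp (ractE b x)).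
apply: (ae_mp (lactE a x)).
by apply/aeW => t h1 h2 h3 h4; rewrite h4 h3 h2 h1 mulrA.
Qed.

Lemma lact1 x : lact 1 x = x.
Proof. by apply: lspace_eq; apply: ae_imply (lactE 1 x) => t ->; rewrite mul1r. Qed.

Lemma ract1 x : ract x 1 = x.
Proof. by apply: lspace_eq; apply: ae_imply (ractE 1 x) => t ->; rewrite mulr1. Qed.

Lemma lact_lmul a x y : lmul (lact a x) y = lact a (lmul x y).
Proof.
apply: lspace_eq; apply: (ae_mp (lmulE (lact a x) y)).
rewrite (conv_ae (lactE a x) (ae_of_forall (fun t => erefl (y t)))).
apply: (ae_mp (lactE a (lmul x y))); apply: (ae_mp (lmulE x y)).
apply: (ae_mp (conv_mulAl a (lfun_smeas x) (lfun_smeas y) (lfun_fin x) (lfun_fin y))).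
by apply/aeW => t h1 h2 h3 h4; rewrite h4 h3 h2 h1.
Qed.

Lemma ract_lmul a x y : lmul x (ract y a) = ract (lmul x y) a.
Proof.
apply: lspace_eq; apply: (ae_mp (lmulE x (ract y a))).
rewrite (conv_ae (ae_of_forall (fun t => erefl (x t))) (ractE a y)).
apply: (ae_mp (ractE a (lmul x y))); apply: (ae_mp (lmulE x y)).
apply: (ae_mp (conv_mulAr a (lfun_smeas x) (lfun_smeas y) (lfun_fin x) (lfun_fin y))).
by apply/aeW => t h1 h2 h3 h4; rewrite h4 h3 h2 h1.
Qed.

Lemma lmul_middle a x y : lmul (ract x a) y = lmul x (lact a y).
Proof.
congr toL; rewrite (conv_ae (ractE a x) (ae_of_forall (fun t => erefl (y t)))).
by rewrite conv_mulAm (conv_ae (ae_of_forall (fun t => erefl (x t))) (lactE a y)).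
Qed.

Lemma lmulDl x y z : lmul (x + y) z = lmul x z + lmul y z.
Proof.
apply: lspace_eq; apply: (ae_mp (lmulE (x + y) z)).
rewrite (conv_ae (lspaceDE x y) (ae_of_forall (fun t => erefl (z t)))).
apply: (ae_mp (lspaceDE (lmul x z) (lmul y z))).
apply: (ae_mp (lmulE x z)); apply: (ae_mp (lmulE y z)).
apply: (ae_mp (convDl (lfun_smeas x) (lfun_smeas y) (lfun_smeas z)
  (lfun_fin x) (lfun_fin y) (lfun_fin z))).
apply/aeW => t h1 h2 h3 h4 h5.
exact: etrans h5 (etrans h1 (esym (etrans h4 (congr2 +%R h3 h2)))).
Qed.

Lemma lmulDr x y z : lmul x (y + z) = lmul x y + lmul x z.
Proof.
apply: lspace_eq; apply: (ae_mp (lmulE x (y + z))).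
rewrite (conv_ae (ae_of_forall (fun t => erefl (x t))) (lspaceDE y z)).
apply: (ae_mp (lspaceDE (lmul x y) (lmul x z))).
apply: (ae_mp (lmulE x y)); apply: (ae_mp (lmulE x z)).
apply: (ae_mp (convDr (lfun_smeas x) (lfun_smeas y) (lfun_smeas z)
  (lfun_fin x) (lfun_fin y) (lfun_fin z))).
apply/aeW => t h1 h2 h3 h4 h5.
exact: etrans h5 (etrans h1 (esym (etrans h4 (congr2 +%R h3 h2)))).
Qed.

Lemma lnormD x y : lnorm (x + y) <= lnorm x + lnorm y.
Proof.
rewrite -lee_fin toL_lnorm; last exact: Lpfun_add.
by rewrite EFinD -!vnormE; exact: vnormD (lfun_smeas x) (lfun_smeas y).
Qed.

Lemma lnormN x : lnorm (- x) = lnorm x.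
Proof.
apply: EFin_inj; rewrite toL_lnorm ?vnormN ?vnormE //; exact: Lpfun_opp.
Qed.

Lemma lnormB x y : lnorm (x - y) <= lnorm x + lnorm y.
Proof. by rewrite -(lnormN y); exact: lnormD. Qed.

Lemma lnormM x y : lnorm (lmul x y) <= lnorm x * lnorm y.
Proof.
rewrite -lee_fin toL_lnorm; last exact: Lpfun_conv.
exact: vnorm_conv_lnorm.
Qed.

Lemma lnorm_scale_le f x (c : R) : Lpfun f -> 0 <= c ->
  (forall t, rnorm (f t) <= c * rnorm (x t)) -> lnorm (toL f) <= c * lnorm x.
Proof.
move=> Lf c0 fx; rewrite -lee_fin toL_lnorm // EFinM -vnormE.
exact: (vnorm_scale_le D (lfun_smeas x) c0 (ae_of_forall fx)).
Qed.

Lemma lnorm_lact a x : lnorm (lact a x) <= rnorm a * lnorm x.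
Proof.
apply: lnorm_scale_le; [exact: Lpfun_mull|exact: rnorm_ge0|move=> t].
exact: rnormM.
Qed.

Lemma lnorm_ract a x : lnorm (ract x a) <= rnorm a * lnorm x.
Proof.
apply: lnorm_scale_le; [exact: Lpfun_mulr|exact: rnorm_ge0|move=> t].
by rewrite mulrC; exact: rnormM.
Qed.

Lemma lnorm_lactZ (k : R[i]) x : lnorm (lact k%:A x) <= normc k * lnorm x.
Proof.
apply: lnorm_scale_le; [exact: Lpfun_mull| |move=> t].
  exact: normc_ge0.
by rewrite mulr_algl rnormZ.
Qed.

Lemma lnorm0 : lnorm 0 = 0.
Proof. by apply: EFin_inj; rewrite toL_lnorm ?vnorm0 //; exact: Lpfun0. Qed.

Lemma lnorm0_eq0 x : lnorm x = 0 -> x = 0.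
Proof.
move=> x0; have : L1norm x = 0%E.
  apply/eqP; rewrite eq_le L1norm_ge0 andbT.
  apply: le_trans (L1norm_le_vnorm D (lfun_smeas x)) _.
  by rewrite vnormE x0 mul0e.
have mx : measurable_fun setT (fun t => (rnorm (x t))%:E).
  exact/measurable_EFinP/smeas_rnorm/lfun_smeas.
move=> L0.
have /((ae_eq_integral_abs mu measurableT mx).1) ae0 :
    (\int[mu]_t `|(rnorm (x t))%:E|)%E = 0%E.
  by rewrite -[RHS]L0; apply: eq_integral => t _; rewrite gee0_abs // lee_fin rnorm_ge0.
apply: lspace_eq.
apply: (ae_mp lspace0E); apply: ae_imply ae0 => t /(_ I) [] /rnorm0_eq0 -> ->.
by [].
Qed.

Lemma simple_dense x (e : R) : 0 < e -> exists2 s, integrable_simple s &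
  (vnorm (fun t => x t - s t)%R <= e%:E)%E.
Proof.
move=> e0; have e1 : 0 < e `^ (aw_p D) by rewrite powR_gt0.
have [s si sP] := simple_approximation_eps (lfun_smeas x) (lfun_fin x) e1.
exists s => //; rewrite /Lpnorm snormE.
have -> : e%:E = ((e `^ (aw_p D))%:E `^ (aw_p D)^-1)%E.
  by rewrite poweR_EFin -powRrM mulfV ?aw_p_neq0 // powRr1 // ltW.
apply: gt0_ler_poweR; last exact: ltW.
- by rewrite invr_ge0 ltW // aw_p_gt0.
- by rewrite in_itv /= leey wpow_ge0.
- by rewrite in_itv /= leey lee_fin ltW.
Qed.

Definition lind (E : set R) a := toL (fun t => (\1_E t)%:C *: a).

(** Simple functions are dense. Through this lemma commutation and associativity reduce to
    indicators, hence to scalar convolutions, and no Fubini theorem for vector-valued functions is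
    called for. *)
Lemma additive_eq0 (T : lspace -> lspace) (C : R) :
  (forall x y, T (x + y) = T x + T y) -> (forall x, lnorm (T x) <= C * lnorm x) ->
  (forall E a, measurable E -> Lpfun (fun t => (\1_E t)%:C *: a) ->
     T (lind E a) = 0) ->
  forall x, T x = 0.
Proof.
move=> TD TC T0 x; apply: lnorm0_eq0; apply: le_anti; rewrite lnorm_ge0 andbT.
have Ts s : simple s -> (vnorm s < +oo)%E -> T (toL s) = 0.
  apply: (@simple_ind _ D _ (fun f => T (toL f) = 0)) => [E a mE fE|].
    by apply: T0 => //; apply: Lpfun_smeas => //; exact/simple_smeas/simple_indic.
  move=> f g mf mg ff gf Tf Tg.
  have -> : toL (fun t => f t + g t) = toL f + toL g.
    have Lf := Lpfun_smeas mf ff; have Lg := Lpfun_smeas mg gf.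
    have Lfg : Lpfun (fun t => f t + g t).
      apply: Lpfun_smeas; first exact: smeasD.
      exact: le_lt_trans (vnormD D mf mg) (lte_add_pinfty ff gf).
    apply: lspace_eq; apply: (ae_mp (toLE Lfg)).
    apply: (ae_mp (lspaceDE (toL f) (toL g))).
    apply: (ae_mp (toLE Lf)); apply: (ae_mp (toLE Lg)).
    by apply/aeW => t h1 h2 h3 h4; rewrite h4 h3 h2 h1.
  by rewrite TD Tf Tg addr0.
have C0 : 0 <= `|C| + 1 by rewrite addr_ge0.
have C1 : 0 < `|C| + 1 by rewrite ltr_wpDl.
apply/ler_addgt0Pr => e e0; rewrite add0r.
have d0 : 0 < e / (`|C| + 1) by rewrite divr_gt0.
have [s si sP] := simple_dense x d0.
have ms : smeas s := simple_smeas si.1.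
have mxs : smeas (fun t => x t - s t) := smeasB (lfun_smeas x) ms.
have sfin : (vnorm s < +oo)%E.
  apply: (@le_lt_trans _ _ (vnorm x + vnorm (fun t => x t - s t)%R)%E).
    apply: vnormD_le (lfun_smeas x) mxs _; apply/aeW => t.
    by rewrite -{1}(subKr (x t) (s t)) rnormB.
  by apply: lte_add_pinfty (lfun_fin x) _; exact: le_lt_trans sP (ltry _).
have -> : T x = T (x - toL s).
  have := TD (x - toL s) (toL s).
  by rewrite (Ts s si.1 sfin) addr0 subrK.
apply: le_trans (TC _) _.
have xsP : lnorm (x - toL s) <= e / (`|C| + 1).
  rewrite -lee_fin -vnormE (@vnorm_ae _ D _ _ (fun t => x t - s t)) //.
  apply: (ae_mp (lspaceBE x (toL s))); apply: (ae_mp (toLE (Lpfun_smeas ms sfin))).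
  by apply/aeW => t h1 h2; rewrite h2 h1.
apply: (@le_trans _ _ ((`|C| + 1) * lnorm (x - toL s))).
  rewrite ler_wpM2r ?lnorm_ge0 //; apply: le_trans (ler_norm C) _.
  by rewrite lerDl.
by rewrite mulrC -ler_pdivlMr.
Qed.

End LpSpace.

(** * Centrality and associativity by reduction to scalar functions *)

Section ScalarElements.
Variables (R : realType) (D : algWeight R) (A : banachAlgType R[i]).
Local Notation mu := (@lebesgue_measure R).
Local Notation lspace := (lspace D A).
Local Notation fconv phi psi := (fun x => fine (sconv phi psi x)).
Implicit Types (a b : A) (x y z : lspace) (phi psi : R -> R).

Definition nnL phi := [/\ measurable_fun setT phi, forall t, 0 <= phi t
  & (snorm D phi < +oo)%E].

Definition lsc phi a : lspace := toL D (fun t => (phi t)%:C *: a).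

Lemma Lpfun_scalar phi a : nnL phi -> Lpfun D (fun t => (phi t)%:C *: a).
Proof.
move=> [mphi phi0 fphi]; apply: Lpfun_smeas; first exact: smeas_scalar.
by rewrite vnorm_scalar // lte_mul_pinfty // lee_fin rnorm_ge0.
Qed.

Lemma nnL_fconv phi psi : nnL phi -> nnL psi -> nnL (fconv phi psi).
Proof.
move=> [mphi phi0 fphi] [mpsi psi0 fpsi]; split.
- exact: measurable_fconv.
- by move=> t; exact: sconv_fine_ge0.
apply: le_lt_trans (young_inequality D mphi mpsi phi0 psi0) _.
have -> : snorm D phi = (fine (snorm D phi))%:E.
  by rewrite fineK // ge0_fin_numE // snorm_ge0.
by rewrite lte_mul_pinfty // lee_fin fine_ge0 // snorm_ge0.
Qed.

Lemma lscE phi a : nnL phi -> {ae mu, forall t, lsc phi a t = (phi t)%:C *: a}.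
Proof. by move=> h; apply: toLE; exact: Lpfun_scalar. Qed.

Lemma lmul_lsc phi psi a b : nnL phi -> nnL psi ->
  lmul (lsc phi a) (lsc psi b) = lsc (fconv phi psi) (a * b).
Proof.
move=> hphi hpsi; apply: lspace_eq; apply: (ae_mp (lmulE (lsc phi a) (lsc psi b))).
rewrite (conv_ae (lscE a hphi) (lscE b hpsi)).
apply: (ae_mp (lscE (a * b) (nnL_fconv hphi hpsi))).
have [[m1 p1 f1] [m2 p2 f2]] := (hphi, hpsi).
apply: (ae_mp (sconv_ae_fin m1 m2 p1 p2 f1 f2)); apply/aeW => t fin h2 h3.
by apply: (etrans h3); apply/esym; apply: (etrans h2); apply/esym; exact: conv_scalar_ge0.
Qed.

Lemma eq_lsc phi psi a : (forall t, phi t = psi t) -> lsc phi a = lsc psi a.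
Proof. by move=> /funext ->. Qed.

Lemma lsc0 phi : lsc phi 0 = 0.
Proof. by congr toL; apply/funext => t; rewrite scaler0. Qed.

Lemma lind_cases (E : set R) a : measurable E ->
  Lpfun D (fun t => (\1_E t)%:C *: a) -> lind D E a = 0 \/ nnL \1_E.
Proof.
move=> mE [_]; have mI : measurable_fun setT (\1_E : R -> R).
  exact: measurable_indic.
have I0 t : 0 <= \1_E t :> R by rewrite indicE.
rewrite vnorm_scalar //; have [->|a0] := eqVneq a 0; first by left; exact: lsc0.
move=> fE; right; split=> //; move: fE; case: (snorm D \1_E) (snorm_ge0 D \1_E) => //.
  by move=> s _ _; rewrite ltry.
rewrite gt0_muley // lte_fin lt_def rnorm_ge0 andbT.
by apply: contra a0 => /eqP/rnorm0_eq0/eqP.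
Qed.

Lemma lmul0x x : lmul 0 x = 0.
Proof. by apply: (addrI (lmul 0 x)); rewrite -lmulDl !addr0. Qed.

Lemma lmulx0 x : lmul x 0 = 0.
Proof. by apply: (addrI (lmul x 0)); rewrite -lmulDr !addr0. Qed.

(** The commutator is additive and bounded in x. On the indicator of a set times a vector it
    vanishes because the scalar convolution is commutative and 1 commutes with the vector. *)
Lemma lsc_central phi x : nnL phi -> lmul (lsc phi 1) x = lmul x (lsc phi 1).
Proof.
move=> hphi; apply/eqP; rewrite -subr_eq0; apply/eqP; move: x.
apply: (@additive_eq0 _ D A (fun x => lmul (lsc phi 1) x - lmul x (lsc phi 1))
  (2 * lnorm (lsc phi 1))) => [x y|x|E a mE fE].
- by rewrite lmulDl lmulDr opprD addrACA.
- apply: le_trans (lnormB _ _) _; rewrite mulrDl mul1r mulrDl.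
  by apply: lerD; [exact: lnormM|rewrite mulrC; exact: lnormM].
- have [->|hE] := lind_cases mE fE; first by rewrite lmul0x lmulx0 subrr.
  rewrite !lmul_lsc // mulr1 mul1r; apply/eqP; rewrite subr_eq0; apply/eqP/eq_lsc => t.
  by congr fine; have [[m1 p1 _] [m2 p2 _]] := (hphi, hE); exact: sconvC.
Qed.

Definition associator x y z := lmul (lmul x y) z - lmul x (lmul y z).

Lemma lnorm_associator x y z :
  lnorm (associator x y z) <= 2 * (lnorm x * lnorm y * lnorm z).
Proof.
apply: le_trans (lnormB _ _) _; rewrite mulrDl mul1r; apply: lerD.
  by apply: le_trans (lnormM _ _) _; rewrite ler_wpM2r ?lnorm_ge0 ?lnormM.
by apply: le_trans (lnormM _ _) _; rewrite -mulrA ler_wpM2l ?lnorm_ge0 ?lnormM.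
Qed.

Lemma associator_lsc phi psi chi a b c : nnL phi -> nnL psi -> nnL chi ->
  associator (lsc phi a) (lsc psi b) (lsc chi c) = 0.
Proof.
move=> h1 h2 h3; rewrite /associator !lmul_lsc //; do ?exact: nnL_fconv.
apply/eqP; rewrite subr_eq0 mulrA; apply/eqP/eq_lsc => t.
have [[[m1 p1 f1] [m2 p2 f2]] [m3 p3 f3]] := (h1, h2, h3).
by congr fine; exact: (sconvA (D := D)).
Qed.

(** The associator is additive and bounded in each variable, so the three variables can be replaced
    in turn by indicators times vectors, where [sconvA] applies. *)
Lemma lmulA : associative (@lmul R D A).
Proof.
suff H x y z : associator x y z = 0.
  by move=> x y z; apply/esym/eqP; rewrite -subr_eq0; apply/eqP; exact: H.
move: x; apply: (@additive_eq0 _ D A (fun x => associator x y z)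
  (2 * (lnorm y * lnorm z))) => [x x'|x|E a mE fE].
- by rewrite /associator !lmulDl opprD addrACA.
- apply: le_trans (lnorm_associator _ _ _) _.
  by rewrite -mulrA -[leRHS]mulrA (mulrC (_ * _) (lnorm x)).
move: y; apply: (@additive_eq0 _ D A (fun y => associator (lind D E a) y z)
  (2 * (lnorm (lind D E a) * lnorm z))) => [y y'|y|F b mF fF].
- by rewrite /associator lmulDr !lmulDl lmulDr opprD addrACA.
- apply: le_trans (lnorm_associator _ _ _) _.
  by rewrite -!mulrA (mulrC (lnorm y)).
move: z; apply: (@additive_eq0 _ D A (fun z => associator (lind D E a) (lind D F b) z)
  (2 * (lnorm (lind D E a) * lnorm (lind D F b)))) => [z z'|z|G c mG fG].
- by rewrite /associator !lmulDr opprD addrACA.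
- by apply: le_trans (lnorm_associator _ _ _) _; rewrite mulrA.
have [->|hE] := lind_cases mE fE; first by rewrite /associator !lmul0x subrr.
have [->|hF] := lind_cases mF fF.
  by rewrite /associator lmulx0 lmul0x lmulx0 subrr.
have [->|hG] := lind_cases mG fG; first by rewrite /associator !lmulx0 subrr.
exact: associator_lsc.
Qed.

End ScalarElements.

(** * The unitization by A, its completeness and Neumann series *)

Section Unitization.
Variables (R : realType) (D : algWeight R) (A : banachAlgType R[i]).
Local Notation mu := (@lebesgue_measure R).
Local Notation lspace := (lspace D A).
Implicit Types (a b : A) (x y z : lspace).

(** All of A is adjoined, not only the complex scalars, so that the inverses of the values 1 +
    fourier x t are available as constants. *)
Definition unz : Type := (A * lspace)%type.
HB.instance Definition _ := GRing.Zmodule.copy unz (A * lspace)%type.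
Implicit Types (u v w : unz).

Definition unz_mul u v : unz :=
  (u.1 * v.1, lact u.1 v.2 + ract u.2 v.1 + lmul u.2 v.2).

Lemma lact0 a : lact a (0 : lspace) = 0.
Proof. by apply: (addrI (lact a 0)); rewrite -lactDr !addr0. Qed.

Lemma ract0 a : ract (0 : lspace) a = 0.
Proof. by apply: (addrI (ract 0 a)); rewrite -ractDl !addr0. Qed.

Lemma lact0l x : lact 0 x = 0.
Proof. by apply: (addrI (lact 0 x)); rewrite -lactDl !addr0. Qed.

Lemma ract0r x : ract x 0 = 0.
Proof. by apply: (addrI (ract x 0)); rewrite -ractDr !addr0. Qed.

Lemma unz_mulA : associative unz_mul.
Proof.
move=> [a x] [b y] [c z]; rewrite /unz_mul; apply: congr2; first exact: mulrA.
rewrite /=.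
rewrite !lactDr !ractDl !lmulDr !lmulDl -lactM -ractM lact_ract lmulA.
rewrite lact_lmul ract_lmul lmul_middle -!addrA; congr (_ + _); congr (_ + _).
rewrite addrCA; congr (_ + _); rewrite [RHS]addrCA; congr (_ + _).
by rewrite addrCA.
Qed.

Definition unz_one : unz := (1, 0).

Lemma unz_mul1l : left_id unz_one unz_mul.
Proof.
by move=> [a x]; rewrite /unz_mul /= mul1r lact1 ract0 lmul0x !addr0.
Qed.

Lemma unz_mul1r : right_id unz_one unz_mul.
Proof.
by move=> [a x]; rewrite /unz_mul /= mulr1 ract1 lact0 lmulx0 addr0 add0r.
Qed.

Lemma unz_mulDl : left_distributive unz_mul +%R.
Proof.
move=> [a x] [b y] [c z]; congr pair; rewrite /= ?mulrDl //.
rewrite lactDl ractDl lmulDl [X in X + _]addrACA; exact: addrACA.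
Qed.

Lemma unz_mulDr : right_distributive unz_mul +%R.
Proof.
move=> [a x] [b y] [c z]; congr pair; rewrite /= ?mulrDr //.
rewrite lactDr ractDr lmulDr [X in X + _]addrACA; exact: addrACA.
Qed.

Lemma unz_one_neq0 : unz_one != 0.
Proof. by apply/eqP => -[/eqP]; rewrite oner_eq0. Qed.

HB.instance Definition _ := GRing.Zmodule_isNzRing.Build unz
  unz_mulA unz_mul1l unz_mul1r unz_mulDl unz_mulDr unz_one_neq0.

Lemma unzM a b x y : ((a, x) : unz) * ((b, y) : unz) =
  (a * b, lact a y + ract x b + lmul x y).
Proof. by []. Qed.

Lemma unzD a b x y : ((a, x) : unz) + ((b, y) : unz) = (a + b, x + y).
Proof. by []. Qed.

Definition unz_norm u : R := rnorm u.1 + lnorm u.2.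

Lemma unorm_ge0 u : 0 <= unz_norm u.
Proof. by rewrite addr_ge0 ?rnorm_ge0 ?lnorm_ge0. Qed.

Lemma unormD u v : unz_norm (u + v) <= unz_norm u + unz_norm v.
Proof. by rewrite /unz_norm addrACA lerD ?rnormD ?lnormD. Qed.

Lemma unormN u : unz_norm (- u) = unz_norm u.
Proof. by rewrite /unz_norm rnormN lnormN. Qed.

Lemma unormM u v : unz_norm (u * v) <= unz_norm u * unz_norm v.
Proof.
case: u v => [a x] [b y]; rewrite unzM /unz_norm /= mulrDl !mulrDr.
rewrite addrACA -!addrA; apply: lerD; first exact: rnormM.
rewrite [leRHS]addrCA; apply: le_trans (lnormD _ _) _; apply: lerD.
  exact: lnorm_lact.
apply: le_trans (lnormD _ _) _; apply: lerD; last exact: lnormM.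
by rewrite mulrC; exact: lnorm_ract.
Qed.

Lemma unorm0_eq0 u : unz_norm u = 0 -> u = 0.
Proof.
case: u => [a x] /eqP; rewrite paddr_eq0 ?rnorm_ge0 ?lnorm_ge0 //=.
by move=> /andP[/eqP/rnorm0_eq0 -> /eqP/lnorm0_eq0 ->].
Qed.

Definition unz_scalar (k : R[i]) : unz := (k%:A, 0).

Lemma uiotaD k l : unz_scalar (k + l) = unz_scalar k + unz_scalar l.
Proof. by rewrite /unz_scalar unzD scalerDl addr0. Qed.

Lemma uiotaM k l : unz_scalar (k * l) = unz_scalar k * unz_scalar l.
Proof.
rewrite /unz_scalar unzM lact0 ract0 lmul0x !addr0.
by rewrite -scalerAl mul1r scalerA.
Qed.

Lemma uiota1 : unz_scalar 1 = 1.
Proof. by rewrite /unz_scalar scale1r. Qed.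

Lemma ract_algE (k : R[i]) x : ract x k%:A = lact k%:A x.
Proof.
by congr toL; apply/funext => t; rewrite mulr_algl mulr_algr.
Qed.

Lemma uiotaC k u : unz_scalar k * u = u * unz_scalar k.
Proof.
case: u => [a x]; rewrite /unz_scalar !unzM lact0 ract0 lmul0x lmulx0 ract_algE.
by rewrite mulr_algl mulr_algr addr0 add0r.
Qed.

Lemma unorm_uiota k u : unz_norm (unz_scalar k * u) <= normc k * unz_norm u.
Proof.
case: u => [a x]; rewrite /unz_scalar unzM ract0 lmul0x !addr0 /unz_norm /= mulrDr.
by rewrite mulr_algl rnormZ lerD // lnorm_lactZ.
Qed.

Lemma rnorm_geometric_tail (s : nat -> A) :
  (forall k, rnorm (s k.+1 - s k) <= 4 ^- k.+1) ->
  forall k d, rnorm (s (k + d)%N - s k) <= 4 ^- k.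
Proof.
move=> sP k d.
(* The subtracted term strengthens the bound enough for an induction on d. *)
suff : rnorm (s (k + d)%N - s k) <= 4 ^- k * (1 - 4 ^- d).
  move=> /le_trans; apply; rewrite ler_piMr ?invr_ge0 ?exprn_ge0 //.
elim: d => [|d IH]; first by rewrite addn0 subrr rnorm0 expr0 invr1 subrr mulr0.
rewrite -(subrKA (s (k + d)%N)); apply: le_trans (rnormD _ _) _.
rewrite addnS; apply: le_trans (lerD (sP _) IH) _.
rewrite !exprS exprD !invfM.
have h1 : 0 <= (4 ^+ k)^-1 :> R by rewrite invr_ge0 exprn_ge0.
have h2 : 0 <= (4 ^+ d)^-1 :> R by rewrite invr_ge0 exprn_ge0.
have -> : 4^-1 = 1 / 4 :> R by rewrite div1r.
nra.
Qed.

Lemma unz_complete (s : nat -> unz) :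
  (forall k, unz_norm (s k.+1 - s k) <= 4 ^- k.+1) ->
  exists w, forall e : R, 0 < e ->
    exists K, forall k, (K <= k)%N -> unz_norm (w - s k) < e.
Proof.
move=> sP.
have sP1 k : rnorm ((s k.+1).1 - (s k).1) <= 4 ^- k.+1.
  by apply: le_trans (sP k); rewrite lerDl lnorm_ge0.
have tail := rnorm_geometric_tail sP1.
have [|a aP] := @rnorm_cauchy_cvg _ A (fun k => (s k).1).
  move=> e e0; have : 2 * 4^-1 ^+ n @[n --> \oo] --> (0 : R).
    rewrite -(mulr0 2); apply: cvgMr; apply: cvg_expr.
    by rewrite ger0_norm ?invr_ge0 // invf_lt1 // ltr1n.
  move=> /cvgrPdist_lt/(_ _ e0)[N _ /(_ N (leqnn _))]; rewrite /= sub0r normrN.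
  rewrite ger0_norm ?mulr_ge0 ?exprn_ge0 ?invr_ge0 // exprVn => Ne.
  exists N => m n Nm Nn; apply: le_lt_trans Ne.
  rewrite -(subrKA (s N).1) mulrDl mul1r; apply: le_trans (rnormD _ _) _.
  apply: lerD; first by rewrite -(subnKC Nm); exact: tail.
  by rewrite rnorm_distC -(subnKC Nn); exact: tail.
have [F [mF fF FP]] : exists F, [/\ smeas F, (Lpnorm D F < +oo)%E &
    forall e : R, 0 < e -> exists K, forall k, (K <= k)%N ->
      (Lpnorm D (fun t => F t - (s k).2 t)%R < e%:E)%E].
  apply: Lp_complete => k; [exact: lfun_smeas|exact: lfun_fin|].
  apply: (@le_trans _ _ (lnorm ((s k.+1).2 - (s k).2))%:E).
    rewrite -vnormE le_eqVlt; apply/orP; left; apply/eqP/vnorm_ae.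
    by apply: ae_imply (lspaceBE (s k.+1).2 (s k).2) => t ->.
  by rewrite lee_fin; apply: le_trans (sP k); rewrite lerDr rnorm_ge0.
exists (a, toL D F) => e e0; have e2 : 0 < e / 2 by rewrite divr_gt0.
have [K1 K1P] := FP _ e2.
move: aP => /cvgrPdist_lt/(_ _ e2)[K2 _ K2P].
exists (maxn K1 K2) => k; rewrite geq_max => /andP[k1 k2].
rewrite (splitr e); apply: ltrD.
  by have := K2P k k2; rewrite /= sub0r normrN ger0_norm ?rnorm_ge0.
rewrite -lte_fin -vnormE; apply: le_lt_trans (K1P k k1).
rewrite le_eqVlt; apply/orP; left; apply/eqP/vnorm_ae.
apply: (ae_mp (toLE (Lpfun_smeas mF fF))).
by apply: ae_imply (lspaceBE (toL D F) (s k).2) => t h1 h2; rewrite [LHS]h1 h2.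
Qed.

Lemma unormX u n : unz_norm (u ^+ n.+1) <= unz_norm u ^+ n.+1.
Proof.
elim: n => [|n IH]; first by rewrite !expr1.
rewrite exprS [leRHS]exprS; apply: le_trans (unormM _ _) _.
by rewrite ler_wpM2l ?unorm_ge0.
Qed.

Lemma geometric_telescope u n : (\sum_(i < n) u ^+ i) * (1 - u) = 1 - u ^+ n.
Proof.
elim: n => [|n IH]; first by rewrite big_ord0 mul0r expr0 subrr.
by rewrite big_ord_recr /= mulrDl IH mulrBr mulr1 -exprSr addrA subrK.
Qed.

(** For this radius the partial sums of the geometric series converge at the rate that
    [unz_complete] requires. *)
Lemma neumann_quarter u : unz_norm u <= 4^-1 -> exists v, v * (1 - u) = 1.
Proof.
move=> u4.
have uX k : unz_norm (u ^+ k.+1) <= 4 ^- k.+1.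
  apply: le_trans (unormX u k) _; rewrite -exprVn.
  by rewrite lerXn2r // nnegrE ?unorm_ge0 ?invr_ge0.
have [k|w wP] := @unz_complete (fun k => \sum_(i < k.+1) u ^+ i).
  by rewrite [X in X - _]big_ord_recr /= addrAC subrr add0r.
exists w; apply/eqP; rewrite -subr_eq0; apply/eqP/unorm0_eq0/le_anti.
rewrite unorm_ge0 andbT; apply/ler_addgt0Pr => e e0; rewrite add0r.
have c0 : 0 < unz_norm (1 - u) + 1 by rewrite ltr_wpDl ?unorm_ge0.
have d0 : 0 < e / 2 / (unz_norm (1 - u) + 1) by rewrite !divr_gt0.
have e2 : 0 < e / 2 by rewrite divr_gt0.
have [K KP] := wP _ d0.
have : 4^-1 ^+ n @[n --> \oo] --> (0 : R).
  by apply: cvg_expr; rewrite ger0_norm ?invr_ge0 // invf_lt1 // ltr1n.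
move=> /cvgrPdist_lt/(_ _ e2)[N _ NP]; pose k := maxn K N.
have -> : w * (1 - u) - 1 =
    (w - \sum_(i < k.+1) u ^+ i) * (1 - u) - u ^+ k.+1.
  by rewrite mulrBl geometric_telescope opprB addrA addrAC addrK.
apply: le_trans (unormD _ _) _; rewrite unormN (splitr e); apply: lerD.
  apply: le_trans (unormM _ _) _.
  apply: (@le_trans _ _ (e / 2 / (unz_norm (1 - u) + 1) * (unz_norm (1 - u) + 1))).
    by apply: ler_pM; rewrite ?unorm_ge0 ?lerDl // ltW // KP // leq_maxl.
  by rewrite divfK // gt_eqF.
apply: le_trans (uX k) _; rewrite -exprVn.
have := NP k.+1; rewrite /= sub0r normrN ger0_norm ?exprn_ge0 ?invr_ge0 //.
by move=> /(_ (leq_trans (leq_maxr K N) (leqnSn k)))/ltW.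
Qed.

(** Some power of u has norm at most 1/4, and 1 - u divides 1 - u^(N+1) with a geometric sum as
    quotient. *)
Lemma neumann u : unz_norm u < 1 -> exists v, v * (1 - u) = 1.
Proof.
move=> u1; have : unz_norm u ^+ n @[n --> \oo] --> (0 : R).
  by apply: cvg_expr; rewrite ger0_norm ?unorm_ge0.
move=> /cvgrPdist_lt/(_ 4^-1); rewrite invr_gt0 => /(_ (ltr0n _ 4))[N _ NP].
have := NP N.+1 (leqnSn N).
rewrite /= sub0r normrN ger0_norm ?exprn_ge0 ?unorm_ge0 // => N4.
have [v vP] := neumann_quarter (le_trans (unormX u N) (ltW N4)).
exists (v * \sum_(i < N.+1) u ^+ i).
by rewrite -mulrA geometric_telescope.
Qed.

End Unitization.

(** * Exponentials and their Fourier transforms *)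

Section ComplexExponential.
Variable R : realType.
Implicit Types (z w : R[i]) (s t : R).

Definition cexp z : R[i] :=
  (expR (complex.Re z) * cos (complex.Im z)) +i*
  (expR (complex.Re z) * sin (complex.Im z)).

Lemma cexpD z w : cexp (z + w) = cexp z * cexp w.
Proof.
case: z w => [a b] [c d]; rewrite /cexp /=; apply/eqP.
rewrite eq_complex /= expRD cosD sinD; apply/andP; split; apply/eqP; ring.
Qed.

Lemma cexp0 : cexp 0 = 1.
Proof. by apply/eqP; rewrite eq_complex /= expR0 cos0 sin0 mulr1 mulr0 !eqxx. Qed.

Lemma normc_cexp z : normc (cexp z) = expR (complex.Re z).
Proof.
rewrite /cexp /= !exprMn -mulrDr cos2Dsin2 mulr1 sqrtr_sqr ger0_norm //.
Qed.

(** The conditions say that p + iq is the inverse of z = a + ib; the primitive is the real part of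
    e^{zt}/z. The imaginary part is treated in [is_derive_exp_sin]. *)
Lemma is_derive_exp_cos (a b p q t : R) : a * p - b * q = 1 -> a * q + b * p = 0 ->
  is_derive t 1 (fun t => expR (a * t) * (cos (b * t) * p - sin (b * t) * q))
    (expR (a * t) * cos (b * t)).
Proof.
move=> h1 h2; apply: is_derive_eq; rewrite /= !scaler1 ?scaler0 ?add0r ?addr0.
rewrite /GRing.scale /=.
have -> : expR (a * t) * cos (b * t) =
  expR (a * t) * cos (b * t) * (a * p - b * q) -
  expR (a * t) * sin (b * t) * (a * q + b * p) by rewrite h1 h2; ring.
ring.
Qed.

Lemma is_derive_exp_sin (a b p q t : R) : a * p - b * q = 1 -> a * q + b * p = 0 ->
  is_derive t 1 (fun t => expR (a * t) * (sin (b * t) * p + cos (b * t) * q))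
    (expR (a * t) * sin (b * t)).
Proof.
move=> h1 h2; apply: is_derive_eq; rewrite /= !scaler1 ?scaler0 ?add0r ?addr0.
rewrite /GRing.scale /=.
have -> : expR (a * t) * sin (b * t) =
  expR (a * t) * sin (b * t) * (a * p - b * q) +
  expR (a * t) * cos (b * t) * (a * q + b * p) by rewrite h1 h2; ring.
ring.
Qed.

End ComplexExponential.

(** * Bochner integrals of exponentials over bounded intervals *)

Section BochnerExponential.
Variables (R : realType) (A : banachAlgType R[i]).
Local Notation mu := (@lebesgue_measure R).
Implicit Types (v : A) (z w : R[i]).

Lemma is_derive_continuous (F f : R -> R) :
  (forall x : R, is_derive x 1 F (f x)) -> continuous F.
Proof.
move=> dF x; apply/differentiable_continuous; rewrite -derivable1_diffP.
by have [] := dF x.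
Qed.

Lemma integral_FTC (f F : R -> R) (a b : R) : a < b -> continuous f ->
  (forall x : R, is_derive x 1 F (f x)) ->
  (\int[mu]_(x in `[a, b]) (f x)%:E = (F b - F a)%:E)%E.
Proof.
move=> ab cf dF; have cF := is_derive_continuous dF.
rewrite EFinB; apply: continuous_FTC2 => //.
- exact: continuous_subspaceT.
- split; [by move=> x _; have [] := dF x| |].
    exact/cvg_at_right_filter/cF.
  exact/cvg_at_left_filter/cF.
- by move=> x _; rewrite derive1E; have [_ ->] := dF x.
Qed.

Lemma measurable_if_itv (f : R -> R) (a b : R) : measurable_fun setT f ->
  measurable_fun setT (fun t => if a < t < b then f t else 0).
Proof.
move=> mf; apply: measurable_fun_ifT => //.
apply: measurable_and; apply: measurable_fun_ltr => //; exact: measurable_id.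
Qed.

Lemma integral_if_itv (f : R -> R) (a b : R) : a < b -> measurable_fun setT f ->
  (\int[mu]_x (if a < x < b then f x else 0)%:E =
   \int[mu]_(x in `[a, b]) (f x)%:E)%E.
Proof.
move=> ab mf; have mfE (D : set R) : measurable_fun D (EFin \o f).
  by apply/measurable_EFinP; exact: measurable_funTS.
rewrite -(integral_itv_bndo_bndc (mfE _)) -(integral_itv_obnd_cbnd (mfE _)).
rewrite [RHS]integral_mkcond; apply: eq_integral => x _.
rewrite patchE; case: ifPn => h.
  by rewrite mem_set //= in_itv.
by rewrite memNset //= in_itv; exact/negP.
Qed.

Lemma bochner_FTC_ge0 (f F : R -> R) (a b : R) v : a < b -> continuous f ->
  (forall x : R, is_derive x 1 F (f x)) -> (forall x, a < x < b -> 0 <= f x) ->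
  let h := fun t => (if a < t < b then f t else 0)%:C *: v in
  [/\ smeas h, (L1norm h < +oo)%E & bochner h = (F b - F a)%:C *: v].
Proof.
move=> ab cf dF f0 h.
have mf : measurable_fun setT f := continuous_measurable_fun cf.
have mh := measurable_if_itv a b mf.
have h0 t : 0 <= (if a < t < b then f t else 0) by case: ifPn => // /f0.
have hE : (\int[mu]_t (if a < t < b then f t else 0)%:E = (F b - F a)%:E)%E.
  by rewrite integral_if_itv //; exact: integral_FTC.
split; first exact: smeas_scalar.
  rewrite /L1norm.
  rewrite (_ : (\int[mu]_x _)%E = ((rnorm v)%:E * (F b - F a)%:E)%E) ?ltry //.
  rewrite -hE -ge0_integralZl_EFin ?rnorm_ge0 //.
  - by apply: eq_integral => t _; rewrite rnorm_scalar_ge0 // mulrC EFinM.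
  - by move=> t _; rewrite lee_fin.
  - exact/measurable_EFinP.
by rewrite (bochner_scalar_ge0 v mh h0) hE // ltry.
Qed.

(** A signed integrand is written as (f + M) - M, two nonnegative ones to which the scalar formula
    applies. *)
Lemma bochner_FTC (f F : R -> R) (a b M : R) v : a < b -> continuous f ->
  (forall x : R, is_derive x 1 F (f x)) -> (forall x, a < x < b -> `|f x| <= M) ->
  let h := fun t => (if a < t < b then f t else 0)%:C *: v in
  [/\ smeas h, (L1norm h < +oo)%E & bochner h = (F b - F a)%:C *: v].
Proof.
move=> ab cf dF fM h.
have M0 : 0 <= M.
  apply: le_trans (normr_ge0 _) (fM ((a + b) / 2) _); apply/andP; split; lra.
have cM : continuous (fun _ : R => M) by move=> x; exact: cvg_cst.
have dM (x : R) : is_derive x 1 (fun x => M * x) M.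
  have := is_deriveZ M (is_derive_id x (1 : R)).
  by rewrite /GRing.scale /= mulr1.
have cfM : continuous (fun x => f x + M).
  by move=> x; apply: cvgD; [exact: cf|exact: cvg_cst].
have dfM (x : R) : is_derive x 1 (fun x => F x + M * x) (f x + M).
  exact: is_deriveD (dF x) (dM x).
have fM0 x : a < x < b -> 0 <= f x + M.
  by move=> /fM; rewrite ler_norml -lerBlDr sub0r => /andP[].
have [m1 l1 e1] := bochner_FTC_ge0 v ab cfM dfM fM0.
have [m2 l2 e2] := bochner_FTC_ge0 (- v) ab cM dM (fun _ _ => M0).
have hE : h = fun t => (if a < t < b then f t + M else 0)%:C *: v +
    (if a < t < b then M else 0)%:C *: - v.
  apply/funext => t; rewrite /h; case: ifP => _; last by rewrite !scale0r addr0.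
  by rewrite scalerN -scalerBl -rmorphB addrK.
split.
- by rewrite hE; exact: smeasD.
- rewrite hE; apply: le_lt_trans (L1normD_le m1 m2 _) (lte_add_pinfty l1 l2).
  by move=> t; exact: rnormD.
rewrite hE bochnerD //; do ?exact: smeas_strongly_measurable.
by rewrite e1 e2 scalerN -scalerBl -rmorphB; congr (_%:C *: v); ring.
Qed.

Lemma complex_scaleE z v :
  z *: v = (complex.Re z)%:C *: v + (complex.Im z)%:C *: ('i *: v).
Proof.
rewrite scalerA -scalerDl; congr (_ *: v); case: z => a b /=.
by apply/eqP; rewrite eq_complex /=; apply/andP; split; apply/eqP; ring.
Qed.

Lemma cexp_real z t : cexp (z * t%:C) =
  (expR (complex.Re z * t) * cos (complex.Im z * t)) +i*
  (expR (complex.Re z * t) * sin (complex.Im z * t)).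
Proof. by case: z => a b; rewrite /cexp /= !mulr0 subr0 add0r. Qed.

Lemma bochner_cexp_itv z (a b : R) v : z != 0 -> a < b ->
  let h := fun t : R => (if a < t < b then cexp (z * t%:C) else 0) *: v in
  [/\ smeas h, (L1norm h < +oo)%E &
      bochner h = ((cexp (z * b%:C) - cexp (z * a%:C)) / z) *: v].
Proof.
move=> z0 ab h; have := mulfV z0.
move: (z^-1) => [p q]; rewrite {}/h => zV.
pose f1 t := expR (complex.Re z * t) * cos (complex.Im z * t).
pose f2 t := expR (complex.Re z * t) * sin (complex.Im z * t).
have cE t : cexp (z * t%:C) = f1 t +i* f2 t by exact: cexp_real.
have [h1 h2] : complex.Re z * p - complex.Im z * q = 1 /\
    complex.Re z * q + complex.Im z * p = 0.
  by move: zV; case: (z) => s u /eqP; rewrite eq_complex /= => /andP[/eqP ? /eqP ?].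
pose F1 t := expR (complex.Re z * t) *
  (cos (complex.Im z * t) * p - sin (complex.Im z * t) * q).
pose F2 t := expR (complex.Re z * t) *
  (sin (complex.Im z * t) * p + cos (complex.Im z * t) * q).
have dF1 (t : R) : is_derive t 1 F1 (f1 t) by exact: is_derive_exp_cos.
have dF2 (t : R) : is_derive t 1 F2 (f2 t) by exact: is_derive_exp_sin.
have [cl csin ccos] : [/\ continuous (fun t => expR (complex.Re z * t) : R),
    continuous (fun t => sin (complex.Im z * t) : R) &
    continuous (fun t => cos (complex.Im z * t) : R)].
  have cm (k : R) : continuous (fun t => k * t).
    by move=> t; apply: cvgMr; exact: cvg_id.
  split=> t.
  - by apply: (continuous_comp (cm _ t)); exact: continuous_expR.
  - by apply: (continuous_comp (cm _ t)); exact: continuous_sin.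
  - by apply: (continuous_comp (cm _ t)); exact: continuous_cos.
have cf1 : continuous f1 by move=> t; apply: cvgM; [exact: cl|exact: ccos].
have cf2 : continuous f2 by move=> t; apply: cvgM; [exact: cl|exact: csin].
pose M := expR (`|complex.Re z| * (`|a| + `|b|)).
have eM t : a < t < b -> expR (complex.Re z * t) <= M.
  move=> /andP[at_ tb]; rewrite ler_expR; apply: le_trans (ler_norm _) _.
  rewrite normrM ler_wpM2l // ler_norml; apply/andP; split.
    rewrite opprD; have := ler_norm (- a); rewrite normrN; have := normr_ge0 b.
    by move: at_; lra.
  by have := ler_norm b; have := normr_ge0 a; move: tb; lra.
have f1M t : a < t < b -> `|f1 t| <= M.
  move=> /eM; apply: le_trans; rewrite normrM ger0_norm ?expR_ge0 //.
  by rewrite ler_piMr ?expR_ge0 // ler_norml cos_geN1 cos_le1.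
have f2M t : a < t < b -> `|f2 t| <= M.
  move=> /eM; apply: le_trans; rewrite normrM ger0_norm ?expR_ge0 //.
  by rewrite ler_piMr ?expR_ge0 // ler_norml sin_geN1 sin_le1.
have [m1 l1 e1] := bochner_FTC v ab cf1 dF1 f1M.
have [m2 l2 e2] := bochner_FTC ('i *: v) ab cf2 dF2 f2M.
have -> : (fun t : R => (if a < t < b then cexp (z * t%:C) else 0) *: v) =
    fun t => (if a < t < b then f1 t else 0)%:C *: v +
             (if a < t < b then f2 t else 0)%:C *: ('i *: v).
  apply/funext => t; case: ifP => _; last by rewrite !scale0r addr0.
  by rewrite cE complex_scaleE.
split.
- exact: smeasD.
- apply: le_lt_trans (L1normD_le m1 m2 _) (lte_add_pinfty l1 l2).
  by move=> t; exact: rnormD.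
rewrite bochnerD //; do ?exact: smeas_strongly_measurable.
rewrite e1 e2 [RHS]complex_scaleE !cE.
congr (_%:C *: _ + _%:C *: _); rewrite /F1 /F2 /f1 /f2 /=; ring.
Qed.

Lemma ge0_integral_exp_tail (s m : R) : 0 < s ->
  (\int[mu]_t (if m < t then expR (- (s * t)) else 0)%:E =
   (expR (- (s * m)) / s)%:E)%E.
Proof.
move=> s0; pose f t : R := expR (- (s * t)).
have cm : continuous (fun t => - (s * t) : R).
  by move=> t; apply: cvgN; apply: cvgMr; exact: cvg_id.
have cf : continuous f.
  by move=> t; apply: (continuous_comp (cm t)); exact: continuous_expR.
pose F t : R := - (f t / s).
have dF (t : R) : is_derive t 1 F (f t).
  rewrite /F /f; apply: is_derive_eq.
  by rewrite /GRing.scale /= ?mulr0 ?add0r ?addr0; field; rewrite gt_eqF.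
have cF := is_derive_continuous dF.
have mf (D : set R) : measurable_fun D (EFin \o f).
  by apply/measurable_EFinP/measurable_funTS; exact: continuous_measurable_fun.
have -> : (\int[mu]_t (if m < t then f t else 0)%:E =
    \int[mu]_(x in `[m, +oo[) (f x)%:E)%E.
  rewrite -(integral_itv_obnd_cbnd (mf _)) [RHS]integral_mkcond.
  apply: eq_integral => x _; rewrite patchE; case: ifPn => h.
    by rewrite mem_set //= in_itv /= h.
  by rewrite memNset //= in_itv /= andbT; exact/negP.
rewrite (@ge0_continuous_FTC2y _ f F m 0) //.
- by rewrite /F /f sub0e -EFinN opprK.
- by move=> x _; exact: expR_ge0.
- exact: continuous_subspaceT.
- rewrite -oppr0 -(mul0r s^-1); apply: cvgN; apply: cvgMl.
  apply: (@cvg_comp _ _ _ (fun t => s * t) (fun t => expR (- t)) _ (pinfty_nbhs R)).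
    exact: gt0_cvgMry.
  exact: cvgr_expR.
- exact/cvg_at_right_filter/cF.
- by move=> x _; rewrite derive1E; have [_ ->] := dF x.
Qed.

End BochnerExponential.

(** * Convolutions and Fourier transforms of one-sided exponentials *)

Section OneSidedExponentials.
Variables (R : realType) (A : banachAlgType R[i]).
Local Notation mu := (@lebesgue_measure R).
Implicit Types (v a b : A) (z w : R[i]).

Lemma simple_comp_reflection c (s : R -> A) : simple s -> simple (fun t => s (c - t)).
Proof.
move=> [fs ms]; split.
  by apply: sub_finite_set fs => _ [t _ <-]; exists (c - t).
move=> v; rewrite -[X in measurable X]setTI.
exact: (measurable_reflection c measurableT (ms v)).
Qed.

Lemma measure_reflection_preimage c (s : R -> A) v : simple s ->
  mu ((fun t => s (c - t)) @^-1` [set v]) = mu (s @^-1` [set v]).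
Proof. by move=> [_ ms]; rewrite -[RHS](lebesgue_measure_reflection c (ms v)). Qed.

Lemma simple_integral_reflection c (s : R -> A) : simple s ->
  simple_integral (fun t => s (c - t)) = simple_integral s.
Proof.
move=> ss; rewrite /simple_integral.
have -> : range (fun t => s (c - t)) = range s.
  apply/seteqP; split=> [_ [t _ <-]|_ [t _ <-]]; first by exists (c - t).
  by exists (c - t) => //; rewrite subKr.
by apply: eq_fsbigr => v _; rewrite measure_reflection_preimage.
Qed.

Lemma is_bochner_integral_reflection c (h : R -> A) v :
  is_bochner_integral h v -> is_bochner_integral (fun t => h (c - t)) v.
Proof.
move=> [mh [s [si sh sv]]]; split.
  have [r [rs rh]] := mh; exists (fun n t => r n (c - t)); split=> [n|].
    exact: simple_comp_reflection.
  exact: (ae_reflection c rh).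
exists (fun n t => s n (c - t)); split=> [n||].
- split; first by apply: simple_comp_reflection; have [] := si n.
  by move=> w w0; rewrite measure_reflection_preimage; have [s1 s2] := si n; [exact: s2|].
- have [g mg hg] := strongly_measurableP mh.
  suff -> : (fun n => \int[mu]_x (rnorm (h (c - x) - s n (c - x)))%:E)%E =
      (fun n => \int[mu]_x (rnorm (h x - s n x))%:E)%E by [].
  apply/funext => n.
  transitivity (\int[mu]_x (rnorm (g (c - x) - s n (c - x)))%:E)%E.
    apply: (@L1norm_ae _ _ (fun x => h (c - x) - s n (c - x))).
    by apply: ae_imply (ae_reflection c hg) => t ->.
  transitivity (\int[mu]_x (rnorm (g x - s n x))%:E)%E; last first.
    apply: (@L1norm_ae _ _ (fun x => g x - s n x)).
    by apply: ae_imply hg => t ->.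
  apply: (@ge0_integral_reflection _ c (fun x => (rnorm (g x - s n x))%:E)).
    apply/measurable_EFinP/smeas_rnorm/smeasB => //.
    exact: integrable_simple_smeas.
  by move=> t; rewrite lee_fin rnorm_ge0.
- rewrite (_ : (fun n => simple_integral _) = fun n => simple_integral (s n)) //.
  apply/funext => n; apply: simple_integral_reflection; exact: (si n).1.
Qed.

Lemma bochner_reflection c (h : R -> A) : smeas h -> (L1norm h < +oo)%E ->
  bochner (fun t => h (c - t)) = bochner h.
Proof.
move=> mh fh; apply: bochner_eq; apply: is_bochner_integral_reflection.
by apply: bochner_exists => //; exact: smeas_strongly_measurable.
Qed.

Lemma bochner0 : bochner (fun=> 0 : A) = 0.
Proof.
apply: rnorm0_eq0; apply/eqP; rewrite eq_le rnorm_ge0 andbT -lee_fin.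
apply: le_trans (rnorm_bochner_le _) _; rewrite /L1norm.
by under eq_integral do rewrite rnorm0; rewrite integral0.
Qed.

Lemma smeas_complex (c : R -> R[i]) v :
  measurable_fun setT (fun t => complex.Re (c t)) ->
  measurable_fun setT (fun t => complex.Im (c t)) ->
  smeas (fun t => c t *: v).
Proof.
move=> m1 m2; rewrite (_ : (fun t => _) = fun t => (complex.Re (c t))%:C *: v +
  (complex.Im (c t))%:C *: ('i *: v)); last by apply/funext => t; exact: complex_scaleE.
by apply: smeasD; exact: smeas_scalar.
Qed.

Lemma measurable_cexp z :
  measurable_fun setT (fun t : R => complex.Re (cexp (z * t%:C))) /\
  measurable_fun setT (fun t : R => complex.Im (cexp (z * t%:C))).
Proof.
have ml (k : R) : measurable_fun setT (fun t : R => k * t).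
  exact: mulrl_measurable.
have me : measurable_fun setT (fun t : R => expR (complex.Re z * t)).
  by apply: (measurableT_comp (continuous_measurable_fun (@continuous_expR R))); exact: ml.
have mc : measurable_fun setT (fun t : R => cos (complex.Im z * t)).
  apply: (measurableT_comp (continuous_measurable_fun (@continuous_cos R))).
  exact: ml.
have ms : measurable_fun setT (fun t : R => sin (complex.Im z * t)).
  apply: (measurableT_comp (continuous_measurable_fun (@continuous_sin R))).
  exact: ml.
split; under eq_fun do rewrite cexp_real /=; exact: measurable_funM.
Qed.

Lemma smeas_cexp_if (E : R -> bool) z v : measurable_fun setT E ->
  smeas (fun t : R => (if E t then cexp (z * t%:C) else 0) *: v).
Proof.
move=> mE; have [m1 m2] := measurable_cexp z; apply: smeas_complex.
  rewrite (_ : (fun t => _) = fun t => if E t then complex.Re (cexp (z * t%:C)) else 0).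
    exact: measurable_fun_ifT.
  by apply/funext => t; case: ifP.
rewrite (_ : (fun t => _) = fun t => if E t then complex.Im (cexp (z * t%:C)) else 0).
  exact: measurable_fun_ifT.
by apply/funext => t; case: ifP.
Qed.

Lemma exp_small (s C e m : R) : 0 < s -> 0 < e -> 0 <= C ->
  exists2 k, m < k & C * expR (- (s * k)) <= e.
Proof.
move=> s0 e0 C0; exists (Num.max (m + 1) (C / (e * s))).
  by rewrite lt_max ltrDl ltr01.
set k := Num.max _ _; rewrite expRN ler_pdivrMr ?expR_gt0 //.
apply: (@le_trans _ _ (e * (1 + s * k))); last by rewrite ler_pM2l // expR_ge1Dx.
have : C / (e * s) <= k by rewrite le_max lexx orbT.
rewrite ler_pdivrMr ?mulr_gt0 //; nra.
Qed.

Lemma L1norm_cexp_tail_le (h : R -> A) (s m c : R) : 0 < s -> 0 <= c ->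
  (forall t, rnorm (h t) <= c * (if m < t then expR (- (s * t)) else 0)) ->
  (L1norm h <= (c * (expR (- (s * m)) / s))%:E)%E.
Proof.
move=> s0 c0 hP; rewrite EFinM -ge0_integral_exp_tail // -ge0_integralZl_EFin //.
- apply: ge0_le_integralT => t; first by rewrite lee_fin rnorm_ge0.
  by rewrite -EFinM lee_fin.
- by move=> t _; rewrite lee_fin; case: ifP => // _; exact: expR_ge0.
- apply/measurable_EFinP; apply: measurable_fun_ifT => //.
    by apply: measurable_fun_ltr => //; exact: measurable_id.
  apply: (measurableT_comp (continuous_measurable_fun (@continuous_expR R))).
  by apply: measurableT_comp => //; exact: mulrl_measurable.
Qed.

Lemma rnorm_cexp_tail z (t : R) v :
  rnorm (cexp (- z * t%:C) *: v) = rnorm v * expR (- (complex.Re z * t)).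
Proof.
rewrite rnormZ normc_cexp mulrC; congr (_ * expR _).
by case: z => x y /=; rewrite mulr0 subr0 mulNr.
Qed.

(** The integral over ]m, n[ is known. What remains beyond n and the boundary term at n are both at
    most |v| e^{-sk}/s with s = Re z and n = k + 1, and [exp_small] makes this arbitrarily small. *)
Lemma bochner_cexp_tail z (m : R) v : 0 < complex.Re z ->
  let h := fun t : R => (if m < t then cexp (- z * t%:C) else 0) *: v in
  [/\ smeas h, (L1norm h < +oo)%E &
      bochner h = (cexp (- z * m%:C) / z) *: v].
Proof.
set s := complex.Re z => s0 h.
have z0 : z != 0 by apply: contraTneq s0 => z0; rewrite /s z0 /= ltxx.
have ltm (k : R) : measurable_fun setT (fun t : R => k < t).
  by apply: measurable_fun_ltr => //; exact: measurable_id.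
have mh : smeas h by apply: smeas_cexp_if.
have fh : (L1norm h < +oo)%E.
  apply: le_lt_trans (L1norm_cexp_tail_le (c := rnorm v) (m := m) s0 _ _) (ltry _).
    exact: rnorm_ge0.
  move=> t; rewrite /h; case: ifP => _; last by rewrite scale0r rnorm0 mulr0.
  by rewrite rnorm_cexp_tail.
split=> //; apply/eqP; rewrite -subr_eq0; apply/eqP/rnorm0_eq0/le_anti.
rewrite rnorm_ge0 andbT; apply/ler_addgt0Pr => e e0; rewrite add0r.
have [|k mk kP] := @exp_small s (rnorm v * (2 / s)) e m s0 e0.
  by rewrite mulr_ge0 ?rnorm_ge0 // divr_ge0 // ltW.
pose n := k + 1; have mn : m < n by rewrite /n ltr_wpDr.
have nz0 : - z != 0 by rewrite oppr_eq0.
have [m1 l1 e1] := bochner_cexp_itv v nz0 mn.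
pose h2 (t : R) := (if m < t < n then 0 else if m < t then cexp (- z * t%:C) else 0) *: v.
have m2 : smeas h2.
  rewrite /h2 (_ : (fun t => _) = fun t : R =>
    (if (m < t) && ~~ (t < n) then cexp (- z * t%:C) else 0) *: v).
    apply: smeas_cexp_if; apply: measurable_and => //; apply: measurable_neg.
    by apply: measurable_fun_ltr => //; exact: measurable_id.
  by apply/funext => t; case: (m < t); case: (t < n).
have L2 : (L1norm h2 <= (rnorm v * (expR (- (s * k)) / s))%:E)%E.
  apply: L1norm_cexp_tail_le => // [|t]; first exact: rnorm_ge0.
  have r0 : 0 <= rnorm v * (if k < t then expR (- (s * t)) else 0).
    by rewrite mulr_ge0 ?rnorm_ge0 //; case: ifP => // _; exact: expR_ge0.
  rewrite /h2; case: ifPn => [_|]; first by rewrite scale0r rnorm0.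
  case: ltP => mt; last by rewrite scale0r rnorm0.
  rewrite /= -leNgt rnorm_cexp_tail => nt.
  by rewrite ifT // (lt_le_trans _ nt) // /n ltrDl.
have -> : bochner h - (cexp (- z * m%:C) / z) *: v =
    bochner h2 - (cexp (- z * n%:C) / z) *: v.
  rewrite (_ : h = fun t => (if m < t < n then cexp (- z * t%:C) else 0) *: v + h2 t).
    rewrite bochnerD ?e1 //; do ?exact: smeas_strongly_measurable; last first.
      exact: le_lt_trans L2 (ltry _).
    rewrite [X in X - _]addrC -addrA; congr (_ + _).
    rewrite invrN mulrN -mulNr opprB mulrBl scalerBl.
    by rewrite addrAC subrr add0r.
  apply/funext => t; rewrite /h /h2; case: (m < t) => /=; last by rewrite scale0r addr0.
  by case: (t < n); rewrite scale0r ?addr0 ?add0r.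
apply: le_trans (rnormB _ _) _; apply: le_trans kP.
have B1 : rnorm (bochner h2) <= rnorm v * (expR (- (s * k)) / s).
  by rewrite -lee_fin; exact: le_trans (rnorm_bochner_le _) L2.
have B2 : rnorm ((cexp (- z * n%:C) / z) *: v) <= rnorm v * (expR (- (s * k)) / s).
  rewrite -scalerA rnorm_cexp_tail rnormZ Normc.normcV.
  have sz : s <= normc z := le_trans (ler_norm _) (Re_le_normc z).
  have zV : (normc z)^-1 <= s^-1 by rewrite lef_pV2 ?posrE // (lt_le_trans s0).
  have nk : expR (- (s * n)) <= expR (- (s * k)).
    by rewrite ler_expR lerN2 ler_pM2l // /n lerDl.
  rewrite (mulrC _ (rnorm v)) -mulrA ler_wpM2l ?rnorm_ge0 // mulrC.
  by apply: ler_pM nk zV; rewrite ?expR_ge0 // invr_ge0 normc_ge0.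
lra.
Qed.

Definition half_exp z (t : R) : R[i] := if 0 < t then cexp (- z * t%:C) else 0.

(** The integrand lives on 0 < t < x, where it is e^{-zx} e^{(z-w)t}. On the transform side this is
    the partial fraction decomposition of 1/((z-it)(w-it)). *)
Lemma conv_ex z w a b (x : R) : z != w ->
  convolution (fun t => half_exp z t *: a) (fun t => half_exp w t *: b) x =
  ((half_exp z x - half_exp w x) / (w - z)) *: (a * b).
Proof.
move=> zw; rewrite /convolution; case: (ltP 0 x) => x0; last first.
  rewrite /half_exp !ltNge x0 /= subrr mul0r scale0r -[RHS]bochner0; congr bochner.
  apply/funext => t; case: ltP => xt; last by rewrite scale0r mul0r.
  rewrite ltNge (_ : (t <= 0) = true) ?scale0r ?mulr0 //.
  by rewrite ltW // (lt_le_trans _ x0) // -subr_gt0.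
have zw0 : z - w != 0 by rewrite subr_eq0.
have [_ _ E] := bochner_cexp_itv (cexp (- z * x%:C) *: (a * b)) zw0 x0.
transitivity (bochner (fun t : R => (if 0 < t < x then cexp ((z - w) * t%:C) else 0) *:
    (cexp (- z * x%:C) *: (a * b)))).
  congr bochner; apply/funext => t; rewrite /half_exp subr_gt0 -scalerAl -scalerAr !scalerA.
  congr (_ *: _); case: (ltP t x) => tx; last by rewrite andbF !mul0r.
  rewrite andbT; case: ltP => t0; last by rewrite mulr0 mul0r.
  rewrite -!cexpD; congr cexp; rewrite rmorphB /=; ring.
rewrite E scalerA; congr (_ *: _); rewrite /half_exp x0 mulr0 cexp0.
rewrite mulrAC mulrBl mul1r -cexpD -(opprB z w) invrN mulrN -mulNr opprB.
by congr ((cexp _ - _) / _); ring.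
Qed.

Lemma conv_ex_neg z w a b (x : R) : z != w ->
  convolution (fun t => half_exp z (- t) *: a) (fun t => half_exp w (- t) *: b) x =
  ((half_exp z (- x) - half_exp w (- x)) / (w - z)) *: (a * b).
Proof.
move=> zw; rewrite /convolution; case: (ltP x 0) => x0; last first.
  rewrite /half_exp !oppr_gt0 !ltNge x0 /= subrr mul0r scale0r -[RHS]bochner0; congr bochner.
  apply/funext => t; rewrite !oppr_gt0 subr_lt0; case: ltP => xt; last first.
    by rewrite scale0r mul0r.
  by rewrite ltNge (ltW (le_lt_trans x0 xt)) /= scale0r mulr0.
have zw0 : w - z != 0 by rewrite subr_eq0 eq_sym.
have [_ _ E] := bochner_cexp_itv (cexp (z * x%:C) *: (a * b)) zw0 x0.
transitivity (bochner (fun t : R => (if x < t < 0 then cexp ((w - z) * t%:C) else 0) *: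
    (cexp (z * x%:C) *: (a * b)))).
  congr bochner; apply/funext => t; rewrite /half_exp !oppr_gt0 subr_lt0.
  rewrite -scalerAl -scalerAr !scalerA; congr (_ *: _).
  case: (ltP x t) => tx; last by rewrite !mul0r.
  rewrite /=; case: ltP => t0; last by rewrite mulr0 mul0r.
  rewrite -!cexpD; congr cexp; rewrite !rmorphN rmorphB /=; ring.
rewrite E scalerA; congr (_ *: _); rewrite /half_exp oppr_gt0 x0 mulr0 cexp0.
rewrite mulrAC mulrBl mul1r -cexpD.
by congr ((cexp _ - cexp _) / _); rewrite rmorphN /=; ring.
Qed.

(** The integrand is an exponential on t < min(x, 0), which a reflection carries to a tail integral.
    At x = 0 both half exponentials are 0 while the convolution is ab/(z+w), whence the exclusion of
    that point. *)
Lemma conv_ex_cross z w a b (x : R) : 0 < complex.Re z -> 0 < complex.Re w ->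
  x != 0 ->
  convolution (fun t => half_exp z t *: a) (fun t => half_exp w (- t) *: b) x =
  ((half_exp z x + half_exp w (- x)) / (z + w)) *: (a * b).
Proof.
move=> z0 w0 x0; have zw : 0 < complex.Re (z + w).
  by move: z0 w0; case: z => ? ?; case: w => ? ?; exact: addr_gt0.
have [m l V] := bochner_cexp_tail (Num.max (- x) 0) (cexp (- z * x%:C) *: (a * b)) zw.
rewrite /convolution.
pose h (t : R) := (if Num.max (- x) 0 < t then cexp (- (z + w) * t%:C) else 0) *:
  (cexp (- z * x%:C) *: (a * b)).
transitivity (bochner (fun t => h (0 - t))).
  congr bochner; apply/funext => t; rewrite /h /half_exp oppr_gt0 sub0r subr_gt0.
  rewrite -scalerAl -scalerAr !scalerA gt_max ltrN2 oppr_gt0; congr (_ *: _).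
  case: (ltP t x) => tx; last by rewrite !mul0r.
  rewrite /=; case: ltP => t0; last by rewrite mulr0 mul0r.
  rewrite -!cexpD; congr cexp; rewrite !rmorphN rmorphB /=; ring.
rewrite bochner_reflection // V scalerA; congr (_ *: _); rewrite mulrAC -cexpD.
congr (_ / _); rewrite /half_exp oppr_gt0; move: x0; case: (ltgtP x 0) => // xs _.
  rewrite add0r max_l; last by rewrite oppr_ge0 ltW.
  by congr cexp; rewrite rmorphN /=; ring.
rewrite addr0 max_r; last by rewrite oppr_le0 ltW.
by rewrite mulr0 add0r.
Qed.

Lemma fourier_ex z a (t : R) : 0 < complex.Re z ->
  fourier (fun x => half_exp z x *: a) t = (z - 'i * t%:C)^-1 *: a.
Proof.
move=> z0; have z1 : 0 < complex.Re (z - 'i * t%:C).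
  by move: z0; case: z => x y /=; rewrite mul0r mulr0 subrr subr0.
have [_ _ E] := bochner_cexp_tail 0 a z1.
rewrite mulr0 cexp0 mul1r in E; rewrite -E /fourier; congr bochner.
apply/funext => x; rewrite /half_exp; case: ltP => _; last by rewrite !scale0r scaler0.
rewrite scalerA; congr (_ *: a).
have -> : cos (t * x) +i* sin (t * x) = cexp (('i * t%:C) * x%:C).
  by rewrite cexp_real /= !mul0r !mulr0 subr0 mul1r mul0r add0r expR0 !mul1r.
by rewrite -cexpD; congr cexp; ring.
Qed.

Lemma fourier_ex_neg z a (t : R) : 0 < complex.Re z ->
  fourier (fun x => half_exp z (- x) *: a) t = (z + 'i * t%:C)^-1 *: a.
Proof.
move=> z0; have z1 : 0 < complex.Re (z + 'i * t%:C).
  by move: z0; case: z => x y /=; rewrite mul0r mulr0 subrr addr0.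
have [m l E] := bochner_cexp_tail 0 a z1.
rewrite mulr0 cexp0 mul1r in E; rewrite -E -(bochner_reflection 0) // /fourier.
congr bochner; apply/funext => x; rewrite /half_exp sub0r.
case: ltP => _; last by rewrite !scale0r scaler0.
rewrite scalerA; congr (_ *: a).
have -> : cos (t * x) +i* sin (t * x) = cexp (('i * t%:C) * x%:C).
  by rewrite cexp_real /= !mul0r !mulr0 subr0 mul1r mul0r add0r expR0 !mul1r.
by rewrite -cexpD; congr cexp; rewrite rmorphN /=; ring.
Qed.

End OneSidedExponentials.

(** * The Fourier transform on the convolution algebra *)

Section FourierTransform.
Variables (R : realType) (D : algWeight R) (A : banachAlgType R[i]).
Local Notation mu := (@lebesgue_measure R).
Local Notation lspace := (lspace D A).
Implicit Types (a b : A) (x y : lspace) (t : R).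

Definition phase t (s : R) : R[i] := cos (t * s) +i* sin (t * s).

Lemma phaseE t s : phase t s = cexp (('i * t%:C) * s%:C).
Proof.
by rewrite cexp_real /= !mul0r !mulr0 subr0 mul1r mul0r add0r expR0 !mul1r.
Qed.

Lemma rnorm_phase t s (v : A) : rnorm (phase t s *: v) = rnorm v.
Proof.
by rewrite rnormZ /phase /= cos2Dsin2 sqrtr1 mul1r.
Qed.

Lemma smeas_phase t (f : R -> A) : smeas f -> smeas (fun s => phase t s *: f s).
Proof.
move=> mf; rewrite (_ : (fun s => _) = fun s : R => (phase t s *: 1) * f s).
  apply: smeasM => //.
  rewrite (_ : (fun s => _) = fun s : R =>
    (if true then cexp (('i * t%:C) * s%:C) else 0) *: (1 : A)); last first.
    by apply/funext => s; rewrite phaseE.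
  by apply: (@smeas_cexp_if R A (fun=> true)); exact: measurable_cst.
by apply/funext => s; rewrite -scalerAl mul1r.
Qed.

Lemma L1norm_phase t x : (L1norm (fun s => phase t s *: x s) < +oo)%E.
Proof.
rewrite (_ : L1norm _ = L1norm x); first exact: L1norm_lty (lfun_smeas x) (lfun_fin x).
by apply: eq_integral => s _; rewrite rnorm_phase.
Qed.

Lemma smeas_phase_lspace t x : strongly_measurable (fun s => phase t s *: x s).
Proof. exact: smeas_strongly_measurable (smeas_phase t (lfun_smeas x)). Qed.

Lemma fourier_ae t (f g : R -> A) : {ae mu, forall s, f s = g s} ->
  fourier f t = fourier g t.
Proof. by move=> fg; apply: bochner_ae; apply: ae_imply fg => s ->. Qed.

Lemma fourierD t x y : fourier (x + y) t = fourier x t + fourier y t.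
Proof.
rewrite (fourier_ae t (lspaceDE x y)) /fourier -bochnerD; first last.
- exact: L1norm_phase.
- exact: smeas_phase_lspace.
- exact: L1norm_phase.
- exact: smeas_phase_lspace.
by congr bochner; apply/funext => s; rewrite scalerDr.
Qed.

Lemma rnorm_fourier_le t x : rnorm (fourier x t) <= aw_cst D * lnorm x.
Proof.
rewrite -lee_fin; apply: le_trans (rnorm_bochner_le _) _.
rewrite (_ : L1norm _ = L1norm x); last first.
  by apply: eq_integral => s _; rewrite rnorm_phase.
by apply: le_trans (L1norm_le_vnorm D (lfun_smeas x)) _; rewrite vnormE -EFinM mulrC.
Qed.

Lemma fourier_lact t a x : fourier (lact a x) t = a * fourier x t.
Proof.
rewrite (fourier_ae t (lactE a x)) /fourier.
rewrite -(@bochner_linear _ _ ( *%R a) (rnorm a)); first last.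
- exact: L1norm_phase.
- exact: smeas_phase_lspace.
- by move=> u; exact: rnormM.
- by move=> r u; rewrite scalerAr.
- by move=> u v; rewrite mulrDr.
by congr bochner; apply/funext => s; rewrite scalerAr.
Qed.

Lemma fourier_ract t a x : fourier (ract x a) t = fourier x t * a.
Proof.
rewrite (fourier_ae t (ractE a x)) /fourier.
rewrite -(@bochner_linear _ _ ( *%R^~ a) (rnorm a)); first last.
- exact: L1norm_phase.
- exact: smeas_phase_lspace.
- by move=> u; rewrite mulrC; exact: rnormM.
- by move=> r u; rewrite scalerAl.
- by move=> u v; rewrite mulrDl.
by congr bochner; apply/funext => s; rewrite scalerAl.
Qed.

End FourierTransform.

(** * Exponentials as elements of the algebra, and their resolvent relations *)

Section ExponentialElements.
Variables (R : realType) (D : algWeight R) (A : banachAlgType R[i]).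
(** The only way in which the growth of the weight enters: all decaying exponentials lie in L^p.
    Regular weights satisfy it by [subexp_snorm]. *)
Hypothesis subexp : forall s : R, 0 < s ->
  (snorm D (fun t => expR (- (s * `|t|))%R) < +oo)%E.
Local Notation mu := (@lebesgue_measure R).
Local Notation lspace := (lspace D A).
Local Notation unz := (unz D A).
Implicit Types (a b : A) (x y : lspace) (t : R) (z w s : R[i]).

Lemma rnorm_ex_le z t a :
  rnorm (half_exp z t *: a) <= rnorm a * expR (- (complex.Re z * `|t|)).
Proof.
rewrite /half_exp; case: ltP => t0; last first.
  by rewrite scale0r rnorm0 mulr_ge0 ?rnorm_ge0 ?expR_ge0.
by rewrite rnorm_cexp_tail gtr0_norm.
Qed.

Lemma smeas_ex z a : smeas (fun t : R => half_exp z t *: a).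
Proof.
apply: smeas_cexp_if; apply: measurable_fun_ltr => //; exact: measurable_id.
Qed.

Lemma measurable_exp_abs (s : R) :
  measurable_fun setT (fun t : R => expR (- (s * `|t|))).
Proof.
apply: (measurableT_comp (continuous_measurable_fun (@continuous_expR R))).
apply: measurableT_comp => //; apply: measurableT_comp; first exact: mulrl_measurable.
exact: normr_measurable.
Qed.

Lemma Lpfun_exp_le (f : R -> A) z a : smeas f -> 0 < complex.Re z ->
  (forall t, rnorm (f t) <= rnorm a * expR (- (complex.Re z * `|t|))) -> Lpfun D f.
Proof.
move=> mf z0 fle; apply: Lpfun_smeas => //.
apply: le_lt_trans (vnorm_le D (ae_of_forall fle)) _.
rewrite (@snormZ _ D (rnorm a) _ (rnorm_ge0 a) (measurable_exp_abs _)
  (fun=> expR_ge0 _)).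
have := subexp z0; case: (snorm _ _) (snorm_ge0 D (fun t => expR (- (complex.Re z * `|t|)))) => //.
by move=> r _ _; rewrite -EFinM ltry.
Qed.

Lemma Lpfun_ex z a : 0 < complex.Re z -> Lpfun D (fun t => half_exp z t *: a).
Proof.
move=> z0; apply: (@Lpfun_exp_le _ z a) => // [|t]; first exact: smeas_ex.
exact: rnorm_ex_le.
Qed.

Lemma Lpfun_ex_neg z a : 0 < complex.Re z -> Lpfun D (fun t => half_exp z (- t) *: a).
Proof.
move=> z0; apply: (@Lpfun_exp_le _ z a) => // [|t].
  exact: (smeas_comp (@oppr_measurable R setT) (smeas_ex z a)).
by rewrite -(normrN t); exact: rnorm_ex_le.
Qed.

Definition right_exp z a : lspace := toL D (fun t => half_exp z t *: a).
Definition left_exp z a : lspace := toL D (fun t => half_exp z (- t) *: a).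

Lemma right_expE z a : 0 < complex.Re z -> {ae mu, forall t, right_exp z a t = half_exp z t *: a}.
Proof. by move=> z0; apply: toLE; exact: Lpfun_ex. Qed.

Lemma left_expE z a : 0 < complex.Re z -> {ae mu, forall t, left_exp z a t = half_exp z (- t) *: a}.
Proof. by move=> z0; apply: toLE; exact: Lpfun_ex_neg. Qed.

Lemma scale_mulE (k : R[i]) (v : A) : k *: v = k%:A * v.
Proof. by rewrite mulr_algl. Qed.

(** The resolvent identity, with the denominator cleared so that z = w is included. *)
Lemma uE_mul z w a b : 0 < complex.Re z -> 0 < complex.Re w ->
  lact (w - z)%:A (lmul (right_exp z a) (right_exp w b)) = right_exp z (a * b) - right_exp w (a * b).
Proof.
move=> z0 w0; have [<-|zw] := eqVneq z w.
  by rewrite !subrr scale0r lact0l.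
apply: lspace_eq.
apply: (ae_mp (lactE (w - z)%:A (lmul (right_exp z a) (right_exp w b)))).
apply: (ae_mp (lmulE (right_exp z a) (right_exp w b))).
rewrite (conv_ae (right_expE a z0) (right_expE b w0)).
apply: (ae_mp (lspaceBE (right_exp z (a * b)) (right_exp w (a * b)))).
apply: (ae_mp (right_expE (a * b) z0)); apply: (ae_mp (right_expE (a * b) w0)).
apply: ae_of_forall => t h1 h2 h3 h4 h5.
apply: etrans h5 _; rewrite h4 conv_ex // [RHS]h3 h2 h1 mulr_algl scalerA.
by rewrite mulrC divfK ?subr_eq0 1?eq_sym // scalerBl.
Qed.

Lemma ae_neq0 : {ae mu, forall t : R, t != 0}.
Proof.
exists [set 0]; split; [exact: measurable_set1|exact: lebesgue_measure_set1|].
by move=> t /= /negP/negPn/eqP.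
Qed.

Lemma uE_uM_mul z w a b : 0 < complex.Re z -> 0 < complex.Re w ->
  lact (z + w)%:A (lmul (right_exp z a) (left_exp w b)) = right_exp z (a * b) + left_exp w (a * b).
Proof.
move=> z0 w0; apply: lspace_eq.
apply: (ae_mp (lactE (z + w)%:A (lmul (right_exp z a) (left_exp w b)))).
apply: (ae_mp (lmulE (right_exp z a) (left_exp w b))).
rewrite (conv_ae (right_expE a z0) (left_expE b w0)).
apply: (ae_mp (lspaceDE (right_exp z (a * b)) (left_exp w (a * b)))).
apply: (ae_mp (right_expE (a * b) z0)); apply: (ae_mp (left_expE (a * b) w0)); apply: (ae_mp ae_neq0).
apply: ae_of_forall => t t0 h1 h2 h3 h4 h5.
apply: etrans h5 _; rewrite h4 conv_ex_cross // [RHS]h3 h2 h1 mulr_algl scalerA.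
rewrite mulrC divfK ?scalerDl //.
apply: contraTneq (addr_gt0 z0 w0) => zw.
have -> : complex.Re z + complex.Re w = complex.Re (z + w).
  by case: (z) (w) => [? ?] [? ?].
by rewrite zw ltxx.
Qed.

Lemma ract_uE z a : 0 < complex.Re z -> ract (right_exp z 1) a = right_exp z a.
Proof.
move=> z0; apply: lspace_eq; apply: (ae_mp (ractE a (right_exp z 1))).
apply: (ae_mp (right_expE 1 z0)); apply: (ae_mp (right_expE a z0)).
by apply: ae_of_forall => t h1 h2 h3; rewrite h3 h2 h1 -scalerAl mul1r.
Qed.

Lemma ract_uM z a : 0 < complex.Re z -> ract (left_exp z 1) a = left_exp z a.
Proof.
move=> z0; apply: lspace_eq; apply: (ae_mp (ractE a (left_exp z 1))).
apply: (ae_mp (left_expE 1 z0)); apply: (ae_mp (left_expE a z0)).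
by apply: ae_of_forall => t h1 h2 h3; rewrite h3 h2 h1 -scalerAl mul1r.
Qed.

Lemma lact_uE z a : 0 < complex.Re z -> lact a (right_exp z 1) = right_exp z a.
Proof.
move=> z0; apply: lspace_eq; apply: (ae_mp (lactE a (right_exp z 1))).
apply: (ae_mp (right_expE 1 z0)); apply: (ae_mp (right_expE a z0)).
by apply: ae_of_forall => t h1 h2 h3; rewrite h3 h2 h1 -scalerAr mulr1.
Qed.

Lemma fourier_uE z a t : 0 < complex.Re z ->
  fourier (right_exp z a) t = (z - 'i * t%:C)^-1 *: a.
Proof. by move=> z0; rewrite (fourier_ae t (right_expE a z0)) fourier_ex. Qed.

Lemma fourier_uM z a t : 0 < complex.Re z ->
  fourier (left_exp z a) t = (z + 'i * t%:C)^-1 *: a.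
Proof. by move=> z0; rewrite (fourier_ae t (left_expE a z0)) fourier_ex_neg. Qed.

(** The generator U, of Fourier transform 1/(1-it). *)
Definition unit_exp : unz := (0, right_exp 1 1).

(* Fourier transform t |-> 1 / (s - i t), whatever the sign of [Re s]. *)
Definition exp_resolvent s : unz :=
  if 0 < complex.Re s then (0, right_exp s 1) else (0, - left_exp (- s) 1).

Lemma Re1_gt0 : 0 < complex.Re (1 : R[i]). Proof. exact: ltr01. Qed.

Lemma uiota_pair k (a : A) x : unz_scalar D A k * ((a, x) : unz) = (k *: a, lact k%:A x).
Proof. by rewrite /unz_scalar unzM ract0 lmul0x !addr0 mulr_algl. Qed.

Lemma unz_mul0 x y : ((0, x) : unz) * ((0, y) : unz) = (0, lmul x y).
Proof. by rewrite unzM mul0r lact0l ract0r !add0r. Qed.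

(** On transforms: 1/(s-it) - 1/(1-it) = (1-s)/((1-it)(s-it)). The case Re s > 0 comes from two
    right exponentials, the case Re s < 0 from a right and a left one. *)
Lemma W_resolvent s : complex.Re s != 0 ->
  unz_scalar D A (1 - s) * (unit_exp * exp_resolvent s) = exp_resolvent s - unit_exp.
Proof.
move=> s0; rewrite /exp_resolvent; case: ifPn => sp.
  rewrite /unit_exp unz_mul0 uiota_pair scaler0.
  rewrite -(opprB s 1) scaleNr; have := uE_mul 1 1 Re1_gt0 sp; rewrite mulr1.
  set x := lmul _ _ => xE.
  have -> : lact (- (s - 1)%:A) x = - lact (s - 1)%:A x.
    by apply/eqP; rewrite -addr_eq0 -lactDl addNr lact0l.
  by rewrite xE opprB -[RHS]/(0 - 0, _) subrr.
have sm : 0 < complex.Re (- s).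
  have -> : complex.Re (- s) = - complex.Re s by case: (s).
  by rewrite oppr_gt0 lt_neqAle s0 /= leNgt.
rewrite /unit_exp unz_mul0 uiota_pair scaler0.
have := uE_uM_mul 1 1 Re1_gt0 sm; rewrite mulr1.
have -> : lmul (right_exp 1 1) (- left_exp (- s) 1) = - lmul (right_exp 1 1) (left_exp (- s) 1).
  by apply/eqP; rewrite -addr_eq0 -lmulDr addNr lmulx0.
set x := lmul _ _ => xE.
have -> : lact (1 - s)%:A (- x) = - lact (1 - s)%:A x.
  by apply/eqP; rewrite -addr_eq0 -lactDr addNr lact0.
by rewrite xE -[RHS]/(0 - 0, _) subrr opprD addrC.
Qed.

Lemma unit_exp_central (c : unz) : unit_exp * c = c * unit_exp.
Proof.
case: c => [b x]; rewrite /unit_exp !unzM mul0r mulr0 lact0l ract0r add0r addr0.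
rewrite ract_uE ?Re1_gt0 // lact_uE ?Re1_gt0 //; congr (_, _ + _).
pose phi t : R := if 0 < t then expR (- t) else 0.
have phiE t : (phi t)%:C *: (1 : A) = half_exp 1 t *: 1.
  rewrite /phi /half_exp; case: ifP => // _; rewrite cexp_real /= oppr0 mul0r.
  by rewrite cos0 sin0 mulr0 mulr1 mulN1r.
have -> : right_exp 1 1 = lsc D phi 1 by rewrite /right_exp /lsc; congr toL; apply/funext => t.
apply: lsc_central; split.
- apply: measurable_fun_ifT => //.
    by apply: measurable_fun_ltr => //; exact: measurable_id.
  apply: (measurableT_comp (continuous_measurable_fun (@continuous_expR R))).
  exact: oppr_measurable.
- by move=> t; rewrite /phi; case: ifP => // _; exact: expR_ge0.
- apply: le_lt_trans (subexp ltr01); apply: snorm_ae_le; apply: ae_of_forall => t.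
  rewrite /phi mul1r; case: ltP => t0; last by rewrite lexx expR_ge0.
  by rewrite gtr0_norm // lexx expR_ge0.
Qed.

End ExponentialElements.

(** * Density of the exponentials *)

Section StoneBounds.
Variable R : realType.
Implicit Types (t r y c : R).

Lemma bernoulli_sub t N : 0 <= t <= 1 -> 1 - N%:R * t <= (1 - t) ^+ N.
Proof.
move=> /andP[t0 t1]; elim: N => [|N IH]; first by rewrite mul0r subr0 expr0.
rewrite exprS; apply: (@le_trans _ _ ((1 - t) * (1 - N%:R * t))).
  have : 0 <= N%:R * (t * t) :> R by rewrite mulr_ge0 // mulr_ge0.
  rewrite -natr1; lra.
by rewrite ler_wpM2l // subr_ge0.
Qed.

Lemma bernoulli_add t N : 0 <= t -> 1 + N%:R * t <= (1 + t) ^+ N.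
Proof.
move=> t0; elim: N => [|N IH]; first by rewrite mul0r addr0 expr0.
rewrite exprS; apply: (@le_trans _ _ ((1 + t) * (1 + N%:R * t))).
  have : 0 <= N%:R * (t * t) :> R by rewrite mulr_ge0 // mulr_ge0.
  rewrite -natr1; lra.
by rewrite ler_wpM2l // addr_ge0.
Qed.

(* The step functions of Brosowski and Deutsch: as n grows, they tend to 1 on
   [0, c[ and to 0 on ]c, 1]. *)
Definition stone (k n : nat) c y : R := (1 - (y / (k%:R * c)) ^+ n) ^+ (k ^ n).

Lemma stone_bounds k n c y : 0 < c -> 0 <= y <= 1 -> 1 <= k%:R * c ->
  [/\ 0 <= stone k n c y <= 1, 1 - (y / c) ^+ n <= stone k n c y
    & stone k n c y * (y / c) ^+ n <= 1].
Proof.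
move=> c0 /andP[y0 y1] kc; have kc0 : 0 < k%:R * c by rewrite (lt_le_trans ltr01).
have k0 : 0 < k%:R :> R by rewrite -(pmulr_lgt0 _ c0).
set t := (y / (k%:R * c)) ^+ n.
have t01 : 0 <= t <= 1.
  have q0 : 0 <= y / (k%:R * c) by rewrite divr_ge0 // ltW.
  rewrite /t exprn_ge0 //= exprn_ile1 //.
  by rewrite ler_pdivrMr // mul1r (le_trans y1).
have Nt : (k ^ n)%:R * t = (y / c) ^+ n.
  by rewrite /t natrX -exprMn; congr (_ ^+ n); field; rewrite !gt_eqF.
have /andP[t0 t1] := t01.
have s01 : 0 <= stone k n c y <= 1.
  rewrite /stone -/t exprn_ge0 ?subr_ge0 //= exprn_ile1 ?subr_ge0 //.
  by rewrite lerBlDr lerDl.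
split=> //; first by rewrite -Nt; exact: bernoulli_sub.
have /andP[s0 s1] := s01.
apply: (@le_trans _ _ (stone k n c y * (1 + t) ^+ (k ^ n))).
  rewrite ler_wpM2l // -Nt; apply: le_trans (bernoulli_add _ t0).
  by rewrite lerDr.
rewrite /stone -/t -exprMn exprn_ile1 //.
  by rewrite mulr_ge0 ?subr_ge0 // addr_ge0.
have : 0 <= t * t by rewrite mulr_ge0.
lra.
Qed.

Lemma cvg_exprS r : 0 <= r -> r < 1 -> r ^+ n.+1 @[n --> \oo] --> (0 : R).
Proof.
move=> r0 r1; rewrite (cvg_shiftS (fun n => r ^+ n : R)).
by apply: cvg_expr; rewrite ger0_norm.
Qed.

Lemma cvg_stone_lt k c y : 0 < c -> 0 <= y <= 1 -> 1 <= k%:R * c -> y < c ->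
  stone k n.+1 c y @[n --> \oo] --> (1 : R).
Proof.
move=> c0 y01 kc yc; have /andP[y0 _] := y01.
apply: (@squeeze_cvgr _ _ _ _ (fun n => 1 - (y / c) ^+ n.+1) (fun=> 1)).
- apply: nearW => n; have [/andP[_ s1] l _] := @stone_bounds k n.+1 c y c0 y01 kc.
  by rewrite l s1.
- rewrite -[X in _ --> X](subr0 1); apply: cvgB; first exact: cvg_cst.
  apply: cvg_exprS; first by rewrite divr_ge0 // ltW.
  by rewrite ltr_pdivrMr // mul1r.
- exact: cvg_cst.
Qed.

Lemma cvg_stone_gt k c y : 0 < c -> 0 <= y <= 1 -> 1 <= k%:R * c -> c < y ->
  stone k n.+1 c y @[n --> \oo] --> (0 : R).
Proof.
move=> c0 y01 kc yc; have y0 : 0 < y := lt_trans c0 yc.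
apply: (@squeeze_cvgr _ _ _ _ (fun=> 0) (fun n => (c / y) ^+ n.+1)).
- apply: nearW => n; have [/andP[-> _] _ l] := @stone_bounds k n.+1 c y c0 y01 kc.
  have e0 : 0 < (y / c) ^+ n.+1 by rewrite exprn_gt0 // divr_gt0.
  by rewrite -(invf_div y c) exprVn -[leRHS]mul1r ler_pdivlMr.
- exact: cvg_cst.
- apply: cvg_exprS; first by rewrite divr_ge0 // ltW.
  by rewrite ltr_pdivrMr // mul1r.
Qed.

(** The domination for [Q_interval]. For y >= c2 the difference of two numbers of [0,1] is at most
    1; for y < c2 both values are within (y/c2)^(n+1), hence within y/c2, of 1. *)
Lemma stone_diff_le k n c1 c2 y : 0 < c2 -> c2 < c1 -> 0 <= y <= 1 ->
  1 <= k%:R * c2 -> `|stone k n.+1 c1 y - stone k n.+1 c2 y| <= y / c2.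
Proof.
move=> c20 c21 y01 kc2; have c10 := lt_trans c20 c21.
have k0 : 0 <= k%:R :> R by [].
have kc1 : 1 <= k%:R * c1 by rewrite (le_trans kc2) // ler_wpM2l // ltW.
have [/andP[a0 a1] la _] := @stone_bounds k n.+1 c1 y c10 y01 kc1.
have [/andP[b0 b1] lb _] := @stone_bounds k n.+1 c2 y c20 y01 kc2.
have /andP[y0 y1] := y01.
have [yc|cy] := ltP y c2; last first.
  apply: (@le_trans _ _ 1); first by rewrite ler_norml; lra.
  by rewrite ler_pdivlMr // mul1r.
have q0 : 0 <= y / c2 by rewrite divr_ge0 // ltW.
have q1 : y / c2 <= 1 by rewrite ltW // ltr_pdivrMr // mul1r.
have e2 : (y / c2) ^+ n.+1 <= y / c2.
  by rewrite exprS ler_piMr // exprn_ile1.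
have e1 : (y / c1) ^+ n.+1 <= (y / c2) ^+ n.+1.
  rewrite lerXn2r ?nnegrE ?divr_ge0 ?(ltW c10) ?(ltW c20) //.
  by rewrite ler_wpM2l // lef_pV2 ?posrE // ltW.
rewrite ler_norml; lra.
Qed.

End StoneBounds.

(** * From exponentials to indicators on the positive half-line *)

Section HalfLineApproximation.
Variables (R : realType) (Q Dom : (R -> R) -> Prop).
Local Notation mu := (@lebesgue_measure R).
Implicit Types (f : R -> R) (t c : R).

Definition hexp (j : nat) t : R := if 0 < t then expR (- (j%:R * t)) else 0.

(** [Q] abstracts a linear class closed under dominated limits almost everywhere, and [Dom] the
    functions allowed as dominants. The abstraction serves both half-lines, the negative one by
    reflection. *)
Hypothesis QD : forall f g, Q f -> Q g -> Q (fun t => f t + g t).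
Hypothesis QZ : forall c f, Q f -> Q (fun t => c * f t).
Hypothesis Qlim : forall (F : nat -> R -> R) f G,
  (forall n, Q (F n)) -> (forall n, measurable_fun setT (F n)) ->
  measurable_fun setT f -> measurable_fun setT G -> Dom G ->
  (forall n t, `|F n t| <= G t) ->
  {ae mu, forall t, F n t @[n --> \oo] --> f t} -> Q f.
Hypothesis Qexp : forall j, Q (hexp j.+1).
Hypothesis Dexp : forall c, 0 <= c -> Dom (fun t => c * hexp 1 t).

Lemma hexpS j t : hexp j.+1 t = hexp 1 t * expR (- t) ^+ j.
Proof.
rewrite /hexp; case: ifP => _; last by rewrite mul0r.
rewrite mul1r -expRM_natr -expRD; congr expR; rewrite -natr1; ring.
Qed.

Lemma Q_poly (p : {poly R}) : Q (fun t => hexp 1 t * p.[expR (- t)]).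
Proof.
rewrite (_ : (fun t => _) = fun t => \sum_(i < size p) p`_i * hexp i.+1 t); last first.
  apply/funext => t; rewrite horner_coef mulr_sumr; apply: eq_bigr => i _.
  by rewrite [in RHS]hexpS mulrCA.
elim: (size p) => [|n IH].
  rewrite (_ : (fun t => _) = fun t => 0 * hexp 1 t); first exact/QZ/Qexp.
  by apply/funext => t; rewrite big_ord0 mul0r.
under eq_fun do rewrite big_ord_recr.
by apply: QD => //; apply: QZ; exact: Qexp.
Qed.

Definition stonep k n c : {poly R} :=
  (1 - ((k%:R * c)^-1 ^+ n.+1) *: ('X ^+ n.+1)) ^+ (k ^ n.+1).

Lemma horner_stonep k n c y : (stonep k n c).[y] = stone k n.+1 c y.
Proof. by rewrite /stonep /stone !hornerE exprMn mulrC. Qed.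

(** Both polynomials take the value 1 at y = 0, so their difference is divisible by y = e^{-t} and
    is a combination of decaying exponentials. *)
Lemma Q_stone k n c1 c2 : Q (fun t => if 0 < t then
  stone k n.+1 c1 (expR (- t)) - stone k n.+1 c2 (expR (- t)) else 0).
Proof.
have : root (stonep k n c1 - stonep k n c2) 0.
  by rewrite rootE hornerD hornerN !horner_stonep /stone !mul0r !expr0n /= subr0
    !expr1n subrr.
move=> /factor_theorem[p pE].
rewrite (_ : (fun t => _) = fun t => hexp 1 t * p.[expR (- t)]); first exact: Q_poly.
apply/funext => t; rewrite /hexp; case: ifP => _; last by rewrite mul0r.
by rewrite -!horner_stonep -hornerN -hornerD pE hornerM hornerXsubC subr0
  mul1r mulrC.
Qed.

Lemma measurable_expRN : measurable_fun setT (fun t : R => expR (- t)).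
Proof.
apply: (measurableT_comp (continuous_measurable_fun (@continuous_expR R))).
exact: oppr_measurable.
Qed.

Lemma measurable_gt0 : measurable_fun setT (fun t : R => 0 < t).
Proof. by apply: measurable_fun_ltr => //; exact: measurable_id. Qed.

Lemma measurable_hexp : measurable_fun setT (hexp 1).
Proof.
rewrite /hexp; under eq_fun do rewrite mul1r.
by apply: measurable_fun_ifT => //; [exact: measurable_gt0|exact: measurable_expRN].
Qed.

Lemma expRN_bounds t : 0 < t -> 0 <= expR (- t) <= 1.
Proof. by move=> t0; rewrite expR_ge0 /= expR_le1 oppr_le0 ltW. Qed.

Lemma ae_neq (c : R) : {ae mu, forall t : R, t != c}.
Proof.
exists [set c]; split; [exact: measurable_set1|exact: lebesgue_measure_set1|].
by move=> t /= /negP/negPn/eqP.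
Qed.

(** The step functions in y = e^{-t} with thresholds e^{-a} and e^{-b} tend to the indicators of t >
    a and t > b, except at the thresholds; their difference is dominated by e^b e^{-t}. *)
Lemma Q_interval a b : 0 <= a -> a < b -> Q (\1_`]a, b[ : R -> R).
Proof.
move=> a0 ab; pose c1 := expR (- a); pose c2 := expR (- b).
have c20 : 0 < c2 by exact: expR_gt0.
have c21 : c2 < c1 by rewrite ltr_expR ltrN2.
have [k kc2] : exists k : nat, 1 <= k%:R * c2.
  exists (Num.bound c2^-1); rewrite -ler_pdivrMr // div1r ltW //.
  by apply: archi_boundP; rewrite invr_ge0 ltW.
have kc1 : 1 <= k%:R * c1 by rewrite (le_trans kc2) // ler_wpM2l // ltW.
have c10 := lt_trans c20 c21.
apply: (@Qlim (fun n t => if 0 < t then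
  stone k n.+1 c1 (expR (- t)) - stone k n.+1 c2 (expR (- t)) else 0) _
  (fun t => c2^-1 * hexp 1 t)).
- by move=> n; exact: Q_stone.
- have ms n c : measurable_fun setT (fun t : R => stone k n.+1 c (expR (- t))).
    apply: (measurableT_comp (exprn_measurable _)).
    apply: measurable_funB => //; apply: measurable_funX.
    by apply: measurable_funM => //; exact: measurable_expRN.
  move=> n; apply: measurable_fun_ifT => //; first exact: measurable_gt0.
  exact: measurable_funB.
- exact: measurable_indic.
- by apply: measurable_funM => //; exact: measurable_hexp.
- by apply: Dexp; rewrite invr_ge0 ltW.
- move=> n t; rewrite /hexp; case: ltP => t0; last by rewrite normr0 mulr0.
  by rewrite mul1r mulrC; exact: stone_diff_le c20 c21 (expRN_bounds t0) kc2.
apply: ae_imply2 (ae_neq a) (ae_neq b) => t ta tb.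
rewrite indicE.
case: ltP => t0; last first.
  rewrite memNset ?(leNgt, t0) /=; first exact: cvg_cst.
  by rewrite in_itv /= => /andP[at_ _]; move: (le_lt_trans a0 at_); rewrite ltNge t0.
have y01 := expRN_bounds t0.
have L (c d : R) : 0 < c -> 1 <= k%:R * c -> c = expR (- d) -> t != d ->
    stone k n.+1 c (expR (- t)) @[n --> \oo] --> ((d < t)%R%:R : R).
  move=> c0 kc cE; rewrite neq_lt => /orP[td|dt].
    rewrite ltNge (ltW td) /=; apply: cvg_stone_gt => //.
    by rewrite cE ltr_expR ltrN2.
  by rewrite dt; apply: cvg_stone_lt => //; rewrite cE ltr_expR ltrN2.
suff <- : (a < t)%R%:R - (b < t)%R%:R = (t \in (`]a, b[%classic : set R))%:R :> R.
  exact: cvgB (L c1 a c10 kc1 erefl ta) (L c2 b c20 kc2 erefl tb).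
case: (ltP a t) => at_; case: (ltP b t) => bt.
- by rewrite subrr memNset //= in_itv /= at_ ltNge (ltW bt).
- by rewrite subr0 mem_set //= in_itv /= at_ lt_neqAle tb.
- by move: (lt_trans ab bt); rewrite ltNge at_.
- by rewrite subrr memNset //= in_itv /= ltNge at_.
Qed.

Local Notation J E n := (\1_(E `&` `]0, n%:R[) : R -> R).

Lemma Dom_bound n t (E : set R) : `|J E n t| <= expR n%:R * hexp 1 t.
Proof.
rewrite indicE; case: (boolP (t \in _)) => [|_]; last first.
  by rewrite normr0 mulr_ge0 ?expR_ge0 // /hexp; case: ifP => // _; exact: expR_ge0.
rewrite in_setE => -[_] /=; rewrite in_itv /= => /andP[t0 tn].
rewrite /hexp t0 /= mul1r -expRD normr1.
by apply: le_trans (expR_ge1Dx _); rewrite lerDl subr_ge0 ltW.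
Qed.

Lemma Q0 : Q (fun=> 0).
Proof.
rewrite (_ : (fun=> 0) = fun t => 0 * hexp 1 t); first exact/QZ/Qexp.
by apply/funext => t; rewrite mul0r.
Qed.

Lemma Q_cvg_indic (E : nat -> set R) (F : set R) (n : nat) :
  (forall m, measurable (E m)) -> measurable F ->
  (forall m, Q (J (E m) n)) ->
  (forall t, \forall m \near \oo, (t \in E m) = (t \in F)) -> Q (J F n).
Proof.
move=> mE mF QE EF; have mI : measurable (`]0, n%:R[ : set R) by [].
apply: (@Qlim (fun m => J (E m) n) _ (fun t => expR n%:R * hexp 1 t)) => //.
- by move=> m; exact: measurable_indic (measurableI _ _ (mE m) mI).
- exact: measurable_indic (measurableI _ _ mF mI).
- by apply: measurable_funM => //; exact: measurable_hexp.
- by apply: Dexp; exact: expR_ge0.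
- by move=> m t; exact: Dom_bound.
apply/aeW => t; apply: cvg_near_cst; have [N _ NP] := EF t; exists N => // m Nm.
by rewrite !indicE !in_setI NP.
Qed.

(** A pi-lambda argument from the rays ]x, +oo[, inside the bounded interval ]0, n[, where e^n
    e^{-t} dominates every indicator. *)
Lemma Q_borel (E : set R) : measurable E -> forall n, Q (J E n).
Proof.
pose H := [set E : set R | measurable E /\ forall n, Q (J E n)].
suff HP : <<s @RGenOInfty.G R >> `<=` H.
  move=> mE; suff [] : H E by [].
  apply: HP; have : (@ocitv R).-sigma.-measurable E by exact: mE.
  by rewrite RGenOInfty.measurableE.
apply: lambda_system_subset => //.
- move=> _ _ [x ->] [y ->]; exists (Num.max x y).
  apply/seteqP; split=> t /=; rewrite !in_itv /= !andbT gt_max.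
    by move=> [-> ->].
  by move=> /andP[].
- split=> //.
  + split=> // n; rewrite setTI.
    have [->|n0] := posnP n; last by apply: Q_interval; rewrite // ltr0n.
    rewrite (_ : \1__ = fun=> 0); first exact: Q0.
    by apply/funext => t; rewrite set_itvoo0 indic0.
  + move=> {}E F FE [mE QE] [mF QF]; split; first exact: measurableD.
    move=> n; rewrite (_ : \1__ = fun t => J E n t + (-1) * J F n t).
      by apply: QD => //; exact: QZ.
    apply/funext => t; rewrite !indicE !in_setI.
    have [tF|tF] := pselect (F t).
      rewrite (@memNset _ (fun x => ~ F x) t); last by apply.
      by rewrite (mem_set tF) (mem_set (FE _ tF)) /= mulN1r subrr.
    by rewrite (@mem_set _ (fun x => ~ F x) t tF) (memNset tF) andbT mulr0 addr0.
  + move=> {}E ndE HE; have mE m : measurable (E m) by have [] := HE m.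
    split=> [|n]; first exact: bigcup_measurable.
    apply: (Q_cvg_indic mE) => [|m|t]; first exact: bigcup_measurable.
      by have [_] := HE m.
    case: (boolP (t \in \bigcup_i E i)) => tE; last first.
      apply: nearW => m; apply: contraNF tE; rewrite !in_setE => tEm.
      by exists m.
    move: tE; rewrite in_setE => -[N _ tN]; exists N => // m /= Nm.
    by apply: mem_set; move: tN; apply/subsetPset/ndE.
- move=> _ [x ->]; split=> // n.
  have [nx|xn] := leP (n%:R : R) (Num.max x 0).
    rewrite (_ : \1__ = fun=> 0); first exact: Q0.
    apply/funext => t; rewrite indicE memNset // => -[] /=.
    rewrite !in_itv /= andbT => xt /andP[t0 tn].
    by move: (lt_le_trans tn nx); rewrite lt_max !ltNge (ltW xt) (ltW t0).
  rewrite (_ : _ `&` _ = `]Num.max x 0, n%:R[%classic).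
    by apply: Q_interval => //; rewrite le_max lexx orbT.
  apply/seteqP; split=> t /=; rewrite !in_itv /= andbT gt_max.
    by move=> [-> /andP[-> ->]].
  by move=> /andP[/andP[-> ->] ->].
Qed.

(** The bounded truncations increase to the indicator, which is its own dominant. *)
Lemma Q_half_line (E : set R) : measurable E ->
  Dom (\1_(E `&` [set t | 0 < t])) -> Q (\1_(E `&` [set t | 0 < t])).
Proof.
move=> mE DE; have mI (n : nat) : measurable (`]0, n%:R[ : set R) by [].
have mP : measurable [set t : R | 0 < t].
  by rewrite (_ : mkset _ = `]0, +oo[%classic) // set_itvE.
have mEP := measurableI _ _ mE mP.
apply: (@Qlim (fun n => J E n) _ (\1_(E `&` [set t | 0 < t]))) => //.
- exact: Q_borel.
- by move=> n; exact: measurable_indic (measurableI _ _ mE (mI n)).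
- move=> n t; rewrite ger0_norm ?indicE ?ler0n // ler_nat.
  case: (boolP (t \in E `&` _)) => //; rewrite in_setE => -[tE] /=.
  rewrite in_itv /= => /andP[t0 _]; by rewrite mem_set.
apply/aeW => t; apply: cvg_near_cst.
exists (Num.bound t) => // n /= tn; rewrite !indicE !in_setI; congr (_%:R).
congr (_ && _); case: (ltP 0 t) => t0.
  rewrite !mem_set //= in_itv /= t0 /=.
  apply: lt_le_trans (archi_boundP (ltW t0)) _; by rewrite ler_nat.
by rewrite !memNset //= ?in_itv /= ltNge t0.
Qed.

End HalfLineApproximation.

(** * Density of the span of exponentials in the vector-valued space *)

Section ExponentialDensity.
Variables (R : realType) (D : algWeight R) (A : banachAlgType R[i]).
Hypothesis subexp : forall s : R, 0 < s ->
  (snorm D (fun t => expR (- (s * `|t|))%R) < +oo)%E.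
Local Notation mu := (@lebesgue_measure R).
Local Notation lspace := (lspace D A).
Local Notation vnorm := (Lpnorm D).
Implicit Types (a b : A) (x y : lspace) (t : R) (phi : R -> R).

Variable P : lspace -> Prop.
(** [P] is an additive property, closed in norm, that holds on all exponentials of integer rate; it
    is shown to hold everywhere. *)
Hypothesis PD : forall x y, P x -> P y -> P (x + y).
Hypothesis Plim : forall x,
  (forall e : R, 0 < e -> exists2 y, P y & lnorm (x - y) <= e) -> P x.
Hypothesis PE : forall j a, P (right_exp D j.+1%:R a).
Hypothesis PM : forall j a, P (left_exp D j.+1%:R a).

Definition Pscalar phi := forall a, Lpfun D (fun t => (phi t)%:C *: a) /\ P (lsc D phi a).

Lemma toLD (f g : R -> A) : Lpfun D f -> Lpfun D g -> Lpfun D (fun t => f t + g t) ->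
  toL D (fun t => f t + g t) = toL D f + toL D g.
Proof.
move=> Lf Lg Lfg; apply: lspace_eq; apply: (ae_mp (toLE Lfg)).
apply: (ae_mp (lspaceDE (toL D f) (toL D g))).
apply: (ae_mp (toLE Lf)); apply: (ae_mp (toLE Lg)).
by apply: ae_of_forall => t h1 h2 h3 h4; rewrite h4 h3 h2 h1.
Qed.

Lemma Lpfun_sum (f g : R -> A) : Lpfun D f -> Lpfun D g -> Lpfun D (fun t => f t + g t).
Proof.
move=> Lf Lg; have [m n] := Lpfun_add (toL D f) (toL D g).
have E : {ae mu, forall t, toL D f t + toL D g t = f t + g t}.
  by apply: ae_imply2 (toLE Lf) (toLE Lg) => t -> ->.
by split; [exact: strongly_measurable_ae_eq E m|rewrite -(vnorm_ae D E)].
Qed.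

Lemma PscalarD phi psi : Pscalar phi -> Pscalar psi -> Pscalar (fun t => phi t + psi t).
Proof.
move=> hf hg a; have [Lf Pf] := hf a; have [Lg Pg] := hg a.
have E : (fun t => (phi t + psi t)%:C *: a) =
    fun t => (phi t)%:C *: a + (psi t)%:C *: a.
  by apply/funext => t; rewrite rmorphD scalerDl.
have L := Lpfun_sum Lf Lg; split; first by rewrite E.
by rewrite /lsc E toLD //; exact: PD.
Qed.

Lemma PscalarZ c phi : Pscalar phi -> Pscalar (fun t => c * phi t).
Proof.
move=> hf a; have := hf (c%:C *: a); rewrite /lsc.
suff -> : (fun t => (phi t)%:C *: (c%:C *: a)) = fun t => (c * phi t)%:C *: a by [].
by apply/funext => t; rewrite scalerA -rmorphM mulrC.
Qed.

Lemma snorm_dominated_small (h : nat -> R -> R) (G : R -> R) (e : R) :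
  (forall n, measurable_fun setT (h n)) -> measurable_fun setT G ->
  (forall n t, 0 <= h n t <= G t) -> (snorm D G < +oo)%E ->
  {ae mu, forall t, h n t @[n --> \oo] --> (0 : R)} -> 0 < e ->
  exists n, (snorm D (h n) <= e%:E)%E.
Proof.
move=> mh mG hG fG h0 e0.
have p0 := aw_p_gt0 D; have e1 : 0 < e `^ (aw_p D) by rewrite powR_gt0.
have C : wpow D (h n) @[n --> \oo] --> 0%E.
  apply: (@dominated_cvg0 _ (fun n t => h n t `^ aw_p D * aw_w D t `^ aw_p D)
    (fun t => G t `^ aw_p D * aw_w D t `^ aw_p D)).
  - by move=> n; exact: measurable_wpow.
  - exact: measurable_wpow.
  - move=> n t; have /andP[hn0 hnG] := hG n t.
    by rewrite wpow_integrand_ge0 ler_wpM2r ?powR_ge0 // ler_powR_base // ltW.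
  - exact: ((snorm_lty D G).1 fG).
  - apply: ae_imply h0 => t ht.
    rewrite -(mul0r (aw_w D t `^ aw_p D)); apply: cvgMl.
    rewrite -(powR0 (lt0r_neq0 p0)).
    apply/cvgrPdist_lt => d d0.
    have d1 : 0 < d `^ (aw_p D)^-1 by rewrite powR_gt0.
    move/cvgrPdist_lt : ht => /(_ _ d1); apply: filterS => n.
    have /andP[hn0 _] := hG n t.
    rewrite powR0 ?lt0r_neq0 // !sub0r !normrN ger0_norm // ger0_norm ?powR_ge0 //.
    move=> hnd; rewrite -[ltRHS](powRr1 (ltW d0)) -(mulVf (lt0r_neq0 p0)) powRrM.
    by apply: gt0_ltr_powR => //; rewrite ?nnegrE ?powR_ge0.
have [N _ NP] := (ecvg0P (fun n => wpow_ge0 D (h n))).1 C _ e1.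
exists N; have /ltW lN := NP N (leqnn N); rewrite snormE.
have -> : e%:E = ((e `^ (aw_p D))%:E `^ (aw_p D)^-1)%E.
  by rewrite poweR_EFin -powRrM mulfV ?aw_p_neq0 // powRr1 // ltW.
apply: gt0_ler_poweR => //.
- by rewrite invr_ge0 ltW // aw_p_gt0.
- by rewrite in_itv /= leey wpow_ge0.
- by rewrite in_itv /= leey lee_fin ltW.
Qed.

Lemma Pscalar_lim (F : nat -> R -> R) (f G : R -> R) :
  (forall n, Pscalar (F n)) -> (forall n, measurable_fun setT (F n)) ->
  measurable_fun setT f -> measurable_fun setT G -> (snorm D G < +oo)%E ->
  (forall n t, `|F n t| <= G t) ->
  {ae mu, forall t, F n t @[n --> \oo] --> f t} -> Pscalar f.
Proof.
move=> PF mF mf mG fG FG Ff a.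
have G0 t : 0 <= G t := le_trans (normr_ge0 _) (FG 0%N t).
have fG_ae : {ae mu, forall t, `|f t| <= G t}.
  apply: ae_imply Ff => t /cvg_norm ft.
  rewrite -(cvg_lim (@Rhausdorff R) ft); apply: limr_le; first exact: cvgP ft.
  by apply: nearW => n; exact: FG.
have Lf : Lpfun D (fun t => (f t)%:C *: a).
  apply: Lpfun_smeas; first exact: smeas_scalar.
  apply: (@le_lt_trans _ _ (snorm D (fun t => rnorm a * G t)%R)).
    apply: vnorm_le; apply: ae_imply fG_ae => t ft.
    by rewrite rnormZ normc_real mulrC ler_wpM2l ?rnorm_ge0.
  rewrite snormZ ?rnorm_ge0 //; move: fG; case: (snorm D G) (snorm_ge0 D G) => //.
  by move=> r _ _; rewrite -EFinM ltry.
split=> //; apply: Plim => e e0.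
(* The limit f is bounded by G only almost everywhere. The truncation makes the domination hold at
   every point without changing the error almost everywhere. *)
pose h n t := Num.min `|F n t - f t| (2 * G t).
have c0 : 0 < rnorm a + 1 by rewrite ltr_wpDl ?rnorm_ge0.
have [||||||n hn] := @snorm_dominated_small h (fun t => 2 * G t) (e / (rnorm a + 1)).
- move=> n; apply: measurable_minr; last exact: measurable_funM.
  apply: measurableT_comp; first exact: normr_measurable.
  exact: measurable_funB.
- exact: measurable_funM.
- by move=> n t; rewrite le_min normr_ge0 mulr_ge0 //= ge_min lexx orbT.
- rewrite snormZ //; move: fG; case: (snorm D G) (snorm_ge0 D G) => //.
  by move=> r _ _; rewrite -EFinM ltry.
- apply: ae_imply Ff => t ft.
  apply: (@squeeze_cvgr _ _ _ _ (fun=> 0) (fun n => `|F n t - f t|)).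
  + by apply: nearW => n; rewrite le_min normr_ge0 mulr_ge0 //= ge_min lexx.
  + exact: cvg_cst.
  + rewrite -(normr0 R) -(subrr (f t)); apply: cvg_norm; apply: cvgB => //.
    exact: cvg_cst.
- by rewrite divr_gt0.
exists (lsc D (F n) a); first by have [] := PF n a.
rewrite -lee_fin -vnormE.
apply: (@le_trans _ _ (snorm D (fun t => rnorm a * h n t)%R)).
  apply: vnorm_le; apply: (ae_mp (lspaceBE (lsc D f a) (lsc D (F n) a))).
  apply: (ae_mp (toLE Lf)); apply: (ae_mp (toLE (PF n a).1)).
  apply: ae_imply fG_ae => t fGt h1 h2 h3.
  rewrite h3 [lsc _ _ _ _]h2 [X in _ - X]h1 -scalerBl -rmorphB rnormZ normc_real mulrC.
  rewrite ler_wpM2l ?rnorm_ge0 // /h distrC le_min lexx /=.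
  by apply: le_trans (ler_normB _ _) _; rewrite mulr2n mulrDl mul1r lerD.
rewrite snormZ ?rnorm_ge0 //; first last.
- by move=> t; rewrite le_min normr_ge0 mulr_ge0.
- apply: measurable_minr; last exact: measurable_funM.
  apply: measurableT_comp; first exact: normr_measurable.
  exact: measurable_funB.
apply: (@le_trans _ _ ((rnorm a)%:E * (e / (rnorm a + 1))%:E)%E).
  by rewrite lee_wpmul2l // lee_fin rnorm_ge0.
rewrite -EFinM lee_fin mulrCA -[leRHS]mulr1 ler_pM2l //.
by rewrite ler_pdivrMr // mul1r lerDl.
Qed.

Lemma complex_nat (j : nat) : j%:R = (j%:R : R)%:C :> R[i].
Proof. by rewrite rmorph_nat. Qed.

Lemma hexp_ex (j : nat) t : (hexp j t)%:C = half_exp j%:R t :> R[i].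
Proof.
rewrite /hexp /half_exp complex_nat; case: ifP => // _; rewrite cexp_real /= oppr0.
by rewrite mul0r cos0 sin0 mulr0 mulr1 mulNr.
Qed.

Lemma Re_natS (j : nat) : 0 < complex.Re (j.+1%:R : R[i]).
Proof. by rewrite complex_nat /= ltr0n. Qed.

Lemma snorm_hexp (c : R) : 0 <= c -> (snorm D (fun t => c * hexp 1 t)%R < +oo)%E.
Proof.
move=> c0; have h0 t : 0 <= hexp 1 t :> R.
  by rewrite /hexp; case: ifP => // _; exact: expR_ge0.
rewrite snormZ //; last exact: measurable_hexp.
have : (snorm D (hexp 1) < +oo)%E.
  apply: le_lt_trans (subexp ltr01); apply: snorm_ae_le; apply: ae_of_forall => t.
  rewrite h0 /= /hexp; case: ltP => t0; last exact: expR_ge0.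
  by rewrite gtr0_norm.
by case: (snorm D (hexp 1)) (snorm_ge0 D (hexp 1)) => // r _ _; rewrite -EFinM ltry.
Qed.

Lemma Pscalar_half_line (E : set R) : measurable E ->
  (snorm D (\1_(E `&` [set t : R | (0 < t)%R]) : R -> R) < +oo)%E ->
  Pscalar (\1_(E `&` [set t : R | (0 < t)%R])).
Proof.
apply: (@Q_half_line _ Pscalar (fun G => (snorm D G < +oo)%E)).
- exact: PscalarD.
- exact: PscalarZ.
- move=> F f G; exact: Pscalar_lim.
- move=> j a; rewrite /lsc; under eq_fun do rewrite hexp_ex.
  by split; [exact: Lpfun_ex (Re_natS j)|exact: PE].
- exact: snorm_hexp.
Qed.

Lemma ae_opp (S : R -> Prop) : {ae mu, forall t, S t} -> {ae mu, forall t, S (- t)}.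
Proof. by move=> /(ae_reflection 0); apply: ae_imply => t; rewrite sub0r. Qed.

Lemma Pscalar_half_line_neg (E : set R) : measurable E ->
  (snorm D (fun t => \1_(E `&` [set t : R | (0 < t)%R]) (- t)%R : R) < +oo)%E ->
  Pscalar (fun t => \1_(E `&` [set t : R | (0 < t)%R]) (- t)).
Proof.
have mN (f : R -> R) : measurable_fun setT f -> measurable_fun setT (fun t => f (- t)).
  by move=> mf; apply: (measurableT_comp mf); exact: oppr_measurable.
apply: (@Q_half_line _ (fun f => Pscalar (fun t => f (- t)))
  (fun G => (snorm D (fun t => G (- t)%R) < +oo)%E)).
- by move=> f g Pf Pg; exact: PscalarD.
- by move=> c f Pf; exact: PscalarZ.
- move=> F f G PF mF mf mG fG FG Ff.
  apply: (@Pscalar_lim (fun n t => F n (- t)) _ (fun t => G (- t))) => //.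
  + by move=> n; exact: mN.
  + exact: mN.
  + exact: mN.
  + exact: ae_opp Ff.
- move=> j a; rewrite /lsc; under eq_fun do rewrite hexp_ex.
  by split; [exact: Lpfun_ex_neg (Re_natS j)|exact: PM].
- move=> c c0; have h0 t : 0 <= hexp 1 t :> R.
    by rewrite /hexp; case: ifP => // _; exact: expR_ge0.
  rewrite snormZ //; last by apply: mN; exact: measurable_hexp.
  have : (snorm D (fun t => hexp 1 (- t)%R) < +oo)%E.
    apply: le_lt_trans (subexp ltr01); apply: snorm_ae_le; apply: ae_of_forall => t.
    rewrite h0 /= /hexp; case: ltP => t0; last exact: expR_ge0.
    by rewrite -(normrN t) gtr0_norm.
  case: (snorm _ _) (snorm_ge0 D (fun t => hexp 1 (- t))) => // r _ _.
  by rewrite -EFinM ltry.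
Qed.

Lemma P_zero : P 0.
Proof.
suff <- : right_exp D 1 (0 : A) = 0 by exact: (PE 0 0).
rewrite /right_exp -[RHS](@lsc0 R D A (fun=> 0)) /lsc; congr toL; apply/funext => t.
by rewrite !scaler0.
Qed.

(** E is cut at 0, a null set: its positive part is approximated by right exponentials, and its
    negative part, reflected, by left ones. *)
Lemma P_lind (E : set R) a : measurable E ->
  Lpfun D (fun t => (\1_E t)%:C *: a) -> P (lind D E a).
Proof.
move=> mE fE; have [->|hE] := lind_cases mE fE; first exact: P_zero.
have mN : measurable [set t : R | E (- t)].
  rewrite -[X in measurable X]setTI; exact: (@oppr_measurable R setT measurableT E mE).
have I0 (F : set R) t : 0 <= \1_F t :> R by rewrite indicE.
have sub (F : set R) (k : R -> R) : (forall t, F (k t) -> E t) ->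
    (snorm D (fun t => \1_F (k t) : R) < +oo)%E.
  move=> FE; have [_ _ fin] := hE; apply: le_lt_trans fin; apply: snorm_ae_le.
  apply: ae_of_forall => t; rewrite I0 /= !indicE ler_nat.
  by case: (boolP (k t \in F)) => //; rewrite in_setE => /FE tE; rewrite mem_set.
have P1 := Pscalar_half_line mE (sub _ id (fun t => @proj1 _ _)).
have h2 t : ([set t | E (- t)] `&` [set t : R | (0 < t)%R]) (- t) -> E t.
  by move=> [/=]; rewrite opprK.
have P2 := Pscalar_half_line_neg mN (sub _ (fun t => - t) h2).
have [[L1 Q1] [L2 Q2]] := (P1 a, P2 a).
suff -> : lind D E a = lsc D (\1_(E `&` [set t : R | (0 < t)%R])) a +
    lsc D (fun t => \1_([set t | E (- t)] `&` [set t : R | (0 < t)%R]) (- t)) a by exact: PD.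
apply: lspace_eq; apply: (ae_mp (toLE fE)).
apply: (ae_mp (lspaceDE (lsc D (\1_(E `&` [set t : R | (0 < t)%R])) a)
  (lsc D (fun t => \1_([set t | E (- t)] `&` [set t : R | (0 < t)%R]) (- t)) a))).
apply: (ae_mp (toLE L1)); apply: (ae_mp (toLE L2)); apply: (ae_mp (@ae_neq0 R)).
apply: ae_of_forall => t t0 h3 h4 h5 h6; rewrite h6 h5 [X in X + _]h4 [X in _ + X]h3.
rewrite -scalerDl -rmorphD; congr (_%:C *: a); rewrite !indicE.
have E1 : (t \in E `&` [set t : R | (0 < t)%R]) = (t \in E) && (0 < t).
  by rewrite in_setI; congr (_ && _); apply/idP/idP; rewrite in_setE.
have E2 : (- t \in [set t | E (- t)] `&` [set t : R | (0 < t)%R]) = (t \in E) && (t < 0).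
  rewrite in_setI; congr (_ && _); apply/idP/idP; rewrite !in_setE /= ?opprK //.
    by rewrite oppr_gt0.
  by rewrite oppr_gt0.
rewrite E1 E2; case: (t \in E) => //=; last by rewrite addr0.
by move: t0; case: (ltgtP t 0) => // _ _; rewrite ?add0r ?addr0.
Qed.

Lemma exponential_density x : P x.
Proof.
apply: Plim => e e0; have [s si sP] := simple_dense x e0.
have ms : smeas s := simple_smeas si.1.
have mxs : smeas (fun t => x t - s t) := smeasB (lfun_smeas x) ms.
have sfin : (vnorm s < +oo)%E.
  apply: (@le_lt_trans _ _ (vnorm x + vnorm (fun t => x t - s t)%R)%E).
    apply: vnormD_le (lfun_smeas x) mxs _; apply/aeW => t.
    by rewrite -{1}(subKr (x t) (s t)) rnormB.
  by apply: lte_add_pinfty (lfun_fin x) _; exact: le_lt_trans sP (ltry _).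
exists (toL D s).
  apply: (@simple_ind _ D _ (fun f => P (toL D f)) _ _ s si.1 sfin) => [E a mE fE|].
    by apply: P_lind => //; apply: Lpfun_smeas => //; exact/simple_smeas/simple_indic.
  move=> f g mf mg ff gf Pf Pg.
  have Lf := Lpfun_smeas mf ff; have Lg := Lpfun_smeas mg gf.
  by rewrite (toLD Lf Lg (Lpfun_sum Lf Lg)); exact: PD.
rewrite -lee_fin -vnormE (@vnorm_ae _ D _ _ (fun t => x t - s t)) //.
apply: (ae_mp (lspaceBE x (toL D s))); apply: (ae_mp (toLE (Lpfun_smeas ms sfin))).
by apply/aeW => t h1 h2; rewrite h2 h1.
Qed.

End ExponentialDensity.

(** * Local inverses *)

Section SubexponentialWeight.
Variables (R : realType) (D : algWeight R) (A : banachAlgType R[i]).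
Hypothesis subexp : forall s : R, 0 < s ->
  (snorm D (fun t => expR (- (s * `|t|))%R) < +oo)%E.
Local Notation lspace := (lspace D A).
Local Notation unz := (unz D A).
Local Notation uiota := (unz_scalar D A).
Local Notation U := (unit_exp D A).
Local Notation W := (exp_resolvent D A).
Local Notation unorm := (@unz_norm R D A).
Implicit Types (a b : A) (x : lspace) (c y r u : unz) (s l m k : R[i]).

Lemma mul_sub_resolvent s l : complex.Re s != 0 ->
  (U - uiota l) * (1 + uiota (1 - s) * W s) = W s - uiota l * (1 + uiota (1 - s) * W s).
Proof.
move=> s0; rewrite mulrBl [U * _]mulrDr mulr1 [U * (_ * _)]mulrA -uiotaC -mulrA.
by rewrite W_resolvent // [U + _]addrC subrK.
Qed.

(** The relation says that m is the value of 1/(s-it) where 1/(1-it) takes the value l. The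
    difference vanishes there and is divisible by U - l with an explicit quotient. *)
Lemma W_sub_scalar s l m : complex.Re s != 0 -> (1 - s) * l * m = m - l ->
  W s - uiota m =
  (U - uiota l) * ((1 + uiota (1 - s) * W s) * uiota (1 + (1 - s) * m)).
Proof.
move=> s0 lm; rewrite mulrA mul_sub_resolvent // mulrBl.
have lE : l * (1 + (1 - s) * m) = m.
  by rewrite mulrDr mulr1 mulrA [l * _]mulrC lm addrC subrK.
rewrite -(uiotaC _ (W s)) -mulrA -(uiotaC _ (1 + _)) mulrA -uiotaM lE.
rewrite uiotaD uiota1 mulrDl mul1r mulrDr mulr1 mulrA -uiotaM [m * _]mulrC.
by rewrite opprD addrACA subrr addr0.
Qed.

(** When l is nonzero and s = 1 - 1/l is off the imaginary axis, this inverts U - l up to the scalar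
    -l. *)
Lemma resolvent_inv s l : complex.Re s != 0 -> l * (1 - s) = 1 ->
  (U - uiota l) * (1 + uiota (1 - s) * W s) = - uiota l.
Proof.
move=> s0 ls; rewrite mul_sub_resolvent // mulrDr mulr1 mulrA -uiotaM ls uiota1.
by rewrite mul1r opprD addrCA subrr addr0.
Qed.

(** On transforms this is -(1+it)/(1-it), a Cayley transform from the line to the unit circle, with
    infinity corresponding to 1. *)
Definition cayley : unz := 1 - uiota 2 * U.

Lemma V_sub k : cayley - uiota k = uiota (-2) * (U - uiota ((1 - k) / 2)).
Proof.
rewrite mulrBr -uiotaM mulrCA mulNr divff ?mulrN1 ?pnatr_eq0 //.
have N2 : uiota (-2) = - uiota 2.
  by apply/eqP; rewrite -addr_eq0 -uiotaD addNr /unz_scalar scale0r.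
have Nk : uiota (- (1 - k)) = uiota k - 1.
  by rewrite opprB; apply/eqP; rewrite eq_sym subr_eq -uiota1 -uiotaD subrK.
by rewrite Nk N2 mulNr opprB addrA [- _ + _]addrC.
Qed.

Lemma V_central u : cayley * u = u * cayley.
Proof.
have E : uiota 2 * U * u = u * (uiota 2 * U).
  by rewrite -(mulrA _ U u) (unit_exp_central subexp u) !mulrA (uiotaC _ u).
by rewrite /cayley mulrBl mulrBr mul1r mulr1 E.
Qed.

Lemma unit_exp_sub_central l u : (U - uiota l) * u = u * (U - uiota l).
Proof. by rewrite mulrBl mulrBr (unit_exp_central subexp) uiotaC. Qed.

(** The map from k to 2/(1-k) takes the circle without 1 to the line Re = 1, the values of 1 - it.
    Off the circle, [resolvent_inv] therefore applies to [cayley] minus k. *)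
Lemma Re_mobius k : k != 1 -> (complex.Re (((1 - k) / 2)^-1) == 1) = (normc k == 1).
Proof.
case: k => a b k1; rewrite invf_div.
have nz : (1 - a) ^+ 2 + b ^+ 2 != 0.
  apply: contra k1; rewrite paddr_eq0 ?sqr_ge0 // !sqrf_eq0 subr_eq0.
  by move=> /andP[/eqP<- /eqP->].
have -> : complex.Re (2 / (1 - (a +i* b))) = 2 * (1 - a) / ((1 - a) ^+ 2 + b ^+ 2).
  rewrite complex_nat /= sub0r sqrrN mul0r subr0; field; exact: nz.
rewrite -[X in (_ == X) = _](divff nz) (inj_eq (mulIf _)) ?invr_eq0 //.
have -> : normc (a +i* b) = Num.sqrt (a ^+ 2 + b ^+ 2) by [].
rewrite -[X in _ = (_ == X)]sqrtr1 eqr_sqrt ?addr_ge0 ?sqr_ge0 //.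
by apply/eqP/eqP; rewrite !expr2; lra.
Qed.

Lemma Re_shift k : k != 1 -> normc k != 1 ->
  complex.Re (1 - ((1 - k) / 2)^-1) != 0.
Proof.
by move=> k1; rewrite -Re_mobius // raddfB /= subr_eq0 eq_sym.
Qed.

Lemma V_invertible k : normc k != 1 -> exists r, r * (cayley - uiota k) = 1.
Proof.
move=> nk; have k1 : k != 1 by apply: contra nk => /eqP ->; rewrite Normc.normc1.
have l0 : (1 - k) / 2 != 0.
  by rewrite mulf_neq0 ?invr_eq0 ?pnatr_eq0 // subr_eq0 eq_sym.
have s0 := Re_shift k1 nk; set l := (1 - k) / 2 in l0 s0 *.
have ls : l * (1 - (1 - l^-1)) = 1 by rewrite subKr mulfV.
have E := resolvent_inv s0 ls.
exists (uiota ((2 * l)^-1) * (1 + uiota (1 - (1 - l^-1)) * W (1 - l^-1))).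
rewrite V_sub -/l -mulrA [X in _ * X]mulrA -uiotaC -mulrA -unit_exp_sub_central E.
rewrite [uiota (-2) * _]mulrN mulrN mulrA -uiotaM -mulrN.
have -> : - uiota l = uiota (- l).
  by apply/eqP; rewrite eq_sym -addr_eq0 -uiotaD addNr /unz_scalar scale0r.
rewrite -uiotaM (_ : _ * _ = 1) ?uiota1 // invfM; field; exact: l0.
Qed.

Lemma left_inverse_central u r : (forall y, u * y = y * u) -> r * u = 1 ->
  forall y, r * y = y * r.
Proof.
move=> uC ru y; have ur : u * r = 1 by rewrite uC.
by rewrite -[RHS]mul1r -ru -mulrA [u * (y * r)]mulrA uC -[y * u * r]mulrA ur mulr1.
Qed.

(** The left Neumann inverse r is also a right one: e = 1 - (1-u)r satisfies e(1-u) = 0, so e = eu,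
    and the norm of u forces e = 0. *)
Lemma neumann_right (u : unz) : unorm u < 1 -> exists r, (1 - u) * r = 1.
Proof.
move=> u1; have [r ru] := neumann u1; exists r.
have e0 : (1 - (1 - u) * r) * (1 - u) = 0.
  by rewrite mulrBl mul1r -mulrA ru mulr1 subrr.
have eE : 1 - (1 - u) * r = (1 - (1 - u) * r) * u.
  by move/eqP: e0; rewrite mulrBr mulr1 subr_eq0 => /eqP.
have : unorm (1 - (1 - u) * r) = 0.
  have := unormM (1 - (1 - u) * r) u; rewrite -eE.
  have := unorm_ge0 (1 - (1 - u) * r); have := unorm_ge0 u.
  move: u1; set N := unorm u; set M := unorm _; nra.
by move=> /unorm0_eq0/eqP; rewrite subr_eq0 => /eqP <-.
Qed.

Definition ucst a : unz := (a, 0).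

Lemma ucstD a b : ucst (a + b) = ucst a + ucst b.
Proof. by rewrite /ucst unzD addr0. Qed.

Lemma uiota_ucst k a : uiota k * ucst a = ucst (k *: a).
Proof. by rewrite /ucst uiota_pair lact0. Qed.

Lemma unz_pairD x x' : ((0, x + x') : unz) = ((0, x) : unz) + ((0, x') : unz).
Proof. by rewrite unzD addr0. Qed.

Lemma W_nat j a : W j.+1%:R * ucst a = (0, right_exp D j.+1%:R a).
Proof.
rewrite /exp_resolvent Re_natS /ucst unzM mul0r lact0l lmulx0 add0r addr0.
by rewrite (ract_uE subexp) // Re_natS.
Qed.

Lemma W_natN j a : - W (- j.+1%:R) * ucst a = (0, left_exp D j.+1%:R a).
Proof.
have Rn : (0 < complex.Re (- j.+1%:R : R[i])) = false.
  by apply/negbTE; rewrite raddfN /= -leNgt oppr_le0 ltW // Re_natS.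
rewrite /exp_resolvent Rn opprK mulNr /ucst unzM mul0r lact0l lmulx0 add0r addr0.
have -> : ract (- left_exp D j.+1%:R 1) a = - left_exp D j.+1%:R a.
  rewrite -[in RHS](ract_uM subexp) ?Re_natS //.
  by apply/eqP; rewrite -addr_eq0 -ractDl addNr ract0.
by rewrite -[LHS]/(- 0, _) oppr0 opprK.
Qed.

Section LocalApproximation.
(** [Phi] abstracts evaluation of the transform at one point, finite or infinite, where U takes the
    value [l]. *)
Variables (l : R[i]) (Phi : lspace -> A) (C : R).
Hypothesis C0 : 0 <= C.
Hypothesis PhiD : forall x x', Phi (x + x') = Phi x + Phi x'.
Hypothesis PhiC : forall x, rnorm (Phi x) <= C * lnorm x.
Hypothesis PhiE : forall j, exists2 m, (1 - j.+1%:R) * l * m = m - l &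
  forall a, Phi (right_exp D j.+1%:R a) = m *: a.
Hypothesis PhiM : forall j, exists2 m, (1 - - j.+1%:R) * l * m = m - l &
  forall a, Phi (left_exp D j.+1%:R a) = - m *: a.

(** On exponentials the identity is exact, with r = 0, by [W_sub_scalar]. It persists under sums
    and, as [Phi] is bounded, under limits with a small r, so density concludes. *)
Lemma local_approximation x (e : R) : 0 < e -> exists y r,
  ((0, x) : unz) = ucst (Phi x) + (U - uiota l) * y + r /\ unorm r <= e.
Proof.
have N0 : unorm 0 = 0 by rewrite /unz_norm rnorm0 lnorm0 addr0.
move: x e; apply: (@exponential_density R D A subexp (fun x => forall e : R, 0 < e ->
  exists y r, ((0, x) : unz) = ucst (Phi x) + (U - uiota l) * y + r /\ unorm r <= e)).
- move=> x x' Px Px' e e0; have e2 : 0 < e / 2 by rewrite divr_gt0.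
  have [y [r [E re]]] := Px _ e2; have [y' [r' [E' re']]] := Px' _ e2.
  exists (y + y'), (r + r'); split.
    rewrite unz_pairD E E' PhiD ucstD mulrDr addrACA; congr (_ + _).
    exact: addrACA.
  by rewrite (splitr e); apply: le_trans (unormD _ _) (lerD re re').
- move=> x Px e e0; have e2 : 0 < e / 2 by rewrite divr_gt0.
  have c0 : 0 < C + 1 by rewrite ltr_wpDl.
  have d0 : 0 < e / 2 / (C + 1) by rewrite divr_gt0.
  have [x' Px' xx'] := Px _ d0; have [y [r [E re]]] := Px' _ e2.
  exists y, (r + ((0, x - x') - ucst (Phi (x - x')))); split.
    have PE : Phi x = Phi x' + Phi (x - x') by rewrite -PhiD addrC subrK.
    have xE : ((0, x) : unz) = (0, x') + (0, x - x').
      by rewrite -unz_pairD [x' + _]addrC subrK.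
    rewrite xE E PE ucstD [ucst _ + ucst _ + _]addrAC -!addrA.
    congr (_ + (_ + _)); rewrite [RHS]addrCA; congr (_ + _).
    by rewrite addrCA subrr addr0.
  rewrite (splitr e); apply: le_trans (unormD _ _) _; apply: lerD => //.
  apply: le_trans (unormD _ _) _; rewrite unormN /unz_norm /= rnorm0 lnorm0.
  rewrite add0r addr0; apply: (@le_trans _ _ ((C + 1) * lnorm (x - x'))).
    by rewrite mulrDl mul1r addrC lerD.
  by rewrite mulrC -ler_pdivlMr.
- move=> j a e e0; have [m lm Pm] := PhiE j.
  exists (((1 + uiota (1 - j.+1%:R) * W j.+1%:R) * uiota (1 + (1 - j.+1%:R) * m)) * ucst a), 0.
  rewrite N0 ltW //; split=> //; rewrite addr0 Pm -uiota_ucst mulrA -W_sub_scalar //.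
    by rewrite -mulrDl addrC subrK W_nat.
  by rewrite gt_eqF // Re_natS.
- move=> j a e e0; have [m lm Pm] := PhiM j.
  exists (((1 + uiota (1 - - j.+1%:R) * W (- j.+1%:R)) *
    uiota (1 + (1 - - j.+1%:R) * m)) * ucst (- a)), 0.
  rewrite N0 ltW //; split=> //.
  rewrite addr0 Pm scaleNr -scalerN -uiota_ucst mulrA -W_sub_scalar //.
    rewrite -mulrDl addrC subrK -W_natN mulNr.
    have -> : ucst (- a) = - ucst a by apply/eqP; rewrite -addr_eq0 -ucstD addNr.
    by rewrite mulrN.
  by rewrite raddfN /= oppr_eq0 gt_eqF // Re_natS.
Qed.

End LocalApproximation.

Lemma inv_sub (z w : R[i]) : z != 0 -> w != 0 ->
  (z - w) * z^-1 * w^-1 = w^-1 - z^-1.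
Proof. by move=> z0 w0; rewrite mulrBl mulfV // mulrBl mul1r mulrAC mulfV // mul1r. Qed.

Lemma fourier_local (t : R) x (e : R) : 0 < e -> exists y r,
  ((0, x) : unz) = ucst (fourier x t) + (U - uiota ((1 - 'i * t%:C)^-1)) * y + r /\
  unorm r <= e.
Proof.
have nz (z : R[i]) : complex.Re z != 0 -> z - 'i * t%:C != 0.
  apply: contra => /eqP zt; have := congr1 (@complex.Re R) zt.
  by case: z {zt} => a b /=; rewrite mul0r mulr0 subrr subr0 => ->.
have nz1 : (1 : R[i]) - 'i * t%:C != 0 by apply: nz; exact: oner_neq0.
apply: (@local_approximation _ (fun x => fourier x t) (aw_cst D)).
- exact: aw_cst_ge0.
- by move=> x' y'; exact: fourierD.
- by move=> x'; exact: rnorm_fourier_le.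
- move=> j; exists (j.+1%:R - 'i * t%:C)^-1; last first.
    by move=> a; rewrite (fourier_uE subexp) // Re_natS.
  have nzj : (j.+1%:R : R[i]) - 'i * t%:C != 0 by apply: nz; rewrite gt_eqF // Re_natS.
  by rewrite -inv_sub // opprB addrA subrK.
- move=> j; exists (- j.+1%:R - 'i * t%:C)^-1; last first.
    move=> a; rewrite (fourier_uM subexp) ?Re_natS //.
    by rewrite -opprD invrN opprK.
  have nzj : - (j.+1%:R : R[i]) - 'i * t%:C != 0.
    by apply: nz; rewrite raddfN /= oppr_eq0 gt_eqF // Re_natS.
  by rewrite -inv_sub // opprB addrA subrK.
Qed.

(** The point at infinity: U takes the value 0 and, as in the Riemann-Lebesgue lemma, so does every
    transform; hence [Phi] = 0. *)
Lemma infinity_local x (e : R) : 0 < e -> exists y r,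
  ((0, x) : unz) = U * y + r /\ unorm r <= e.
Proof.
move=> e0; have [|||||y [r [E re]]] := @local_approximation 0 (fun=> 0) 0 _ _ _ _ _ x e e0.
- by [].
- by move=> x' y'; rewrite addr0.
- by move=> x'; rewrite rnorm0 mul0r.
- by move=> j; exists 0 => [|a]; rewrite ?mulr0 ?subrr ?scale0r.
- by move=> j; exists 0 => [|a]; rewrite ?mulr0 ?subrr ?oppr0 ?scale0r.
exists y, r; split=> //.
rewrite E /ucst (_ : uiota 0 = 0) ?subr0; last by rewrite /unz_scalar scale0r.
by rewrite -[X in X + _ + _]/(0 : unz) add0r.
Qed.

(** [F t] will be 1 + x multiplied, on the left or on the right, by a local inverse at t, so that
    its transform at t is 1. The point k = 1 is infinity, where 1 + x itself is already close to 1
    modulo V - 1. *)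
Lemma circle_local k (F : R -> A * lspace) : normc k = 1 ->
  (forall t, (F t).1 + fourier (F t).2 t = 1) ->
  forall x, exists u : unz, (u = (1, x) \/ exists t, u = F t :> unz) /\
    exists y r, u = 1 - r - (cayley - uiota k) * y /\ unorm r < 1.
Proof.
have h2 : (0 : R) < 2^-1 by rewrite invr_gt0.
move=> nk FE x; have uN (w : R[i]) : uiota (- w) = - uiota w.
  by apply/eqP; rewrite -addr_eq0 -uiotaD addNr /unz_scalar scale0r.
have half (k' : R[i]) y : (cayley - uiota k') * (uiota (- 2^-1) * y) =
    (U - uiota ((1 - k') / 2)) * y.
  rewrite V_sub -mulrA [(U - _) * _]mulrA -(uiotaC _ (U - _)) !mulrA -uiotaM.
  have two0 : (2 : R[i]) != 0 by rewrite pnatr_eq0.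
  by rewrite mulrNN (mulfV two0) uiota1 mul1r.
have [k1|k1] := eqVneq k 1.
  exists (1, x); split; first by left.
  have [y [r [E re]]] := infinity_local x h2.
  exists (uiota (2^-1) * y), (- r); rewrite unormN; split; last first.
    by apply: le_lt_trans re _; rewrite invf_lt1 // ltr1n.
  have := half k y; rewrite k1 subrr mul0r (_ : uiota 0 = 0) ?subr0; last first.
    by rewrite /unz_scalar scale0r.
  rewrite uN mulNr mulrN opprK => ->.
  have -> : ((1, x) : unz) = 1 + ((0, x) : unz) by rewrite unzD addr0 add0r.
  by rewrite E -addrA [r + _]addrC.
have l0 : (1 - k) / 2 != 0.
  by rewrite mulf_neq0 ?invr_eq0 ?pnatr_eq0 // subr_eq0 eq_sym.
have := Re_mobius k1; rewrite nk eqxx => /eqP.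
(* The frequency belonging to k is read off from 2/(1-k) = 1 - it. *)
set z := ((1 - k) / 2)^-1 => z1; pose t := - complex.Im z.
have zE : z = 1 - 'i * t%:C.
  rewrite /t; move: z1; case: (z) => p q /= ->; apply/eqP.
  by rewrite eq_complex /=; apply/andP; split; apply/eqP; ring.
exists (F t); split; first by right; exists t.
have [y [r [E re]]] := fourier_local t (F t).2 h2.
have lE : (1 - 'i * t%:C)^-1 = (1 - k) / 2 by rewrite -zE invrK.
rewrite lE in E; exists (uiota (2^-1) * y), (- r); rewrite unormN; split; last first.
  by apply: le_lt_trans re _; rewrite invf_lt1 // ltr1n.
rewrite -(half k y) uN mulNr mulrN in E; rewrite opprK.
have -> : F t = ucst (F t).1 + ((0, (F t).2) : unz).
  by case: (F t) => b' x' /=; rewrite /ucst unzD addr0 add0r.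
rewrite E addrA addrA -ucstD FE.
exact: addrAC.
Qed.

(** [left_inverse_of_local] with v = V and a = 1 + x. The local left inverse at the point k is the
    constant b_t, or 1 at infinity. *)
Theorem left_inverse_unz x :
  (forall t, exists b, b * (1 + fourier x t) = 1) ->
  exists u : unz, u * (1, x) = 1.
Proof.
move=> inv; have [b bP] := choice inv.
have res k : exists r, normc k != 1 -> r * (cayley - uiota k) = 1.
  by have [_|/V_invertible[r]] := eqVneq (normc k) 1; [exists 0|exists r].
have [rs rsP] := choice res.
(* The value 0 on the circle makes the chosen resolvent central for every k. *)
pose rs' k := if normc k == 1 then 0 else rs k.
have rsE k : normc k != 1 -> rs' k * (cayley - uiota k) = 1.
  by move=> nk; rewrite /rs' (negbTE nk) rsP.
have VC k u : (cayley - uiota k) * u = u * (cayley - uiota k).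
  by rewrite mulrBl mulrBr V_central uiotaC.
have rsC k u : rs' k * u = u * rs' k.
  rewrite /rs'; case: ifPn => nk; first by rewrite mul0r mulr0.
  exact: left_inverse_central (VC k) (rsP k nk) u.
apply: (@left_inverse_of_local R unz unorm uiota (@unorm_ge0 _ _ _) (@unormD _ _ _)
  (@unormN _ _ _) (@unormM _ _ _) (@neumann _ _ _) (@uiotaD _ _ _) (@uiotaM _ _ _)
  (@uiota1 _ _ _) (@uiotaC _ _ _) (@unorm_uiota _ _ _) cayley rs' V_central rsC rsE).
move=> k nk.
have FE t : b t + fourier (lact (b t) x) t = 1.
  by rewrite fourier_lact -[X in X + _]mulr1 -mulrDr bP.
have [u [right_exp [y [r [E re]]]]] := circle_local nk (F := fun t => (b t, lact (b t) x)) FE x.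
case: right_exp => [u1|[t ut]].
  by exists 1, y, r; rewrite mul1r -u1.
exists (ucst (b t)), y, r; split; last exact: re.
rewrite -E ut /ucst unzM mulr1 ract0 lmul0x.
by rewrite !addr0.
Qed.

(** The same abstract theorem in the opposite ring, with [neumann_right] as its Neumann series. *)
Theorem right_inverse_unz x :
  (forall t, exists b, (1 + fourier x t) * b = 1) ->
  exists u : unz, ((1, x) : unz) * u = 1.
Proof.
move=> inv; have [b bP] := choice inv.
have res k : exists r, normc k != 1 -> r * (cayley - uiota k) = 1.
  by have [_|/V_invertible[r]] := eqVneq (normc k) 1; [exists 0|exists r].
have [rs rsP] := choice res.
pose rs' k := if normc k == 1 then 0 else rs k.
have VC k u : (cayley - uiota k) * u = u * (cayley - uiota k).
  by rewrite mulrBl mulrBr V_central uiotaC.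
have rsC k u : u * rs' k = rs' k * u.
  rewrite /rs'; case: ifPn => nk; first by rewrite mul0r mulr0.
  exact/esym/(left_inverse_central (VC k) (rsP k nk)).
have rsE k : normc k != 1 -> (cayley - uiota k) * rs' k = 1.
  by move=> nk; rewrite VC /rs' (negbTE nk) rsP.
apply: (@left_inverse_of_local R (unz^c)%type unorm uiota (@unorm_ge0 _ _ _)
  (@unormD _ _ _) (@unormN _ _ _) _ (@neumann_right) (@uiotaD _ _ _) _
  (@uiota1 _ _ _) _ _ cayley rs' _ rsC rsE).
- by move=> u u'; rewrite mulrC; exact: unormM.
- by move=> k l; rewrite mulrC; exact: uiotaM.
- by move=> k u; exact/esym/uiotaC.
- by move=> k u; have := unorm_uiota k u; rewrite uiotaC => h; exact: h.
- by move=> u; exact/esym/V_central.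
move=> k nk.
have FE t : b t + fourier (ract x (b t)) t = 1.
  by rewrite fourier_ract -[X in X + _]mul1r -mulrDl bP.
have [u [right_exp [y [r [E re]]]]] := circle_local nk (F := fun t => (b t, ract x (b t))) FE x.
have E' : u = 1 - r - y * (cayley - uiota k) by rewrite -VC.
case: right_exp => [u1|[t ut]].
  exists 1, y, r; split; last exact: re.
  have E1 : ((1, x) : unz) * 1 = 1 - r - y * (cayley - uiota k).
    by rewrite mulr1 -u1; exact: E'.
  exact: E1.
exists (ucst (b t)), y, r; split; last exact: re.
have E1 : ((1, x) : unz) * ucst (b t) = 1 - r - y * (cayley - uiota k).
  rewrite /ucst unzM mul1r lact0 lmulx0 add0r addr0.
  by apply: etrans E'; exact/esym.
exact: E1.
Qed.

End SubexponentialWeight.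

(** * From the unitization by A back to the unitization by scalars *)

Section InverseInLp.
Variables (R : realType) (D : algWeight R) (A : banachAlgType R[i]).
Hypothesis subexp : forall s : R, 0 < s ->
  (snorm D (fun t => expR (- (s * `|t|))%R) < +oo)%E.
Local Notation mu := (@lebesgue_measure R).
Local Notation p := (aw_p D).
Local Notation w := (aw_w D).
Local Notation lspace := (lspace D A).
Local Notation unz := (unz D A).

Lemma lspace_Lp (g : lspace) : Lp p w (lfun g).
Proof.
by apply/LpE; split; [exact/smeas_strongly_measurable/lfun_smeas|exact: lfun_fin].
Qed.

(** The component in A of a left inverse must be 1, so the inverse already lies in the scalar
    unitization. *)
Lemma unz_one_pair (c : A) (x y : lspace) : ((c, y) : unz) * (1, x) = 1 ->
  c = 1 /\ x + y + lmul y x = 0.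
Proof. by rewrite unzM mulr1 ract1 => -[-> ]; rewrite lact1. Qed.

Lemma eq1_mul1 (f g : R -> A) (x y : lspace) :
  {ae mu, forall t, f t = x t} -> {ae mu, forall t, g t = y t} ->
  y + x + lmul x y = 0 -> eq1 (mul1 (1, f) (1, g)) (@one1 R A).
Proof.
move=> fx gy E; split; first by rewrite /= mulr1.
rewrite /= (conv_ae fx gy); apply: (ae_mp fx); apply: (ae_mp gy).
apply: (ae_mp (lmulE x y)); apply: (ae_mp (lspaceDE y x)).
apply: (ae_mp (lspaceDE (y + x) (lmul x y))); apply: (ae_mp (@lspace0E R D A)).
apply: ae_of_forall => t h0 h1 h2 h3 h4 h5.
by rewrite !scale1r h5 h4 -h3 -h2 -h1 E h0.
Qed.

Lemma Lp_inverse (f : R -> A) (d : side) : Lp p w f ->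
  (forall t, invertible d (1 + fourier f t)) ->
  exists2 g, Lp p w g & is_inverse1 p w d (1, f) (1, g).
Proof.
move=> Lf inv; have Lf' : Lpfun D f by exact/LpE.
pose x := toL D f; have fx : {ae mu, forall t, f t = x t}.
  by apply: ae_sym; exact: toLE.
have fE t : fourier f t = fourier x t by exact: fourier_ae.
have left : (forall t, exists b, b * (1 + fourier f t) = 1) ->
    exists g : lspace, ((1, g) : unz) * (1, x) = 1.
  move=> h; have [t|[c g] cg] := left_inverse_unz subexp (x := x).
    by have [b bP] := h t; exists b; rewrite -fE.
  by have [c1 _] := unz_one_pair cg; exists g; subst c; exact: cg.
have right : (forall t, exists b, (1 + fourier f t) * b = 1) ->
    exists g : lspace, ((1, x) : unz) * (1, g) = 1.
  move=> h; have [t|[c g] cg] := right_inverse_unz subexp (x := x).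
    by have [b bP] := h t; exists b; rewrite -fE.
  suff c1 : c = 1 by exists g; subst c; exact: cg.
  by have := congr1 fst cg; rewrite unzM /= mul1r.
have leftP (g : lspace) : ((1, g) : unz) * (1, x) = 1 ->
    eq1 (mul1 (1, lfun g) (1, f)) (@one1 R A).
  move=> /unz_one_pair[_ E].
  exact: (eq1_mul1 (ae_of_forall (fun t => erefl (g t))) fx E).
have rightP (g : lspace) : ((1, x) : unz) * (1, g) = 1 ->
    eq1 (mul1 (1, f) (1, lfun g)) (@one1 R A).
  move=> /unz_one_pair[_ E].
  exact: (eq1_mul1 fx (ae_of_forall (fun t => erefl (g t))) E).
case: d inv => inv.
- have [t|g gP] := left; first by have [b bP] := inv t; exists b.
  exists g; first exact: lspace_Lp.
  by split; [exact: Lf|exact: lspace_Lp|exact: leftP].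
- have [t|g gP] := right; first by have [b bP] := inv t; exists b.
  exists g; first exact: lspace_Lp.
  by split; [exact: Lf|exact: lspace_Lp|exact: rightP].
have [t|g gP] := left; first by have [b [bP _]] := inv t; exists b.
have [t|h hP] := right; first by have [b [_ bP]] := inv t; exists b.
(* By associativity a left and a right inverse coincide. *)
have gh : ((1, g) : unz) = (1, h).
  have := mulrA ((1, g) : unz) ((1, x) : unz) ((1, h) : unz).
  by rewrite gP hP mulr1 mul1r => E; exact: E.
exists g; first exact: lspace_Lp.
split; [exact: Lf|exact: lspace_Lp|split; first exact: leftP].
by apply: rightP; rewrite gh.
Qed.

End InverseInLp.

(** * Reduction to subexponential weights *)

Section WeightGrowth.
Variables (R : realType).
Local Notation mu := (@lebesgue_measure R).
Implicit Types (w : R -> R) (x y : R).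

Lemma weight_gt0 w x : weight w -> 0 < w x.
Proof. by move=> [_ w1 _]; exact: lt_le_trans (w1 x). Qed.

Lemma ln_weight_ge0 w x : weight w -> 0 <= ln (w x).
Proof. by move=> [_ w1 _]; exact: ln_ge0. Qed.

Lemma weight_ge_expR_pos w x : weight w -> 0 < x -> expR (rho2 w * x) <= w x.
Proof.
move=> hw x0; have wx := weight_gt0 x hw.
rewrite -[leRHS]lnK ?posrE // ler_expR -ler_pdivlMr // mulrC.
have lb : has_lbound [set ln (w x `^ x^-1) | x in [set x | 0 < x]].
  exists 0 => _ [y /= y0 <-].
  by rewrite ln_powR mulr_ge0 ?invr_ge0 ?ln_weight_ge0 // ltW.
by rewrite -ln_powR; apply: (ge_inf lb); exists x.
Qed.

Lemma weight_ge_expR_neg w x : weight w -> x < 0 -> expR (rho1 w * x) <= w x.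
Proof.
move=> hw x0; have wx := weight_gt0 x hw.
rewrite -[leRHS]lnK ?posrE // ler_expR -ler_ndivrMr // mulrC.
have ub : has_ubound [set ln (w x `^ x^-1) | x in [set x | x < 0]].
  exists 0 => _ [y /= y0 <-].
  by rewrite ln_powR mulr_le0_ge0 ?invr_le0 ?ln_weight_ge0 // ltW.
by rewrite -ln_powR; apply: (ub_le_sup ub); exists x.
Qed.

Lemma rho2_ge0 w : weight w -> 0 <= rho2 w.
Proof.
move=> hw; apply: lb_le_inf.
  by exists (ln (w 1 `^ 1^-1)), 1 => //=; exact: ltr01.
move=> _ [y /= y0 <-].
by rewrite ln_powR mulr_ge0 ?invr_ge0 ?ln_weight_ge0 // ltW.
Qed.

Lemma rho1_le0 w : weight w -> rho1 w <= 0.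
Proof.
move=> hw; apply: ge_sup.
  by exists (ln (w (-1) `^ (-1)^-1)), (-1) => //=; rewrite oppr_lt0 ltr01.
move=> _ [y /= y0 <-].
by rewrite ln_powR mulr_le0_ge0 ?invr_le0 ?ln_weight_ge0 // ltW.
Qed.

Definition reflected w x := w (- x).

Lemma weight_reflect w : weight w -> weight (reflected w).
Proof.
move=> [mw w1 wM]; split=> [|x|x y].
- by apply: (measurableT_comp mw); exact: oppr_measurable.
- exact: w1.
- by rewrite /reflected opprD.
Qed.

Lemma weight_mul_nat w x n : weight w -> w (x *+ n.+1) <= w x ^+ n.+1.
Proof.
move=> hw; have [_ w1 wM] := hw; elim: n => [|n IH]; first by rewrite expr1.
rewrite mulrS exprS; apply: le_trans (wM _ _) _.
by rewrite ler_wpM2l // ltW // weight_gt0.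
Qed.

(* By almost monotonicity it suffices to bound [w] on the multiples of a point
   [x0] where [w x0 < exp (e x0)]. *)
Lemma subexp_pos w K (e : R) : weight w -> 0 < K ->
  (forall x y, 0 <= x -> 0 <= y -> w x <= K * w (x + y)) -> rho2 w = 0 -> 0 < e ->
  exists2 C, 0 < C & forall x, 0 <= x -> w x <= C * expR (e * x).
Proof.
move=> hw K0 mon r0 e0.
have [_ [x0 /= x00 <-]] : exists2 r, [set ln (w x `^ x^-1) | x in [set x | 0 < x]] r
    & r < rho2 w + e.
  apply: (@inf_adherent _ [set ln (w x `^ x^-1) | x in [set x | 0 < x]]) => //; split.
    by exists (ln (w 1 `^ 1^-1)), 1 => //=; exact: ltr01.
  exists 0 => _ [y /= y0 <-].
  by rewrite ln_powR mulr_ge0 ?invr_ge0 ?ln_weight_ge0 // ltW.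
rewrite r0 add0r ln_powR mulrC ltr_pdivrMr // => we.
have wx0 : w x0 <= expR (e * x0).
  by rewrite -[leLHS]lnK ?posrE ?weight_gt0 // ler_expR ltW.
exists (K * expR (e * x0)); first by rewrite mulr_gt0 ?expR_gt0.
move=> x xge0; pose n := Num.truncn (x / x0).
have q0 : 0 <= x / x0 by rewrite divr_ge0 // ltW.
have /andP[n1 n2] : n%:R <= x / x0 < n.+1%:R by exact: truncn_itv.
have xn : x <= x0 *+ n.+1.
  by rewrite -mulr_natl -ler_pdivrMr // ltW.
have xn' : x0 *+ n.+1 <= x + x0.
  by rewrite mulrSr lerD2r -mulr_natl -ler_pdivlMr.
apply: (@le_trans _ _ (K * w (x0 *+ n.+1))).
  by rewrite -[in leRHS](subrKC x (x0 *+ n.+1)) mon // subr_ge0.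
rewrite -mulrA ler_pM2l //; apply: le_trans (weight_mul_nat _ _ hw) _.
apply: (@le_trans _ _ (expR (e * x0) ^+ n.+1)).
  by rewrite lerXn2r // nnegrE ?expR_ge0 // ltW // weight_gt0.
rewrite -expRD -expRM_natr ler_expR.
rewrite -mulrDr -mulrA ler_pM2l // mulr_natr.
by rewrite addrC.
Qed.

Lemma rho2_reflect w : weight w -> rho1 w = 0 -> rho2 (reflected w) = 0.
Proof.
move=> hw r0; apply/eqP; rewrite eq_le rho2_ge0 ?andbT; last exact: weight_reflect.
rewrite leNgt; apply/negP => r2.
suff : rho1 w <= - rho2 (reflected w) by rewrite r0 oppr_ge0 leNgt r2.
apply: ge_sup.
  by exists (ln (w (-1) `^ (-1)^-1)), (-1) => //=; rewrite oppr_lt0 ltr01.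
move=> _ [y /= y0 <-]; have yN : 0 < - y by rewrite oppr_gt0.
have := weight_ge_expR_pos (weight_reflect hw) yN.
rewrite /reflected opprK -[leRHS]lnK ?posrE ?weight_gt0 // ler_expR.
by move=> h; rewrite ln_powR mulrC ler_ndivrMr // mulNr -mulrN.
Qed.

Lemma subexp_neg w K (e : R) : weight w -> 0 < K ->
  (forall x y, x <= 0 -> y <= 0 -> w x <= K * w (x + y)) -> rho1 w = 0 -> 0 < e ->
  exists2 C, 0 < C & forall x, x <= 0 -> w x <= C * expR (e * - x).
Proof.
move=> hw K0 mon r0 e0.
have [|C C0 CP] := @subexp_pos (reflected w) K e (weight_reflect hw) K0 _
  (rho2_reflect hw r0) e0.
  by move=> x y x0 y0; rewrite /reflected opprD mon // oppr_le0.
by exists C => // x x0; have := CP (- x); rewrite /reflected opprK oppr_ge0; exact.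
Qed.

Lemma integral_exp_abs (s : R) : 0 < s ->
  (\int[mu]_t (expR (- (s * `|t|)))%:E < +oo)%E.
Proof.
move=> s0; pose h (t : R) := if -1 < t then expR (- (s * t)) else 0.
have h0 t : 0 <= h t by rewrite /h; case: ifP => // _; exact: expR_ge0.
have mh : measurable_fun setT h.
  apply: measurable_fun_ifT => //.
    by apply: measurable_fun_ltr => //; exact: measurable_id.
  apply: (measurableT_comp (continuous_measurable_fun (@continuous_expR R))).
  by apply: measurableT_comp => //; exact: mulrl_measurable.
have mhN : measurable_fun setT (fun t : R => h (0 - t)).
  exact: measurable_reflect_comp.
apply: (@le_lt_trans _ _ (\int[mu]_t ((h t)%:E + (h (0 - t))%:E))%E).
  apply: ge0_le_integralT => t; first by rewrite lee_fin expR_ge0.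
  rewrite -EFinD lee_fin sub0r; case: (leP 0 t) => t0.
    rewrite ger0_norm // {1}/h (lt_le_trans _ t0) ?oppr_lt0 ?ltr01 //.
    by rewrite lerDl.
  rewrite ltr0_norm // {2}/h (lt_trans _ (_ : 0 < - t)) ?oppr_lt0 ?ltr01 ?oppr_gt0 //.
  by rewrite lerDr.
rewrite ge0_integralD //; first last.
- exact/measurable_EFinP.
- by move=> t _; rewrite lee_fin.
- exact/measurable_EFinP.
- by move=> t _; rewrite lee_fin.
rewrite (@ge0_integral_reflection _ 0 (fun t => (h t)%:E)); first last.
- by move=> t; rewrite lee_fin.
- exact/measurable_EFinP.
by rewrite ge0_integral_exp_tail // -EFinD ltry.
Qed.

(** Half of the decay rate s absorbs the weight, which is at most C e^{s|t|/2}; the other half keeps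
    the p-th power integrable. *)
Lemma subexp_snorm (D : algWeight R) :
  (forall e, 0 < e -> exists2 C, 0 < C & forall x, aw_w D x <= C * expR (e * `|x|)) ->
  forall s, 0 < s -> (snorm D (fun t => expR (- (s * `|t|))%R) < +oo)%E.
Proof.
move=> wC s s0; apply/snorm_lty; have p0 := aw_p_gt0 D.
have s2 : 0 < s / 2 by rewrite divr_gt0.
have [C C0 CP] := wC _ s2.
have ps : 0 < s / 2 * aw_p D by rewrite mulr_gt0.
apply: (@le_lt_trans _ _ (\int[mu]_t ((C `^ aw_p D)%:E *
  (expR (- (s / 2 * aw_p D * `|t|)))%:E))%E).
  apply: ge0_le_integralT => t; first by rewrite lee_fin mulr_ge0 ?powR_ge0.
  rewrite -EFinM lee_fin -powRM ?expR_ge0 ?aw_w_ge0 //.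
  apply: (@le_trans _ _ ((C * expR (- (s / 2 * `|t|))) `^ aw_p D)).
    apply: ler_powR_base; first exact: ltW.
      by rewrite mulr_ge0 ?expR_ge0 ?aw_w_ge0.
    apply: (@le_trans _ _ (expR (- (s * `|t|)) * (C * expR (s / 2 * `|t|)))).
      by rewrite ler_wpM2l ?expR_ge0.
    rewrite mulrCA ler_pM2l // -expRD ler_expR.
    by rewrite le_eqVlt; apply/orP; left; apply/eqP; field.
  rewrite powRM ?expR_ge0 ?(ltW C0) // ler_wpM2l ?powR_ge0 //.
  by rewrite -expRM mulNr mulrAC.
rewrite ge0_integralZl_EFin ?powR_ge0 //; first last.
- apply/measurable_EFinP.
  apply: (measurableT_comp (continuous_measurable_fun (@continuous_expR R))).
  apply: measurableT_comp => //; apply: measurableT_comp; first exact: mulrl_measurable.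
  exact: normr_measurable.
apply: lte_mul_pinfty; [by rewrite lee_fin powR_ge0|by []|].
exact: integral_exp_abs.
Qed.

End WeightGrowth.

(** * Construction of a regular weight below a multiple of the given one *)

Section WeightReduction.
Variables (R : realType) (q : R).
Hypothesis q1 : 1 < q.
Local Notation mu := (@lebesgue_measure R).
Implicit Types (w v : R -> R) (x y t : R).

Definition regular_weight v := almost_monotone_algebra_weight q v /\
  forall e, 0 < e -> exists2 C, 0 < C & forall x, v x <= C * expR (e * `|x|).

Lemma q_gt0 : 0 < q. Proof. exact: lt_trans ltr01 q1. Qed.

Lemma powRN_scale (c a : R) : 0 <= c -> 0 <= a ->
  (c * a) `^ (- q) = c `^ (- q) * a `^ (- q).
Proof. by move=> c0 a0; rewrite powRM. Qed.

Lemma measurable_powR_comp v : measurable_fun setT v ->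
  measurable_fun setT (fun t => v t `^ (- q)).
Proof. by move=> mv; apply: (measurableT_comp (measurable_powR _)). Qed.

(** Multiplication by k = 1 + L + M removes both constants: k >= L restores submultiplicativity, and
    k^q >= k >= M restores the convolution inequality, which scales by k^{-2q} on the left and
    k^{-q} on the right. *)
Lemma normalized_weight v (L M K : R) : measurable_fun setT v ->
  (forall x, 1 <= v x) -> 0 <= L -> (forall x y, v (x + y) <= L * (v x * v y)) ->
  0 <= M ->
  (forall x, (\int[mu]_t (v (x - t) `^ (- q) * v t `^ (- q))%:E <=
              (M * v x `^ (- q))%:E)%E) ->
  (\int[mu]_x (v x `^ (- q))%:E < +oo)%E -> 0 < K ->
  (forall x y, x <= 0 -> y <= 0 -> v x <= K * v (x + y)) ->
  (forall x y, 0 <= x -> 0 <= y -> v x <= K * v (x + y)) ->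
  (forall e, 0 < e -> exists2 C, 0 < C & forall x, v x <= C * expR (e * `|x|)) ->
  regular_weight (fun x => (1 + L + M) * v x).
Proof.
move=> mv v1 L0 vM M0 conv int K0 monn monp sub; set k := 1 + L + M.
have k1 : 1 <= k by rewrite /k; lra.
have k0 : 0 < k := lt_le_trans ltr01 k1.
have v0 x : 0 <= v x := le_trans ler01 (v1 x).
have ckM : k `^ (- q) * M <= 1.
  rewrite powRN mulrC ler_pdivrMr ?powR_gt0 // mul1r.
  apply: (@le_trans _ _ k); first by rewrite /k; lra.
  by rewrite -[leLHS]powRr1 ?(ltW k0) // ler_powR // ltW.
split; last first.
  move=> e e0; have [C C0 CP] := sub e e0; exists (k * C); first by rewrite mulr_gt0.
  by move=> x; rewrite -mulrA ler_pM2l.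
split.
- split=> [|x|x y].
  + exact: measurable_funM.
  + by rewrite -[leLHS]mulr1 ler_pM.
  + apply: (@le_trans _ _ (k * (L * (v x * v y)))); first by rewrite ler_pM2l.
    rewrite [leRHS]mulrACA -mulrA ler_pM2l // ler_wpM2r ?mulr_ge0 //.
    by rewrite /k; lra.
- move=> x; under eq_integral do rewrite !powRN_scale ?(ltW k0) // mulrACA EFinM.
  rewrite ge0_integralZl_EFin ?mulr_ge0 ?powR_ge0 //; first last.
  + apply/measurable_EFinP/measurable_funM; last exact: measurable_powR_comp.
    exact: (measurable_reflect_comp x (measurable_powR_comp mv)).
  + by move=> t _; rewrite lee_fin mulr_ge0 ?powR_ge0.
  apply: (@le_trans _ _ ((k `^ (- q) * k `^ (- q))%:E * (M * v x `^ (- q))%:E)%E).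
    by rewrite lee_wpmul2l // lee_fin mulr_ge0 ?powR_ge0.
  rewrite -EFinM lee_fin powRN_scale ?(ltW k0) // -!mulrA ler_wpM2l ?powR_ge0 //.
  by rewrite mulrA ler_piMl ?powR_ge0.
- under eq_integral do rewrite powRN_scale ?(ltW k0) // EFinM.
  rewrite ge0_integralZl_EFin ?powR_ge0 //; first last.
  + by apply/measurable_EFinP; exact: measurable_powR_comp.
  + by move=> t _; rewrite lee_fin powR_ge0.
  by apply: lte_mul_pinfty; rewrite ?lee_fin ?powR_ge0.
- by move=> _; exists K => // x y x0 y0; rewrite mulrCA ler_pM2l //; exact: monn.
- by move=> _; exists K => // x y x0 y0; rewrite mulrCA ler_pM2l //; exact: monp.
Qed.

Lemma powRN_le (K a b : R) : 0 < K -> 0 < a -> 0 < b -> a <= K * b ->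
  b `^ (- q) <= K `^ q * a `^ (- q).
Proof.
move=> K0 a0 b0 ab; rewrite !powRN ler_pdivlMr ?powR_gt0 // mulrC.
rewrite ler_pdivrMr ?powR_gt0 // -powRM ?(ltW K0) ?(ltW b0) //.
by rewrite ler_powR_base ?(ltW q_gt0) ?(ltW a0).
Qed.

(** The shape of the convolution estimates below: a part already controlled, plus a constant times
    the integrals of [b(t)] and [b(x-t)], which are equal by reflection. *)
Lemma conv_bound (a b : R -> R) (B H1 H2 x : R) :
  measurable_fun setT a -> measurable_fun setT b ->
  (forall t, 0 <= a t) -> (forall t, 0 <= b t) -> 0 <= B ->
  (\int[mu]_t (a t)%:E <= H1%:E)%E -> (\int[mu]_t (b t)%:E = H2%:E)%E ->
  (\int[mu]_t (a t + B * (b t + b (x - t)))%:E <= (H1 + B * (H2 + H2))%:E)%E.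
Proof.
move=> ma mb a0 b0 B0 aH bH.
have mb' : measurable_fun setT (fun t : R => b (x - t)) := measurable_reflect_comp x mb.
have b0' (t : R) : 0 <= b t + b (x - t) by rewrite addr_ge0.
under eq_integral do rewrite EFinD.
rewrite ge0_integralD //; first last.
- by apply/measurable_EFinP/measurable_funM => //; exact: measurable_funD.
- by move=> t _; rewrite lee_fin mulr_ge0.
- exact/measurable_EFinP.
- by move=> t _; rewrite lee_fin.
rewrite EFinD; apply: leeD => //; under eq_integral do rewrite EFinM.
rewrite ge0_integralZl_EFin //; first last.
- by apply/measurable_EFinP; exact: measurable_funD.
- by move=> t _; rewrite lee_fin.
under eq_integral do rewrite EFinD.
rewrite ge0_integralD //; first last.
- exact/measurable_EFinP.
- by move=> t _; rewrite lee_fin.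
- exact/measurable_EFinP.
- by move=> t _; rewrite lee_fin.
rewrite (@ge0_integral_reflection _ x (fun t => (b t)%:E)) ?bH //.
- exact/measurable_EFinP.
Qed.

(* [w (- |x|)] is dominated by [w] since [w] is subexponential on the left and
   grows exponentially on the right. *)
Lemma even_weight w (K r : R) : weight w ->
  (forall x, (\int[mu]_t (w (x - t) `^ (- q) * w t `^ (- q))%:E <=
              (w x `^ (- q))%:E)%E) ->
  (\int[mu]_x (w x `^ (- q))%:E < +oo)%E -> 0 < K ->
  (forall x y, x <= 0 -> y <= 0 -> w x <= K * w (x + y)) ->
  rho1 w = 0 -> 0 < r -> (forall x, 0 < x -> expR (r * x) <= w x) ->
  exists v (K' : R), [/\ regular_weight v, forall x, v (- x) = v x, 0 < K'
    & forall x, v x <= K' * w x].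
Proof.
move=> hw conv int K0 mon r1 r0 wr; have [mw w1 wM] := hw.
have w0 x : 0 < w x := weight_gt0 x hw.
pose v x := w (- `|x|); pose h t := v t `^ (- q).
have mv : measurable_fun setT v.
  apply: (measurableT_comp mw).
  by apply: measurableT_comp; [exact: oppr_measurable|exact: normr_measurable].
have mh : measurable_fun setT h := measurable_powR_comp mv.
have h0 t : 0 <= h t := powR_ge0 _ _.
have vle x y : `|x| <= `|y| -> v x <= K * v y.
  move=> xy; rewrite /v -[in leRHS](subrKC (- `|x|) (- `|y|)) mon //.
  by rewrite opprK addrC subr_le0.
have v0 x : 0 < v x := w0 _.
have mwq := measurable_powR_comp mw.
have Hfin : (\int[mu]_t (h t)%:E < +oo)%E.
  apply: (@le_lt_trans _ _
    (\int[mu]_t ((w t `^ (- q))%:E + (w (0 - t) `^ (- q))%:E))%E).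
    apply: ge0_le_integralT => t; first by rewrite lee_fin.
    rewrite -EFinD lee_fin /h /v sub0r; case: (leP 0 t) => t0.
      by rewrite ger0_norm // lerDr powR_ge0.
    by rewrite ltr0_norm // opprK lerDl powR_ge0.
  rewrite ge0_integralD //; first last.
  - apply/measurable_EFinP; exact: (measurable_reflect_comp 0 mwq).
  - by move=> t _; rewrite lee_fin powR_ge0.
  - exact/measurable_EFinP.
  - by move=> t _; rewrite lee_fin powR_ge0.
  rewrite (@ge0_integral_reflection _ 0 (fun t => (w t `^ (- q))%:E)).
  - by rewrite lte_add_pinfty.
  - exact/measurable_EFinP.
  - by move=> t; rewrite lee_fin powR_ge0.
set H := fine (\int[mu]_t (h t)%:E)%E.
have HE : (\int[mu]_t (h t)%:E = H%:E)%E.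
  by rewrite fineK // ge0_fin_numE // integral_ge0 // => t _; rewrite lee_fin.
have H0 : 0 <= H by rewrite fine_ge0 // integral_ge0 // => t _; rewrite lee_fin.
have Kq0 : 0 <= K `^ q := powR_ge0 _ _.
pose M := 1 + K `^ q * (H + H).
have M0 : 0 <= M by rewrite addr_ge0 // mulr_ge0 // addr_ge0.
have vN x : v (- x) = v x by rewrite /v normrN.
have convn x : x <= 0 -> (\int[mu]_t (v (x - t) `^ (- q) * v t `^ (- q))%:E <=
    (M * v x `^ (- q))%:E)%E.
  move=> x0; have vx : v x = w x by rewrite /v ler0_norm // opprK.
  pose B := K `^ q * w x `^ (- q); have B0 : 0 <= B by rewrite mulr_ge0 ?powR_ge0.
  have mc : measurable_fun setT (fun t : R => w (x - t) `^ (- q) * w t `^ (- q)).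
    by apply: measurable_funM => //; exact: (measurable_reflect_comp x mwq).
  have c0 t : 0 <= w (x - t) `^ (- q) * w t `^ (- q) by rewrite mulr_ge0 ?powR_ge0.
  have := @conv_bound _ h B _ H x mc mh c0 h0 B0 (conv x) HE.
  rewrite vx (_ : w x `^ (- q) + B * (H + H) = M * w x `^ (- q)); last first.
    by rewrite /B /M; ring.
  apply: le_trans; apply: ge0_le_integralT => t.
    by rewrite lee_fin mulr_ge0 ?powR_ge0.
  rewrite lee_fin; have BH : 0 <= B * (h t + h (x - t)) by rewrite mulr_ge0 // addr_ge0.
  (* Three ranges for x <= 0. If t > 0 then |x-t| >= |x|, and if t < x then |t| >= |x|; in both
     cases one factor is at most K^q v(x)^{-q} and the other is integrable. For x <= t <= 0 the
     integrand is that of w. *)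
  case: (ltP 0 t) => t0.
    apply: (@le_trans _ _ (B * h t)); last first.
      by apply: (@le_trans _ _ (B * (h t + h (x - t)))); rewrite ?lerDr // ler_wpM2l // lerDl.
    apply: ler_wpM2r; first exact: h0.
    rewrite /B -vx; apply: powRN_le => //; apply: vle.
    rewrite !ler0_norm //; last by rewrite subr_le0 (le_trans x0) // ltW.
    by rewrite opprB; lra.
  case: (ltP t x) => tx.
    apply: (@le_trans _ _ (B * h (x - t))); last first.
      by apply: (@le_trans _ _ (B * (h t + h (x - t)))); rewrite ?lerDr // ler_wpM2l // lerDr.
    rewrite mulrC; apply: ler_wpM2r; first exact: h0.
    rewrite /B -vx; apply: powRN_le => //; apply: vle.
    by rewrite !ler0_norm // lerN2 ltW.
  rewrite {1}/v ler0_norm ?subr_le0 // opprK /v (ler0_norm t0) opprK.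
  by rewrite lerDl.
have bound e : 0 < e -> exists2 C, 0 < C & forall x, v x <= C * expR (e * `|x|).
  move=> e0; have [C C0 CP] := subexp_neg hw K0 mon r1 e0; exists C => // x.
  by have := CP (- `|x|); rewrite opprK oppr_le0; exact.
exists (fun x => (1 + K + M) * v x).
have [C C0 CP] := bound r r0.
have k0 : 0 < 1 + K + M by lra.
exists ((1 + K + M) * (1 + C)); split.
- apply: (@normalized_weight v K M K) => //.
  + by move=> x; exact: w1.
  + exact: ltW.
  + move=> x y; apply: (@le_trans _ _ (K * w (- `|x| - `|y|))).
      rewrite /v -[in leRHS](subrKC (- `|x + y|) (- `|x| - `|y|)) mon //.
      by have := ler_normD x y; lra.
    by rewrite ler_pM2l // wM.
  + move=> x; case: (leP x 0) => x0; first exact: convn.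
    have xN : - x <= 0 by rewrite oppr_le0 ltW.
    have := convn _ xN; rewrite vN; apply: le_trans.
    rewrite -(@ge0_integral_reflection _ 0
      (fun t => (v (- x - t) `^ (- q) * v t `^ (- q))%:E)).
    * rewrite le_eqVlt; apply/orP; left; apply/eqP/eq_integral => t _.
      by rewrite sub0r vN -vN; congr (_ `^ _ * _)%:E; congr v; ring.
    * apply/measurable_EFinP/measurable_funM => //.
      exact: (measurable_reflect_comp (- x) mh).
    * by move=> t; rewrite lee_fin mulr_ge0 ?powR_ge0.
  + by move=> x y x0 y0; apply: vle; rewrite !ler0_norm ?addr_le0 //; lra.
  + by move=> x y x0 y0; apply: vle; rewrite !ger0_norm ?addr_ge0 //; lra.
- by move=> x; rewrite vN.
- by rewrite mulr_gt0 // ltr_wpDl // ltW.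
move=> x; rewrite -mulrA ler_pM2l //; case: (leP x 0) => x0.
  by rewrite /v ler0_norm // opprK ler_peMl ?(ltW (w0 x)) // lerDl ltW.
apply: le_trans (CP x) _; rewrite gtr0_norm //.
apply: (@le_trans _ _ (C * w x)); first by rewrite ler_pM2l // wr.
by rewrite ler_pM2r // lerDr.
Qed.

(** From e^u >= (1 + u/2)^2 with u = e|x|: the square contains (e|x|)^2/4, and the factor 4/e^2
    recovers x^2. *)
Lemma quadratic_le_exp (e x : R) : 0 < e ->
  1 + x ^+ 2 <= (1 + 4 / e ^+ 2) * expR (e * `|x|).
Proof.
move=> e0; have u0 : 0 <= e * `|x| by rewrite mulr_ge0 // ltW.
have -> : x ^+ 2 = `|x| ^+ 2 by rewrite real_normK ?num_real.
have E : e * `|x| = e * `|x| / 2 + e * `|x| / 2 by field.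
have h1 := expR_ge1Dx (e * `|x| / 2).
have h2 : (1 + e * `|x| / 2) ^+ 2 <= expR (e * `|x|).
  rewrite [in leRHS]E expRD -expr2 lerXn2r // nnegrE ?expR_ge0 //; lra.
have c0 : 0 <= 4 / e ^+ 2 by rewrite divr_ge0 // sqr_ge0.
apply: (@le_trans _ _ ((1 + 4 / e ^+ 2) * (1 + e * `|x| / 2) ^+ 2)); last first.
  by rewrite ler_wpM2l // addr_ge0.
have -> : (1 + 4 / e ^+ 2) * (1 + e * `|x| / 2) ^+ 2 =
    1 + `|x| ^+ 2 + (e * `|x| + (e * `|x| / 2) ^+ 2 + 4 / e ^+ 2 * (1 + e * `|x|)).
  by field; rewrite gt_eqF.
by rewrite lerDl !addr_ge0 ?sqr_ge0 // mulr_ge0 // addr_ge0.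
Qed.

Lemma integral_quadratic : (\int[mu]_x ((1 + x ^+ 2) `^ (- q))%:E < +oo)%E.
Proof.
pose g (t : R) := if 0 <= t then (1 + t ^+ 2)^-1 else 0.
have D1 (t : R) : 1 <= 1 + t ^+ 2 by rewrite lerDl sqr_ge0.
have D0 (t : R) : 0 < 1 + t ^+ 2 := lt_le_trans ltr01 (D1 t).
have g0 t : 0 <= g t by rewrite /g; case: ifP => // _; rewrite invr_ge0 ltW.
have mi : measurable_fun setT (fun t : R => (1 + t ^+ 2)^-1).
  exact: (continuous_measurable_fun (@continuous_oneDsqrV R)).
have mg : measurable_fun setT g.
  apply: measurable_fun_ifT => //.
  by apply: measurable_fun_ler => //; exact: measurable_id.
have gE : (\int[mu]_t (g t)%:E = (pi / 2)%:E)%E.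
  rewrite -integral0y_oneDsqr [RHS]integral_mkcond; apply: eq_integral => t _.
  rewrite patchE /g; case: leP => t0.
    by rewrite mem_set //= in_itv /= t0.
  by rewrite memNset //= in_itv /= leNgt t0.
apply: (@le_lt_trans _ _ (\int[mu]_t ((g t)%:E + (g (0 - t))%:E))%E).
  apply: ge0_le_integralT => t; first by rewrite lee_fin powR_ge0.
  have le1 : (1 + t ^+ 2) `^ (- q) <= (1 + t ^+ 2)^-1.
    rewrite powRN lef_pV2 ?posrE ?powR_gt0 //.
    by rewrite -[leLHS]powRr1 ?(ltW (D0 t)) // ler_powR // ltW.
  rewrite -EFinD lee_fin; apply: le_trans le1 _; rewrite sub0r; case: (leP 0 t) => t0.
    by rewrite {1}/g t0 lerDl.
  by rewrite {2}/g oppr_ge0 (ltW t0) sqrrN lerDr.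
rewrite ge0_integralD //; first last.
- by apply/measurable_EFinP; exact: (measurable_reflect_comp 0 mg).
- by move=> t _; rewrite lee_fin.
- exact/measurable_EFinP.
- by move=> t _; rewrite lee_fin.
rewrite (@ge0_integral_reflection _ 0 (fun t => (g t)%:E)) ?gE -?EFinD ?ltry //.
exact/measurable_EFinP.
Qed.

(** The function v = 1 + x^2 is submultiplicative up to 2. For the convolution, the larger of |x-t|
    and |t| is at least |x|/2, so v(x) is at most 4 times v there; that factor leaves the integral
    as 4^q v(x)^{-q}. *)
Lemma quadratic_weight : exists2 k : R, 0 < k & regular_weight (fun x => k * (1 + x ^+ 2)).
Proof.
pose v (x : R) := 1 + x ^+ 2; pose h t := v t `^ (- q).
have v1 (t : R) : 1 <= v t by rewrite lerDl sqr_ge0.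
have v0 (t : R) : 0 < v t := lt_le_trans ltr01 (v1 t).
have mv : measurable_fun setT v.
  exact: (continuous_measurable_fun (@continuous_oneDsqr R)).
have mh : measurable_fun setT h := measurable_powR_comp mv.
have h0 t : 0 <= h t := powR_ge0 _ _.
set H := fine (\int[mu]_t (h t)%:E)%E.
have HE : (\int[mu]_t (h t)%:E = H%:E)%E.
  rewrite fineK // ge0_fin_numE; first exact: integral_quadratic.
  by apply: integral_ge0 => t _; rewrite lee_fin.
have H0 : 0 <= H by rewrite fine_ge0 // integral_ge0 // => t _; rewrite lee_fin.
pose M := 4 `^ q * (H + H).
have M0 : 0 <= M by rewrite mulr_ge0 ?powR_ge0 // addr_ge0.
exists (1 + 2 + M); first lra.
apply: (@normalized_weight v 2 M 1) => //.
- move=> x y; rewrite /v; have := sqr_ge0 (x - y); have := sqr_ge0 (x * y).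
  by rewrite exprMn sqrrB sqrrD; lra.
- move=> x; pose B := 4 `^ q * v x `^ (- q).
  have B0 : 0 <= B by rewrite mulr_ge0 ?powR_ge0.
  have I0 : (\int[mu]_t (0 : R)%:E <= (0 : R)%:E)%E by rewrite integral0.
  have := @conv_bound (fun=> 0) h B 0 H x (measurable_cst (0 : R)) mh
    (fun=> lexx (0 : R)) h0 B0 I0 HE.
  rewrite add0r (_ : B * (H + H) = M * v x `^ (- q)); last by rewrite /B /M; ring.
  apply: le_trans; apply: ge0_le_integralT => t.
    by rewrite lee_fin mulr_ge0 ?powR_ge0.
  rewrite lee_fin add0r mulrDr.
  have xt : x = (x - t) + t by rewrite subrK.
  case: (leP ((x - t) ^+ 2) (t ^+ 2)) => c.
    apply: (@le_trans _ _ (B * h (x - t))); last by rewrite lerDr mulr_ge0.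
    rewrite mulrC; apply: ler_wpM2r; first exact: h0.
    apply: powRN_le => //; rewrite /v {1}xt; have := sqr_ge0 ((x - t) - t).
    by move: c; rewrite [((x - t) + t) ^+ 2]sqrrD [((x - t) - t) ^+ 2]sqrrB; lra.
  apply: (@le_trans _ _ (B * h t)); last by rewrite lerDl mulr_ge0.
  apply: ler_wpM2r; first exact: h0.
  apply: powRN_le => //; rewrite /v {1}xt; have := sqr_ge0 ((x - t) - t).
  by move: c; rewrite [((x - t) + t) ^+ 2]sqrrD [((x - t) - t) ^+ 2]sqrrB; lra.
- exact: integral_quadratic.
- move=> x y x0 y0; rewrite mul1r lerD2l sqrrD -addrA lerDl addr_ge0 ?sqr_ge0 //.
  by rewrite mulrn_wge0 // mulr_le0.
- move=> x y x0 y0; rewrite mul1r lerD2l sqrrD -addrA lerDl addr_ge0 ?sqr_ge0 //.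
  by rewrite mulrn_wge0 // mulr_ge0.
- move=> e e0; exists (1 + 4 / e ^+ 2).
    by rewrite addr_gt0 // divr_gt0 // exprn_gt0.
  by move=> x; exact: quadratic_le_exp.
Qed.

Lemma regular_self w : almost_monotone_algebra_weight q w ->
  rho1 w = 0 -> rho2 w = 0 -> regular_weight w.
Proof.
move=> hw r1 r2; split=> // e e0; have [hw' _ _ m1 m2] := hw.
have [K1 K10 m1'] := m1 r1; have [K2 K20 m2'] := m2 r2.
have [C1 C10 C1P] := subexp_neg hw' K10 m1' r1 e0.
have [C2 C20 C2P] := subexp_pos hw' K20 m2' r2 e0.
exists (C1 + C2) => [|x]; first exact: addr_gt0.
rewrite mulrDl; have := expR_ge0 (e * `|x|); case: (leP 0 x) => x0 E0.
  rewrite ger0_norm // in E0 *.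
  by apply: le_trans (C2P _ x0) _; rewrite lerDr mulr_ge0 // ltW.
rewrite ltr0_norm // in E0 *.
by apply: le_trans (C1P _ (ltW x0)) _; rewrite lerDl mulr_ge0 // ltW.
Qed.

Lemma integral_reflect (f : R -> R) : measurable_fun setT f ->
  (forall t, 0 <= f t) ->
  (\int[mu]_t (f (- t))%:E = \int[mu]_t (f t)%:E)%E.
Proof.
move=> mf f0; rewrite -(@ge0_integral_reflection _ 0 (fun t => (f t)%:E)).
- by apply: eq_integral => t _; rewrite sub0r.
- exact/measurable_EFinP.
- by move=> t; rewrite lee_fin.
Qed.

(** Four cases, according to the vanishing of [rho1] and [rho2]. A vanishing exponent gives
    subexponential growth on its side; a nonvanishing one gives a lower bound e^{r|x|}, above any
    subexponential weight up to a constant. The case [rho2] = 0 with [rho1] nonzero is the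
    reflection of its mirror image. *)
Lemma regular_minorant w : almost_monotone_algebra_weight q w ->
  exists v (K : R), [/\ regular_weight v, 0 < K & forall x, v x <= K * w x].
Proof.
move=> hw; have [hw' conv int m1 m2] := hw; have [mw w1 wM] := hw'.
have mwq := measurable_powR_comp mw.
have [r1|r1] := eqVneq (rho1 w) 0; have [r2|r2] := eqVneq (rho2 w) 0.
- exists w, 1; split; [exact: regular_self|exact: ltr01|].
  by move=> x; rewrite mul1r.
- have [K K0 mon] := m1 r1.
  have r20 : 0 < rho2 w by rewrite lt_def r2 rho2_ge0.
  have [v [K' [rv _ K'0 vw]]] := even_weight hw' conv int K0 mon r1 r20
    (fun x => @weight_ge_expR_pos _ w x hw').
  by exists v, K'.
- have [K K0 mon] := m2 r2.
  have r10 : 0 < - rho1 w by rewrite oppr_gt0 lt_neqAle r1 rho1_le0.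
  have hr := weight_reflect hw'.
  have convr x : (\int[mu]_t (reflected w (x - t) `^ (- q) * reflected w t `^ (- q))%:E
      <= (reflected w x `^ (- q))%:E)%E.
    have := conv (- x); apply: le_trans.
    rewrite -integral_reflect; first last.
    - by move=> t; rewrite mulr_ge0 ?powR_ge0.
    - have [/measurable_powR_comp mr _ _] := hr.
      exact: measurable_funM (measurable_reflect_comp x mr) mr.
    rewrite le_eqVlt; apply/orP; left; apply/eqP/eq_integral => t _.
    have -> : reflected w (x - - t) = w (- x - t) by rewrite /reflected; congr w; ring.
    by rewrite /reflected opprK.
  have intr : (\int[mu]_x (reflected w x `^ (- q))%:E < +oo)%E.
    by rewrite (@integral_reflect (fun t => w t `^ (- q))) // => t; exact: powR_ge0.
  have monr x y : x <= 0 -> y <= 0 -> reflected w x <= K * reflected w (x + y).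
    by move=> x0 y0; rewrite /reflected opprD; apply: mon; rewrite oppr_ge0.
  have rhor : rho1 (reflected w) = 0.
    apply/eqP; rewrite eq_le rho1_le0 //= leNgt; apply/negP => rn.
    suff : - rho1 (reflected w) <= rho2 w by rewrite r2 oppr_le0 leNgt rn.
    apply: lb_le_inf; first by exists (ln (w 1 `^ 1^-1)), 1 => //=; exact: ltr01.
    move=> _ [y /= y0 <-]; have yN : - y < 0 by rewrite oppr_lt0.
    have := weight_ge_expR_neg hr yN.
    rewrite /reflected opprK -[leRHS]lnK ?posrE ?weight_gt0 // ler_expR.
    by move=> h; rewrite ln_powR mulrC ler_pdivlMr // mulNr -mulrN.
  have growr x : 0 < x -> expR (- rho1 w * x) <= reflected w x.
    move=> x0; rewrite mulNr -mulrN.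
    by apply: (@weight_ge_expR_neg _ w (- x) hw'); rewrite oppr_lt0.
  have [v [K' [rv vN K'0 vw]]] := even_weight hr convr intr K0 monr rhor r10 growr.
  exists v, K'; split=> // x; rewrite -vN.
  by have := vw (- x); rewrite /reflected opprK.
have [k k0 rk] := quadratic_weight.
pose r := Num.min (rho2 w) (- rho1 w).
have r0 : 0 < r.
  by rewrite lt_min lt_def r2 rho2_ge0 //= oppr_gt0 lt_neqAle r1 rho1_le0.
exists (fun x => k * (1 + x ^+ 2)), (k * (1 + 4 / r ^+ 2)).
have c0 : 0 < 1 + 4 / r ^+ 2 by rewrite addr_gt0 // divr_gt0 // exprn_gt0.
split=> //; first by rewrite mulr_gt0.
move=> x; rewrite -mulrA ler_pM2l //; apply: le_trans (quadratic_le_exp x r0) _.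
rewrite ler_pM2l //; have [x0|x0|->] := ltgtP x 0.
- rewrite ltr0_norm //; apply: le_trans (weight_ge_expR_neg hw' x0).
  by rewrite ler_expR mulrN -mulNr ler_nM2r // lerNr ge_min lexx orbT.
- rewrite gtr0_norm //; apply: le_trans (weight_ge_expR_pos hw' x0).
  by rewrite ler_expR ler_pM2r // ge_min lexx.
- by rewrite normr0 mulr0 expR0; exact: w1.
Qed.

End WeightReduction.

Lemma conjugate_gt1 (R : realType) (p q : R) : 1 < p -> p^-1 + q^-1 = 1 -> 1 < q.
Proof.
move=> p1 pq; have p0 : 0 < p := lt_trans ltr01 p1.
have pV : 0 < p^-1 by rewrite invr_gt0.
have pV1 : p^-1 < 1 by rewrite invf_lt1.
have qV : 0 < q^-1 by lra.
have q0 : 0 < q by rewrite -invr_gt0.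
by rewrite -invf_lt1 //; lra.
Qed.

Lemma Lp_le (R : realType) (D D' : algWeight R) (A : banachAlgType R[i]) (K : R)
    (f : R -> A) : aw_p D = aw_p D' -> 0 < K ->
  (forall x, aw_w D' x <= K * aw_w D x) ->
  Lp (aw_p D) (aw_w D) f -> Lp (aw_p D) (aw_w D') f.
Proof.
move=> pp K0 wK; rewrite LpE pp LpE => -[mf ff]; split=> //.
have [g mg fg] := strongly_measurableP mf.
rewrite (vnorm_ae _ fg); rewrite (vnorm_ae _ fg) in ff.
apply/snorm_lty; move/snorm_lty: ff => ff; have p0 := aw_p_gt0 D'.
apply: (@le_lt_trans _ _ ((K `^ aw_p D')%:E * wpow D (fun x => rnorm (g x)))%E).
  rewrite /wpow pp -ge0_integralZl_EFin ?powR_ge0 //; first last.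
  - by apply/measurable_EFinP; rewrite -pp; exact: measurable_wpow (smeas_rnorm mg).
  - by move=> t _; rewrite lee_fin mulr_ge0 ?powR_ge0.
  apply: ge0_le_integralT => t; first by rewrite lee_fin mulr_ge0 ?powR_ge0.
  rewrite -EFinM lee_fin mulrCA ler_wpM2l ?powR_ge0 // -powRM ?aw_w_ge0 ?(ltW K0) //.
  by rewrite ler_powR_base ?aw_w_ge0 ?(ltW p0).
by apply: lte_mul_pinfty; rewrite ?lee_fin ?powR_ge0.
Qed.

Theorem theorem4 (R : realType) (A : banachAlgType R[i]) (p q : R)
    (hp : 1 < p) (hpq : p^-1 + q^-1 = 1)
    (w : R -> R) (hw : almost_monotone_algebra_weight q w)
    (f : R -> A) (hf : Lp p w f)
    (d : side) (hinv : forall t : R, invertible d (1 + fourier f t)) :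
  (exists (nu : R -> R) (g : R -> A),
     [/\ almost_monotone_algebra_weight q nu,
         Lp p nu g,
         exists2 K : R, 0 < K & forall x : R, 1 <= nu x /\ nu x <= K * w x
       & is_inverse1 p nu d (1, f) (1, g)]) /\
  (admissible w ->
     exists v : R[i] * (R -> A), is_inverse1 p w d (1, f) v).
Proof.
have q1 := conjugate_gt1 hp hpq.
have inverse v (hv : regular_weight q v) : Lp p v f ->
    exists2 g, Lp p v g & is_inverse1 p v d (1, f) (1, g).
  have [[vw vc vi _ _] vs] := hv.
  move=> Lf; pose D := AlgWeight hp hpq vw vc vi.
  exact: (@Lp_inverse R D A (@subexp_snorm R D vs) f d Lf hinv).
split; last first.
  (* An admissible weight is regular, so the inverse is found for [w] itself. *)
  move=> [r1 r2]; have [g _ gP] := inverse w (regular_self hw r1 r2) hf.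
  by exists (1, g).
(* In general [f] is viewed in the larger space of the regular weight [v], and the Fourier
   transforms of [f] are unchanged. *)
have [v [K [hv K0 vw]]] := regular_minorant q1 hw.
have [ww wc wi _ _] := hw; have [[vW vc vi _ _] _] := hv.
have hf' : Lp p v f.
  exact: (@Lp_le R (AlgWeight hp hpq ww wc wi) (AlgWeight hp hpq vW vc vi) A K f).
have [g Lg gP] := inverse v hv hf'.
exists v, g; split=> //; first by have [] := hv.
by exists K => // x; split; [have [_ v1 _] := vW; exact: v1|exact: vw].
Qed.
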